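(* Let $N\geq 3$ be an integer and $\frac12\leq \alpha\leq 1$. If a smooth critical point of the functional $\mathcal{I}_{\alpha,N}$ restricted to $\mathcal{L}_{r,N}$ is a non-constant function, then it is unstable. Consequently, every stable critical point of $\mathcal{I}_{\alpha,N}$ restricted to $\mathcal{L}_{r,N}$ is constant.
   Context: Let $\xi=(\xi_1,\dots,\xi_{N+1})$ denote points of $\mathbb{S}^N\subset\mathbb{R}^{N+1}$ and write $x=\xi_1\in[-1,1]$. A function of the form $u=u(x)$ on $\mathbb{S}^N$ is called axially symmetric. The Paneitz operator on $\mathbb{S}^N$ is $$P_N=\prod_{k=0}^{\frac{N-2}{2}}(-\Delta+k(N-k-1))\ \ (N\text{ even}),\qquad P_N=\Big(-\Delta+\big(\tfrac{N-1}{2}\big)^2\Big)^{1/2}\prod_{k=0}^{\frac{N-3}{2}}(-\Delta+k(N-k-1))\ \ (N\text{ odd}),$$ where $\Delta$ is the Laplace–Beltrami operator of the round sphere and the square root is the spectral one. $P_{r,N}$ denotes $P_N$ acting on axially symmetric functions $u=u(x)$ (on such functions, $-\Delta=-(1-x^2)\frac{d^2}{dx^2}+Nx\frac{d}{dx}$). Spectrally, $P_N$ multiplies spherical harmonics of degree $k\ge 1$ by $\Gamma(k+N)/\Gamma(k)$ and kills constants; for $u\in H^{N/2}$ the integral of $uP_{r,N}u$ is understood as the associated quadratic form. For axially symmetric $u\in H^{N/2}(\mathbb{S}^N)$ define $$\mathcal{I}_{\alpha,N}(u)=\frac{\alpha}{2}\int_{-1}^{1}(1-x^2)^{\frac{N-2}{2}}u\,P_{r,N}u\,dx+(N-1)!\int_{-1}^{1}(1-x^2)^{\frac{N-2}{2}}u\,dx-\frac{(N-1)!\sqrt{\pi}\,\Gamma(\frac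 N2)}{N\,\Gamma(\frac{N+1}{2})}\log\left(\frac{\Gamma(\frac{N+1}{2})}{\sqrt{\pi}\,\Gamma(\frac N2)}\int_{-1}^{1}(1-x^2)^{\frac{N-2}{2}}e^{Nu}\,dx\right),$$ and $$\mathcal{L}_{r,N}=\Big\{u\in H^{\frac N2}(\mathbb{S}^N):\ u=u(x)\ \text{and}\ \int_{-1}^{1}x(1-x^2)^{\frac{N-2}{2}}e^{Nu}\,dx=0\Big\}.$$ A function $u\in\mathcal{L}_{r,N}$ is a critical point of $\mathcal{I}_{\alpha,N}$ restricted to $\mathcal{L}_{r,N}$ if $\frac{d}{ds}\big|_{s=0}\mathcal{I}_{\alpha,N}(u_s)=0$ for every $C^2$ curve $s\mapsto u_s\in H^{N/2}(\mathbb{S}^N)$, defined for small $|s|$, with $u_0=u$ and $u_s\in\mathcal{L}_{r,N}$ for all $s$. Such a critical point is stable if $\frac{d^2}{ds^2}\big|_{s=0}\mathcal{I}_{\alpha,N}(u_s)\ge 0$ for every such curve, and unstable otherwise, i.e. if $\frac{d^2}{ds^2}\big|_{s=0}\mathcal{I}_{\alpha,N}(u_s)<0$ for some such curve. *)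

(* Defs.v *)
From mathcomp Require Import all_boot all_order all_algebra.
From mathcomp Require Import all_classical all_reals all_analysis.
From mathcomp Require Import ring lra.
Set Implicit Arguments.
Unset Strict Implicit.
Unset Printing Implicit Defensive.
Import Order.TTheory GRing.Theory Num.Theory.
Import numFieldNormedType.Exports.
Local Open Scope classical_set_scope.
Local Open Scope ring_scope.

(** An axially symmetric function on the sphere S^N is represented by its
    profile [u : R -> R], i.e. it is the function [xi |-> u xi_1] on S^N; only
    the values of [u] on [-1, 1] matter. *)

Section Paneitz.
Context {R : realType}.
Implicit Types (N k : nat) (alpha x s : R) (u v f : R -> R).

Definition Gamma_fun (a : R) : R :=
  \int[lebesgue_measure]_(t in `]0, +oo[) (t `^ (a - 1) * expR (- t)).

(** The surface measure of S^N pushes forward under [xi |-> xi_1], up to the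
    constant factor |S^(N-1)|, to the measure of density [zweight N]. *)
Definition zweight N x : R := (1 - x ^+ 2) `^ ((N%:R - 2) / 2).

Definition zint N f : R :=
  \int[lebesgue_measure]_(x in `[-1, 1]) (zweight N x * f x).

(** Gegenbauer polynomials of parameter (N-1)/2.  [gegenbauer N k] spans the
    axially symmetric spherical harmonics of degree [k]; see
    [gegenbauer_eigen] below. *)
Fixpoint gegenbauer N k : {poly R} :=
  match k with
  | 0 => 1
  | k1.+1 =>
    match k1 with
    | 0 => (N.-1)%:R *: 'X
    | k2.+1 =>
      (k1.+1)%:R^-1 *: ((k1.*2 + N.-1)%:R *: ('X * gegenbauer N k1)
                        - (k2 + N.-1)%:R *: gegenbauer N k2)
    end
  end.

(** Coefficient of [u] along the [k]-th zonal harmonic normalized in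
    L^2(zweight N dx). *)
Definition zcoef N u k : R :=
  zint N (fun x => u x * (gegenbauer N k).[x])
  / Num.sqrt (zint N (fun x => (gegenbauer N k).[x] ^+ 2)).

(** Eigenvalue of -Delta on spherical harmonics of degree [k]. *)
Definition lap_eig N k : R := k%:R * (k%:R + N%:R - 1).

(** Eigenvalue of P_N on spherical harmonics of degree [k], computed factor by
    factor; the last index of the product is (N-2)/2 for N even and (N-3)/2
    for N odd, which is [N./2 - 1] in both cases. *)
Definition paneitz_eig N k : R :=
  (if odd N then Num.sqrt (lap_eig N k + ((N%:R - 1) / 2) ^+ 2) else 1)
  * \prod_(i < N./2) (lap_eig N k + i%:R * (N%:R - i%:R - 1)).

(** Squared H^{N/2} norm, i.e. the quadratic form of (1 - Delta)^{N/2}. *)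
Definition sobolev_sqnorm N u : \bar R :=
  (\sum_(0 <= k <oo) ((1 + lap_eig N k) `^ (N%:R / 2) * zcoef N u k ^+ 2)%:E)%E.

(** Axially symmetric elements of H^{N/2}(S^N). *)
Definition zsobolev N u : Prop :=
  [/\ measurable_fun (`[-1, 1] : set R) u,
      lebesgue_measure.-integrable (`[-1, 1] : set R)
        (fun x => (zweight N x * u x ^+ 2)%:E)
    & (sobolev_sqnorm N u < +oo)%E].

Definition sobolev_norm N u : R := Num.sqrt (fine (sobolev_sqnorm N u)).

(** The integral of (1-x^2)^((N-2)/2) u P_{r,N} u, as a quadratic form. *)
Definition paneitz_form N u : R :=
  fine (\sum_(0 <= k <oo) (paneitz_eig N k * zcoef N u k ^+ 2)%:E)%E.

Definition functional alpha N u : R :=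
  alpha / 2 * paneitz_form N u
  + (N.-1)`!%:R * zint N u
  - (N.-1)`!%:R * Num.sqrt pi * Gamma_fun (N%:R / 2)
      / (N%:R * Gamma_fun ((N%:R + 1) / 2))
    * ln (Gamma_fun ((N%:R + 1) / 2) / (Num.sqrt pi * Gamma_fun (N%:R / 2))
          * zint N (fun x => expR (N%:R * u x))).

Definition centered N u : Prop :=
  zsobolev N u /\ zint N (fun x => x * expR (N%:R * u x)) = 0.

(** [c'] is the derivative at time [s] of the curve [c], in H^{N/2} norm. *)
Definition curve_derive N (c c' : R -> R -> R) s : Prop :=
  sobolev_norm N (fun x => h^-1 * (c (s + h) x - c s x) - c' s x)
    @[h --> 0^'] --> (0 : R).

Definition curve_continuous N (c : R -> R -> R) s : Prop :=
  sobolev_norm N (fun x => c t x - c s x) @[t --> s] --> (0 : R).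

(** C^2 curves [s |-> c s] in H^{N/2}, defined for small |s|, starting at [u]
    and staying in the constraint set. *)
Definition admissible_curve N u (c : R -> R -> R) : Prop :=
  c 0 = u /\
  exists e : R, 0 < e /\
  exists c1 c2 : R -> R -> R, forall s, `|s| < e ->
    [/\ centered N (c s), zsobolev N (c1 s) & zsobolev N (c2 s)] /\
    [/\ curve_derive N c c1 s, curve_derive N c1 c2 s
      & curve_continuous N c2 s].

(** [g] is twice differentiable at 0, with second derivative [d]. *)
Definition second_derive0 (g : R -> R) (d : R) : Prop :=
  (\forall s \near (0 : R), derivable g s 1) /\ is_derive (0 : R) 1 (derive1 g) d.

Definition critical_point alpha N u : Prop :=
  centered N u /\
  forall c, admissible_curve N u c ->
    is_derive (0 : R) 1 (fun s => functional alpha N (c s)) 0.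

Definition stable_critical_point alpha N u : Prop :=
  critical_point alpha N u /\
  forall c d, admissible_curve N u c ->
    second_derive0 (fun s => functional alpha N (c s)) d -> 0 <= d.

Definition unstable_critical_point alpha N u : Prop :=
  critical_point alpha N u /\
  exists c d, [/\ admissible_curve N u c,
    second_derive0 (fun s => functional alpha N (c s)) d & d < 0].

(** Class C^n on R^(m+1): iterated directional derivatives up to order [n]
    exist everywhere, those of order [n] being continuous. *)
Fixpoint class_C m n (F : 'rV[R]_m.+1 -> R) : Prop :=
  match n with
  | 0 => continuous F
  | n'.+1 => forall v : 'rV[R]_m.+1,
      (forall xi, derivable F xi v) /\ class_C n' ('D_v F)
  end.

(** [xi |-> u xi_1] is smooth on S^N, i.e. it is the restriction of a smooth
    function on R^(N+1). *)
Definition smooth_on_sphere N u : Prop :=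
  exists F : 'rV[R]_N.+1 -> R,
    (forall n, class_C n F) /\
    forall xi : 'rV[R]_N.+1,
      \sum_(i < N.+1) xi ord0 i ^+ 2 = 1 -> F xi = u (xi ord0 ord0).

(** Elements of H^{N/2} are classes modulo equality almost everywhere. *)
Definition ae_constant u : Prop :=
  exists a : R, {ae lebesgue_measure, forall x, x \in `[-1, 1] -> u x = a}.

Let natZ n (p : {poly R}) : n%:R *: p = n%:R * p.
Proof. by rewrite scaler_nat mulr_natl. Qed.

Let deriv_natM n (p : {poly R}) : (n%:R * p)^`() = n%:R * p^`().
Proof. by rewrite -natZ derivZ natZ. Qed.

Lemma gegenbauer_rec N k :
  (k.+2)%:R * gegenbauer N k.+2 =
  (k.+1.*2 + N.-1)%:R * 'X * gegenbauer N k.+1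
  - (k + N.-1)%:R * gegenbauer N k.
Proof.
have nz : (k.+2)%:R != 0 :> R by rewrite pnatr_eq0.
rewrite [gegenbauer N k.+2]/= -/(gegenbauer N k.+1).
by rewrite -natZ scalerA mulfV // scale1r !natZ mulrA.
Qed.

Lemma gegenbauer_deriv N k :
  (1 - 'X ^+ 2) * (gegenbauer N k)^`() =
  (k + N.-1)%:R * 'X * gegenbauer N k - (k.+1)%:R * gegenbauer N k.+1.
Proof.
set P := fun k => (1 - 'X ^+ 2) * (gegenbauer N k)^`() =
  (k + N.-1)%:R * 'X * gegenbauer N k - (k.+1)%:R * gegenbauer N k.+1.
suff [] : P k /\ P k.+1 by [].
elim: k => [|k [IH1 IH2]].
  split; rewrite /P.
    have -> : (gegenbauer N 0)^`() = 0 by rewrite /= -polyC1 derivC.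
    by rewrite /= natZ; ring.
  rewrite (gegenbauer_rec N 0) /= natZ deriv_natM derivX.
  by rewrite -addnn !natrD; ring.
split=> //; rewrite /P in IH1 IH2 *.
have nz : (k.+2)%:R != 0 :> {poly R}.
  by rewrite -polyC_natr polyC_eq0 pnatr_eq0.
apply: (mulfI nz).
have rec1 := gegenbauer_rec N k; have rec2 := gegenbauer_rec N k.+1.
have drec := congr1 (@deriv R) rec1.
rewrite derivB -!mulrA !deriv_natM derivM derivX mul1r in drec.
set C0 := gegenbauer N k in IH1 IH2 rec1 rec2 drec *.
set C1 := gegenbauer N k.+1 in IH1 IH2 rec1 rec2 drec *.
set C2 := gegenbauer N k.+2 in IH1 IH2 rec1 rec2 drec *.
set C3 := gegenbauer N k.+3 in IH1 IH2 rec1 rec2 drec *.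
rewrite rec2 mulrCA drec.
transitivity ((k.+1.*2 + N.-1)%:R * ((1 - 'X ^+ 2) * C1
   + 'X * ((1 - 'X ^+ 2) * C1^`()))
   - (k + N.-1)%:R * ((1 - 'X ^+ 2) * C0^`())); first by ring.
rewrite IH1 IH2.
move: rec1; rewrite -!addnn !natrD -!natr1.
move: (k%:R : {poly R}) ('X : {poly R}) (N.-1%:R : {poly R}) => a x m rec1.
apply/eqP; rewrite -subr_eq0; apply/eqP.
transitivity (- ((a + m) * x) * ((a + 1 + 1) * C2
   - ((a + 1 + (a + 1) + m) * x * C1 - (a + m) * C0))); first by ring.
by rewrite rec1 subrr mulr0.
Qed.

Lemma gegenbauer_derivS N k :
  (1 - 'X ^+ 2) * (gegenbauer N k.+1)^`() =
  (k + N.-1)%:R * gegenbauer N k - (k.+1)%:R * 'X * gegenbauer N k.+1.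
Proof.
rewrite gegenbauer_deriv gegenbauer_rec.
by rewrite -!addnn !natrD -!natr1; ring.
Qed.

(** On profiles, -Delta is -(1-x^2) d^2/dx^2 + N x d/dx. *)
Lemma gegenbauer_eigen N k : (0 < N)%N ->
  - (1 - 'X ^+ 2) * (gegenbauer N k)^`()^`()
  + N%:R * 'X * (gegenbauer N k)^`() = lap_eig N k *: gegenbauer N k.
Proof.
case: N => // N _.
have nz : 1 - 'X ^+ 2 != 0 :> {poly R}.
  rewrite subr_eq0; apply/eqP => /(congr1 (fun p : {poly R} => size p)).
  by rewrite size_poly1 size_polyXn.
apply: (mulfI nz).
have d0 := gegenbauer_deriv N.+1 k; have d1 := gegenbauer_derivS N.+1 k.
have dd := congr1 (@deriv R) d0.
have dx : (1 - 'X ^+ 2)^`() = - ('X + 'X) :> {poly R}.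
  by rewrite derivB -polyC1 derivC derivXn sub0r expr1 mulr2n.
rewrite derivB -!mulrA !deriv_natM !derivM dx derivX mul1r in dd.
have -> : lap_eig N.+1 k *: gegenbauer N.+1 k
    = k%:R * (k%:R + N%:R) * gegenbauer N.+1 k.
  rewrite -mul_polyC /lap_eig -natr1 addrA addrK polyCM polyCD.
  by rewrite -!raddfMn /= !polyC_natr.
move: d0 d1 dd; rewrite -[N.+1.-1]/N natrD -!natr1.
set C0 := gegenbauer N.+1 k; set C1 := gegenbauer N.+1 k.+1.
set D0 := C0^`(); set D1 := C1^`(); set DD := D0^`().
move: (k%:R : {poly R}) ('X : {poly R}) (N%:R : {poly R}) => a x m d0 d1 dd.
have {}dd : (1 - x ^+ 2) * DD = (2 + a + m) * x * D0 + (a + m) * C0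
    - (a + 1) * D1.
  transitivity (- (x + x) * D0 + (1 - x ^+ 2) * DD + (x + x) * D0); first by ring.
  by rewrite dd; ring.
transitivity ((1 - x ^+ 2) * ((m + 1) * x * D0 - (1 - x ^+ 2) * DD)).
  by ring.
rewrite dd.
transitivity ((- (1 + a) * x) * ((1 - x ^+ 2) * D0)
  - (1 - x ^+ 2) * (a + m) * C0 + (a + 1) * ((1 - x ^+ 2) * D1)).
  by ring.
by rewrite d0 d1; ring.
Qed.

(** The eigenvalue is Gamma(k+N)/Gamma(k) for k >= 1, and 0 for k = 0. *)
Lemma paneitz_eig0 N : (1 < N)%N -> paneitz_eig N 0 = 0.
Proof.
case: N => [|[|N]] // _.
by rewrite /paneitz_eig /= big_ord_recl /lap_eig !mul0r addr0 mul0r mulr0.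
Qed.

Lemma paneitz_prod N k :
  (if odd N then k.+1%:R + (N./2)%:R else 1)
  * \prod_(i < N./2) (lap_eig N k.+1 + i%:R * (N%:R - i%:R - 1))
  = ((k + N)`!)%:R / (k`!)%:R :> R.
Proof.
have fact_neq0 n : (n`!)%:R != 0 :> R by rewrite pnatr_eq0 -lt0n fact_gt0.
elim/ltn_ind: N k => -[|[|N]] IH k.
- by rewrite big_ord0 mul1r addn0 divff.
- by rewrite big_ord0 /= mulr1 addr0 addn1 factS natrM mulfK.
rewrite big_ord_recl /= negbK mul0r addr0.
have {IH} := IH N _ k.+1 => /(_ (ltnW (leqnn _))) IH.
have -> : \prod_(i < N./2) (lap_eig N.+2 k.+1 +
      (bump 0 i)%:R * (N.+2%:R - (bump 0 i)%:R - 1))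
    = \prod_(i < N./2) (lap_eig N k.+2 + i%:R * (N%:R - i%:R - 1)) :> R.
  apply: eq_bigr => i _; rewrite /lap_eig /bump leq0n add1n -!natr1; ring.
have -> : (if odd N then k.+1%:R + (N./2.+1)%:R else 1)
    = (if odd N then k.+2%:R + (N./2)%:R else 1) :> R.
  by case: ifP => // _; rewrite -!natr1; ring.
rewrite mulrCA IH /lap_eig !addnS !addSn !factS !natrM -!natr1 natrD.
by field; rewrite fact_neq0 natr1 pnatr_eq0.
Qed.

Lemma paneitz_eigS N k :
  paneitz_eig N k.+1 = ((k + N)`!)%:R / (k`!)%:R.
Proof.
rewrite -paneitz_prod /paneitz_eig; congr (_ * _).
have [oN|//] := boolP (odd N).
have NE : N%:R = (N./2)%:R * 2 + 1 :> R.
  by rewrite -[in LHS](odd_double_half N) oN natrD -muln2 natrM addrC.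
have -> : (N%:R - 1) / 2 = (N./2)%:R :> R by rewrite NE addrK mulfK ?pnatr_eq0.
have -> : lap_eig N k.+1 + (N./2)%:R ^+ 2 = (k.+1%:R + (N./2)%:R) ^+ 2.
  by rewrite /lap_eig NE; ring.
by rewrite sqrtr_sqr ger0_norm // addr_ge0.
Qed.

End Paneitz.

(* Main.v *)
(** Let w = (1 - x^2)^((N-2)/2), W = \int w, rho = W e^(Nu) / \int e^(Nu) w and
    T = \int x^2 rho w.  Criticality along the curves u + s eta + tau(s) x, with
    eta a polynomial and tau determined by the constraint, gives the
    Euler-Lagrange equation alpha P u = (N-1)! (rho (1 + lam x) - 1) on zonal
    coefficients, so that no regularity of u is needed.  After one derivative P
    is inverted by the zonal kernel of 1 / (1 - s): the function
    G = (1 - x^2) u' equals (x + V) / alpha, where V is W^-1 times the integral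
    of (y - x) E[1 / (1 - s)] against rho (1 + lam y), s being the scalar product
    of two points of the sphere with first coordinates x and y, and E its average
    given x and y.  The antisymmetry of (y - x) E[1 / (1 - s)] and the
    Kazdan-Warner identity \int rho (N (G - x) p + (1 - x^2) p') w = 0 force
    lam = 0, and a quadratic minorant of 1 / (1 - s) gives T < W / 2.

    If the second variation is nonnegative, testing it on G - x corrected by a
    multiple of x yields (T - S) (T - alpha W) >= 0 with S = W / (N + 1), hence
    T <= S.  On the other hand T - S is a positive multiple of
    \int (rho - 1) x G w, which a telescoping sum bounds below by a positive
    combination of the squared coefficients of G.  So G = 0 and u is constant. *)

Require Import Defs.
From mathcomp Require Import all_boot all_order all_algebra.
From mathcomp Require Import all_classical all_reals all_analysis.
From mathcomp Require Import measurable_realfun ring lra.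
Set Implicit Arguments.
Unset Strict Implicit.
Unset Printing Implicit Defensive.
Import Order.TTheory GRing.Theory Num.Theory.
Import numFieldNormedType.Exports.
Local Open Scope classical_set_scope.
Local Open Scope ring_scope.

(** The obstacle is regularity. H^(N/2) does not embed in the bounded functions, so rho is only
    known to be a positive integrable density, and it is paired with polynomials or bounded
    functions only. This is why G is the right unknown: the factor y - x cancels the singularity of
    E[1 / (1 - s)] on the diagonal, so G is bounded as soon as rho is integrable, and u is recovered
    from it almost everywhere as a primitive of G / (1 - x^2).

    The test function G - x is not a polynomial, and its partial sums have to converge in L^2(rho).
    Stability itself provides this: on polynomials without components of degree 0 and 1 it bounds
    the L^2(rho) norm by the Paneitz form, and the linearized equation then bounds the Paneitz form
    of G - x.

    The bound alpha >= 1/2 gives T < W / 2 <= alpha W, hence the sign of the second factor in (T -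
    S) (T - alpha W), and alpha (N + 1) > 1, which makes the multiple relating T - S to the
    telescoping sum positive. The bound alpha <= 1 excludes a nonzero multiplier. *)

Arguments gegenbauer : simpl never.

(** * Gegenbauer polynomials normalized to the value 1 at x = 1 *)

Section NormalizedGegenbauer.
Context {R : realType}.
Variable N : nat.
Hypothesis hN : (3 <= N)%N.
Implicit Types (k j : nat) (x y : R) (p q : {poly R}).
Local Notation n := (N%:R : R).

Lemma ge3 : 3 <= n. Proof. by rewrite (ler_nat R 3 N). Qed.

Lemma predNE : (N.-1)%:R = n - 1.
Proof. by case: N hN => // m _; rewrite -natr1 addrK. Qed.

Lemma geg1S k :
  (k%:R + n - 1) * (gegenbauer N k).[1] = (k%:R + 1) * (gegenbauer N k.+1).[1] :> R.
Proof.
have := congr1 (horner^~ 1) (gegenbauer_derivS (R:=R) N k).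
move: (gegenbauer N k) (gegenbauer N k.+1) => p q.
rewrite !hornerE !hornerMn !hornerE expr1n subrr mul0r => /esym/eqP.
rewrite subr_eq0 natrD predNE -[k.+1%:R]natr1 => /eqP <-.
by rewrite addrA.
Qed.

Lemma geg1_gt0 k : 0 < (gegenbauer N k).[1] :> R.
Proof.
have n3 := ge3; elim: k => [|k IH]; first by rewrite /= hornerE.
have k0 : 0 <= k%:R :> R by [].
have := geg1S k; move: IH; set a := _.[1]; set b := _.[1] => a0 e.
have : 0 < (k%:R + 1) * b by rewrite -e mulr_gt0//; lra.
by rewrite pmulr_rgt0//; lra.
Qed.

(** With the value 1 at 1, the product formula [ztrans_zonal] holds without a constant and the two
    coefficients of [zonal_mulX] add up to 1. The lock keeps computation from unfolding the
    recursive polynomials. *)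
Definition zonal k : {poly R} :=
  locked ((gegenbauer N k).[1]^-1 *: gegenbauer N k).
Local Notation c := zonal.

Lemma zonalE k : c k = (gegenbauer N k).[1]^-1 *: gegenbauer N k.
Proof. by rewrite /zonal -lock. Qed.

Lemma gegenbauerE k : gegenbauer N k = (gegenbauer N k).[1] *: c k.
Proof. by rewrite zonalE scalerA mulfV ?scale1r// gt_eqF ?geg1_gt0. Qed.

(* Coefficients of the recurrence [zonal_mulX]. *)
Definition upc k : R := locked ((k%:R + n - 1) / (2 * k%:R + n - 1)).
Definition downc k : R := locked (k%:R / (2 * k%:R + n - 1)).
Local Notation A := upc.
Local Notation B := downc.

Lemma upc_def k : A k = (k%:R + n - 1) / (2 * k%:R + n - 1).
Proof. by rewrite /upc -lock. Qed.

Lemma downc_def k : B k = k%:R / (2 * k%:R + n - 1).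
Proof. by rewrite /downc -lock. Qed.

Lemma upc_gt0 k : 0 < A k.
Proof. by have n3 := ge3; have k0 : 0 <= k%:R :> R by []; rewrite upc_def divr_gt0//; lra. Qed.

Lemma downc_ge0 k : 0 <= B k.
Proof. by have n3 := ge3; have k0 : 0 <= k%:R :> R by []; rewrite downc_def divr_ge0//; lra. Qed.

Lemma downc_gt0 k : 0 < B k.+1.
Proof.
have n3 := ge3; have k0 : 0 <= k%:R :> R by [].
by rewrite downc_def divr_gt0 -?natr1//; lra.
Qed.

Lemma updownc k : A k + B k = 1.
Proof. by have n3 := ge3; have k0 : 0 <= k%:R :> R by []; rewrite upc_def downc_def; field; lra. Qed.

Lemma zonal0 : c 0 = 1.
Proof. by rewrite zonalE /gegenbauer hornerE invr1 scale1r. Qed.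

Lemma zonal_at1 k : (c k).[1] = 1.
Proof. by rewrite zonalE hornerZ mulVf// gt_eqF ?geg1_gt0. Qed.


Lemma zonal_ratio k :
  (k%:R + n - 1) * (gegenbauer N k.+1).[1]^-1
  = (k%:R + 1) * (gegenbauer N k).[1]^-1 :> R.
Proof.
have e := geg1S k; have a0 := geg1_gt0 k; have b0 := geg1_gt0 k.+1.
by apply/eqP; rewrite eqr_div ?lt0r_neq0// e.
Qed.

Lemma zonal_deriv k :
  (1 - 'X ^+ 2) * (c k)^`() = k%:R *: (c k.-1 - 'X * c k).
Proof.
case: k => [|k]; first by rewrite zonal0 -polyC1 derivC mulr0 scale0r.
have z := zonal_ratio k; rewrite !zonalE derivZ -scalerAr gegenbauer_derivS.
move: z; move: (gegenbauer N k) (gegenbauer N k.+1) => p q.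
move: (p.[1]^-1) (q.[1]^-1) => a b z; rewrite -!mul_polyC.
have -> : (k + N.-1)%:R = (k%:R + n - 1)%:P :> {poly R}.
  by rewrite -addrA -predNE -natrD polyC_natr.
rewrite -[X in X * 'X * q]polyC_natr -[k.+1%:R]natr1.
have zP := congr1 polyC z; rewrite !polyCM in zP.
rewrite [in LHS]mulrBr !mulrA [b%:P * _]mulrC zP; ring.
Qed.

Lemma upcE k : (2 * k%:R + n - 1) * A k = k%:R + n - 1.
Proof. by have n3 := ge3; have k0 : 0 <= k%:R :> R by []; rewrite upc_def; field; lra. Qed.

Lemma downcE k : (2 * k%:R + n - 1) * B k = k%:R.
Proof. by have n3 := ge3; have k0 : 0 <= k%:R :> R by []; rewrite downc_def; field; lra. Qed.


Lemma zonal_mulX k : 'X * c k = A k *: c k.+1 + B k *: c k.-1.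
Proof.
have n3 := ge3; have k0 : 0 <= k%:R :> R by [].
case: k k0 => [|k] k0.
  rewrite downc_def mul0r scale0r addr0 zonal0 mulr1 upc_def mulr0 !add0r divff ?scale1r; last lra.
  by rewrite zonalE /gegenbauer !hornerE predNE scalerA mulVf ?scale1r//; lra.
apply: (scalerI (a := 2 * k.+1%:R + n - 1)); first by apply/eqP; lra.
rewrite scalerDr !scalerA upcE downcE.
have r := gegenbauer_rec (R:=R) N k.
have z1 := zonal_ratio k; have z2 := zonal_ratio k.+1.
rewrite !zonalE; move: r z1 z2.
move: (gegenbauer N k) (gegenbauer N k.+1) (gegenbauer N k.+2) => p q u.
move: (p.[1]^-1) (q.[1]^-1) (u.[1]^-1) => a b d r z1 z2.
rewrite -[X in _ *: X]scalerAr !scalerA z2 -[k.+1%:R]natr1 -z1 -!mul_polyC .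
have -> : ((k%:R + 1 + 1) * b)%:P * u = b%:P * (k.+2%:R * u).
  by rewrite !natr1 polyCM polyC_natr; ring.
rewrite r -addnn !natrD !polyCM.
have -> : (N.-1)%:R = N%:R - 1 :> {poly R} by rewrite -polyC_natr predNE polyCB polyC_natr.
by rewrite -!natr1 !(polyCD, polyCN, polyC_natr, polyCM); ring.
Qed.

Definition Lop p : {poly R} := - (1 - 'X ^+ 2) * p^`()^`() + N%:R * 'X * p^`().

Lemma LopZ a p : Lop (a *: p) = a *: Lop p.
Proof. by rewrite /Lop !derivZ -!scalerAr scalerDr. Qed.

Lemma LopD p q : Lop (p + q) = Lop p + Lop q.
Proof. by rewrite /Lop !derivD; ring. Qed.

Lemma Lop_zonal k : Lop (c k) = lap_eig N k *: c k.
Proof.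
rewrite zonalE LopZ /Lop gegenbauer_eigen; first by rewrite !scalerA mulrC.
by apply: leq_trans hN.
Qed.

Lemma coef_Lop p i :
  (Lop p)`_i = lap_eig N i * p`_i - (i%:R + 2) * (i%:R + 1) * p`_i.+2.
Proof.
rewrite /Lop -[N%:R]polyC_natr coefD -mulrA coefCM mulNr coefN mulrBl mul1r coefB.
rewrite coefXnM coefXM !coef_deriv /lap_eig.
have mE (a : R) m : a *+ m = m%:R * a by rewrite mulr_natl.
case: i => [|[|i]] /=; rewrite ?coef_deriv ?subn2 /= -?mulrnA ?(mE p`_2) ?(mE p`_3) ?(mE p`_1) ?(mE p`_i.+4) ?(mE p`_i.+2).
- by rewrite subr0 mulr0 mul0r; ring.
- by rewrite subr0; ring.
by rewrite !natrM -[i.+4%:R]natr1 -[i.+3%:R]natr1 -[i.+2%:R]natr1 -[i.+1%:R]natr1; ring.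
Qed.

Lemma lap_eig_inj i k : lap_eig N i = lap_eig N k :> R -> i = k.
Proof.
have n3 := ge3; have i0 : 0 <= i%:R :> R by []; have k0 : 0 <= k%:R :> R by [].
rewrite /lap_eig => e; apply/eqP; rewrite -(eqr_nat R); apply/eqP.
have : (i%:R - k%:R) * (i%:R + k%:R + n - 1) = 0 :> R by nra.
by move/eqP; rewrite mulf_eq0 => /orP[/eqP|/eqP]; lra.
Qed.

(** Comparing coefficients, p_i (lambda_i - lambda_k) = (i + 2) (i + 1) p_(i+2). Descending from
    above the degree, each p_i with i <> k vanishes because the eigenvalues are distinct, and p_k
    vanishes by hypothesis. *)
Lemma Lop_eigen0 k p : Lop p = lap_eig N k *: p -> p`_k = 0 -> p = 0.
Proof.
move=> e pk; apply/polyP => i; rewrite coef0.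
have H m : forall i, (size p <= i + m)%N -> p`_i = 0.
  elim: m => [|m IH] j jm; first by rewrite nth_default// -(addn0 j).
  have [->//|jk] := eqVneq j k.
  have := congr1 (fun q : {poly R} => q`_j) e.
  rewrite coef_Lop coefZ (IH j.+2); last by rewrite !addSn ltnW// -addnS.
  rewrite mulr0 subr0 => /eqP; rewrite -subr_eq0 -mulrBl mulf_eq0 => /orP[|/eqP//].
  rewrite subr_eq0 => /eqP/lap_eig_inj ij; by rewrite ij eqxx in jk.
by apply: (H (size p)); rewrite leq_addl.
Qed.

Lemma zonal_lead k : (c k)`_k != 0.
Proof.
apply/eqP => ck; have := zonal_at1 k.
rewrite (Lop_eigen0 (Lop_zonal k) ck) horner0 => /eqP.
by rewrite eq_sym oner_eq0.
Qed.

Lemma Lop_eigen k p : Lop p = lap_eig N k *: p -> p = p.[1] *: c k.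
Proof.
move=> e; set a := (c k)`_k; set b := p`_k.
have /eqP : a *: p - b *: c k = 0.
  apply: (@Lop_eigen0 k); last first.
    by rewrite coefB coefZ [X in _ - X]coefZ -/a -/b; ring.
  rewrite -!scaleNr LopD !LopZ e Lop_zonal scalerDr !scalerA.
  by congr (_ *: _ + _ *: _); ring.
rewrite subr_eq0 => /eqP E.
have := congr1 (horner^~ 1) E; rewrite /= !hornerZ zonal_at1 mulr1 => Eb.
by apply: (scalerI (zonal_lead k)); rewrite -/a E -Eb scalerA.
Qed.

(** The polynomial (c_k - c_(k+1)) / (1 - x). Its weighted integral is the difference of two
    consecutive zonal coefficients of 1 / (1 - x), and the coefficients of that kernel occur later
    only through such differences. *)
Fixpoint zquot k : {poly R} :=
  if k is k'.+1 then
    (k%:R + n - 1)^-1 *: ((2 * k%:R + n - 1) *: c k + k%:R *: zquot k')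
  else 1.

Lemma zquotE k : c k - c k.+1 = (1 - 'X) * zquot k.
Proof.
have n3 := ge3.
(* The three-term recurrence rewritten for consecutive differences; divided by 1 - X it becomes the
   recursion of [zquot]. *)
have key j : (j%:R + n - 1) *: (c j - c j.+1) =
    (2 * j%:R + n - 1) *: ((1 - 'X) * c j) + j%:R *: (c j.-1 - c j).
  have j0 : 0 <= j%:R :> R by [].
  rewrite mulrBl mul1r zonal_mulX !scalerBr !scalerDr !scalerA upcE downcE.
  apply/polyP => i; rewrite !(coefZ, coefD, coefB, coefN); ring.
elim: k => [|k IH].
  by have := key 0%N; rewrite scale0r addr0 mulr0 !add0r => /scalerI -> //;
     rewrite ?zonal0//; apply/eqP; lra.
have k0 : 0 <= k.+1%:R :> R by [].
apply: (scalerI (a := k.+1%:R + n - 1)); first by apply/eqP; lra.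
rewrite key [zquot k.+1]/= -[in RHS]scalerAr scalerA divff ?scale1r; last by apply/eqP; lra.
by rewrite mulrDr -!scalerAr IH.
Qed.

(** * Averaging over points of the sphere with given first coordinates *)

Section ZonalTranslation.
Variable y : R.

(* The average over t of s^k, where s = x y + sqrt(1 - x^2) sqrt(1 - y^2) cos t
   and t has density proportional to sin^(N-2) t: it is a polynomial in x, and
   the recursion is an integration by parts in t. *)
Fixpoint powavg k : {poly R} :=
  match k with
  | 0 => 1
  | k1.+1 =>
    match k1 with
    | 0 => y *: 'X
    | k2.+1 =>
      (k1%:R + n - 1)^-1 *:
        (((2 * k1%:R + n - 1) * y) *: ('X * powavg k1)
         + k1%:R *: (((1 - y ^+ 2)%:P - 'X ^+ 2) * powavg k2))
    end
  end.
Local Notation P := powavg.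


Lemma powavg_rec k : (k%:R + N%:R - 1) * P k.+1 =
  (2 * k%:R + N%:R - 1) * y%:P * 'X * P k
  + k%:R * (1 - y%:P ^+ 2 - 'X ^+ 2) * P k.-1.
Proof.
have n3 := ge3; have k0 : 0 <= k%:R :> R by [].
have E : k%:R + N%:R - 1 = (k%:R + n - 1)%:P :> {poly R}.
  by rewrite !(polyCD, polyCN, polyC_natr).
case: k k0 E => [|k] k0 E.
  by rewrite /= -mul_polyC !mul0r addr0; ring.
rewrite [P k.+2]/= -/(P k.+1) {1}E mul_polyC scalerA divff ?scale1r; last by apply/eqP; lra.
rewrite -!mul_polyC [k.+1.-1]/= !(polyCD, polyCN, polyCM, polyC_natr, polyCB, polyC_exp); ring.
Qed.

Lemma facN0 k : k%:R + N%:R - 1 != 0 :> {poly R}.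
Proof.
have n3 := ge3; have k0 : 0 <= k%:R :> R by [].
rewrite (_ : _ - _ = (k%:R + n - 1)%:P) ?polyC_eq0; first by apply/eqP; lra.
by rewrite !(polyCD, polyCN, polyC_natr).
Qed.

Let dsq : (1 - 'X ^+ 2)^`() = - (2 * 'X) :> {poly R}.
Proof. by rewrite derivB -polyC1 derivC derivXn sub0r expr1 -mulr_natl. Qed.

Let d2 : (1 - y%:P ^+ 2 - 'X ^+ 2)^`() = - (2 * 'X) :> {poly R}.
Proof. by rewrite !derivB -polyC_exp -polyC1 !derivC derivXn !sub0r oppr0 add0r expr1 -mulr_natl. Qed.

Let derivCM (a : R) p : (a%:P * p)^`() = a%:P * p^`().
Proof. by rewrite derivM derivC mul0r add0r. Qed.

Let derivnM (m : nat) p : (m%:R * p)^`() = m%:R * p^`().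
Proof. by rewrite mulr_natl derivMn mulr_natl. Qed.

(** This is the average over t of the derivative of s^k, because (1 - x^2) ds/dx = y - x s. It is
    derived from the recursion alone: the induction step differentiates [powavg_rec] and then uses
    that recursion once more, one index lower. *)
Lemma powavg_deriv k :
  (1 - 'X ^+ 2) * (P k)^`() = k%:R * (y%:P * P k.-1 - 'X * P k).
Proof.
suff [] : (1 - 'X ^+ 2) * (P k)^`() = k%:R * (y%:P * P k.-1 - 'X * P k)
   /\ (1 - 'X ^+ 2) * (P k.+1)^`() = k.+1%:R * (y%:P * P k - 'X * P k.+1) by [].
elim: k => [|k [IH1 IH2]].
  split; first by rewrite /= -polyC1 derivC mulr0 mul0r.
  by rewrite /= -mul_polyC derivCM derivX; ring.
split=> //; apply: (mulfI (facN0 k.+1)).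
have r1 := powavg_rec k; have r2 := powavg_rec k.+1.
have d := congr1 (@deriv R) r2.
have cst1 : (k.+1%:R + N%:R - 1) = (k.+1%:R + n - 1)%:P :> {poly R}.
  by rewrite !(polyCD, polyCN, polyC_natr).
have cst2 : (2 * k.+1%:R + N%:R - 1) = (2 * k.+1%:R + n - 1)%:P :> {poly R}.
  by rewrite !(polyCD, polyCN, polyC_natr, polyCM).
rewrite derivD -!mulrA derivnM {1}cst1 {1}cst2 !derivCM !derivM d2 derivX -cst1 -cst2 in d.
rewrite mulrCA d {d}.
transitivity ((2 * k.+1%:R + N%:R - 1) * (y%:P * ((1 - 'X ^+ 2) * P k.+1 +
     'X * ((1 - 'X ^+ 2) * (P k.+1)^`()))) +
   k.+1%:R * (- (2 * 'X) * (1 - 'X ^+ 2) * P k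
     + (1 - y%:P ^+ 2 - 'X^2) * ((1 - 'X ^+ 2) * (P k)^`()))); first by rewrite /=; ring.
rewrite IH1 IH2.
transitivity (k.+2%:R * (y%:P * ((k.+1%:R + N%:R - 1) * P k.+1)
   - 'X * ((k.+1%:R + N%:R - 1) * P k.+2))); last by rewrite /=; ring.
rewrite r2 [k.+1.-1]/=.
move: r1; rewrite -[k.+2%:R]natr1 -[k.+1%:R]natr1.
move: (P k.-1) (P k) (P k.+1) => q2 q1 p.
move: (k%:R : {poly R}) (N%:R : {poly R}) ('X : {poly R}) (y%:P) => a m x z r1.
apply/eqP; rewrite -subr_eq0; apply/eqP.
transitivity ((a + 1) * z * (((2 * a + m - 1) * z * x * q1 + a * (1 - z ^+ 2 - x ^+ 2) * q2) - (a + m - 1) * p)); first by ring.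
by rewrite r1 subrr mulr0.
Qed.

Lemma one_subX2_neq0 : 1 - 'X ^+ 2 != 0 :> {poly R}.
Proof.
rewrite subr_eq0; apply/eqP => /(congr1 (fun p : {poly R} => size p)).
by rewrite size_poly1 size_polyXn.
Qed.

(** The coefficients are those of [LopXn], so averaging commutes with [Lop]: an algebraic form of
    the rotation invariance of the Laplacian. *)
Lemma Lop_powavg k : Lop (P k) =
  k%:R * (k%:R + N%:R - 1) * P k - k%:R * (k%:R - 1) * P k.-2.
Proof.
apply: (mulfI one_subX2_neq0).
have D := powavg_deriv k; have D1 := powavg_deriv k.-1.
have DD := congr1 (@deriv R) D.
have DDr : (y%:P * P k.-1 - 'X * P k)^`() =
    y%:P * (P k.-1)^`() - (P k + 'X * (P k)^`()).
  by rewrite derivB derivCM [('X * _)^`()]derivM derivX mul1r.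
rewrite [LHS]derivM dsq [RHS]derivnM DDr in DD.
case: k D D1 DD DDr => [|k] D D1 DD _.
  by rewrite /Lop /= -polyC1 derivC deriv0; ring.
have r := powavg_rec k.
have E : (1 - 'X ^+ 2) * ((1 - 'X ^+ 2) * (P k.+1)^`()^`()) =
   2 * 'X * ((1 - 'X ^+ 2) * (P k.+1)^`()) + k.+1%:R * (y%:P * ((1 - 'X ^+ 2) * (P k)^`())
   - (1 - 'X ^+ 2) * P k.+1 - 'X * ((1 - 'X ^+ 2) * (P k.+1)^`())).
  transitivity ((1 - 'X ^+ 2) * ((- (2 * 'X) * (P k.+1)^`() +
    (1 - 'X^2) * (P k.+1)^`()^`()) + (2 * 'X) * (P k.+1)^`())); first by ring.
  by rewrite DD /=; ring.
transitivity (- ((1 - 'X ^+ 2) * ((1 - 'X ^+ 2) * (P k.+1)^`()^`()))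
  + N%:R * 'X * ((1 - 'X ^+ 2) * (P k.+1)^`())); first by rewrite /Lop; ring.
rewrite E D D1 [k.+1.-1]/= [k.+1.-2]/=; move: r; rewrite -[k.+1%:R]natr1.
move: (P k.-1) (P k) (P k.+1) => q2 q1 p.
move: (k%:R : {poly R}) (N%:R : {poly R}) ('X : {poly R}) (y%:P) => a m x z r.
apply/eqP; rewrite -subr_eq0; apply/eqP.
transitivity ((a + 1) * (((2 * a + m - 1) * z * x * q1 + a * (1 - z ^+ 2 - x ^+ 2) * q2) - (a + m - 1) * p)); first by ring.
by rewrite r subrr mulr0.
Qed.

Lemma powavg_at1 k : (P k).[1] = y ^+ k.
Proof.
suff [] : (P k).[1] = y ^+ k /\ (P k.+1).[1] = y ^+ k.+1 by [].
have n3 := ge3; elim: k => [|k [IH1 IH2]].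
  by rewrite /= hornerC !hornerE expr0 expr1.
split=> //; have k0 : 0 <= k%:R :> R by [].
have : ((k.+1%:R + N%:R - 1) * P k.+2).[1] = _ := congr1 (horner^~ 1) (powavg_rec k.+1).
have cst1 : (k.+1%:R + N%:R - 1) = (k.+1%:R + n - 1)%:P :> {poly R}.
  by rewrite !(polyCD, polyCN, polyC_natr).
have cst2 : (2 * k.+1%:R + N%:R - 1) = (2 * k.+1%:R + n - 1)%:P :> {poly R}.
  by rewrite !(polyCD, polyCN, polyC_natr, polyCM).
have cst3 : k.+1%:R * (1 - y%:P ^+ 2 - 'X ^+ 2) = (k.+1%:R)%:P * (1 - (y ^+ 2)%:P - 'X ^+ 2) :> {poly R}.
  by rewrite polyC_natr polyC_exp.
rewrite cst1 cst2 cst3 [k.+1.-1]/=.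
rewrite !(hornerM, hornerD, hornerN, hornerXn, hornerX, hornerC) IH1 IH2 => e.
apply: (mulfI (x := k.+1%:R + n - 1)); first by apply/eqP; rewrite -natr1; lra.
rewrite e !exprS; ring.
Qed.

(** The average of p(s) over t, as a polynomial in x. The integral form, from which positivity
    follows, is [ztransE_avg]. *)
Definition ztrans p : {poly R} := \sum_(i < size p) p`_i *: P i.

Lemma ztransE m p : (size p <= m)%N -> ztrans p = \sum_(i < m) p`_i *: P i.
Proof.
move=> pm; rewrite /ztrans (big_ord_widen m (fun i => p`_i *: P i) pm).
rewrite [RHS](bigID (fun i : 'I_m => (i < size p)%N)) /= [X in _ = _ + X]big1 ?addr0// => i.
by rewrite -leqNgt => pi; rewrite nth_default// scale0r.
Qed.

Lemma ztrans_lin a p q : ztrans (a *: p + q) = a *: ztrans p + ztrans q.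
Proof.
pose m := maxn (size (a *: p + q)) (maxn (size p) (size q)).
rewrite (@ztransE m) ?(@ztransE m p) ?(@ztransE m q) /m.
- rewrite scaler_sumr -big_split /=; apply: eq_bigr => i _.
  by rewrite coefD coefZ scalerDl scalerA.
- by rewrite !leq_max leqnn !orbT.
- by rewrite !leq_max leqnn !orbT.
- by rewrite !leq_max leqnn.
Qed.

Lemma ztrans0 : ztrans 0 = 0.
Proof. by rewrite /ztrans size_poly0 big_ord0. Qed.

Lemma ztransZ a p : ztrans (a *: p) = a *: ztrans p.
Proof. by rewrite -[a *: p]addr0 ztrans_lin ztrans0 addr0. Qed.

Lemma ztransD p q : ztrans (p + q) = ztrans p + ztrans q.
Proof. by rewrite -[p]scale1r ztrans_lin !scale1r. Qed.

Lemma ztrans_sum (I : Type) (s : seq I) (Q : pred I) (F : I -> {poly R}) :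
  ztrans (\sum_(i <- s | Q i) F i) = \sum_(i <- s | Q i) ztrans (F i).
Proof.
elim/big_rec2: _ => [|i u v _ <-]; first exact: ztrans0.
by rewrite ztransD.
Qed.

Lemma ztransXn k : ztrans 'X^k = P k.
Proof.
rewrite (@ztransE k.+1) ?size_polyXn// big_ord_recr /= coefXn eqxx scale1r.
by rewrite big1 ?add0r// => i _; rewrite coefXn ltn_eqF ?scale0r.
Qed.

Lemma Lop_sum (I : Type) (s : seq I) (Q : pred I) (F : I -> {poly R}) :
  Lop (\sum_(i <- s | Q i) F i) = \sum_(i <- s | Q i) Lop (F i).
Proof.
elim/big_rec2: _ => [|i u v _ <-]; last by rewrite LopD.
by rewrite /Lop !deriv0; ring.
Qed.

Lemma LopXn k : Lop 'X^k = (k%:R * (k%:R + n - 1)) *: 'X^k - (k%:R * (k%:R - 1)) *: 'X^(k.-2).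
Proof.
rewrite -!mul_polyC !(polyCM, polyCD, polyCB, polyC_natr, polyCN).
have dX m : ('X^m)^`() = m%:R * 'X^(m.-1) :> {poly R} by rewrite derivXn mulr_natl.
rewrite /Lop dX derivnM dX.
case: k => [|[|k]] /=; rewrite ?expr0 ?expr1 ?mul0r; try ring.
rewrite -[k.+2%:R]natr1 -[k.+1%:R]natr1 !exprS; ring.
Qed.

Lemma ztrans_Lop p : ztrans (Lop p) = Lop (ztrans p).
Proof.
rewrite [in LHS](_ : p = \sum_(i < size p) p`_i *: 'X^i); last first.
  by rewrite -[LHS]coefK poly_def.
rewrite Lop_sum ztrans_sum [in RHS]/ztrans Lop_sum; apply: eq_bigr => i _.
rewrite (LopZ p`_i 'X^i) LopZ ztransZ; congr (_ *: _).
rewrite LopXn -scaleNr ztransD !ztransZ !ztransXn Lop_powavg.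
by rewrite -!mul_polyC !(polyCM, polyCD, polyCB, polyC_natr, polyCN); ring.
Qed.

Lemma ztrans_at1 p : (ztrans p).[1] = p.[y].
Proof.
rewrite /ztrans horner_sum horner_coef; apply: eq_bigr => i _.
by rewrite hornerZ powavg_at1.
Qed.

(** The product formula for zonal polynomials. The left side is an eigenpolynomial of [Lop] for the
    eigenvalue of degree k, hence a multiple of c_k, and at x = 1 the scalar product s equals y. *)
Lemma ztrans_zonal k : ztrans (c k) = (c k).[y] *: c k.
Proof.
rewrite [LHS](@Lop_eigen k) ?ztrans_at1//.
by rewrite -ztrans_Lop Lop_zonal ztransZ.
Qed.

End ZonalTranslation.
End NormalizedGegenbauer.

(** * Integration against the weight (1 - x^2)^((N-2)/2) *)

Section WeightedIntegral.
Context {R : realType}.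
Variable N : nat.
Hypothesis hN : (3 <= N)%N.
Implicit Types (f g : R -> R) (p q : {poly R}) (x : R).
Local Notation n := (N%:R : R).
Local Notation mu := (@lebesgue_measure R).
Local Notation I := (`](-1)%R, 1%R[%classic : set R).
Local Notation mf f := (measurable_fun I f).
Local Notation w := (zweight N : R -> R).

Lemma mem_I x : I x = (-1 < x < 1) :> Prop.
Proof. by rewrite /= in_itv. Qed.

Lemma onem_sq_gt0 x : -1 < x < 1 -> 0 < 1 - x ^+ 2.
Proof. by move=> /andP[a b]; nra. Qed.

Lemma zweight_ge0 x : 0 <= w x. Proof. exact: powR_ge0. Qed.

Lemma zweight_gt0 x : -1 < x < 1 -> 0 < w x.
Proof. by move=> h; apply: powR_gt0; exact: onem_sq_gt0. Qed.

Lemma zweight_exp_gt0 : 0 < (n - 2) / 2.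
Proof. by have := @ge3 R N hN => h; lra. Qed.

Lemma zweight_le1 x : -1 < x < 1 -> w x <= 1.
Proof.
move=> h; have h0 := onem_sq_gt0 h; have e0 := zweight_exp_gt0.
have := @ge0_ler_powR _ _ (ltW e0) (1 - x ^+ 2) 1; rewrite powR1 !nnegrE; apply => //.
  exact: ltW.
by rewrite gerBl sqr_ge0.
Qed.

Lemma measurable_onem_sq_powR (a : R) D : measurable_fun D (fun x => (1 - x ^+ 2) `^ a : R).
Proof.
apply: measurable_funTS.
have h2 : measurable_fun [set: R] (fun x : R => 1 - x ^+ 2).
  by apply: measurable_funB => //; exact: measurable_funX.
exact: measurableT_comp (measurable_powR a) h2.
Qed.

Lemma measurable_zweight : measurable_fun [set: R] w.
Proof.
by apply: measurable_onem_sq_powR.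
Qed.

Lemma mfw : mf w. Proof. exact: measurable_funTS measurable_zweight. Qed.

Lemma measurable_horner D p : measurable_fun D (horner p).
Proof. by apply: measurable_funTS; apply: continuous_measurable_fun; exact: continuous_horner. Qed.

(** Integrability is stated on the open interval, where the weight is positive, so that it implies
    the measurability of [f] itself ([zI_mf]); [zintE] reconciles it with the closed interval in
    [zint]. *)
Definition zI f := mu.-integrable I (EFin \o (fun x => w x * f x)).

Lemma mIo : measurable I. Proof. by []. Qed.

Lemma muI : (mu I < +oo)%E.
Proof. by rewrite lebesgue_measure_itv /= lte_fin; case: ifP => _; rewrite -?EFinB ltry. Qed.

Lemma zintE f : mf f -> zint N f = \int[mu]_(x in I) (w x * f x).
Proof.
move=> h; rewrite /zint /Rintegral integral_itv_bndoo//.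
by apply/measurable_EFinP; apply: measurable_funM => //; exact: mfw.
Qed.

Lemma zI_mf f : zI f -> mf f.
Proof.
move=> /measurable_int/measurable_EFinP h.
apply: (@eq_measurable_fun _ _ _ _ _ (fun x => (w x)^-1 * (w x * f x))).
  move=> x; rewrite inE mem_I => hx.
  by rewrite mulrA mulVf ?mul1r// gt_eqF ?zweight_gt0.
apply: measurable_funM => //.
apply: (@eq_measurable_fun _ _ _ _ _ (fun x : R => (1 - x ^+ 2) `^ (- ((n - 2) / 2)))).
  by move=> x _; rewrite powRN.
exact: measurable_onem_sq_powR.
Qed.

Lemma zint_ext f g : (forall x, -1 < x < 1 -> f x = g x) -> zint N f = zint N g.
Proof.
move=> h; apply: eq_Rintegral => x; rewrite inE /= in_itv /= => /andP[a b].
(* At the end points the weight vanishes because its exponent is positive for N >= 3, so the values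
   of the functions there do not matter, measurable or not. *)
have [->|x1] := eqVneq x 1.
  by rewrite /zweight expr1n subrr powR0 ?mul0r// gt_eqF ?zweight_exp_gt0.
have [->|x2] := eqVneq x (-1).
  by rewrite /zweight sqrrN expr1n subrr powR0 ?mul0r// gt_eqF ?zweight_exp_gt0.
by rewrite h// lt_neqAle eq_sym x2 a lt_neqAle x1.
Qed.

Lemma zI_ext f g : (forall x, -1 < x < 1 -> f x = g x) -> zI f -> zI g.
Proof.
move=> h; apply: eq_integrable => // x.
by rewrite inE mem_I => /h /= ->.
Qed.

Lemma zI_le f g : mf f -> zI g -> (forall x, -1 < x < 1 -> `|f x| <= g x) -> zI f.
Proof.
move=> hf hg h; apply: le_integrable hg => //.
  by apply/measurable_EFinP; apply: measurable_funM => //; exact: mfw.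
move=> x; rewrite mem_I => hx /=.
rewrite lee_fin !normrM ler_wpM2l// (le_trans (h _ hx))//; exact: ler_norm.
Qed.

Lemma zI_cst c : zI (fun=> c).
Proof.
apply: measurable_bounded_integrable => //; first exact: muI.
  by apply: measurable_funM => //; exact: mfw.
exists `|c|; split => // M cM x /=; rewrite in_itv /= => hx.
rewrite normrM ger0_norm ?zweight_ge0// (le_trans _ (ltW cM))//.
by rewrite ler_piMl// zweight_le1.
Qed.

Lemma zI_bdd f M : mf f -> (forall x, -1 < x < 1 -> `|f x| <= M) -> zI f.
Proof. by move=> h hM; apply: zI_le h (zI_cst M) hM. Qed.

Lemma zID f g : zI f -> zI g -> zI (fun x => f x + g x).
Proof.
move=> hf hg; have := integrableD (mIo : measurable (I : set (measurableTypeR R))) hf hg.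
by apply: eq_integrable => // x _ /=; rewrite mulrDr EFinD.
Qed.

Lemma zIZ c f : zI f -> zI (fun x => c * f x).
Proof.
move=> hf; have := integrableZl (mIo : measurable (I : set (measurableTypeR R))) c hf.
by apply: eq_integrable => // x _ /=; rewrite mulrCA EFinM.
Qed.

Lemma zIN f : zI f -> zI (fun x => - f x).
Proof. by move=> /(zIZ (-1)); apply: zI_ext => x _; rewrite mulN1r. Qed.

Lemma zIB f g : zI f -> zI g -> zI (fun x => f x - g x).
Proof. by move=> hf hg; exact: zID hf (zIN hg). Qed.

Lemma zI_norm f : zI f -> zI (fun x => `|f x|).
Proof.
move=> h; have := integrable_norm h; apply: eq_integrable => // x _ /=.
by rewrite normrM ger0_norm// zweight_ge0.
Qed.

Lemma zintD f g : zI f -> zI g -> zint N (fun x => f x + g x) = zint N f + zint N g.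
Proof.
move=> hf hg; rewrite !zintE; try exact: zI_mf; last by exact: zI_mf (zID _ _).
by under eq_Rintegral do rewrite mulrDr; rewrite RintegralD.
Qed.

Lemma zintZ c f : zI f -> zint N (fun x => c * f x) = c * zint N f.
Proof.
move=> hf; rewrite !zintE; try exact: zI_mf; last by exact: zI_mf (zIZ _ _).
by under eq_Rintegral do rewrite mulrCA; rewrite RintegralZl.
Qed.

Lemma zintN f : zI f -> zint N (fun x => - f x) = - zint N f.
Proof.
by move=> h; rewrite -mulN1r -zintZ//; apply: zint_ext => x _; rewrite mulN1r.
Qed.

Lemma zintB f g : zI f -> zI g -> zint N (fun x => f x - g x) = zint N f - zint N g.
Proof. by move=> hf hg; rewrite zintD ?zintN//; exact: zIN. Qed.

Lemma zint0 : zint N (fun=> 0 : R) = 0.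
Proof.
rewrite -[RHS](mul0r (zint N (fun=> 0 : R))) -(zintZ 0 (zI_cst 0)).
by apply: zint_ext => x _; rewrite mul0r.
Qed.

Lemma zI_sum (J : Type) (s : seq J) (Q : pred J) (F : J -> R -> R) :
  (forall i, zI (F i)) -> zI (fun x => \sum_(i <- s | Q i) F i x).
Proof.
move=> h; elim: s => [|i s IH].
  by apply: zI_ext (zI_cst 0) => x _; rewrite big_nil.
case E : (Q i); last by apply: zI_ext IH => x _; rewrite big_cons E.
by apply: zI_ext (zID (h i) IH) => x _; rewrite big_cons E.
Qed.

Lemma zint_sum (J : Type) (s : seq J) (Q : pred J) (F : J -> R -> R) :
  (forall i, zI (F i)) ->
  zint N (fun x => \sum_(i <- s | Q i) F i x) = \sum_(i <- s | Q i) zint N (F i).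
Proof.
move=> h; elim: s => [|i s IH].
  by rewrite big_nil -[RHS]zint0; apply: zint_ext => x _; rewrite big_nil.
rewrite big_cons; case: ifP => E; rewrite -IH.
  rewrite -zintD//; last exact: zI_sum.
  by apply: zint_ext => x _; rewrite big_cons E.
by apply: zint_ext => x _; rewrite big_cons E.
Qed.

Lemma zint_ge0 f : (forall x, -1 < x < 1 -> 0 <= f x) -> 0 <= zint N f.
Proof.
move=> h; rewrite (@zint_ext f (fun x => if -1 < x < 1 then f x else 0)); last first.
  by move=> x ->.
apply: Rintegral_ge0 => x _; apply: mulr_ge0; first exact: zweight_ge0.
by case: ifP => // /h.
Qed.

Lemma zint_le f g : zI f -> zI g -> (forall x, -1 < x < 1 -> f x <= g x) ->
  zint N f <= zint N g.
Proof.
move=> hf hg h; rewrite -subr_ge0 -zintB//; apply: zint_ge0 => x /h.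
by rewrite subr_ge0.
Qed.

Lemma zint_norm f : zI f -> `|zint N f| <= zint N (fun x => `|f x|).
Proof.
move=> h; rewrite ler_norml -zintN; last exact: zI_norm.
apply/andP; split; apply: zint_le => //; try exact: zI_norm.
- by apply: zIN; exact: zI_norm.
- by move=> x _; rewrite lerNnormlW.
- by move=> x _; exact: ler_norm.
Qed.

Lemma zI_mulb f g M : zI f -> mf g -> (forall x, -1 < x < 1 -> `|g x| <= M) ->
  zI (fun x => g x * f x).
Proof.
move=> hf hg h; apply: (@zI_le _ (fun x => M * `|f x|)).
- by apply: measurable_funM => //; exact: zI_mf.
- by apply: zIZ; exact: zI_norm.
- by move=> x hx; rewrite normrM ler_wpM2r// h.
Qed.

Lemma is_derive_horner p x : is_derive x 1 (horner p) (p^`()).[x].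
Proof. by apply: DeriveDef; [exact: derivable_horner|rewrite derivE derive1E]. Qed.

Lemma horner_bound p : exists M : R, 0 <= M /\ forall x, -1 <= x <= 1 -> `|p.[x]| <= M.
Proof.
exists (\sum_(i < size p) `|p`_i|); split; first exact: sumr_ge0.
move=> x hx; rewrite horner_coef; apply: le_trans (ler_norm_sum _ _ _) _.
apply: ler_sum => i _; rewrite normrM ler_piMr// normrX exprn_ile1//.
by rewrite ler_norml.
Qed.

Lemma oo_cc x : -1 < x < 1 -> -1 <= x <= 1.
Proof. by move=> /andP[a b]; rewrite !ltW. Qed.

Lemma zI_mulp f p : zI f -> zI (fun x => p.[x] * f x).
Proof.
move=> hf; have [M [_ hM]] := horner_bound p; apply: (@zI_mulb _ _ M) => //.
  exact: measurable_horner.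
by move=> x /oo_cc; exact: hM.
Qed.

Lemma zI_poly p : zI (horner p).
Proof. by apply: zI_ext (zI_mulp p (zI_cst 1)) => x _; rewrite mulr1. Qed.

Lemma zint_dct (f_ : nat -> R -> R) f g :
  (forall m, mf (f_ m)) ->
  (forall x, -1 < x < 1 -> f_ ^~ x @ \oo --> f x) -> zI g ->
  (forall m x, -1 < x < 1 -> `|f_ m x| <= g x) ->
  zI f /\ zint N (f_ m) @[m --> \oo] --> zint N f.
Proof.
move=> mf_ cf ig fg.
have hmf : mf f.
  by apply: measurable_fun_cvg mf_ _ => x; rewrite mem_I; exact: cf.
have mwf (h : R -> R) : mf h -> measurable_fun I (fun x => (w x * h x)%:E).
  by move=> hh; apply/measurable_EFinP; apply: measurable_funM => //; exact: mfw.
have [] := @dominated_convergence _ _ _ mu I (measurable_itv _)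
  (fun m x => (w x * f_ m x)%:E) (fun x => (w x * f x)%:E)
  (fun x => (w x * g x)%:E) _ _ _ ig _.
- by move=> m; exact: mwf.
- exact: mwf.
- apply: aeW => x; rewrite mem_I => hx; apply: cvg_EFin; first exact: nearW.
  by apply: cvgM; [exact: cvg_cst|exact: cf].
- apply: aeW => x m; rewrite mem_I => hx /=.
  by rewrite lee_fin normrM ger0_norm ?zweight_ge0// ler_wpM2l ?zweight_ge0// fg.
move=> i1 _ c; split => //.
rewrite zintE// /Rintegral.
under eq_fun do rewrite zintE//.
have h : (\int[mu]_(x in I) (w x * f x)%:E)%E \is a fin_num by exact: integrable_fin_num.
by apply: fine_cvg; rewrite fineK.
Qed.

Lemma zint_eq0_ae f : zI f -> (forall x, -1 < x < 1 -> 0 <= f x) -> zint N f = 0 ->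
  {ae mu, forall x, I x -> f x = 0}.
Proof.
move=> hf f0 e; have mff := zI_mf hf; move: e; rewrite zintE//.
have fin : (\int[mu]_(x in I) (w x * f x)%:E)%E \is a fin_num by exact: integrable_fin_num.
rewrite /Rintegral => e.
have : (\int[mu]_(x in I) `|(w x * f x)%:E| = 0)%E.
  rewrite -[RHS](_ : (\int[mu]_(x in I) (w x * f x)%:E)%E = 0%E).
    apply: eq_integral => x; rewrite inE mem_I => hx.
    by rewrite gee0_abs// lee_fin mulr_ge0 ?zweight_ge0// f0.
  by rewrite -[LHS]fineK// e.
move/ae_eq_integral_abs => h.
have /h : measurable_fun I (fun x => (w x * f x)%:E) by exact: measurable_int hf.
move=> /(_ (measurable_itv _)); apply: filterS => x hx Ix; have := hx Ix => /= -[] /eqP.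
rewrite mulf_eq0 gt_eqF ?orFb; first by move/eqP.
by move: Ix; rewrite mem_I => /zweight_gt0.
Qed.

Lemma not_negligible_I : ~ {ae mu, forall x, I x -> False}.
Proof.
move=> /negligibleP; rewrite (_ : ~` _ = I); last first.
  by apply/seteqP; split => x /=; [move=> /contrapT|move=> ? h; exact: h].
move=> /(_ mIo) h.
have := @lebesgue_measure_itv R `](-1), 1[; rewrite /= lte_fin.
have -> : (-1 < 1 :> R)%R by lra.
move=> h2; have := etrans (esym (h : mu I = 0%E)) h2; rewrite -EFinB => /(congr1 fine) /=; lra.
Qed.

Lemma zint_gt0 f : zI f -> (forall x, -1 < x < 1 -> 0 <= f x) ->
  {ae mu, forall x, I x -> f x != 0} -> 0 < zint N f.
Proof.
move=> hf f0 fn; rewrite lt_neqAle zint_ge0// andbT eq_sym; apply/eqP => e.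
have := zint_eq0_ae hf f0 e => h; apply: not_negligible_I.
apply: (@filterS2 _ _ (ae_filter_ringOfSetsType mu) _ _ _ _ h fn) => x h1 h2 Ix; by move: (h2 Ix); rewrite h1 ?eqxx.
Qed.

Lemma zint_ae_ext f g : mf f -> mf g -> {ae mu, forall x, I x -> f x = g x} ->
  zint N f = zint N g.
Proof.
move=> h1 h2 h; rewrite !zintE// /Rintegral; congr fine; apply: ae_eq_integral => //.
- by apply/measurable_EFinP; apply: measurable_funM => //; exact: mfw.
- by apply/measurable_EFinP; apply: measurable_funM => //; exact: mfw.
- by apply: (@filterS _ _ (ae_filter_ringOfSetsType mu) _ _ _ h) => x hx Ix /=; rewrite hx.
Qed.

Lemma zI_ae_ext f g : mf g -> {ae mu, forall x, I x -> f x = g x} -> zI f -> zI g.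
Proof.
move=> h2 h hf; apply/integrableP; split.
  by apply/measurable_EFinP; apply: measurable_funM => //; exact: mfw.
have mff := zI_mf hf.
move/integrableP : hf => [m1]; apply: le_lt_trans; rewrite le_eqVlt; apply/orP; left.
apply/eqP; apply: ge0_ae_eq_integral => //.
- apply: measurableT_comp => //; apply/measurable_EFinP; apply: measurable_funM => //; exact: mfw.
- exact: measurableT_comp.
- by apply: (@filterS _ _ (ae_filter_ringOfSetsType mu) _ _ _ h) => x hx Ix /=; rewrite hx.
Qed.

Lemma onem_sq_powR_cvg1 (a : R) : 0 < a -> (1 - x ^+ 2) `^ a @[x --> 1^'-] --> 0.
Proof.
move=> a0; have h : 1 - x ^+ 2 @[x --> 1^'-] --> (0 : R)^'+.
  have c : 1 - x ^+ 2 @[x --> (1:R)^'-] --> (0 : R).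
    rewrite -[X in _ --> X](subrr 1); apply: cvgB; first exact: cvg_cst.
    rewrite -[X in _ --> X](expr1n _ 2); apply: cvg_at_left_filter; exact: exprn_continuous.
  move=> A /= A0; have := c _ A0; rewrite /nbhs /= => h.
  near=> x; have hA : 0 < 1 - x ^+ 2 -> A (1 - x ^+ 2) by near: x; exact: h.
  apply: hA; apply: onem_sq_gt0; apply/andP; split => //.
exact: cvg_comp h (powR_cvg0 a0).
Unshelve. all: by end_near. Qed.

Lemma onem_sq_powR_cvgN1 (a : R) : 0 < a -> (1 - x ^+ 2) `^ a @[x --> (-1)^'+] --> 0.
Proof.
move=> a0; have h : 1 - x ^+ 2 @[x --> (-1)^'+] --> (0 : R)^'+.
  have c : 1 - x ^+ 2 @[x --> (-1:R)^'+] --> (0 : R).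
    rewrite -[X in _ --> X](subrr 1); apply: cvgB; first exact: cvg_cst.
    have e : (-1) ^+ 2 = 1 :> R by rewrite sqrrN expr1n.
    rewrite -[X in _ --> X]e; apply: cvg_at_right_filter; exact: exprn_continuous.
  move=> A /= A0; have := c _ A0; rewrite /nbhs /= => h.
  near=> x; have hA : 0 < 1 - x ^+ 2 -> A (1 - x ^+ 2) by near: x; exact: h.
  apply: hA; apply: onem_sq_gt0; apply/andP; split => //.
exact: cvg_comp h (powR_cvg0 a0).
Unshelve. all: by end_near. Qed.

Lemma is_derive_onem_sq_powR (a x : R) : -1 < x < 1 ->
  is_derive x 1 (fun y => (1 - y ^+ 2) `^ a) (- (2 * a) * x * (1 - x ^+ 2) `^ (a - 1)).
Proof.
move=> hx; have h0 := onem_sq_gt0 hx.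
have d1 : is_derive x 1 (fun y : R => 1 - y ^+ 2) (- (2 * x)).
  apply: is_derive_eq.
  by rewrite /GRing.scale /=; ring.
have := @is_derive1_comp R (fun y : R => y `^ a) (fun y => 1 - y ^+ 2) x _ _ (@is_derive1_powR R a _ h0) d1.
move=> d; apply: (is_derive_eq d); ring.
Qed.

Definition zbig x : R := (1 - x ^+ 2) `^ (n / 2).

Lemma zbigE x : -1 < x < 1 -> zbig x = (1 - x ^+ 2) * w x.
Proof.
move=> hx; have h0 := onem_sq_gt0 hx; have := @ge3 R N hN => n3.
rewrite /zbig -mulr_powRB1 ?ltW//; last lra.
by rewrite /zweight; congr (_ * _ `^ _); field.
Qed.

Lemma is_derive_zbig x : -1 < x < 1 -> is_derive x 1 zbig (- n * x * w x).
Proof.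
move=> hx; apply: (is_derive_eq (is_derive_onem_sq_powR (n / 2) hx)).
rewrite /zweight (_ : n / 2 - 1 = (n - 2) / 2); last by field.
by congr (_ * _); congr (_ * _); field.
Qed.

Lemma within_zweight : {within `[(-1 : R), 1], continuous w}.
Proof.
apply: derivable_oo_LRcontinuous_within; split.
- by move=> x; rewrite in_itv /= => hx; apply: ex_derive; exact: is_derive_onem_sq_powR.
- rewrite {2}/zweight sqrrN expr1n subrr powR0 ?gt_eqF ?zweight_exp_gt0//.
  exact: onem_sq_powR_cvgN1 zweight_exp_gt0.
- rewrite {2}/zweight expr1n subrr powR0 ?gt_eqF ?zweight_exp_gt0//.
  exact: onem_sq_powR_cvg1 zweight_exp_gt0.
Qed.

(** Times the weight, the integrand is the derivative of - (1 - x^2)^(N/2) p, which vanishes at both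
    ends. The symmetry of [Lop], and with it the orthogonality of the zonal polynomials, comes from
    here. *)
Lemma zint_divX p : zint N (fun x => n * x * p.[x] - (1 - x ^+ 2) * (p^`()).[x]) = 0.
Proof.
have n3 := @ge3 R N hN; have n2 : 0 < n / 2 by lra.
pose F x := zbig x * - p.[x].
pose P := n%:P * 'X * p - (1 - 'X ^+ 2) * p^`().
have PE x : P.[x] = n * x * p.[x] - (1 - x ^+ 2) * (p^`()).[x].
  by rewrite /P !hornerE.
rewrite (@zint_ext _ (horner P)); last by move=> x _; rewrite PE.
have F1 : F 1 = 0 by rewrite /F /zbig expr1n subrr powR0 ?mul0r// gt_eqF.
have F2 : F (-1) = 0 by rewrite /F /zbig sqrrN expr1n subrr powR0 ?mul0r// gt_eqF.
have D x : -1 < x < 1 -> is_derive x 1 F (w x * P.[x]).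
  move=> hx; have h0 := onem_sq_gt0 hx.
  have d1 := is_derive_zbig hx.
  have d2 : is_derive x 1 (fun y => - p.[y]) (- (p^`()).[x]).
    exact: is_deriveN (is_derive_horner p x).
  apply: (is_derive_eq (is_deriveM d1 d2)); rewrite PE zbigE// /GRing.scale /=; ring.
rewrite /zint /Rintegral.
have -> : (\int[mu]_(x in `[(-1)%R, 1%R]) (w x * P.[x])%:E = (F 1)%:E - (F (-1))%:E)%E.
  apply: (@continuous_FTC2 _ (fun x => w x * P.[x])); first lra.
  - have cP : {within `[(-1 : R), 1], continuous (horner P)}.
      by apply: continuous_subspaceT; exact: continuous_horner.
    move=> x; apply: cvgM; first exact: within_zweight.
    exact: cP.
  - split; rewrite ?F1 ?F2.
    + by move=> x; rewrite in_itv /= => /D d; exact: ex_derive.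
    + rewrite -(mul0r (- p.[-1])); apply: cvgM; first exact: onem_sq_powR_cvgN1.
      by apply: cvgN; apply: cvg_at_right_filter; exact: continuous_horner.
    + rewrite -(mul0r (- p.[1])); apply: cvgM; first exact: onem_sq_powR_cvg1.
      by apply: cvgN; apply: cvg_at_left_filter; exact: continuous_horner.
  - by move=> x; rewrite in_itv /= => /D d; rewrite derive1E; apply: derive_val.
by rewrite F1 F2 -EFinB /= subrr.
Qed.

End WeightedIntegral.

(** * Zonal coefficients and the eigenvalues of the Paneitz operator *)

Section ZonalCoefficients.
Context {R : realType}.
Variable N : nat.
Hypothesis hN : (3 <= N)%N.
Implicit Types (f g : R -> R) (p q : {poly R}) (x : R) (k j m : nat).
Local Notation n := (N%:R : R).
Local Notation mu := (@lebesgue_measure R).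
Local Notation I := (`](-1)%R, 1%R[%classic : set R).
Local Notation c := (@zonal R N).
Local Notation A := (@upc R N).
Local Notation B := (@downc R N).
Local Notation zI := (@zI R N).
Local Notation zint := (zint N).
Local Notation pe := (@paneitz_eig R N).

Definition zW : R := zint (fun=> 1).
(** The coefficients are not normalized: f expands with coefficients [zhat f k / znorm k] along c_k,
    which keeps square roots out of the identities. *)
Definition zhat f k : R := zint (fun x => f x * (c k).[x]).
Definition znorm k : R := zint (horner (c k * c k)).
Local Notation h := znorm.

Lemma poly_ae_neq0 p : p != 0 -> {ae mu, forall x, I x -> p.[x] != 0}.
Proof.
move=> p0; have fin : finite_set [set x | root p x].
  apply/finite_seqP.
  have [s hs] : exists s : seq R, forall x, root p x -> x \in s.
    (* If no list contained all the roots, distinct roots could be collected without end, beyond the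
       size of p. *)
    pose P m := exists s : seq R, (size s = m) /\ uniq s /\ all (root p) s.
    have bd m : P m -> (m < size p)%N.
      by move=> [s [<- [us rs]]]; exact: max_poly_roots.
    apply: contrapT => nh.
    have H m : P m.
      elim: m => [|m [s [sm [us rs]]]]; first by exists [::].
      have [x [rx xs]] : exists x, root p x /\ x \notin s.
        apply: contrapT => ne; apply: nh; exists s => x rx.
        by apply: contrapT => /negP xs; apply: ne; exists x.
      by exists (x :: s); rewrite /= sm xs us rx rs.
    by have := bd _ (H (size p)); rewrite ltnn.
  exists [seq x <- s | root p x]; apply/seteqP; split => x /=.
    by move=> rx; rewrite mem_filter rx hs.
  by rewrite mem_filter => /andP[].
exists [set x | root p x]; split.
- have cs := finite_set_countable fin; apply: countable_measurable; [by move=> ?; exact: measurable_set1|exact: cs].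
- by apply: countable_lebesgue_measure0; exact: finite_set_countable.
- by move=> x /= /not_implyP [_ /negP]; rewrite negbK.
Qed.

Lemma zint_poly_gt0 p : p != 0 -> (forall x, -1 < x < 1 -> 0 <= p.[x]) ->
  0 < zint (horner p).
Proof.
move=> p0 pge; apply: zint_gt0 => //; first exact: zI_poly.
exact: poly_ae_neq0.
Qed.

Lemma zW_gt0 : 0 < zW.
Proof.
rewrite /zW (_ : (fun=> 1) = horner (1 : {poly R})); last by apply/funext => x; rewrite hornerC.
by apply: zint_poly_gt0; rewrite ?oner_eq0// => x _; rewrite hornerC.
Qed.

Lemma zint_hornerD p q : zint (horner (p + q)) = zint (horner p) + zint (horner q).
Proof.
by rewrite -zintD//; try exact: zI_poly; apply: zint_ext => // x _; rewrite hornerD.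
Qed.

Lemma zint_hornerZ a p : zint (horner (a *: p)) = a * zint (horner p).
Proof.
by rewrite -zintZ//; try exact: zI_poly; apply: zint_ext => // x _; rewrite hornerZ.
Qed.

Lemma zint_horner0 : zint (horner (0 : {poly R})) = 0.
Proof. by rewrite -(scale0r (0 : {poly R})) zint_hornerZ mul0r. Qed.

Lemma zint_hornerN p : zint (horner (- p)) = - zint (horner p).
Proof. by rewrite -scaleN1r zint_hornerZ mulN1r. Qed.

Lemma zint_horner_sum (J : Type) (s : seq J) (Q : pred J) (F : J -> {poly R}) :
  zint (horner (\sum_(i <- s | Q i) F i)) = \sum_(i <- s | Q i) zint (horner (F i)).
Proof.
elim/big_rec2: _ => [|i u v _ <-]; first exact: zint_horner0.
by rewrite zint_hornerD.
Qed.

Lemma zint_divXp p : zint (horner (N%:R * 'X * p - (1 - 'X ^+ 2) * p^`())) = 0.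
Proof.
rewrite -(zint_divX hN p); apply: zint_ext => // x _.
by rewrite -polyC_natr !hornerE.
Qed.

Lemma zint_Lop_sym p q : zint (horner (Lop N p * q)) = zint (horner (p * Lop N q)).
Proof.
have H (u v : {poly R}) : zint (horner (Lop N u * v)) = zint (horner ((1 - 'X ^+ 2) * u^`() * v^`())).
  apply/eqP; rewrite -subr_eq0 -zint_hornerN -zint_hornerD.
  rewrite -[X in _ == X](zint_divXp (u^`() * v)); apply/eqP; congr (zint (horner _)).
  by rewrite /Lop derivM; ring.
rewrite H [p * _]mulrC H; congr (zint (horner _)); ring.
Qed.

Lemma zonal_orth j k : j != k -> zint (horner (c j * c k)) = 0.
Proof.
move=> jk; have := zint_Lop_sym (c j) (c k).
rewrite !Lop_zonal// -scalerAl -scalerAr !zint_hornerZ => /eqP.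
rewrite -subr_eq0 -mulrBl mulf_eq0 => /orP[|/eqP//].
by rewrite subr_eq0 => /eqP/(@lap_eig_inj R N hN) e; rewrite e eqxx in jk.
Qed.

Lemma zonal_neq0 k : c k != 0.
Proof.
apply/eqP => e; have := @zonal_at1 R N hN k.
by rewrite e horner0 => /eqP; rewrite eq_sym oner_eq0.
Qed.

Lemma znorm_gt0 k : 0 < h k.
Proof.
apply: zint_poly_gt0; first by rewrite mulf_neq0// zonal_neq0.
by move=> x _; rewrite hornerM -expr2 sqr_ge0.
Qed.

Lemma znorm0 : h 0 = zW.
Proof. by rewrite /h zonal0// mulr1; apply: zint_ext => // x _; rewrite hornerC. Qed.

Lemma zint_zonal k : zint (horner (c k)) = if k == 0%N then zW else 0.
Proof.
case: k => [|k]; first by rewrite -znorm0 /h zonal0// mulr1.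
by rewrite -[c _]mul1r -(@zonal0 R N) zonal_orth.
Qed.

(** Both sides are the integral of x c_k c_(k+1), with x absorbed into one factor or into the
    other. *)
Lemma znorm_rec k : A k * h k.+1 = B k.+1 * h k.
Proof.
have n3 := @ge3 R N hN.
transitivity (zint (horner ('X * c k * c k.+1))).
  rewrite zonal_mulX// mulrDl -!scalerAl zint_hornerD !zint_hornerZ.
  by rewrite [X in _ + _ * X]zonal_orth ?mulr0 ?addr0//; case: k => // k; rewrite ?ltn_eqF// ltnW.
rewrite -mulrA [c k * _]mulrC mulrA zonal_mulX// mulrDl -!scalerAl zint_hornerD !zint_hornerZ /=.
by rewrite zonal_orth ?mulr0 ?add0r// gtn_eqF.
Qed.

Lemma size_zonal k : (size (c k) <= k.+1)%N.
Proof.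
apply/leq_sizeP => i ki.
have H m : forall i, (k < i)%N -> (size (c k) <= i + m)%N -> (c k)`_i = 0.
  elim: m => [|m IH] l kl lm; first by rewrite nth_default// -(addn0 l).
  have := congr1 (fun q : {poly R} => q`_l) (@Lop_zonal R N hN k).
  rewrite coef_Lop coefZ (IH l.+2); last 2 first.
  - by rewrite (leq_trans kl)// -addn2 leq_addr.
  - by rewrite !addSn ltnW// -addnS.
  rewrite mulr0 subr0 => /eqP; rewrite -subr_eq0 -mulrBl mulf_eq0 => /orP[|/eqP//].
  by rewrite subr_eq0 => /eqP/(@lap_eig_inj R N hN) e; rewrite e ltnn in kl.
by apply: (H (size (c k))); rewrite // leq_addl.
Qed.

Lemma zonal_span m p : (size p <= m)%N -> exists a : nat -> R, p = \sum_(k < m) a k *: c k.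
Proof.
elim: m p => [|m IH] p hp.
  by exists (fun=> 0); rewrite big_ord0; apply/eqP; rewrite -size_poly_eq0 -leqn0.
have cm := @zonal_lead R N hN m.
pose b := p`_m / (c m)`_m.
have [a ha] : exists a : nat -> R, p - b *: c m = \sum_(k < m) a k *: c k.
  apply: IH; apply/leq_sizeP => i; rewrite leq_eqVlt => /orP[/eqP<-|mi].
    by rewrite coefB coefZ /b divfK ?subrr.
  by rewrite coefB coefZ !nth_default ?mulr0 ?subr0// (leq_trans _ mi)// size_zonal.
exists (fun k => if k == m then b else a k).
rewrite big_ord_recr /= eqxx; apply/eqP; rewrite -subr_eq ha; apply/eqP.
by apply: eq_bigr => i _; rewrite ltn_eqF.
Qed.

Definition phat p k : R := zint (horner (p * c k)).

Lemma zhat_horner p k : zhat (horner p) k = phat p k.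
Proof. by apply: zint_ext => // x _; rewrite hornerM. Qed.

Lemma phat_sum m (a : nat -> R) k :
  phat (\sum_(i < m) a i *: c i) k = if (k < m)%N then a k * h k else 0.
Proof.
rewrite /phat mulr_suml zint_horner_sum.
under eq_bigr do rewrite -scalerAl zint_hornerZ.
case: ifP => km.
  rewrite (bigD1 (Ordinal km)) //= big1 ?addr0// => i ik.
  by rewrite zonal_orth ?mulr0//.
rewrite big1// => i _; rewrite zonal_orth ?mulr0//.
by apply: contraFN km => /eqP <-.
Qed.

Lemma zonal_expand m p : (size p <= m)%N -> p = \sum_(k < m) (phat p k / h k) *: c k.
Proof.
move=> /zonal_span[a e]; rewrite {1}e; apply: eq_bigr => i _.
by rewrite {1}e phat_sum ltn_ord mulfK// gt_eqF// znorm_gt0.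
Qed.

Lemma phat_big p k : (size p <= k)%N -> phat p k = 0.
Proof. by move=> /zonal_span[a ->]; rewrite phat_sum ltnn. Qed.

Lemma phat_zonal j k : phat (c j) k = if j == k then h k else 0.
Proof. by case: eqVneq => [->//|jk]; rewrite /phat zonal_orth. Qed.

Lemma phatD p q k : phat (p + q) k = phat p k + phat q k.
Proof. by rewrite /phat mulrDl zint_hornerD. Qed.

Lemma phatZ a p k : phat (a *: p) k = a * phat p k.
Proof. by rewrite /phat -scalerAl zint_hornerZ. Qed.

Lemma phatX p k : phat ('X * p) k = A k * phat p k.+1 + B k * phat p k.-1.
Proof.
rewrite /phat -mulrA [p * _]mulrC mulrA zonal_mulX// mulrDl -!scalerAl.
by rewrite zint_hornerD !zint_hornerZ ![c _ * p]mulrC.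
Qed.

Lemma zhatX f k : zI f -> zhat (fun x => x * f x) k = A k * zhat f k.+1 + B k * zhat f k.-1.
Proof.
move=> hf; have hp q : zI (fun x => f x * q.[x]).
  by apply: zI_ext (zI_mulp q hf) => // x _; rewrite mulrC.
rewrite /zhat -!zintZ// -zintD//; try exact: zIZ.
apply: zint_ext => // x _.
transitivity (f x * ('X * c k).[x]); first by rewrite hornerM hornerX; ring.
by rewrite zonal_mulX// hornerD !hornerZ; ring.
Qed.

Lemma zhatD f g k : zI f -> zI g -> zhat (fun x => f x + g x) k = zhat f k + zhat g k.
Proof.
move=> hf hg; have hp f' q : zI f' -> zI (fun x => f' x * q.[x]).
  by move=> hf'; apply: zI_ext (zI_mulp q hf') => // x _; rewrite mulrC.
by rewrite /zhat -zintD//; try exact: hp; apply: zint_ext => // x _; rewrite mulrDl.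
Qed.

Lemma zhatZ a f k : zI f -> zhat (fun x => a * f x) k = a * zhat f k.
Proof.
move=> hf; have hp f' q : zI f' -> zI (fun x => f' x * q.[x]).
  by move=> hf'; apply: zI_ext (zI_mulp q hf') => // x _; rewrite mulrC.
by rewrite /zhat -zintZ//; try exact: hp; apply: zint_ext => // x _; rewrite mulrA.
Qed.

Lemma zint_mulp_expand f m p : zI f -> (size p <= m)%N ->
  zint (fun x => f x * p.[x]) = \sum_(k < m) phat p k * zhat f k / h k.
Proof.
move=> hf hp; rewrite {1}(zonal_expand hp).
have hq q : zI (fun x => f x * q.[x]).
  by apply: zI_ext (zI_mulp q hf) => // x _; rewrite mulrC.
transitivity (zint (fun x => \sum_(k < m) phat p k / h k * (f x * (c k).[x]))).
  apply: zint_ext => // x _; rewrite horner_sum mulr_sumr; apply: eq_bigr => i _.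
  by rewrite hornerZ mulrCA.
rewrite zint_sum//; last by move=> i; exact: zIZ.
by apply: eq_bigr => i _; rewrite zintZ// /zhat mulrAC.
Qed.

Definition zquotI k : R := zint (horner (@zquot R N k)).

Lemma zquotI0 : zquotI 0 = zW.
Proof. by apply: zint_ext => // x _; rewrite hornerC. Qed.

Lemma zquotIS k : (k%:R + n) * zquotI k.+1 = k.+1%:R * zquotI k.
Proof.
have n3 := @ge3 R N hN; have k0 : 0 <= k%:R :> R by [].
rewrite /zquotI [zquot N k.+1]/= zint_hornerZ zint_hornerD !zint_hornerZ zint_zonal /= mulr0 add0r.
rewrite -[k.+1%:R]natr1.
rewrite (_ : k%:R + 1 + n - 1 = k%:R + n); last ring.
by rewrite mulVKf//; apply/eqP; lra.
Qed.

Lemma pe1 : pe 1 = (N`!)%:R.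
Proof. by rewrite paneitz_eigS add0n fact0 divr1. Qed.

Lemma pe_gt0 k : 0 < pe k.+1.
Proof. by rewrite paneitz_eigS divr_gt0 ?ltr0n ?fact_gt0. Qed.

Lemma pe_ge0 k : 0 <= pe k.
Proof.
case: k => [|k]; last exact: ltW (pe_gt0 k).
by rewrite paneitz_eig0// (leq_trans _ hN).
Qed.

Lemma pe0 : pe 0 = 0. Proof. by rewrite paneitz_eig0// (leq_trans _ hN). Qed.

Lemma pe_rec k : k%:R * pe k.+1 = (k%:R + n) * pe k.
Proof.
case: k => [|k]; first by rewrite mul0r pe0 mulr0.
have f0 m : (m`!)%:R != 0 :> R by rewrite pnatr_eq0 -lt0n fact_gt0.
rewrite !paneitz_eigS addSn !factS !natrM -!natr1 natrD.
by field; rewrite f0 natr1 pnatr_eq0.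
Qed.

(** This is why the kernel 1 / (1 - s) inverts the Paneitz operator after one derivative: up to a
    shift, the integrals [zquotI] and the eigenvalues obey inverse recursions in k, so their product
    is explicit. *)
Lemma zquotI_pe k : zquotI k * pe k.+1 = (k%:R + n) * (N.-1`!)%:R * zW.
Proof.
have n3 := @ge3 R N hN.
elim: k => [|k IH].
  rewrite zquotI0 pe1 add0r (_ : N = N.-1.+1); last by rewrite prednK// (leq_trans _ hN).
  by rewrite factS natrM /= mulrC.
have k0 : 0 <= k%:R :> R by [].
apply: (mulfI (x := (k%:R + n) * k.+1%:R)).
  by rewrite mulf_neq0// ?pnatr_eq0//; apply/eqP; lra.
transitivity ((k%:R + n) * zquotI k.+1 * (k.+1%:R * pe k.+2)); first by ring.
rewrite zquotIS pe_rec.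
transitivity (k.+1%:R * (k.+1%:R + n) * (zquotI k * pe k.+1)); first by ring.
by rewrite IH; ring.
Qed.

Lemma zquotI_pe' k : (0 < k)%N -> zquotI k * pe k = k%:R * (N.-1`!)%:R * zW.
Proof.
move=> k1; have n3 := @ge3 R N hN; have k0 : 0 <= k%:R :> R by [].
apply: (mulfI (x := k%:R + n)); first by apply/eqP; lra.
rewrite mulrCA -pe_rec mulrCA zquotI_pe; ring.
Qed.

End ZonalCoefficients.

(** * The averaging integral and truncations of the kernel E[1 / (1 - s)] *)

Section SphericalAverage.
Context {R : realType}.
Variable N : nat.
Hypothesis hN : (3 <= N)%N.
Implicit Types (p q : {poly R}) (x y t : R) (k j m : nat).
Local Notation n := (N%:R : R).
Local Notation mu := (@lebesgue_measure R).
Local Notation J := (`[0%R, pi]%classic : set R).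
Local Notation c := (@zonal R N).

Lemma continuous_integrable_J (f : R -> R) : continuous f -> mu.-integrable J (EFin \o f).
Proof.
move=> cf; apply: continuous_compact_integrable; first exact: segment_compact.
exact: continuous_subspaceT.
Qed.

Lemma mJ : measurable (J : set (measurableTypeR R)). Proof. by []. Qed.

Lemma sin_powJ_gt0 m : 0 < \int[mu]_(t in J) (sin t ^+ m).
Proof.
have cf : continuous (fun t : R => sin t ^+ m).
  by move=> t; apply: (@continuous_comp _ _ _ sin (fun z : R => z ^+ m) t); [exact: continuous_sin|exact: exprn_continuous].
have fJ := continuous_integrable_J cf.
have f0 t : J t -> 0 <= sin t ^+ m.
  by rewrite /= in_itv /= => h; rewrite exprn_ge0// sin_ge0_pi.
rewrite lt_neqAle Rintegral_ge0// andbT eq_sym; apply/eqP.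
have fin : (\int[mu]_(t in J) (sin t ^+ m)%:E)%E \is a fin_num.
  exact: integrable_fin_num fJ.
rewrite /Rintegral => e.
have : (\int[mu]_(t in J) `|(sin t ^+ m)%:E| = 0)%E.
  rewrite -[RHS](_ : (\int[mu]_(t in J) (sin t ^+ m)%:E)%E = 0%E).
    by apply: eq_integral => x; rewrite inE => hx; rewrite gee0_abs// lee_fin f0.
  by rewrite -[LHS]fineK// e.
move/ae_eq_integral_abs => h.
have /h : measurable_fun J (fun x => (sin x ^+ m)%:E) by exact: measurable_int fJ.
move=> /(_ mJ) H.
have : {ae mu, forall x, `]0%R, pi[%classic x -> False}.
  apply: (@filterS _ _ (ae_filter_ringOfSetsType mu) _ _ _ H) => x hx /= xI.
  have xJ : J x by move: xI; rewrite /= !in_itv /= => /andP[a b]; rewrite !ltW.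
  have [] := hx xJ; apply/eqP; rewrite gt_eqF// exprn_gt0// sin_gt0_pi//.
move=> /negligibleP; rewrite (_ : ~` _ = `]0%R, pi[%classic); last first.
  by apply/seteqP; split => x /=; [move=> /contrapT|move=> ? g; exact: g].
have mI0 : measurable (`]0%R, pi[%classic : set (measurableTypeR R)) by [].
move=> /(_ mI0) h0.
have := @lebesgue_measure_itv R `]0, pi[; rewrite /= lte_fin pi_gt0 => h2.
have := etrans (esym (h0 : mu `]0%R, pi[%classic = 0%E)) h2.
by rewrite -EFinB => /(congr1 fine) /=; have := pi_gt0 R; lra.
Qed.

Definition sint p : R := \int[mu]_(t in J) (p.[cos t] * sin t ^+ (N - 2)).

Lemma sint_cont p m : continuous (fun t : R => p.[cos t] * sin t ^+ m).
Proof.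
move=> t; apply: cvgM.
  apply: continuous_comp; [exact: continuous_cos|exact: continuous_horner].
by apply: (@continuous_comp _ _ _ sin (fun z : R => z ^+ m) t); [exact: continuous_sin|exact: exprn_continuous].
Qed.

Lemma sintD p q : sint (p + q) = sint p + sint q.
Proof.
have ip := continuous_integrable_J (@sint_cont p (N - 2)).
have iq := continuous_integrable_J (@sint_cont q (N - 2)).
rewrite /sint -(RintegralD mJ ip iq).
by apply: eq_Rintegral => t _; rewrite hornerD mulrDl.
Qed.

Lemma sintZ a p : sint (a *: p) = a * sint p.
Proof.
have ip := continuous_integrable_J (@sint_cont p (N - 2)).
rewrite /sint -(RintegralZl a mJ ip).
by apply: eq_Rintegral => t _; rewrite hornerZ mulrA.
Qed.

Lemma sin_ge0J t : J t -> 0 <= sin t.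
Proof. by rewrite /= in_itv /= => h; exact: sin_ge0_pi. Qed.

Lemma sint_ge0 p : (forall z, -1 <= z <= 1 -> 0 <= p.[z]) -> 0 <= sint p.
Proof.
move=> h; apply: Rintegral_ge0 => t /sin_ge0J t0.
by rewrite mulr_ge0 ?exprn_ge0// h// cos_geN1 cos_le1.
Qed.

Lemma sint1_gt0 : 0 < sint 1.
Proof.
rewrite /sint; under eq_Rintegral do rewrite hornerC mul1r.
exact: sin_powJ_gt0.
Qed.

Definition savg p : R := sint p / sint 1.

Lemma savgD p q : savg (p + q) = savg p + savg q.
Proof. by rewrite /savg sintD mulrDl. Qed.

Lemma savgZ a p : savg (a *: p) = a * savg p.
Proof. by rewrite /savg sintZ mulrA. Qed.

Lemma savgB p q : savg (p - q) = savg p - savg q.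
Proof. by rewrite savgD -scaleN1r savgZ mulN1r. Qed.

Lemma savg0 : savg 0 = 0.
Proof. by rewrite -(scale0r (0 : {poly R})) savgZ mul0r. Qed.

Lemma savg_sum (T : Type) (s : seq T) (Q : pred T) (F : T -> {poly R}) :
  savg (\sum_(i <- s | Q i) F i) = \sum_(i <- s | Q i) savg (F i).
Proof.
elim/big_rec2: _ => [|i u v _ <-]; first exact: savg0.
by rewrite savgD.
Qed.

Lemma savg1 : savg 1 = 1.
Proof. by rewrite /savg mulfV// gt_eqF// sint1_gt0. Qed.

Lemma savg_ge0 p : (forall z, -1 <= z <= 1 -> 0 <= p.[z]) -> 0 <= savg p.
Proof. by move=> h; apply: divr_ge0; [exact: sint_ge0|exact: ltW sint1_gt0]. Qed.

Lemma savg_le p q : (forall z, -1 <= z <= 1 -> p.[z] <= q.[z]) -> savg p <= savg q.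
Proof.
move=> h; rewrite -subr_ge0 -savgB; apply: savg_ge0 => z /h.
by rewrite hornerD hornerN subr_ge0.
Qed.

(** The counterpart of [zint_divX] one dimension lower: the integrand is the derivative of sin^(N-1)
    t p(cos t), which vanishes at 0 and pi. *)
Lemma sint_div p : sint (N.-1%:R * 'X * p - (1 - 'X ^+ 2) * p^`()) = 0.
Proof.
have eN1 : (N.-1 = (N - 2).+1)%N by move: hN; case: N => [|[|[|m]]].
pose F t := ('X^(N.-1)).[sin t] * p.[cos t].
pose P := (N.-1)%:R * 'X * p - (1 - 'X ^+ 2) * p^`().
have D t : is_derive t 1 F (P.[cos t] * sin t ^+ (N - 2)).
  have dp1 := is_derive_horner ('X^(N.-1) : {poly R}) (sin t).
  have d1 := @is_derive1_comp R (horner 'X^(N.-1)) sin t _ _ dp1 (is_derive_sin t).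
  have d2 : is_derive t 1 (fun u : R => p.[cos u]) (p^`().[cos t] * (- sin t)).
    have dp := is_derive_horner p (cos t).
    exact: (@is_derive1_comp R (horner p) cos t _ _ dp (is_derive_cos t)).
  apply: (is_derive_eq (is_deriveM d1 d2)).
  rewrite /P /GRing.scale /= derivXn hornerMn !hornerXn -mulr_natl eN1 -polyC_natr !hornerE /=.
  rewrite (_ : 1 - cos t * cos t = sin t ^+ 2); last by rewrite sin2cos2 expr2.
  by rewrite !exprS; ring.
rewrite /sint /Rintegral.
have -> : (\int[mu]_(t in J) (P.[cos t] * sin t ^+ (N - 2))%:E = (F pi)%:E - (F 0)%:E)%E.
  apply: (@continuous_FTC2 _ (fun t => P.[cos t] * sin t ^+ (N - 2))); first exact: pi_gt0.
  - by apply: continuous_subspaceT; exact: sint_cont.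
  - have cF : continuous F by move=> t; apply: differentiable_continuous; apply/derivable1_diffP; exact: ex_derive.
    split.
    + by move=> t _; exact: ex_derive.
    + by apply: cvg_at_right_filter; exact: cF.
    + by apply: cvg_at_left_filter; exact: cF.
  - by move=> t _; rewrite derive1E; apply: derive_val.
by rewrite -EFinB /F sinpi sin0 eN1 !hornerXn expr0n /= !mul0r subrr.
Qed.

Lemma savg_div p : (n - 1) * savg ('X * p) = savg ((1 - 'X ^+ 2) * p^`()).
Proof.
apply/eqP; rewrite -subr_eq0 -savgZ -savgB; apply/eqP.
rewrite /savg (_ : _ - _ = N.-1%:R * 'X * p - (1 - 'X ^+ 2) * p^`()); last first.
  by rewrite -mul_polyC -(@predNE R N hN) polyC_natr mulrA.
by rewrite sint_div mul0r.
Qed.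

(** The symmetry t |-> pi - t. It amounts to the vanishing of the odd moments of cos t, which
    [savg_div] yields recursively without a change of variables. *)
Lemma savg_comp_oppX p : savg (p \Po - 'X) = savg p.
Proof.
have n3 := @ge3 R N hN.
have mrec k : (n - 1 + k%:R) * savg 'X^(k.+1) = k%:R * savg 'X^(k.-1).
  have := savg_div 'X^k; rewrite -exprS derivXn.
  have -> : (1 - 'X ^+ 2) * ('X^(k.-1) *+ k) =
     k%:R *: ('X^(k.-1) - 'X^(k.+1)) :> {poly R}.
    rewrite -[X in _ * X]mulr_natr -mul_polyC polyC_natr; case: k => [|k]; first by ring.
    by rewrite [k.+1.-1]/= !exprS; ring.
  by rewrite savgZ savgB => e; rewrite [LHS]mulrDl e; ring.
have odd0 k : savg 'X^(k.*2.+1) = 0.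
  elim: k => [|k IH].
    have := mrec 0%N; rewrite mul0r addr0 => /eqP; rewrite mulf_eq0 => /orP[|/eqP->//].
    by move/eqP; lra.
  have := mrec k.*2.+2; rewrite /= doubleS IH mulr0 => /eqP; rewrite mulf_eq0.
  move=> /orP[|/eqP//]; have : 0 <= (k.*2.+2)%:R :> R by [].
  by move=> ? /eqP; lra.
have key k : savg ((- 'X) ^+ k) = savg 'X^k.
  rewrite exprNn -signr_odd; case: (boolP (odd k)) => ok; last by rewrite expr0 mul1r.
  have -> : k = (k./2).*2.+1 by rewrite -{1}(odd_double_half k) ok.
  by rewrite expr1 mulN1r -scaleN1r savgZ odd0 mulr0.
rewrite comp_polyE savg_sum.
rewrite [in RHS](_ : p = \sum_(i < size p) p`_i *: 'X^i); last first.
  by rewrite -[LHS]coefK poly_def.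
by rewrite savg_sum; apply: eq_bigr => i _; rewrite !savgZ key.
Qed.

(** The amplitude in s = x y + [sphb x y] cos t. The lock hides the square roots behind [sphb_ge0]
    and [sphb2]. *)
Definition sphb x y : R := locked (Num.sqrt (1 - x ^+ 2) * Num.sqrt (1 - y ^+ 2)).

Section Kernel.
Variables x y : R.
Hypothesis hx : -1 <= x <= 1.
Hypothesis hy : -1 <= y <= 1.

Local Notation b := (sphb x y).

Lemma sq_le1 (z : R) : -1 <= z <= 1 -> z ^+ 2 <= 1.
Proof. by move=> /andP[h1 h2]; nra. Qed.

Lemma sphb_ge0 : 0 <= b. Proof. by rewrite /sphb -lock mulr_ge0// sqrtr_ge0. Qed.

Lemma sphb2 : b ^+ 2 = (1 - x ^+ 2) * (1 - y ^+ 2).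
Proof. by rewrite /sphb -lock exprMn !sqr_sqrtr ?subr_ge0 ?sq_le1. Qed.

Lemma sphb_le : b <= 1 - x * y.
Proof.
have h1 : 0 <= 1 - x * y by move: hx hy => /andP[? ?] /andP[? ?]; nra.
rewrite -ler_sqr ?nnegrE ?sphb_ge0// sphb2 -subr_ge0.
by rewrite (_ : _ - _ = (x - y) ^+ 2) ?sqr_ge0//; ring.
Qed.

Lemma sphb_leN : b <= 1 + x * y.
Proof.
have h1 : 0 <= 1 + x * y by move: hx hy => /andP[? ?] /andP[? ?]; nra.
rewrite -ler_sqr ?nnegrE ?sphb_ge0// sphb2 -subr_ge0.
by rewrite (_ : _ - _ = (x + y) ^+ 2) ?sqr_ge0//; ring.
Qed.

Definition sphP : {poly R} := (x * y)%:P + b *: 'X.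

Lemma horner_sphP z : sphP.[z] = x * y + b * z.
Proof. by rewrite !hornerE. Qed.

Lemma sphP_itv z : -1 <= z <= 1 -> -1 <= sphP.[z] <= 1.
Proof.
have := sphb_ge0; have := sphb_le; have := sphb_leN; rewrite horner_sphP.
by move=> h1 h2 h3 /andP[z1 z2]; apply/andP; split; nra.
Qed.

Lemma powavgE k : (powavg N y k).[x] = savg (sphP ^+ k).
Proof.
have n3 := @ge3 R N hN.
pose e k := savg (sphP ^+ k).
have erec m : (m%:R + n - 1) * e m.+1 =
    (2 * m%:R + n - 1) * (x * y) * e m + m%:R * (1 - x ^+ 2 - y ^+ 2) * e m.-1.
  have dS : sphP^`() = b%:P by rewrite /sphP derivD derivC derivZ derivX add0r alg_polyC.
  have := savg_div (sphP ^+ m); rewrite deriv_exp dS => E.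
  have E1 : e m.+1 = x * y * e m + b * savg ('X * sphP ^+ m).
    rewrite /e -savgZ -savgZ -savgD; congr savg.
    by rewrite exprS /sphP mulrDl mul_polyC scalerAl.
  (* Since b X = s - x y, the factor b^2 (1 - X^2) is a quadratic polynomial in s, so only three
     consecutive moments of s appear. *)
  have E2 : b * savg ((1 - 'X ^+ 2) * (b%:P * sphP ^+ m.-1 *+ m)) =
      m%:R * ((1 - x ^+ 2 - y ^+ 2) * e m.-1 + 2 * (x * y) * e m - e m.+1).
    case: m {E E1} => [|m]; first by rewrite !mulr0n mulr0 savg0 mulr0 mul0r.
    rewrite /e -!savgZ -savgD -savgB -savgZ; congr savg.
    have XS : b%:P * 'X = sphP - (x * y)%:P by rewrite /sphP mul_polyC addrC addKr.
    have -> : (1 - x ^+ 2 - y ^+ 2) = b ^+ 2 - (x * y) ^+ 2 by rewrite sphb2; ring.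
    rewrite -[_ *+ m.+1]mulr_natl -!mul_polyC !(polyCB, polyCM, polyC_exp, polyC_natr) /= !exprS.
    transitivity (m.+1%:R * (b%:P ^+ 2 - (b%:P * 'X) ^+ 2) * sphP ^+ m); first by ring.
    by rewrite XS polyCM; ring.
  have E3 : (n - 1) * (e m.+1 - x * y * e m) =
      m%:R * ((1 - x ^+ 2 - y ^+ 2) * e m.-1 + 2 * (x * y) * e m - e m.+1).
    by rewrite -E2 -E {1}E1; ring.
  have -> : (m%:R + n - 1) * e m.+1 = m%:R * e m.+1 + (n - 1) * (e m.+1 - x * y * e m) + (n - 1) * (x * y * e m) by ring.
  by rewrite E3; ring.
suff [] : (powavg N y k).[x] = e k /\ (powavg N y k.+1).[x] = e k.+1 by [].
elim: k => [|k [IH1 IH2]].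
  split; first by rewrite /e /= hornerC expr0 savg1.
  have := erec 0%N; rewrite /e expr0 savg1 !mul0r addr0 !mulr1 mulr0 add0r => E.
  rewrite /= !hornerE; apply: (mulfI (x := n - 1)); first by apply/eqP; lra.
  by rewrite E; ring.
split=> //; have k0 : 0 <= k%:R :> R by [].
apply: (mulfI (x := k.+1%:R + n - 1)); first by apply/eqP; rewrite -natr1; lra.
rewrite erec -IH1 -IH2.
have : ((k.+1%:R + N%:R - 1) * powavg N y k.+2).[x] = _ := congr1 (horner^~ x) (powavg_rec hN y k.+1).
have cst1 : (k.+1%:R + N%:R - 1) = (k.+1%:R + n - 1)%:P :> {poly R}.
  by rewrite !(polyCD, polyCN, polyC_natr).
have cst2 : (2 * k.+1%:R + N%:R - 1) = (2 * k.+1%:R + n - 1)%:P :> {poly R}.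
  by rewrite !(polyCD, polyCN, polyC_natr, polyCM).
have cst3 : k.+1%:R * (1 - y%:P ^+ 2 - 'X ^+ 2) = (k.+1%:R)%:P * (1 - (y ^+ 2)%:P - 'X ^+ 2) :> {poly R}.
  by rewrite polyC_natr polyC_exp.
rewrite cst1 cst2 cst3 [k.+1.-1]/=.
rewrite !(hornerM, hornerD, hornerN, hornerXn, hornerX, hornerC) => ->.
ring.
Qed.

Lemma ztransE_avg p : (ztrans N y p).[x] = savg (p \Po sphP).
Proof.
rewrite /ztrans horner_sum comp_polyE savg_sum; apply: eq_bigr => i _.
by rewrite hornerZ powavgE savgZ.
Qed.

Lemma ztrans_ge0 p : (forall z, -1 <= z <= 1 -> 0 <= p.[z]) -> 0 <= (ztrans N y p).[x].
Proof.
move=> h; rewrite ztransE_avg; apply: savg_ge0 => z hz.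
by rewrite horner_comp; apply: h; exact: sphP_itv.
Qed.

Lemma ztrans_le p q : (forall z, -1 <= z <= 1 -> p.[z] <= q.[z]) ->
  (ztrans N y p).[x] <= (ztrans N y q).[x].
Proof.
move=> h; rewrite -subr_ge0 -hornerN -hornerD -scaleN1r -(ztransZ N y) -(ztransD N y).
by apply: ztrans_ge0 => z /h; rewrite scaleN1r hornerD hornerN subr_ge0.
Qed.

Lemma powavg_even_bound k :
  (powavg N y k.*2).[x] <= (`|x * y| + b) ^+ k.*2.
Proof.
rewrite powavgE -[leRHS]mulr1 -savg1 -savgZ; apply: savg_le => z hz.
rewrite hornerZ hornerC mulr1 horner_exp horner_sphP.
have e2 (u : R) : u ^+ k.*2 = `|u| ^+ k.*2.
  by rewrite -mul2n !exprM real_normK ?num_real.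
rewrite [leLHS]e2 lerXn2r ?nnegrE ?addr_ge0 ?sphb_ge0//.
apply: le_trans (ler_normD _ _) _; rewrite lerD2l normrM ger0_norm ?sphb_ge0//.
by rewrite ler_piMr ?sphb_ge0// ler_norml.
Qed.

(** For fixed x and y the left side is the maximum of |s|. The identity (1 - |x y|)^2 - b^2 = (|x| -
    |y|)^2 shows that it reaches 1 only when |x| = |y|. *)
Lemma sphb_lt1 : `|x| != `|y| -> `|x * y| + b < 1.
Proof.
move=> xy; have b2 := sphb2; have b0 := sphb_ge0.
have z1 := sq_le1 hx; have z2 := sq_le1 hy.
have w1 : `|x| <= 1 by rewrite ler_norml. have w2 : `|y| <= 1 by rewrite ler_norml.
rewrite normrM; move: xy w1 w2 b2 (normr_ge0 x) (normr_ge0 y).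
rewrite -(real_normK (num_real x)) -(real_normK (num_real y)).
move: `|x| `|y| => u v xy w1 w2 b2 u0 v0.
have uv1 : 0 <= 1 - u * v by nra.
rewrite -ltrBrDl -ltr_sqr ?nnegrE// b2 -subr_gt0.
rewrite (_ : _ - _ = (u - v) ^+ 2); last ring.
by rewrite exprn_even_gt0//= subr_eq0.
Qed.


Lemma savgX : savg 'X = 0.
Proof.
have := savg_comp_oppX 'X; rewrite comp_polyX -scaleN1r savgZ; lra.
Qed.

(** Jensen's inequality: s has mean x y because cos t has mean 0, and the hypothesis is a supporting
    line at that mean. *)
Lemma ztrans_convex p (d : R) :
  (forall z, -1 <= z <= 1 -> p.[x * y] + d * (z - x * y) <= p.[z]) ->
  p.[x * y] <= (ztrans N y p).[x].
Proof.
move=> h; rewrite ztransE_avg.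
have -> : p.[x * y] = savg ((p.[x * y])%:P + (d * b) *: 'X).
  by rewrite savgD savgZ savgX mulr0 addr0 -alg_polyC savgZ savg1 mulr1.
apply: savg_le => z hz; rewrite horner_comp.
apply: le_trans (h _ (sphP_itv hz)).
by rewrite horner_sphP !hornerE; lra.
Qed.

End Kernel.

(* Truncation of 1 / (1 - s); an even number of terms makes it nonnegative and
   nondecreasing in [m] on [-1, 1]. *)
Definition geom2 m : {poly R} := \sum_(i < m.*2) 'X^i.

Lemma geom2E m : (1 - 'X) * geom2 m = 1 - 'X^(m.*2).
Proof. by rewrite -opprB mulNr -subrX1 opprB. Qed.

Lemma geom2S m : geom2 m.+1 = geom2 m + 'X^(m.*2) * (1 + 'X).
Proof. by rewrite /geom2 doubleS !big_ord_recr /= -addrA; congr (_ + _); rewrite exprSr; ring. Qed.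

Lemma even_pow_ge0 (z : R) m : 0 <= z ^+ m.*2.
Proof. by rewrite -mul2n exprM exprn_ge0// sqr_ge0. Qed.

Lemma geom2_ge0 m z : -1 <= z <= 1 -> 0 <= (geom2 m).[z].
Proof.
move=> /andP[z1 z2]; elim: m => [|m IH]; first by rewrite /geom2 big_ord0 horner0.
rewrite geom2S !hornerE addr_ge0// mulr_ge0 ?even_pow_ge0//; lra.
Qed.

Lemma geom2_le m z : (1 - z) * (geom2 m).[z] <= 1.
Proof.
have := congr1 (horner^~ z) (geom2E m).
by rewrite /= hornerM !hornerE => ->; rewrite gerBl even_pow_ge0.
Qed.

Definition kern m x y := (ztrans N y (geom2 m)).[x].

Lemma kern_ge0 m x y : -1 <= x <= 1 -> -1 <= y <= 1 -> 0 <= kern m x y.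
Proof. by move=> hx hy; apply: ztrans_ge0 => // z; exact: geom2_ge0. Qed.

Lemma kern_homo x y : -1 <= x <= 1 -> -1 <= y <= 1 ->
  nondecreasing_seq (fun m => kern m x y).
Proof.
move=> hx hy; apply/nondecreasing_seqP => m; apply: ztrans_le => // z /andP[z1 z2].
by rewrite geom2S hornerD lerDl hornerM mulr_ge0// !hornerE ?even_pow_ge0//; lra.
Qed.

(** Meant for a = 1 - x y, d = |x - y|, [s] the sine of t, and u, v the values of one minus the
    scalar product at t and at pi - t. Then f + g <= 1/u + 1/v = 2 a / (u v) while u v >= d a s.
    Pairing t with pi - t is what lets the two denominators combine. *)
Lemma kern_pointwise (a d s u v f g : R) : 0 <= d -> d <= a -> 0 <= s -> s <= 1 ->
  0 <= u -> 0 <= v -> u + v = 2 * a -> u * v = a ^+ 2 * s ^+ 2 + d ^+ 2 * (1 - s ^+ 2) ->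
  0 <= f -> 0 <= g -> u * f <= 1 -> v * g <= 1 -> d * (f + g) * s <= 2.
Proof.
move=> d0 da s0 s1 u0 v0 uv puv f0 g0 uf vg.
have key : d * a * s <= u * v.
  rewrite puv -subr_ge0; set Z := a * s.
  have Z0 : d * s <= Z by rewrite /Z ler_wpM2r.
  rewrite (_ : _ - _ = (Z - d * s) * (Z + d * s - d) + d ^+ 2 * (1 - s)); last by rewrite /Z; ring.
  have [h|h] := leP d (Z + d * s).
    by rewrite addr_ge0 ?mulr_ge0 ?subr_ge0 ?sqr_ge0.
  have ds : 0 <= d * s by rewrite mulr_ge0.
  have : (Z - d * s) * (d - (Z + d * s)) <= d * (d - d * s).
    apply: ler_pM; rewrite ?subr_ge0//; lra.
  by rewrite expr2; lra.
have [e0|ds] := eqVneq (d * s) 0.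
  by rewrite (_ : d * (f + g) * s = (d * s) * (f + g)); [rewrite e0 mul0r|ring].
have {}ds : 0 < d * s by rewrite lt_neqAle eq_sym ds mulr_ge0.
have a0 : 0 < a by rewrite (lt_le_trans _ da)// lt_neqAle eq_sym d0 andbT; apply: contraTneq ds => ->; rewrite mul0r ltxx.
have uv0 : 0 < u * v by apply: lt_le_trans key; rewrite mulrAC mulr_gt0.
have : (u * v) * (f + g) <= 2 * a by rewrite -uv; nra.
move=> h; have : d * a * s * (f + g) <= 2 * a.
  by apply: le_trans h; rewrite ler_wpM2r// addr_ge0.
by rewrite (_ : d * a * s * (f + g) = (d * (f + g) * s) * a) ?ler_pM2r//; ring.
Qed.

Definition kernC : R := (\int[mu]_(t in J) (sin t ^+ (N - 3))) / sint 1.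

Lemma subn2_subn3 : (N - 2 = (N - 3).+1)%N.
Proof. by rewrite -subSn ?subSS. Qed.

(** The bound is uniform in m: the singularity on the diagonal costs at most one factor |x - y|.
    After symmetrization in t |-> pi - t, [kern_pointwise] spends one power of sin t, and N >= 3
    leaves the nonnegative power sin^(N-3) t. *)
Lemma kern_bound m x y : -1 <= x <= 1 -> -1 <= y <= 1 -> `|x - y| * kern m x y <= kernC.
Proof.
move=> hx hy; rewrite /kern ztransE_avg//.
set q := _ \Po _; have e : savg q = savg (2^-1 *: (q + (q \Po (- 'X)))).
  by rewrite savgZ savgD savg_comp_oppX; field.
rewrite e -savgZ /savg /kernC; apply: ler_wpM2r; first by rewrite invr_ge0 ltW// sint1_gt0.
apply: le_Rintegral => //.
- exact: (continuous_integrable_J (@sint_cont _ (N - 2))).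
- have := continuous_integrable_J (@sint_cont 1 (N - 3)).
  by apply: eq_integrable => // t _ /=; rewrite hornerC mul1r.
move=> t tJ; have s0 := sin_ge0J tJ.
rewrite subn2_subn3 exprS mulrA -[leRHS]mul1r ler_wpM2r ?exprn_ge0//.
set z := cos t; have hz : -1 <= z <= 1 by rewrite cos_geN1 cos_le1.
have hz' : -1 <= - z <= 1 by move: hz => /andP[? ?]; apply/andP; split; lra.
rewrite !hornerZ hornerD !horner_comp hornerN hornerX.
have b2 := sphb2 hx hy.
have := sphP_itv hx hy hz; have := sphP_itv hx hy hz'.
rewrite !horner_sphP; set f' := x * y + _ * - z; set f := x * y + _ * z => h1 h2.
have := @kern_pointwise (1 - x * y) `|x - y| (sin t) (1 - f) (1 - f')
  (geom2 m).[f] (geom2 m).[f'].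
have zz : z ^+ 2 = 1 - sin t ^+ 2 by rewrite sin2cos2 opprB addrC subrK.
have hP : `|x - y| * ((geom2 m).[f] + (geom2 m).[f']) * sin t <= 2 ->
   `|x - y| * (2^-1 * ((geom2 m).[f] + (geom2 m).[f'])) * sin t <= 1 by lra.
move=> H; apply: hP; apply: H => //.
- by rewrite ler_norml; move: hx hy => /andP[? ?] /andP[? ?]; apply/andP; split; nra.
- by move: h2 => /andP[]; lra.
- by move: h1 => /andP[]; lra.
- by rewrite /f /f'; ring.
- rewrite real_normK ?num_real// -zz.
  rewrite (_ : (1 - f) * (1 - f') = (1 - x * y) ^+ 2 - sphb x y ^+ 2 * z ^+ 2); last by rewrite /f /f'; ring.
  rewrite b2 -[sin t ^+ 2](_ : 1 - z ^+ 2 = _); last by rewrite zz; ring.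
  ring.
- exact: geom2_ge0.
- exact: geom2_ge0.
- exact: geom2_le.
- exact: geom2_le.
Qed.

(* For r = 1 - s in ]0, 2] one has 1/r - 2 a + a^2 r = (1 - a r)^2 / r, which is at
   least (1 - a r)^2 / 2: this is a quadratic minorant of 1 / (1 - s). *)
Definition quadQ (a : R) : {poly R} :=
  (2 * a)%:P - a ^+ 2 *: (1 - 'X) + 2^-1 *: (1 - a *: (1 - 'X)) ^+ 2.

Lemma horner_quadQ a z :
  (quadQ a).[z] = 2 * a - a ^+ 2 * (1 - z) + (1 - a * (1 - z)) ^+ 2 / 2.
Proof. by rewrite /quadQ !(hornerD, hornerN, hornerZ, hornerC, hornerX, horner_exp); field. Qed.

(** With P = s^(2m), the truncation is (1 - P) / (1 - s) >= (1 - P) Q for the minorant Q, and P Q is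
    at most P times a bound of Q on [-1, 1]; the constant is such a bound. Jensen's inequality then
    replaces s by x y in the average of Q. *)
Lemma kern_lower a m x y : 0 <= a -> -1 <= x <= 1 -> -1 <= y <= 1 ->
  (quadQ a).[x * y] - (2 * a + (1 + 2 * a) ^+ 2) * (powavg N y m.*2).[x] <= kern m x y.
Proof.
move=> a0 hx hy; set M := 2 * a + _.
apply: (@le_trans _ _ (ztrans N y (quadQ a - M *: 'X^(m.*2))).[x]).
  have -> : quadQ a - M *: 'X^(m.*2) = quadQ a + (- M) *: 'X^(m.*2) by rewrite scaleNr.
  rewrite (ztransD N y) (ztransZ N y) (ztransXn N y) hornerD hornerZ mulNr lerD2r.
  (* The slope is the derivative of [quadQ a] at x y, and the difference is the exact quadratic
     remainder. *)
  apply: (@ztrans_convex x y hx hy _ (a ^+ 2 + a * (1 - a * (1 - x * y)))) => z hz.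
  rewrite !horner_quadQ -subr_ge0.
  rewrite (_ : _ - _ = (a * (z - x * y)) ^+ 2 / 2); last by field.
  by rewrite divr_ge0 ?sqr_ge0.
apply: ztrans_le => // z hz.
rewrite hornerD hornerN hornerZ hornerXn horner_quadQ.
have g0 := geom2_ge0 m hz; have z0 := even_pow_ge0 z m.
have gE : (1 - z) * (geom2 m).[z] = 1 - z ^+ m.*2.
  by have := congr1 (horner^~ z) (geom2E m); rewrite /= hornerM !hornerE.
move: (geom2 m).[z] (z ^+ m.*2) g0 z0 gE hz => g P g0 P0 gE /andP[z1 z2].
have QM : 2 * a - a ^+ 2 * (1 - z) + (1 - a * (1 - z)) ^+ 2 / 2 <= M.
  have h1 : 0 <= a ^+ 2 * (1 - z) by rewrite mulr_ge0 ?sqr_ge0//; lra.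
  have h2 : 0 <= a * (1 - z) by rewrite mulr_ge0//; lra.
  have h3 : a * (1 - z) <= a * 2 by rewrite ler_wpM2l//; lra.
  have : (1 - a * (1 - z)) ^+ 2 <= (1 + 2 * a) ^+ 2.
    by rewrite -subr_ge0; nra.
  have : 0 <= (1 + 2 * a) ^+ 2 by rewrite sqr_ge0.
  by rewrite /M; lra.
move: QM; set Q := (X in X <= M) => QM.
rewrite -/Q; have [zlt|zge] := ltP z 1; last first.
  have ez : z = 1 by lra.
  have P1 : P = 1 by move: gE; rewrite ez subrr mul0r; lra.
  by rewrite P1; lra.
have u0 : 0 < 1 - z by lra.
have : (1 - z) * Q <= 1.
  rewrite -subr_ge0 (_ : 1 - (1 - z) * Q = (1 - a * (1 - z)) ^+ 2 * ((1 + z) / 2)); last by rewrite /Q; field.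
  by rewrite mulr_ge0 ?sqr_ge0//; lra.
have P1 : P <= 1.
  have : 0 <= (1 - z) * g by rewrite mulr_ge0// ltW.
  lra.
move=> h; have : (1 - z) * ((1 - P) * Q) <= (1 - z) * g.
  rewrite gE mulrCA -[leRHS]mulr1; apply: ler_wpM2l => //; lra.
rewrite ler_pM2l// => h2; apply: le_trans h2.
have : P * Q <= P * M by rewrite ler_wpM2l.
by lra.
Qed.

Lemma kern_cvg x y : -1 <= x <= 1 -> -1 <= y <= 1 -> x != y -> cvgn (fun m => kern m x y).
Proof.
move=> hx hy xy; apply: nondecreasing_is_cvgn; first exact: kern_homo.
exists (kernC / `|x - y|) => _ [m _ <-].
by rewrite ler_pdivlMr ?normr_gt0 ?subr_eq0// mulrC kern_bound.
Qed.

Lemma powavg_even_ge0 x y m : -1 <= x <= 1 -> -1 <= y <= 1 -> 0 <= (powavg N y m.*2).[x].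
Proof.
move=> hx hy; rewrite -(ztransXn N y) ztrans_ge0// => z _.
by rewrite hornerXn even_pow_ge0.
Qed.

Lemma powavg_even_cvg0 x y : -1 <= x <= 1 -> -1 <= y <= 1 -> `|x| != `|y| ->
  (powavg N y m.*2).[x] @[m --> \oo] --> 0.
Proof.
move=> hx hy xy; set r := `|x * y| + sphb x y.
have r0 : 0 <= r by rewrite addr_ge0// sphb_ge0.
have r1 : r < 1 by exact: sphb_lt1.
apply: (@squeeze_cvgr _ _ _ _ (fun=> 0) (fun m => (r ^+ 2) ^+ m)).
- apply: nearW => m; rewrite powavg_even_ge0//=.
  by rewrite (le_trans (powavg_even_bound hx hy m))// -exprM mul2n.
- exact: cvg_cst.
- by apply: cvg_expr; rewrite ger0_norm ?sqr_ge0// expr_lt1.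
Qed.

Lemma powavg_even_le1 x y m : -1 <= x <= 1 -> -1 <= y <= 1 -> (powavg N y m.*2).[x] <= 1.
Proof.
move=> hx hy; apply: le_trans (powavg_even_bound hx hy m) _.
rewrite exprn_ile1 ?addr_ge0 ?sphb_ge0//.
have h1 := sphb_le hx hy; have h2 := sphb_leN hx hy.
have : `|x * y| <= 1 - sphb x y by rewrite ler_norml; apply/andP; split; lra.
lra.
Qed.

(** The product formula exhibits the symmetry of the kernel in x and y, which its definition as a
    polynomial in x hides. *)
Lemma kernE m x y : kern m x y =
  \sum_(k < m.*2) phat N (geom2 m) k / znorm N k * ((c k).[y] * (c k).[x]).
Proof.
have sz : (size (geom2 m) <= m.*2)%N.
  rewrite (_ : geom2 m = \poly_(i < m.*2) 1) ?size_poly// poly_def.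
  by apply: eq_bigr => i _; rewrite scale1r.
rewrite /kern {1}(zonal_expand hN sz) (ztrans_sum N y) horner_sum.
apply: eq_bigr => i _; rewrite (ztransZ N y) (ztrans_zonal hN) !hornerZ; ring.
Qed.

Lemma phat_geom2_diff m k :
  phat N (geom2 m) k - phat N (geom2 m) k.+1
  = zint N (horner ((1 - 'X^(m.*2)) * zquot N k)).
Proof.
rewrite /phat -(zint_hornerN hN) -(zint_hornerD hN); congr (zint N (horner _)).
by rewrite -mulrBr (zquotE hN) mulrA [_ * (1 - 'X)]mulrC geom2E.
Qed.

(** The factor 1 - X of c_k - c_(k+1) turns the truncated kernel into 1 - X^(2m), which converges
    boundedly to 1 inside the interval. *)
Lemma phat_geom2_cvg k :
  phat N (geom2 m) k - phat N (geom2 m) k.+1 @[m --> \oo] --> zquotI N k.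
Proof.
under eq_fun do rewrite phat_geom2_diff.
have [M [M0 hM]] := horner_bound (@zquot R N k).
have [] // := @zint_dct R N (fun m => horner ((1 - 'X^(m.*2)) * zquot N k)) (horner (zquot N k)) (fun=> M).
- by move=> m; exact: measurable_horner.
- move=> z hz; have -> : (zquot N k).[z] = (1 - 0) * (zquot N k).[z] by rewrite subr0 mul1r.
  under eq_fun do rewrite hornerM hornerD hornerN hornerC hornerXn.
  apply: cvgM; last exact: cvg_cst.
  apply: cvgB; first exact: cvg_cst.
  under eq_fun do rewrite -mul2n exprM.
  apply: cvg_expr; rewrite ger0_norm ?sqr_ge0//; move: hz => /andP[? ?]; nra.
- exact: zI_cst.
- move=> m z /oo_cc hz; rewrite hornerM normrM -[leRHS]mul1r ler_pM//; last exact: hM.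
  rewrite hornerD hornerN hornerC hornerXn ger0_norm ?gerBl ?even_pow_ge0//.
  by rewrite subr_ge0 -mul2n exprM exprn_ile1 ?sqr_ge0// sq_le1.
Qed.

End SphericalAverage.

(** * Zonal coefficients determine an integrable function *)

Section Density.
Context {R : realType}.
Variable N : nat.
Hypothesis hN : (3 <= N)%N.
Implicit Types (p q : {poly R}) (x y t a r : R) (k j m : nat).
Local Notation n := (N%:R : R).
Local Notation mu := (@lebesgue_measure R).
Local Notation I := (`](-1)%R, 1%R[%classic : set R).
Local Notation c := (@zonal R N).
Local Notation zI := (@zI R N).

Lemma mulrn_geometric_cvg0 r : 0 <= r < 1 -> m%:R * r ^+ m @[m --> \oo] --> (0 : R).
Proof.
move=> /andP[r0 r1]; set s := Num.sqrt r.
have s0 : 0 <= s by exact: sqrtr_ge0.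
have rs : r = s ^+ 2 by rewrite sqr_sqrtr.
have s1 : s < 1 by rewrite -(@ltr_pXn2r _ 2)// ?nnegrE// -rs expr1n.
pose d := 1 - s; have d0 : 0 < d by rewrite subr_gt0.
have bd m : m%:R * s ^+ m <= d^-1.
  have H : (1 + m%:R * d) * s ^+ m <= 1.
    elim: m => [|m IH]; first by rewrite mul0r addr0 mul1r expr0.
    apply: le_trans IH; rewrite exprSr mulrA mulrAC ler_wpM2r ?exprn_ge0//.
    rewrite -natr1 /d -subr_ge0.
    rewrite (_ : _ - _ = (1 - s) ^+ 2 * (1 + m%:R)); last ring.
    by rewrite mulr_ge0 ?sqr_ge0// addr_ge0.
  have sm : 0 <= s ^+ m by rewrite exprn_ge0.
  by rewrite -div1r ler_pdivlMr//; nra.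
apply: (@squeeze_cvgr _ _ _ _ (fun=> 0) (fun m => d^-1 * s ^+ m)).
- apply: nearW => m; rewrite mulr_ge0 ?exprn_ge0//=.
  by rewrite rs -exprM mul2n -addnn exprD mulrA ler_wpM2r ?exprn_ge0.
- exact: cvg_cst.
- rewrite -[X in _ --> X](mulr0 d^-1); apply: cvgM; first exact: cvg_cst.
  by apply: cvg_expr; rewrite ger0_norm.
Qed.

Lemma bernoulli_ge (z : R) k : 0 <= z <= 1 -> 1 - k%:R * z <= (1 - z) ^+ k.
Proof.
move=> /andP[z0 z1]; elim: k => [|k IH]; first by rewrite mul0r subr0 expr0.
have k0 : 0 <= k%:R :> R by [].
rewrite exprS -natr1; apply: le_trans (ler_wpM2l _ IH); last by rewrite subr_ge0.
by rewrite -subr_ge0 (_ : _ - _ = k%:R * z ^+ 2); [rewrite mulr_ge0 ?sqr_ge0|ring].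
Qed.

Lemma bernoulli_le (z : R) k : 0 <= z <= 1 -> (1 + k%:R * z) * (1 - z) ^+ k <= 1.
Proof.
move=> /andP[z0 z1]; elim: k => [|k IH]; first by rewrite mul0r addr0 expr0 mulr1.
have k0 : 0 <= k%:R :> R by [].
apply: le_trans IH; rewrite exprS mulrA ler_wpM2r ?exprn_ge0 ?subr_ge0//.
by rewrite -natr1; nra.
Qed.

(* On [-1, 1] these polynomials converge boundedly to the indicator function of
   x <= a, because the base of the inner power is at least 1/2 exactly when x <= a. *)
Definition step_poly a m : {poly R} :=
  1 - (1 - ((2^-1)%:P - 4^-1 *: ('X - a%:P)) ^+ m) ^+ (m * 2 ^ m).

Lemma horner_step a m x :
  (step_poly a m).[x] = 1 - (1 - (2^-1 - 4^-1 * (x - a)) ^+ m) ^+ (m * 2 ^ m).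
Proof. by rewrite /step_poly !(hornerE, horner_exp). Qed.

Lemma step_itv a x : -1 <= a <= 1 -> -1 <= x <= 1 -> 0 <= 2^-1 - 4^-1 * (x - a) <= 1.
Proof. by move=> /andP[? ?] /andP[? ?]; apply/andP; split; lra. Qed.

Lemma step_bound a m x : -1 <= a <= 1 -> -1 <= x <= 1 -> `|(step_poly a m).[x]| <= 1.
Proof.
move=> ha hx; have := step_itv ha hx; rewrite horner_step.
move: (_ - 4^-1 * _) => t /andP[t0 t1].
have h1 : 0 <= 1 - t ^+ m by rewrite subr_ge0 exprn_ile1.
have h2 : 1 - t ^+ m <= 1 by rewrite gerBl exprn_ge0.
have h3 : 0 <= (1 - t ^+ m) ^+ (m * 2 ^ m) by rewrite exprn_ge0.
have h4 : (1 - t ^+ m) ^+ (m * 2 ^ m) <= 1 by rewrite exprn_ile1.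
by rewrite ler_norml; apply/andP; split; lra.
Qed.

(** With t the inner base, (m 2^m) t^m = m (2 t)^m tends to infinity for t >= 1/2, where the factor
    m serves the case t = 1/2, and to 0 for t < 1/2. Bernoulli's inequalities turn this into the
    limits 0 and 1 of (1 - t^m)^(m 2^m). *)
Lemma step_cvg a x : -1 <= a <= 1 -> -1 <= x <= 1 ->
  (step_poly a m).[x] @[m --> \oo] --> ((x <= a)%R%:R : R).
Proof.
move=> ha hx; have ht := step_itv ha hx; have /andP[t0 t1] := ht.
under eq_fun do rewrite horner_step.
have Kz (t : R) m : (m * 2 ^ m)%:R * t ^+ m = m%:R * (2 * t) ^+ m.
  by rewrite natrM natrX -mulrA -exprMn.
have [xa|xa] := leP x a.
  have th : 2^-1 <= 2^-1 - 4^-1 * (x - a) by lra.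
  move: (_ - 4^-1 * _) th t0 t1 {ht} => t th t0 t1.
  rewrite (_ : true%:R = 1 - 0); last by rewrite subr0.
  apply: cvgB; first exact: cvg_cst.
  apply: (@squeeze_cvgr _ _ _ _ (fun=> 0) (fun m => (m.+1%:R)^-1)).
  - apply: nearW => m; have h1 : 0 <= 1 - t ^+ m by rewrite subr_ge0 exprn_ile1.
    rewrite exprn_ge0//=; have := @bernoulli_le (t ^+ m) (m * 2 ^ m).
    rewrite exprn_ge0// exprn_ile1// Kz => /(_ isT).
    have : m%:R <= m%:R * (2 * t) ^+ m by rewrite ler_peMr// exprn_ege1//; lra.
    set P := _ ^+ (m * _) => h2 h3; have P0 : 0 <= P by rewrite exprn_ge0.
    rewrite -div1r ler_pdivlMr ?ltr0n// -natr1.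
    by have : (m%:R + 1) * P <= (1 + m%:R * (2 * t) ^+ m) * P; [rewrite ler_wpM2r//; lra|lra].
  - exact: cvg_cst.
  - exact: cvg_harmonic.
have th : 2^-1 - 4^-1 * (x - a) < 2^-1 by lra.
move: (_ - 4^-1 * _) th t0 t1 {ht} => t th t0 t1.
rewrite (_ : false%:R = 1 - 1); last by rewrite subrr.
apply: cvgB; first exact: cvg_cst.
apply: (@squeeze_cvgr _ _ _ _ (fun m => 1 - m%:R * (2 * t) ^+ m) (fun=> 1)).
- apply: nearW => m; have h1 : 0 <= 1 - t ^+ m by rewrite subr_ge0 exprn_ile1.
  rewrite exprn_ile1 ?gerBl ?exprn_ge0// andbT -Kz; apply: bernoulli_ge.
  by rewrite exprn_ge0// exprn_ile1.
- rewrite -[X in _ --> X]subr0; apply: cvgB; first exact: cvg_cst.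
  by apply: mulrn_geometric_cvg0; apply/andP; split; lra.
- exact: cvg_cst.
Qed.

Lemma zint_step0 (h : R -> R) a : zI h -> (forall k, zhat N h k = 0) ->
  zint N (fun x => (x <= a)%R%:R * h x) = 0.
Proof.
move=> hh h0.
have hp p : zint N (fun x => p.[x] * h x) = 0.
  transitivity (zint N (fun x => h x * p.[x])); first by apply: zint_ext => // x _; rewrite mulrC.
  by rewrite (zint_mulp_expand hN hh (leqnn _)) big1// => i _; rewrite h0 mulr0 mul0r.
have [a1|a1] := leP a (-1).
  rewrite -[RHS](zint0 hN); apply: zint_ext => // x /andP[x1 _].
  by rewrite leNgt (le_lt_trans a1 x1) mul0r.
have [a2|a2] := leP 1 a.
  rewrite -[RHS](hp 1); apply: zint_ext => // x /andP[_ x1].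
  by rewrite (ltW (lt_le_trans x1 a2)) hornerC.
have ha : -1 <= a <= 1 by rewrite !ltW.
have mh := zI_mf hh.
have H1 m : measurable_fun I (fun x => (step_poly a m).[x] * h x).
  by apply: measurable_funM => //; exact: measurable_horner.
have H2 x : -1 < x < 1 -> (step_poly a m).[x] * h x @[m --> \oo] --> (x <= a)%R%:R * h x.
  by move=> /oo_cc hx; apply: cvgM; [exact: step_cvg|exact: cvg_cst].
have H4 m x : -1 < x < 1 -> `|(step_poly a m).[x] * h x| <= `|h x|.
  by move=> /oo_cc hx; rewrite normrM -[leRHS]mul1r ler_wpM2r// step_bound.
have [_] := zint_dct H1 H2 (zI_norm hh) H4.
under eq_fun do rewrite hp.
by move=> /cvg_lim <-//; rewrite lim_cst.
Qed.

Lemma zhat_eq0_ae (h : R -> R) : zI h -> (forall k, zhat N h k = 0) ->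
  {ae mu, forall x, I x -> h x = 0}.
Proof.
move=> hh h0; pose f := (fun x => zweight N x * h x) \_ I.
have fi : mu.-integrable setT (EFin \o f).
  have mI : measurable (I : set (measurableTypeR R)) by [].
  have := (@integrable_mkcond _ _ R mu I (EFin \o (fun x => zweight N x * h x)) mI).1 hh.
  by rewrite restrict_EFin.
have F0 y : (\int[mu]_(t in [set` `]-oo, y]]) (f t))%R = 0.
  rewrite -[RHS](zint_step0 y hh h0) zintE//; last first.
    apply: measurable_funM; last exact: zI_mf hh.
    apply: (@eq_measurable_fun _ _ _ _ _ (\1_(`]-oo, y]%classic : set R) : R -> R)).
      by move=> x _; rewrite indicE mem_setE /= in_itv.
    exact: measurable_indic.
  rewrite /f -Rintegral_mkcondr setIC Rintegral_mkcondr.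
  apply: eq_Rintegral => x _; rewrite /= patchE.
  case: ifPn; rewrite ?inE ?notin_setE /= in_itv /=.
    by move=> ->; rewrite mul1r.
  by move/negP/negbTE => ->; rewrite mul0r mulr0.
have mI : measurable (I : set (measurableTypeR R)) by [].
have iy y : mu.-integrable `]-oo, y] (EFin \o f) by exact: integrableS fi.
have := FTC1Ny iy (integrable_locally mI hh).
apply: (@filterS _ _ (ae_filter_ringOfSetsType mu)) => x + Ix.
rewrite (_ : (fun _ => _) = cst 0); last by apply/funext => y; exact: F0.
move=> [_]; rewrite derive1_cst /f patchE mem_set// => /esym/eqP.
rewrite mulf_eq0 gt_eqF ?orFb; first by move/eqP.
by move: Ix; rewrite mem_I; exact: zweight_gt0.
Qed.

End Density.

(** * The function V and its zonal coefficients *)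

Section KernelOperator.
Context {R : realType}.
Variable N : nat.
Hypothesis hN : (3 <= N)%N.
Implicit Types (p q : {poly R}) (x y t a : R) (k j m : nat).
Local Notation n := (N%:R : R).
Local Notation I := (`](-1)%R, 1%R[%classic : set R).
Local Notation c := (@zonal R N).
Local Notation zI := (@zI R N).
Local Notation W := (@zW R N).

Lemma zI_mulx (f : R -> R) : zI f -> zI (fun x => x * f x).
Proof. by move=> hf; apply: zI_ext (zI_mulp 'X hf) => x _; rewrite hornerX. Qed.

Lemma zI_mulpr (f : R -> R) p : zI f -> zI (fun x => f x * p.[x]).
Proof. by move=> hf; apply: zI_ext (zI_mulp p hf) => x _; rewrite mulrC. Qed.

Lemma phat_bigsum (J : Type) (s : seq J) (Q : pred J) (F : J -> {poly R}) k :
  phat N (\sum_(i <- s | Q i) F i) k = \sum_(i <- s | Q i) phat N (F i) k.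
Proof. by rewrite /phat mulr_suml zint_horner_sum. Qed.

Variable r : R -> R.
Hypothesis hr : zI r.

Definition kcoef m k : R := phat N (geom2 m) k / znorm N k.

(** The truncation of V. The spectral form makes it a polynomial in x; [kconvE] recovers the
    integral of (y - x) times the kernel. *)
Definition kconv m : {poly R} := W^-1 *: \sum_(k < m.*2)
  kcoef m k *: (zhat N (fun x => x * r x) k *: c k - zhat N r k *: ('X * c k)).

Lemma kconvE m x :
  (kconv m).[x] = W^-1 * zint N (fun y => (y - x) * kern N m x y * r y).
Proof.
rewrite /kconv hornerZ; congr (_ * _); rewrite horner_sum.
under eq_bigr do rewrite !(hornerD, hornerN, hornerZ, hornerM, hornerX).
transitivity (zint N (fun y => \sum_(k < m.*2) (kcoef m k * (c k).[x] * (y * r y * (c k).[y])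
    + - (kcoef m k * (c k).[x] * x) * (r y * (c k).[y])))).
  have h1 k : zI (fun y => y * r y * (c k).[y]) by apply: zI_mulpr; exact: zI_mulx.
  have h2 k : zI (fun y => r y * (c k).[y]) by exact: zI_mulpr.
  rewrite zint_sum//; last by move=> k; apply: zID; apply: zIZ.
  apply: eq_bigr => k _; rewrite zintD; [|exact: zIZ..].
  by rewrite !zintZ// /zhat; ring.
apply: zint_ext => // y _; rewrite kernE// mulr_sumr mulr_suml; apply: eq_bigr => k _.
by rewrite -/(kcoef m k); ring.
Qed.

(** Multiplication by y - x moves the degree by one on either side, so the coefficients of the
    kernel enter only through consecutive differences, whose limits are the [zquotI]. *)
Lemma phat_kconv m j : phat N (kconv m) j = W^-1 *
  (upc N j * (phat N (geom2 m) j - phat N (geom2 m) j.+1) * zhat N r j.+1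
   - downc N j * (phat N (geom2 m) j.-1 - phat N (geom2 m) j) * zhat N r j.-1).
Proof.
rewrite /kconv phatZ// phat_bigsum; congr (_ * _).
set f := phat N (geom2 m).
have f0 k : (m.*2 <= k)%N -> f k = 0.
  move=> h; apply: phat_big => //; apply: leq_trans h.
  by apply: (leq_trans (size_sum _ _ _)); apply/bigmax_leqP => i _; rewrite size_polyXn.
have pick (a : nat -> R) i :
    \sum_(k < m.*2) kcoef m k * (a k * (if k == i :> nat then znorm N k else 0)) = f i * a i.
  have [him|him] := ltnP i m.*2.
    rewrite (bigD1 (Ordinal him))//= eqxx big1 ?addr0.
      by rewrite /kcoef -/(f i); field; rewrite gt_eqF// znorm_gt0.
    by move=> k hk; rewrite ifN ?mulr0//; apply: contra hk => /eqP hk; apply/eqP/val_inj.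
  rewrite f0// mul0r big1// => k _; rewrite ifN ?mulr0//.
  by apply: contraL him => /eqP <-; rewrite -ltnNge.
transitivity (\sum_(k < m.*2) (kcoef m k * (zhat N (fun x => x * r x) k * (if k == j :> nat then znorm N k else 0))
   - upc N j * (kcoef m k * (zhat N r k * (if k == j.+1 :> nat then znorm N k else 0)))
   - downc N j * (kcoef m k * (zhat N r k * (if k == j.-1 :> nat then znorm N k else 0))))).
  apply: eq_bigr => k _; rewrite phatZ// -scaleNr phatD// !phatZ// phatX// !phat_zonal//.
  have e i : (if k == i :> nat then znorm N i else 0) = (if k == i :> nat then znorm N k else 0) :> R.
    by case: eqP => // ->.
  by rewrite !e; ring.
rewrite !sumrB -!mulr_sumr !pick zhatX//.
by ring.
Qed.

Lemma zint_mul_kconv m (g : R -> R) : zI g ->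
  zint N (fun x => g x * (kconv m).[x]) = W^-1 * \sum_(k < m.*2) kcoef m k *
    (zhat N (fun x => x * r x) k * zhat N g k - zhat N r k * zhat N (fun x => x * g x) k).
Proof.
move=> hg; have h1 k : zI (fun y => g y * (c k).[y]) by exact: zI_mulpr.
have h2 k : zI (fun y => y * g y * (c k).[y]) by apply: zI_mulpr; exact: zI_mulx.
have h3 k : zI (fun x => kcoef m k * (zhat N (fun x => x * r x) k * (g x * (c k).[x])
   + - zhat N r k * (x * g x * (c k).[x]))) by apply: zIZ; apply: zID; apply: zIZ.
transitivity (zint N (fun x => W^-1 * \sum_(k < m.*2) kcoef m k *
  (zhat N (fun x => x * r x) k * (g x * (c k).[x]) + - zhat N r k * (x * g x * (c k).[x])))).
  apply: zint_ext => // x _; rewrite /kconv hornerZ mulrCA horner_sum mulr_sumr; congr (_ * _).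
  by apply: eq_bigr => k _; rewrite !(hornerD, hornerN, hornerZ, hornerM, hornerX); ring.
rewrite zintZ; last exact: zI_sum.
congr (_ * _); rewrite zint_sum//; apply: eq_bigr => k _.
rewrite zintZ; last by apply: zID; apply: zIZ.
by rewrite zintD ?zintZ//; [rewrite /zhat; ring|exact: zIZ..].
Qed.

(** The antisymmetry of (y - x) times the kernel; in the spectral form each term cancels by
    itself. *)
Lemma zint_r_kconv m : zint N (fun x => r x * (kconv m).[x]) = 0.
Proof.
by rewrite zint_mul_kconv// big1 ?mulr0// => k _; rewrite [X in X - _]mulrC subrr mulr0.
Qed.

Definition kern_poly m x : {poly R} := \sum_(k < m.*2) (kcoef m k * (c k).[x]) *: c k.

Lemma horner_kern_poly m x y : (kern_poly m x).[y] = kern N m x y.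
Proof.
rewrite kernE// horner_sum; apply: eq_bigr => k _.
by rewrite hornerZ -/(kcoef m k); ring.
Qed.

Lemma measurable_subx_kern m x : measurable_fun I (fun y => (y - x) * kern N m x y).
Proof.
apply: (@eq_measurable_fun _ _ _ _ _ (horner (('X - x%:P) * kern_poly m x))).
  by move=> y _; rewrite hornerM horner_kern_poly !hornerE.
exact: measurable_horner.
Qed.

Definition kbound : R := W^-1 * (kernC N * zint N (fun y => `|r y|)).

Lemma kconv_bound m x : -1 < x < 1 -> `|(kconv m).[x]| <= kbound.
Proof.
move=> hx; have W0 := @zW_gt0 R N hN; have hxc := oo_cc hx.
rewrite kconvE normrM gtr0_norm ?invr_gt0// ler_wpM2l ?invr_ge0 ?(ltW W0)//.
have h1 : zI (fun y => (y - x) * kern N m x y * r y).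
  apply: (@zI_mulb _ _ _ _ (kernC N)) => //.
    exact: measurable_subx_kern.
  by move=> y /oo_cc hy; rewrite normrM (ger0_norm (kern_ge0 _ _ _ _))// distrC kern_bound.
apply: le_trans (zint_norm _ h1) _ => //; rewrite -zintZ; last exact: zI_norm.
apply: zint_le => //; first exact: zI_norm.
  by apply: zIZ; exact: zI_norm.
move=> y /oo_cc hy; rewrite !normrM ler_wpM2r//.
by rewrite (ger0_norm (kern_ge0 _ _ _ _))// distrC kern_bound.
Qed.

Lemma kconv_cvg x : -1 < x < 1 -> cvgn (fun m => (kconv m).[x]).
Proof.
move=> hx; have hxc := oo_cc hx.
have mk m : measurable_fun I (fun y => (y - x) * kern N m x y * r y).
  apply: measurable_funM; last exact: zI_mf hr.
  exact: measurable_subx_kern.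
pose f y := limn (fun m => (y - x) * kern N m x y * r y).
have hf y : -1 < y < 1 -> (y - x) * kern N m x y * r y @[m --> \oo] --> f y.
  move=> /oo_cc hy; have [->|xy] := eqVneq y x.
    by apply/cvg_ex; exists 0; rewrite subrr; under eq_fun do rewrite !mul0r; exact: cvg_cst.
  apply: is_cvgM; last exact: is_cvg_cst.
  by apply: is_cvgM; [exact: is_cvg_cst|apply: kern_cvg => //; rewrite eq_sym].
have hb m y : -1 < y < 1 -> `|(y - x) * kern N m x y * r y| <= kernC N * `|r y|.
  move=> /oo_cc hy; rewrite !normrM ler_wpM2r//.
  by rewrite (ger0_norm (kern_ge0 _ _ _ _))// distrC kern_bound.
have [_ h] := zint_dct mk hf (zIZ _ (zI_norm hr)) hb.
under eq_fun do rewrite kconvE.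
by apply: is_cvgM; [exact: is_cvg_cst|apply/cvg_ex; eexists; exact: h].
Qed.

Definition kconv_lim x : R := limn (fun m => (kconv m).[x]).

Lemma kconv_limP x : -1 < x < 1 -> (kconv m).[x] @[m --> \oo] --> kconv_lim x.
Proof. exact: kconv_cvg. Qed.

Lemma kconv_lim_bound x : -1 < x < 1 -> `|kconv_lim x| <= kbound.
Proof.
move=> hx; have h : `|(kconv m).[x]| @[m --> \oo] --> `|kconv_lim x| by apply: cvg_norm; exact: kconv_limP.
rewrite -(cvg_lim _ h)//; apply: limr_le; first by apply/cvg_ex; eexists; exact: h.
by apply: nearW => m; exact: kconv_bound.
Qed.

Lemma zint_kconv_lim (g : R -> R) : zI g ->
  zint N (fun x => g x * (kconv m).[x]) @[m --> \oo] --> zint N (fun x => g x * kconv_lim x).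
Proof.
move=> hg; have [] := @zint_dct R N (fun m x => g x * (kconv m).[x])
  (fun x => g x * kconv_lim x) (fun x => kbound * `|g x|).
- by move=> m; exact: zI_mf (zI_mulpr _ hg).
- by move=> x hx; apply: cvgM; [exact: cvg_cst|exact: kconv_limP].
- by apply: zIZ; exact: zI_norm.
- by move=> m x hx; rewrite normrM mulrC ler_wpM2r// kconv_bound.
by [].
Qed.

Lemma measurable_kconv_lim : measurable_fun I kconv_lim.
Proof.
apply: (@measurable_fun_cvg _ _ R I (fun m => horner (kconv m))).
  by move=> m; exact: measurable_horner.
by move=> x; rewrite mem_I; exact: kconv_limP.
Qed.

Lemma zI_kconv_lim : zI kconv_lim.
Proof. exact: zI_bdd measurable_kconv_lim kconv_lim_bound. Qed.

Lemma zint_r_kconv_lim : zint N (fun x => r x * kconv_lim x) = 0.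
Proof.
have := zint_kconv_lim hr; under eq_fun do rewrite zint_r_kconv.
by move=> /cvg_lim <-//; rewrite lim_cst.
Qed.

Lemma zhat_kconv_lim j : zhat N kconv_lim j = W^-1 *
  (upc N j * zquotI N j * zhat N r j.+1 - downc N j * zquotI N j.-1 * zhat N r j.-1).
Proof.
have := zint_kconv_lim (zI_poly hN (c j)).
have -> : (fun m => zint N (fun x => (c j).[x] * (kconv m).[x])) = (fun m => phat N (kconv m) j).
  by apply/funext => m; apply: zint_ext => // x _; rewrite hornerM mulrC.
have -> : zint N (fun x => (c j).[x] * kconv_lim x) = zhat N kconv_lim j.
  by apply: zint_ext => // x _; rewrite mulrC.
move=> h; apply: (cvg_unique _ h) => //.
rewrite (funext (phat_kconv^~ j)).
apply: cvgM; first exact: cvg_cst.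
apply: cvgB; apply: cvgM; try exact: cvg_cst.
  by apply: cvgM; [exact: cvg_cst|exact: phat_geom2_cvg].
(* For j = 0 the predecessor [j.-1] is again 0 and not a genuine degree; the factor [downc 0] = 0
   removes the term. *)
case: j {h} => [|j]; last by apply: cvgM; [exact: cvg_cst|exact: phat_geom2_cvg].
rewrite downc_def !mul0r; under eq_fun do rewrite mul0r; exact: cvg_cst.
Qed.

End KernelOperator.

(** * Integration by parts with primitives of G / (1 - x^2) *)

Section IntegrationByParts.
Context {R : realType}.
Variable N : nat.
Hypothesis hN : (3 <= N)%N.
Implicit Types (p q : {poly R}) (x y t a b : R) (k j m : nat).
Local Notation n := (N%:R : R).
Local Notation mu := (@lebesgue_measure R).
Local Notation I := (`](-1)%R, 1%R[%classic : set R).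
Local Notation w := (zweight N).
Local Notation zI := (@zI R N).

Lemma continuous_in_within (f : R -> R) a b :
  (forall x, a <= x <= b -> {for x, continuous f}) -> {within `[a, b], continuous f}.
Proof.
move=> h; apply: continuous_in_subspaceT => x; rewrite inE /= in_itv /=; exact: h.
Qed.

Lemma is_derive_continuous (f : R -> R) x d : is_derive x 1 f d -> {for x, continuous f}.
Proof. by move=> h; apply/differentiable_continuous/derivable1_diffP; exact: ex_derive. Qed.

Lemma Rintegral_derive (F f : R -> R) a b : a < b ->
  (forall x, a <= x <= b -> is_derive x 1 F (f x)) ->
  (forall x, a <= x <= b -> {for x, continuous f}) ->
  \int[mu]_(x in `[a, b]) f x = F b - F a.
Proof.
move=> ab dF cf; have cF x : a <= x <= b -> {for x, continuous F}.
  by move=> /dF; exact: is_derive_continuous.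
rewrite /Rintegral (@continuous_FTC2 _ f F)//.
- exact: continuous_in_within.
- split.
  + by move=> x; rewrite in_itv /= => /andP[h1 h2]; apply: ex_derive; apply: dF; rewrite !ltW.
  + by apply: cvg_at_right_filter; apply: cF; rewrite lexx ltW.
  + by apply: cvg_at_left_filter; apply: cF; rewrite lexx ltW.
- move=> x; rewrite in_itv /= => /andP[h1 h2]; rewrite derive1E; apply: derive_val.
  by apply: dF; rewrite !ltW.
Qed.

Lemma Rintegral_bounded_cvg (f : nat -> R -> R) a b K :
  (forall m x, a <= x <= b -> {for x, continuous (f m)}) ->
  (forall x, a <= x <= b -> cvgn (f ^~ x)) ->
  (forall m x, a <= x <= b -> `|f m x| <= K) ->
  cvgn (fun m => \int[mu]_(x in `[a, b]) f m x).
Proof.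
move=> cf cvf fK.
pose D := (`[a, b]%classic : set R).
have mD : measurable (D : set (measurableTypeR R)) by exact: measurable_itv.
have mf m : measurable_fun D (f m).
  by apply: subspace_continuous_measurable_fun; [exact: mD|exact: continuous_in_within (cf m)].
pose g x := limn (f ^~ x).
have hg x : D x -> f ^~ x @ \oo --> g x by rewrite /D /= in_itv /=; exact: cvf.
have mg : measurable_fun D g by apply: measurable_fun_cvg mf _.
have [] := @dominated_convergence _ _ _ mu D mD
  (fun m x => (f m x)%:E) (fun x => (g x)%:E) (fun x => K%:E).
- by move=> m; apply/measurable_EFinP; exact: mf.
- by apply/measurable_EFinP; exact: mg.
- by apply: aeW => x hx; apply: cvg_EFin; [exact: nearW|exact: hg].
- apply/integrableP; split; first exact: measurable_cst.
  rewrite integral_cst//= lebesgue_measure_itv /=; case: ifP => _.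
    by rewrite -EFinB -EFinM ltry.
  by rewrite mule0 ltry.
- by apply: aeW => x m; rewrite /D /= in_itv /= lee_fin; exact: fK.
move=> i1 _ c; apply/cvg_ex; exists (\int[mu]_(x in D) g x); apply: fine_cvg.
by rewrite fineK//; exact: integrable_fin_num.
Qed.

Lemma continuous_zweight x : -1 < x < 1 -> {for x, continuous w}.
Proof. by move=> hx; apply: is_derive_continuous; exact: is_derive_onem_sq_powR. Qed.

Lemma zint_itv (f : R -> R) a : measurable_fun I f -> 0 < a < 1 ->
  zint N (fun x => (`|x| <= a)%R%:R * f x) = \int[mu]_(x in `[- a, a]) (w x * f x).
Proof.
move=> mf /andP[a0 a1]; rewrite zintE; last first.
  apply: measurable_funM => //.
  apply: (@eq_measurable_fun _ _ _ _ _ (\1_(`[- a, a]%classic : set R) : R -> R)).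
    by move=> x _; rewrite indicE mem_setE /= in_itv /= ler_norml.
  exact: measurable_indic.
rewrite Rintegral_mkcond [RHS]Rintegral_mkcond; apply: eq_Rintegral => x _.
rewrite !patchE !mem_setE !in_itv /= -ler_norml -ltr_norml.
have [h|h] := leP `|x| a; first by rewrite (le_lt_trans h a1) mul1r.
by case: ifP => //; rewrite mul0r mulr0.
Qed.

(** F is controlled only inside the interval. Integrating over [-a, a] leaves boundary terms of size
    at most (1 - a^2) C, which vanish as a tends to 1, while the truncated integrals converge by
    domination. *)
Lemma zint_div (F F' : R -> R) C :
  (forall x, -1 < x < 1 -> is_derive x 1 F (F' x)) ->
  (forall x, -1 < x < 1 -> {for x, continuous F'}) ->
  (forall x, -1 < x < 1 -> `|F x| <= C) ->
  zI (fun x => n * x * F x - (1 - x ^+ 2) * F' x) ->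
  zint N (fun x => n * x * F x - (1 - x ^+ 2) * F' x) = 0.
Proof.
move=> dF cF' FC; set f := (fun x => _ - _) => hf.
pose a m : R := 1 - (m.+2%:R)^-1.
have ha m : 0 < a m < 1.
  have h : 0 < (m.+2%:R : R)^-1 by rewrite invr_gt0.
  by rewrite /a gtrBl h subr_gt0 invf_lt1// ltr1n.
have C0 : 0 <= C by apply: le_trans (FC 0 _) => //; apply/andP; split; lra.
have a1 : a m @[m --> \oo] --> (1 : R).
  rewrite -[X in _ --> X]subr0; apply: cvgB; first exact: cvg_cst.
  apply: (@squeeze_cvgr _ _ _ _ (fun=> 0) (fun m => m.+1%:R^-1)); last exact: cvg_harmonic.
    by apply: nearW => m; rewrite invr_ge0 ler0n/= lef_pV2 ?posrE// ler_nat.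
  exact: cvg_cst.
have m1 m : measurable_fun I (fun x => (`|x| <= a m)%R%:R * f x).
  apply: measurable_funM; last exact: zI_mf hf.
  apply: (@eq_measurable_fun _ _ _ _ _ (\1_(`[- a m, a m]%classic : set R) : R -> R)).
    by move=> x _; rewrite indicE mem_setE /= in_itv /= ler_norml.
  exact: measurable_indic.
have m2 x : -1 < x < 1 -> (`|x| <= a m)%R%:R * f x @[m --> \oo] --> f x.
  move=> hx; apply: cvg_near_cst; near=> m; rewrite (_ : `|x| <= a m) ?mul1r//.
  apply: ltW; near: m; apply: (cvgr_gt _ a1); by rewrite ltr_norml.
have m3 m x : -1 < x < 1 -> `|(`|x| <= a m)%R%:R * f x| <= `|f x|.
  by move=> _; rewrite normrM ler_piMl//; case: (`|x| <= a m); rewrite ?normr0 ?normr1.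
have [_] := zint_dct m1 m2 (zI_norm hf) m3.
move=> h; rewrite -(cvg_lim _ h)//.
apply: cvg_lim => //.
pose H x := zbig N x * - F x.
have dH x : -1 < x < 1 -> is_derive x 1 H (w x * f x).
  move=> hx; have d1 := is_derive_zbig N hx.
  have d2 : is_derive x 1 (fun y => - F y) (- F' x) by exact: is_deriveN (dF _ hx).
  apply: (is_derive_eq (is_deriveM d1 d2)); rewrite zbigE// /GRing.scale /= /f; ring.
have cf x : -1 < x < 1 -> {for x, continuous (fun x => w x * f x)}.
  move=> hx; apply: cvgM; first exact: continuous_zweight.
  apply: cvgB; apply: cvgM.
  - by apply: cvgM; [exact: cvg_cst|exact: cvg_id].
  - exact: is_derive_continuous (dF _ hx).
  - apply: cvgB; [exact: cvg_cst|exact: exprn_continuous].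
  - exact: cF'.
have e m : zint N (fun x => (`|x| <= a m)%R%:R * f x) = H (a m) - H (- a m).
  have /andP[h1 h2] := ha m.
  rewrite zint_itv//; last exact: zI_mf hf.
  apply: Rintegral_derive; first lra.
  - by move=> x /andP[? ?]; apply: dH; apply/andP; split; lra.
  - by move=> x /andP[? ?]; apply: cf; apply/andP; split; lra.
rewrite (funext e).
have bH x : -1 < x < 1 -> `|H x| <= (1 - x ^+ 2) * C.
  move=> hx; have h0 := onem_sq_gt0 hx; rewrite /H normrM normrN; apply: ler_pM => //; last exact: FC.
  rewrite zbigE// ger0_norm ?mulr_ge0 ?zweight_ge0 ?(ltW h0)//.
  by rewrite ler_piMr ?(ltW h0)// zweight_le1.
have bb : (1 - a m ^+ 2) * C + (1 - a m ^+ 2) * C @[m --> \oo] --> (0 : R).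
  have hc : (1 - a m ^+ 2) * C @[m --> \oo] --> (0 : R).
    rewrite -[X in _ --> X](mul0r C); apply: cvgM; last exact: cvg_cst.
    rewrite -[X in _ --> X](subrr 1); apply: cvgB; first exact: cvg_cst.
    by rewrite -[X in _ --> X](mulr1 1); under eq_fun do rewrite expr2; apply: cvgM.
  by rewrite -[X in _ --> X](addr0 0); apply: cvgD.
apply: (@squeeze_cvgr _ _ _ _ (fun m => - ((1 - a m ^+ 2) * C + (1 - a m ^+ 2) * C))
  (fun m => (1 - a m ^+ 2) * C + (1 - a m ^+ 2) * C)) => //; last first.
  by rewrite -[X in _ --> X]oppr0; apply: cvgN.
apply: nearW => m; rewrite -ler_norml; have /andP[h1 h2] := ha m.
apply: le_trans (ler_normB _ _) _; apply: lerD.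
  by apply: bH; apply/andP; split; lra.
by rewrite -[a m ^+ 2]sqrrN; apply: bH; apply/andP; split; lra.
Unshelve. all: by end_near. Qed.

(* A primitive of x^k / (1 - x^2). *)
Fixpoint monprim k x : R :=
  match k with
  | 0 => 2^-1 * (ln (1 + x) - ln (1 - x))
  | 1 => - 2^-1 * (ln (1 + x) + ln (1 - x))
  | (k2.+1 as k1).+1 => monprim k2 x - (k1%:R)^-1 * x ^+ k1
  end.

Lemma is_derive_monprim k x : -1 < x < 1 ->
  is_derive x 1 (monprim k) (x ^+ k / (1 - x ^+ 2)).
Proof.
move=> hx; have h0 := onem_sq_gt0 hx; have /andP[x1 x2] := hx.
have p1 : 0 < 1 + x by lra.
have p2 : 0 < 1 - x by lra.
have l1 : is_derive x 1 (fun y : R => ln (1 + y)) (1 + x)^-1.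
  have d1 : is_derive x 1 (fun y : R => 1 + y) 1.
    have h := is_deriveD (is_derive_cst (1 : R) x 1) (is_derive_id x 1); rewrite add0r in h; exact: h.
  have := @is_derive1_comp R (@ln R) (fun y => 1 + y) x _ _ (is_derive1_ln p1) d1.
  by rewrite mulr1.
have l2 : is_derive x 1 (fun y : R => ln (1 - y)) (- (1 - x)^-1).
  have d1 : is_derive x 1 (fun y : R => 1 - y) (-1).
    have h := is_deriveB (is_derive_cst (1 : R) x 1) (is_derive_id x 1); rewrite sub0r in h; exact: h.
  have := @is_derive1_comp R (@ln R) (fun y => 1 - y) x _ _ (is_derive1_ln p2) d1.
  by rewrite mulrN1.
have e : 1 - x ^+ 2 = (1 + x) * (1 - x) by ring.
suff [] : is_derive x 1 (monprim k) (x ^+ k / (1 - x ^+ 2)) /\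
  is_derive x 1 (monprim k.+1) (x ^+ k.+1 / (1 - x ^+ 2)) by [].
elim: k => [|k [IH1 IH2]]; [split|split; first exact: IH2].
- apply: (is_derive_eq (is_deriveZ (2^-1) (is_deriveB l1 l2))).
  by rewrite e /GRing.scale /=; field; rewrite !gt_eqF.
- apply: (is_derive_eq (is_deriveZ (- 2^-1) (is_deriveD l1 l2))).
  by rewrite e /GRing.scale /= expr1; field; rewrite !gt_eqF.
- have d : is_derive x 1 (fun y : R => y ^+ k.+1) (k.+1%:R * x ^+ k).
    have h := is_derive_horner 'X^(k.+1) x; rewrite derivXn hornerMn hornerXn in h.
    have -> : (fun y : R => y ^+ k.+1) = horner 'X^(k.+1) by apply/funext => y; rewrite hornerXn.
    by rewrite mulr_natl.
  apply: (is_derive_eq (is_deriveB IH1 (is_deriveZ (k.+1%:R^-1) d))).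
  rewrite /GRing.scale /= mulrA mulVf ?mul1r ?pnatr_eq0//.
  by rewrite !exprS; field; rewrite gt_eqF// -e.
Qed.

Definition polyprim p x : R := \sum_(i < size p) p`_i * (monprim i x - monprim i 0).

Lemma polyprim0 p : polyprim p 0 = 0.
Proof. by rewrite /polyprim big1// => i _; rewrite subrr mulr0. Qed.

Lemma is_derive_polyprim p x : -1 < x < 1 ->
  is_derive x 1 (polyprim p) (p.[x] / (1 - x ^+ 2)).
Proof.
move=> hx.
have -> : polyprim p = \sum_(i < size p) (fun y => p`_i * (monprim i y - monprim i 0)).
  by apply/funext => y; rewrite fct_sumE.
rewrite horner_coef mulr_suml; apply: is_derive_sum => i.
have d : is_derive x 1 (fun y => monprim i y - monprim i 0) (x ^+ i / (1 - x ^+ 2)).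
  by apply: (is_derive_eq (is_deriveB (is_derive_monprim i hx) (is_derive_cst (monprim i 0) x 1))); rewrite subr0.
by apply: (is_derive_eq (is_deriveZ (p`_i) d)); rewrite /GRing.scale /= mulrA.
Qed.

Lemma powR_onem_sq_le1 a x : 0 <= a -> -1 < x < 1 -> (1 - x ^+ 2) `^ a <= 1.
Proof.
move=> a0 /onem_sq_gt0/ltW h0; rewrite -[leRHS](congr1 (@^~ a) (powR1 R)).
by apply: ge0_ler_powR; rewrite ?nnegrE ?ler01// gerBl sqr_ge0.
Qed.

Section Limit.
Variables (G_ : nat -> {poly R}) (G : R -> R) (K : R).
Hypothesis G_cvg : forall x, -1 < x < 1 -> (G_ m).[x] @[m --> \oo] --> G x.
Hypothesis G_bound : forall m x, -1 < x < 1 -> `|(G_ m).[x]| <= K.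

Let K0 : 0 <= K.
Proof. by apply: le_trans (G_bound 0 (x:=0) _) => //; apply/andP; split; lra. Qed.

(** Its derivative is K (1 - x^2)^(-3/2), which dominates the bound K / (1 - x^2) for the
    derivatives of the primitives. The growth (1 - x^2)^(-1/2) at the ends is absorbed by the
    weight, whose exponent (N - 2) / 2 is at least 1/2. *)
Definition primbound x : R := K * (x * (1 - x ^+ 2) `^ (- 2^-1)).

Lemma is_derive_primbound x : -1 < x < 1 ->
  exists d, is_derive x 1 primbound d /\ K / (1 - x ^+ 2) <= d.
Proof.
move=> hx; have h0 := onem_sq_gt0 hx.
have d1 := is_deriveM (is_derive_id x 1) (is_derive_onem_sq_powR (- 2^-1) hx).
eexists; split; first exact: (is_deriveZ K d1).
rewrite /GRing.scale /= ler_wpM2l// mulr1.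
set q := 1 - x ^+ 2 in h0 *.
have e1 : q `^ (- 2^-1) = q * q `^ (- 2^-1 - 1).
  by rewrite -{2}(powRr1 (ltW h0)) -powRD ?(gt_eqF h0) ?implybT//; congr (_ `^ _); ring.
rewrite e1; set P := q `^ _.
have -> : x * (- (2 * - 2^-1) * x * P) + q * P = P.
  by rewrite -[RHS]mul1r [in RHS](_ : 1 = x ^+ 2 + q); [field|rewrite /q; ring].
rewrite -powR_inv1 ?(ltW h0)// /P.
rewrite -[leRHS]mul1r -ler_pdivrMr ?powR_gt0// -powRN -powRD ?(gt_eqF h0) ?implybT//.
rewrite (_ : _ + _ = 2^-1); last by field.
by apply: powR_onem_sq_le1.
Qed.

Lemma polyprim_bound m x : -1 < x < 1 -> `|polyprim (G_ m) x| <= `|primbound x|.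
Proof.
move=> hx.
(* A function vanishing at 0 with nonnegative derivative has the sign of x. Applying this to
   [primbound] plus and minus the primitive gives the bound. *)
have mono (F : R -> R) : F 0 = 0 ->
    (forall y, -1 < y < 1 -> exists2 d, is_derive y 1 F d & 0 <= d) -> 0 <= x * F x.
  move=> F0 dF.
  have le a b : -1 < a -> a <= b -> b < 1 -> F a <= F b.
    move=> a1 ab b1; apply: (@ger0_derive1_ndecr R F a b) => //.
    - move=> y; rewrite in_itv /= => /andP[y1 y2]; have [|d h _] := dF y; last exact: ex_derive.
      by rewrite (lt_trans a1 y1) (lt_trans y2 b1).
    - move=> y; rewrite in_itv /= => /andP[y1 y2]; have [|d h h2] := dF y.
        by rewrite (lt_trans a1 y1) (lt_trans y2 b1).
      by rewrite derive1E derive_val.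
    - apply: continuous_in_within => y /andP[y1 y2]; have [|d h _] := dF y.
        by rewrite (lt_le_trans a1 y1) (le_lt_trans y2 b1).
      exact: is_derive_continuous h.
  have /andP[x1 x2] := hx; have [x0|x0] := leP 0 x.
    by rewrite mulr_ge0// -F0 le//; lra.
  by rewrite mulr_le0 ?(ltW x0)// -F0 le// ?(ltW x0)//; lra.
have B0 : primbound 0 = 0 by rewrite /primbound mul0r mulr0.
have dd y s : -1 < y < 1 -> `|s| <= 1 ->
    exists2 d, is_derive y 1 (primbound + (fun z => s * polyprim (G_ m) z)) d & 0 <= d.
  move=> hy hs; have [d [d1 d2]] := is_derive_primbound hy.
  eexists; first exact: is_deriveD d1 (is_deriveZ s (is_derive_polyprim (G_ m) hy)).
  have h0 := onem_sq_gt0 hy.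
  rewrite /GRing.scale /= -lerBlDr sub0r; apply: le_trans d2.
  rewrite mulrA -mulNr ler_pM2r ?invr_gt0//; apply: le_trans (ler_norm _) _.
  rewrite normrN normrM -[leRHS]mul1r; apply: ler_pM => //; exact: G_bound.
have m1 := mono (primbound + (fun z => 1 * polyprim (G_ m) z)).
have m2 := mono (primbound + (fun z => -1 * polyprim (G_ m) z)).
have e1 : 0 <= x * (primbound x + 1 * polyprim (G_ m) x).
  apply: m1; first by rewrite /GRing.add /= B0 polyprim0 mulr0 addr0.
  by move=> y hy; apply: dd; rewrite ?normr1.
have e2 : 0 <= x * (primbound x + -1 * polyprim (G_ m) x).
  apply: m2; first by rewrite /GRing.add /= B0 polyprim0 mulr0 addr0.
  by move=> y hy; apply: dd; rewrite ?normrN ?normr1.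
have [x0|x0|x0] := ltgtP x 0.
- rewrite -normrN -[leRHS]normrN; apply: le_trans (ler_norm _).
  by rewrite ler_norml; apply/andP; split; nra.
- by apply: le_trans (ler_norm _); rewrite ler_norml; apply/andP; split; nra.
- by rewrite x0 polyprim0 normr0.
Qed.

(** On a compact subinterval 1 - x^2 is bounded below, so bounded convergence applies to the
    integrals between 0 and x. *)
Lemma polyprim_cvg x : -1 < x < 1 -> cvgn (fun m => polyprim (G_ m) x).
Proof.
move=> hx; have /andP[x1 x2] := hx.
have key a b : a < b -> -1 < a -> b < 1 ->
    cvgn (fun m => polyprim (G_ m) b - polyprim (G_ m) a).
  move=> ab a1 b1.
  have hin y : a <= y <= b -> -1 < y < 1.
    by move=> /andP[y1 y2]; rewrite (lt_le_trans a1 y1) (le_lt_trans y2 b1).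
  have ci y : -1 < y < 1 -> {for y, continuous (fun y : R => (1 - y ^+ 2)^-1)}.
    move=> hy; apply: cvgV; first by rewrite gt_eqF// onem_sq_gt0.
    by apply: cvgB; [exact: cvg_cst|exact: exprn_continuous].
  have cf m y : a <= y <= b -> {for y, continuous (fun y => (G_ m).[y] / (1 - y ^+ 2))}.
    by move=> /hin hy; apply: cvgM; [exact: continuous_horner|exact: ci].
  have -> : (fun m => polyprim (G_ m) b - polyprim (G_ m) a) =
      (fun m => \int[mu]_(y in `[a, b]) ((G_ m).[y] / (1 - y ^+ 2))).
    apply/funext => m; apply/esym; apply: (@Rintegral_derive (polyprim (G_ m)) (fun y => (G_ m).[y] / (1 - y ^+ 2))) => //.
      by move=> y /hin; exact: is_derive_polyprim.
    exact: cf.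
  apply: (@Rintegral_bounded_cvg _ _ _ (K / ((1 - b) * (1 + a)))) => //.
  - move=> y /hin hy; apply: is_cvgM; last exact: is_cvg_cst.
    by apply/cvg_ex; eexists; exact: G_cvg.
  - move=> m y hy; have /andP[ay yb] := hy; have hI := hin _ hy.
    have h1 : 0 < (1 - b) * (1 + a) by apply: mulr_gt0; lra.
    have h2 := onem_sq_gt0 hI; rewrite normrM normfV (gtr0_norm h2).
    apply: ler_pM => //; [by rewrite invr_ge0 ltW|exact: G_bound|].
    rewrite lef_pV2 ?posrE// (_ : 1 - y ^+ 2 = (1 - y) * (1 + y)); last ring.
    by apply: ler_pM; lra.
have [x0|x0|->] := ltgtP x 0.
- have := key x 0 x0 x1 ltr01; under eq_fun do rewrite polyprim0 sub0r.
  move=> h; rewrite (_ : (fun m => polyprim (G_ m) x) = fun m => - - polyprim (G_ m) x).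
    exact: is_cvgN.
  by apply/funext => m; rewrite opprK.
- have h01 : -1 < (0:R) by lra.
  have := key 0 x x0 h01 x2; under eq_fun do rewrite polyprim0 subr0.
  by [].
- under eq_fun do rewrite polyprim0; exact: is_cvg_cst.
Qed.

Definition limprim x : R := limn (fun m => polyprim (G_ m) x).

Lemma limprimP x : -1 < x < 1 -> polyprim (G_ m) x @[m --> \oo] --> limprim x.
Proof. exact: polyprim_cvg. Qed.

Lemma measurable_of_continuous (f : R -> R) :
  (forall x, -1 < x < 1 -> {for x, continuous f}) -> measurable_fun I f.
Proof.
move=> h; apply: subspace_continuous_measurable_fun; first exact: mIo.
apply: continuous_in_subspaceT => x; rewrite inE mem_I; exact: h.
Qed.

Lemma measurable_limprim : measurable_fun I limprim.
Proof.
apply: (@measurable_fun_cvg _ _ R I (fun m => polyprim (G_ m))).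
  move=> m; apply: measurable_of_continuous => x hx.
  exact: is_derive_continuous (is_derive_polyprim _ hx).
by move=> x; rewrite mem_I; exact: limprimP.
Qed.

Lemma zI_limprim : zI limprim.
Proof. 
have wprim x : -1 < x < 1 -> w x * `|primbound x| <= K.
  move=> hx; have h0 := onem_sq_gt0 hx; rewrite /primbound !normrM (ger0_norm K0) mulrCA.
  rewrite -[leRHS]mulr1 ler_wpM2l// mulrCA [X in _ * (_ * X)]ger0_norm ?powR_ge0//.
  rewrite /zweight -powRD ?(gt_eqF h0) ?implybT//.
  have x1 : `|x| <= 1 by rewrite ler_norml; exact: oo_cc.
  rewrite -[leRHS]mul1r; apply: ler_pM => //; first exact: powR_ge0.
  have n3 := @ge3 R N hN.
  by apply: powR_onem_sq_le1 => //; lra.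
have lb x : -1 < x < 1 -> `|limprim x| <= `|primbound x|.
  move=> hx; have h : `|polyprim (G_ m) x| @[m --> \oo] --> `|limprim x|.
    by apply: cvg_norm; exact: limprimP.
  rewrite -(cvg_lim _ h)//; apply: limr_le; first by apply/cvg_ex; eexists; exact: h.
  by apply: nearW => m; exact: polyprim_bound.
apply/integrableP; split.
  apply/measurable_EFinP; apply: measurable_funM; [exact: mfw|exact: measurable_limprim].
have mI := @mIo R.
apply: le_lt_trans (_ : (\int[mu]_(x in I) K%:E < +oo)%E).
  apply: ge0_le_integral => //.
  - apply: measurableT_comp => //; apply/measurable_EFinP; apply: measurable_funM; [exact: mfw|exact: measurable_limprim].
  - move=> x; rewrite mem_I => hx; rewrite /= lee_fin normrM (ger0_norm (zweight_ge0 _ _)).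
    by apply: le_trans (wprim _ hx); rewrite ler_wpM2l ?zweight_ge0// lb.
by rewrite integral_cst//= lebesgue_measure_itv /=; case: ifP => _; rewrite ?mule0 ?ltry// -EFinB -EFinM ltry.
Qed.

(** This is [zint_div] for psi(U_m) p, with U_m the primitive of the m-th polynomial, in the limit
    of large m. The bounds on psi and its derivative control the boundary terms and provide the
    domination. *)
Lemma zint_limprim_bdd (psi dpsi : R -> R) M p :
  (forall z : R, is_derive z 1 psi (dpsi z)) -> continuous dpsi ->
  (forall z, `|psi z| <= M) -> (forall z, `|dpsi z| <= M) ->
  zint N (fun x => psi (limprim x) * (n * x * p.[x] - (1 - x ^+ 2) * (p^`()).[x])
    - dpsi (limprim x) * (G x * p.[x])) = 0.
Proof.
move=> dpsiE cdpsi bpsi bdpsi.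
have cpsi : continuous psi by move=> z; exact: is_derive_continuous (dpsiE z).
pose Xp : {poly R} := n%:P * 'X * p - (1 - 'X ^+ 2) * p^`().
have XpE x : Xp.[x] = n * x * p.[x] - (1 - x ^+ 2) * (p^`()).[x] by rewrite /Xp !hornerE.
pose f m x := psi (polyprim (G_ m) x) * Xp.[x] - dpsi (polyprim (G_ m) x) * ((G_ m).[x] * p.[x]).
pose f0 x := psi (limprim x) * Xp.[x] - dpsi (limprim x) * (G x * p.[x]).
have [M1 [M10 hM1]] := horner_bound Xp; have [M2 [M20 hM2]] := horner_bound p.
have cU m x : -1 < x < 1 -> {for x, continuous (polyprim (G_ m))}.
  by move=> hx; exact: is_derive_continuous (is_derive_polyprim _ hx).
have cf m x : -1 < x < 1 -> {for x, continuous (f m)}.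
  move=> hx; apply: cvgB; apply: cvgM.
  - exact: (@continuous_comp _ _ _ (polyprim (G_ m)) psi x (cU m x hx) (cpsi _)).
  - exact: continuous_horner.
  - exact: (@continuous_comp _ _ _ (polyprim (G_ m)) dpsi x (cU m x hx) (cdpsi _)).
  - by apply: cvgM; exact: continuous_horner.
have fb m x : -1 < x < 1 -> `|f m x| <= M * M1 + M * (K * M2).
  move=> hx; apply: le_trans (ler_normB _ _) _; rewrite !normrM.
  by apply: lerD; apply: ler_pM => //; rewrite ?hM1 ?oo_cc//; apply: ler_pM => //; rewrite ?G_bound// ?hM2// oo_cc.
have fc x : -1 < x < 1 -> f ^~ x @ \oo --> f0 x.
  move=> hx; have hU := limprimP hx; apply: cvgB; apply: cvgM; try exact: cvg_cst.
  - exact: cvg_comp hU (cpsi _).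
  - exact: cvg_comp hU (cdpsi _).
  - by apply: cvgM; [exact: G_cvg|exact: cvg_cst].
have fz m : zint N (f m) = 0.
  have e x : -1 < x < 1 -> f m x = n * x * (psi (polyprim (G_ m) x) * p.[x])
     - (1 - x ^+ 2) * (dpsi (polyprim (G_ m) x) * ((G_ m).[x] / (1 - x ^+ 2)) * p.[x] + psi (polyprim (G_ m) x) * (p^`()).[x]).
    by move=> hx; rewrite /f XpE; field; rewrite gt_eqF// onem_sq_gt0.
  rewrite (zint_ext hN e); apply: (@zint_div _ _ (M * M2)).
  - move=> x hx.
    have d1 := @is_derive1_comp R psi (polyprim (G_ m)) x _ _ (dpsiE _) (is_derive_polyprim (G_ m) hx).
    apply: (is_derive_eq (is_deriveM d1 (is_derive_horner p x))); rewrite /GRing.scale /=; ring.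
  - move=> x hx; apply: cvgD; apply: cvgM; try exact: continuous_horner.
    + apply: cvgM; first exact: (@continuous_comp _ _ _ (polyprim (G_ m)) dpsi x (cU m x hx) (cdpsi _)).
      apply: cvgM; first exact: continuous_horner.
      apply: cvgV; first by rewrite gt_eqF// onem_sq_gt0.
      by apply: cvgB; [exact: cvg_cst|exact: exprn_continuous].
    + exact: (@continuous_comp _ _ _ (polyprim (G_ m)) psi x (cU m x hx) (cpsi _)).
  - by move=> x hx; rewrite normrM; apply: ler_pM => //; rewrite hM2// oo_cc.
  - apply: (zI_ext e); apply: zI_bdd (fb m) => //; exact: measurable_of_continuous (cf m).
rewrite (@zint_ext _ _ hN _ f0); last by move=> x _; rewrite /f0 XpE.
have [_] := zint_dct (fun m => measurable_of_continuous (cf m)) fc (zI_cst hN _) fb.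
by rewrite (funext fz) => h; rewrite -(cvg_lim _ h)// lim_cst.
Qed.

(** Extends the identity to an unbounded [psi0]: the bounds of the [psi m] may grow with m, but a
    single [Psi] dominates them all and is integrable when composed with the primitive. *)
Lemma zint_limprim (psi dpsi : nat -> R -> R) (psi0 dpsi0 Psi : R -> R) (M : nat -> R) p :
  (forall m (z : R), is_derive z 1 (psi m) (dpsi m z)) -> (forall m, continuous (dpsi m)) ->
  (forall m z, `|psi m z| <= M m) -> (forall m z, `|dpsi m z| <= M m) ->
  (forall m z, `|psi m z| <= Psi z) -> (forall m z, `|dpsi m z| <= Psi z) ->
  (forall z, psi ^~ z @ \oo --> psi0 z) -> (forall z, dpsi ^~ z @ \oo --> dpsi0 z) ->
  measurable_fun I G ->
  zI (fun x => Psi (limprim x)) ->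
  zint N (fun x => psi0 (limprim x) * (n * x * p.[x] - (1 - x ^+ 2) * (p^`()).[x])
    - dpsi0 (limprim x) * (G x * p.[x])) = 0.
Proof.
move=> d1 c1 b1 b2 B1 B2 l1 l2 mG hI.
pose Xp : {poly R} := n%:P * 'X * p - (1 - 'X ^+ 2) * p^`().
have XpE x : Xp.[x] = n * x * p.[x] - (1 - x ^+ 2) * (p^`()).[x] by rewrite /Xp !hornerE.
have [M1 [M10 hM1]] := horner_bound Xp; have [M2 [M20 hM2]] := horner_bound p.
have mU := measurable_limprim.
have cc (f : R -> R) : continuous f -> measurable_fun I (f \o limprim).
  by move=> cf; apply: measurableT_comp => //; exact: continuous_measurable_fun.
have Gb x : -1 < x < 1 -> `|G x| <= K.
  move=> hx; have h : `|(G_ m).[x]| @[m --> \oo] --> `|G x| by apply: cvg_norm; exact: G_cvg.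
  rewrite -(cvg_lim _ h)//; apply: limr_le; first by apply/cvg_ex; eexists; exact: h.
  by apply: nearW => m; exact: G_bound.
rewrite (@zint_ext _ _ hN _ (fun x => psi0 (limprim x) * Xp.[x] - dpsi0 (limprim x) * (G x * p.[x]))); last first.
  by move=> x _; rewrite XpE.
pose f m x := psi m (limprim x) * Xp.[x] - dpsi m (limprim x) * (G x * p.[x]).
have f1 m : measurable_fun I (f m).
  apply: measurable_funB; apply: measurable_funM.
  - by apply: cc => z; exact: is_derive_continuous (d1 m z).
  - exact: measurable_horner.
  - exact: cc.
  - by apply: measurable_funM => //; exact: measurable_horner.
have f2 x : -1 < x < 1 -> f ^~ x @ \oo --> psi0 (limprim x) * Xp.[x] - dpsi0 (limprim x) * (G x * p.[x]).
  by move=> hx; apply: cvgB; apply: cvgM; try exact: cvg_cst; [exact: l1|exact: l2].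
have f3 m x : -1 < x < 1 -> `|f m x| <= (M1 + K * M2) * Psi (limprim x).
  move=> hx; apply: le_trans (ler_normB _ _) _; rewrite !normrM.
  rewrite [leRHS](_ : _ = Psi (limprim x) * M1 + Psi (limprim x) * (K * M2)); last ring.
  apply: lerD; apply: ler_pM => //; first by rewrite hM1// oo_cc.
  by apply: ler_pM => //; rewrite ?Gb// hM2// oo_cc.
have [_] := zint_dct f1 f2 (zIZ _ hI) f3.
rewrite (_ : (fun m => zint N (f m)) = fun=> 0).
  by move=> h; rewrite -(cvg_lim _ h)// lim_cst.
apply/funext => m; rewrite -[RHS](zint_limprim_bdd p (d1 m) (c1 m) (b1 m) (b2 m)).
by apply: zint_ext => // x _; rewrite /f XpE.
Qed.

End Limit.

End IntegrationByParts.

(** * Weak equation and Kazdan-Warner identity for the primitive U of G / (1 - x^2) *)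

Section KazdanWarner.
Context {R : realType}.
Variable N : nat.
Hypothesis hN : (3 <= N)%N.
Implicit Types (p q : {poly R}) (x y t a b : R) (k j m : nat).
Local Notation n := (N%:R : R).
Local Notation mu := (@lebesgue_measure R).
Local Notation I := (`](-1)%R, 1%R[%classic : set R).
Local Notation c := (@zonal R N).
Local Notation w := (zweight N).
Local Notation zI := (@zI R N).
Local Notation W := (@zW R N).

Lemma cvg_invS : (m.+1%:R)^-1 @[m --> \oo] --> (0 : R).
Proof. exact: cvg_harmonic. Qed.

(* Bounded functions converging to the identity, and below to exp: composed with
   the unbounded primitive [limprim] they make the boundary terms
   of the integration by parts vanish. *)
Definition trunc_id m (z : R) := z / (1 + m.+1%:R^-1 * z ^+ 2).
Definition trunc_id' m (z : R) := (1 - m.+1%:R^-1 * z ^+ 2) / (1 + m.+1%:R^-1 * z ^+ 2) ^+ 2.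

Lemma invS_itv m : 0 < (m.+1%:R : R)^-1 <= 1.
Proof. by rewrite invr_gt0 ltr0n/= invf_le1 ?ltr0n// ler1n. Qed.

Lemma trunc_id_den m z : 0 < 1 + m.+1%:R^-1 * z ^+ 2 :> R.
Proof. by have /andP[h _] := invS_itv m; rewrite ltr_pwDl// mulr_ge0 ?sqr_ge0// ltW. Qed.

Lemma is_derive_trunc_id m (z : R) : is_derive z 1 (trunc_id m) (trunc_id' m z).
Proof.
have h := trunc_id_den m z; set s := m.+1%:R^-1 in h *.
have d : is_derive z 1 (fun y => 1 + s * y ^+ 2) (s * (2 * z)).
  have -> : (fun y => 1 + s * y ^+ 2) = horner (1 + s *: 'X ^+ 2).
    by apply/funext => y; rewrite !(hornerE, horner_exp).
  apply: (is_derive_eq (is_derive_horner _ z)).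
  by rewrite derivD -polyC1 derivC derivZ derivXn add0r hornerZ hornerMn hornerXn expr1 mulr_natl.
apply: (is_derive_eq (is_deriveM (is_derive_id z 1) (is_deriveV _ d))); first by rewrite gt_eqF.
by rewrite /trunc_id' -/s /GRing.scale /=; field; rewrite gt_eqF.
Qed.

Lemma continuous_trunc_den m : continuous (fun z : R => 1 + m.+1%:R^-1 * z ^+ 2).
Proof.
by move=> z; apply: cvgD; [exact: cvg_cst|apply: cvgM; [exact: cvg_cst|exact: exprn_continuous]].
Qed.

Lemma continuous_trunc_id' m : continuous (trunc_id' m).
Proof.
move=> z; apply: cvgM.
  by apply: cvgB; [exact: cvg_cst|apply: cvgM; [exact: cvg_cst|exact: exprn_continuous]].
apply: cvgV; first by rewrite expf_neq0// gt_eqF// trunc_id_den.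
under eq_fun do rewrite expr2; rewrite expr2; apply: cvgM; exact: continuous_trunc_den.
Qed.

Lemma trunc_id_le m z : `|trunc_id m z| <= `|z|.
Proof.
have h := trunc_id_den m z; rewrite /trunc_id normrM normfV (gtr0_norm h).
have /andP[/ltW s0 _] := invS_itv m.
by rewrite ler_pdivrMr// ler_peMr// lerDl mulr_ge0 ?sqr_ge0.
Qed.

Lemma trunc_id_bound m z : `|trunc_id m z| <= m.+1%:R.
Proof.
have h := trunc_id_den m z; rewrite /trunc_id normrM normfV (gtr0_norm h).
have /andP[s0 s1] := invS_itv m; rewrite ler_pdivrMr// mulrDr mulr1 mulrA mulfV ?pnatr_eq0// mul1r.
have : 1 <= (m.+1%:R : R) by rewrite ler1n.
have := sqr_ge0 (`|z| - 1).
by rewrite -(@real_normK _ z) ?num_real//; have := normr_ge0 z; nra.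
Qed.

Lemma trunc_id'_le1 m z : `|trunc_id' m z| <= 1.
Proof.
have h := trunc_id_den m z; have /andP[s0 _] := invS_itv m.
rewrite /trunc_id' normrM normfV (ger0_norm (sqr_ge0 _)) ler_pdivrMr ?exprn_gt0// mul1r.
have : 0 <= m.+1%:R^-1 * z ^+ 2 by rewrite mulr_ge0 ?sqr_ge0// ltW.
by move: (_ * z ^+ 2) => t t0; rewrite ler_norml; apply/andP; split; nra.
Qed.

Lemma trunc_den_cvg (t : R) : 1 + m.+1%:R^-1 * t @[m --> \oo] --> (1 : R).
Proof.
rewrite -[X in _ --> X]addr0 -[X in _ --> _ + X](mul0r t).
by apply: cvgD; [exact: cvg_cst|apply: cvgM; [exact: cvg_invS|exact: cvg_cst]].
Qed.

Lemma trunc_id_cvg z : trunc_id m z @[m --> \oo] --> z.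
Proof.
rewrite -[X in _ --> X]divr1; apply: cvgM; first exact: cvg_cst.
by apply: cvgV; [rewrite oner_neq0|exact: trunc_den_cvg].
Qed.

Lemma trunc_id'_cvg z : trunc_id' m z @[m --> \oo] --> (1 : R).
Proof.
rewrite -[X in _ --> X](divr1 1); apply: cvgM.
  rewrite -[X in _ --> X]subr0 -[X in _ --> _ - X](mul0r (z ^+ 2)).
  by apply: cvgB; [exact: cvg_cst|apply: cvgM; [exact: cvg_invS|exact: cvg_cst]].
apply: cvgV; first by rewrite oner_neq0.
rewrite -[X in _ --> X](mulr1 1); apply: cvgM; exact: trunc_den_cvg.
Qed.

Definition trunc_exp m (z : R) := m.+1%:R * (1 - (1 + m.+1%:R^-1 * expR (n * z))^-1).
Definition trunc_exp' m (z : R) := n * expR (n * z) / (1 + m.+1%:R^-1 * expR (n * z)) ^+ 2.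

Lemma trunc_exp_den m z : 1 <= 1 + m.+1%:R^-1 * expR (n * z) :> R.
Proof. by have /andP[h _] := invS_itv m; rewrite lerDl mulr_ge0 ?expR_ge0// ltW. Qed.

Lemma is_derive_expn (z : R) : is_derive z 1 (fun y => expR (n * y)) (n * expR (n * z)).
Proof.
have d : is_derive z 1 (fun y : R => n * y) n.
  by apply: (is_derive_eq (is_deriveZ n (is_derive_id z 1))); rewrite /GRing.scale /= mulr1.
by apply: (is_derive_eq (@is_derive1_comp R (@expR R) (fun y => n * y) z _ _ (is_derive_expR _) d)); rewrite mulrC.
Qed.

Lemma is_derive_trunc_exp m (z : R) : is_derive z 1 (trunc_exp m) (trunc_exp' m z).
Proof.
have h : 0 < 1 + m.+1%:R^-1 * expR (n * z) by exact: lt_le_trans (trunc_exp_den m z).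
have s0 : m.+1%:R != 0 :> R by rewrite pnatr_eq0.
have d : is_derive z 1 (fun y => 1 + m.+1%:R^-1 * expR (n * y)) (m.+1%:R^-1 * (n * expR (n * z))).
  have hh := is_deriveD (is_derive_cst (1 : R) z 1) (is_deriveZ (m.+1%:R^-1) (is_derive_expn z)).
  by rewrite add0r in hh; exact: hh.
have d2 := is_deriveB (is_derive_cst (1 : R) z 1) (is_deriveV _ d).
have {}d2 := is_deriveZ (m.+1%:R) (d2 (lt0r_neq0 h)).
apply: (is_derive_eq d2).
have hE := addr_gt0 (ltr0Sn R m) (expR_gt0 (n * z)).
rewrite /trunc_exp' /GRing.scale /=; move: (m.+1%:R : R) s0 hE => M s0 hE.
by field; rewrite (gt_eqF hE) s0.
Qed.

Lemma continuous_expn : continuous (fun z : R => expR (n * z)).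
Proof. by move=> z; exact: is_derive_continuous (is_derive_expn z). Qed.

Lemma continuous_trunc_exp' m : continuous (trunc_exp' m).
Proof.
have cd : continuous (fun z : R => 1 + m.+1%:R^-1 * expR (n * z)).
  by move=> z; apply: cvgD; [exact: cvg_cst|apply: cvgM; [exact: cvg_cst|exact: continuous_expn]].
move=> z; apply: cvgM; first by apply: cvgM; [exact: cvg_cst|exact: continuous_expn].
apply: cvgV; first by rewrite expf_neq0// gt_eqF// (lt_le_trans _ (trunc_exp_den m z)).
under eq_fun do rewrite expr2; rewrite expr2; apply: cvgM; exact: cd.
Qed.

Lemma trunc_expE m z : trunc_exp m z = expR (n * z) / (1 + m.+1%:R^-1 * expR (n * z)).
Proof.
have h : 0 < 1 + m.+1%:R^-1 * expR (n * z) by exact: lt_le_trans (trunc_exp_den m z).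
have s0 : m.+1%:R != 0 :> R by rewrite pnatr_eq0.
have hE := addr_gt0 (ltr0Sn R m) (expR_gt0 (n * z)).
rewrite /trunc_exp; move: (m.+1%:R : R) s0 hE => M s0 hE.
by field; rewrite (gt_eqF hE) s0.
Qed.

Lemma trunc_exp_le m z : `|trunc_exp m z| <= n * expR (n * z).
Proof.
have h := trunc_exp_den m z; have h0 := lt_le_trans ltr01 h.
have n3 := @ge3 R N hN; have e0 := expR_gt0 (n * z).
rewrite trunc_expE normrM normfV (gtr0_norm h0) (gtr0_norm e0) ler_pdivrMr//.
have h2 : 1 <= n * (1 + m.+1%:R^-1 * expR (n * z)).
  by rewrite -[leLHS]mulr1; apply: ler_pM => //; lra.
by rewrite mulrAC -[leLHS]mul1r ler_wpM2r// ltW.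
Qed.

Lemma trunc_exp_bound m z : `|trunc_exp m z| <= n * m.+1%:R.
Proof.
have h := trunc_exp_den m z; have h0 := lt_le_trans ltr01 h.
have n3 := @ge3 R N hN; have m1 : 1 <= (m.+1%:R : R) by rewrite ler1n.
have h1 : 0 <= 1 - (1 + m.+1%:R^-1 * expR (n * z))^-1 by rewrite subr_ge0 invf_le1.
rewrite /trunc_exp normrM (ger0_norm h1) (@ger0_norm _ m.+1%:R)//.
have h2 : 0 < (1 + m.+1%:R^-1 * expR (n * z))^-1 by rewrite invr_gt0.
by move: (_^-1) h1 h2 => t h1 h2; nra.
Qed.

Lemma trunc_exp'E m z : trunc_exp' m z = n * trunc_exp m z / (1 + m.+1%:R^-1 * expR (n * z)).
Proof.
have h : 0 < 1 + m.+1%:R^-1 * expR (n * z) by exact: lt_le_trans (trunc_exp_den m z).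
have hE := addr_gt0 (ltr0Sn R m) (expR_gt0 (n * z)).
have s0 : m.+1%:R != 0 :> R by rewrite pnatr_eq0.
rewrite trunc_expE /trunc_exp'; move: (m.+1%:R : R) s0 hE => M s0 hE.
by field; rewrite (gt_eqF hE) s0.
Qed.

Lemma trunc_exp'_le_trunc m z : `|trunc_exp' m z| <= n * `|trunc_exp m z|.
Proof.
have h := trunc_exp_den m z; have h0 := lt_le_trans ltr01 h.
rewrite trunc_exp'E !normrM normfV (gtr0_norm h0) (@ger0_norm _ n)//.
by rewrite ler_pdivrMr// ler_peMr// mulr_ge0.
Qed.

Lemma trunc_exp_cvg z : trunc_exp m z @[m --> \oo] --> expR (n * z).
Proof.
rewrite (funext (trunc_expE^~ z)).
rewrite -[X in _ --> X]divr1; apply: cvgM; first exact: cvg_cst.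
by apply: cvgV; [rewrite oner_neq0|exact: trunc_den_cvg].
Qed.

Lemma trunc_exp'_cvg z : trunc_exp' m z @[m --> \oo] --> n * expR (n * z).
Proof.
rewrite (funext (trunc_exp'E^~ z)).
rewrite -[X in _ --> X]divr1; apply: cvgM.
  by apply: cvgM; [exact: cvg_cst|exact: trunc_exp_cvg].
by apply: cvgV; [rewrite oner_neq0|exact: trunc_den_cvg].
Qed.

Section Limit.
Variables (G_ : nat -> {poly R}) (G : R -> R) (K : R).
Hypothesis G_cvg : forall x, -1 < x < 1 -> (G_ m).[x] @[m --> \oo] --> G x.
Hypothesis G_bound : forall m x, -1 < x < 1 -> `|(G_ m).[x]| <= K.
Hypothesis mG : measurable_fun I G.
Local Notation U := (limprim G_).

(** The weak form of (1 - x^2) U' = G, which later identifies U with u through zonal coefficients.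
    The domination is by 1 + |U|. *)
Lemma zint_limprim_id p :
  zint N (fun x => U x * (n * x * p.[x] - (1 - x ^+ 2) * (p^`()).[x]) - G x * p.[x]) = 0.
Proof.
have zU := zI_limprim hN G_cvg G_bound.
have b1 m z : `|trunc_id' m z| <= 1 + `|z| by rewrite (le_trans (trunc_id'_le1 _ _))// lerDl.
have b2 m z : `|trunc_id m z| <= 1 + `|z| by rewrite (le_trans (trunc_id_le _ _))// lerDr.
have b3 m z : `|trunc_id' m z| <= m.+1%:R by rewrite (le_trans (trunc_id'_le1 _ _))// ler1n.
have := @zint_limprim R N hN G_ G K G_cvg G_bound trunc_id trunc_id' id (fun=> 1) _ _ p
  is_derive_trunc_id continuous_trunc_id' trunc_id_bound b3 b2 b1 trunc_id_cvg trunc_id'_cvg mG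
  (zID (zI_cst hN 1) (zI_norm zU)).
by move=> h; rewrite -[RHS]h; apply: zint_ext => // x _; rewrite mul1r.
Qed.

(** The weak form of the equation (1 - x^2) (e^(N U))' = N G e^(N U). *)
Lemma zint_limprim_exp p : zI (fun x => expR (n * U x)) ->
  zint N (fun x => expR (n * U x) * (n * (G x - x) * p.[x] + (1 - x ^+ 2) * (p^`()).[x])) = 0.
Proof.
move=> zE; have n3 := @ge3 R N hN.
have b1 m z : `|trunc_exp' m z| <= n * (n * expR (n * z)).
  by apply: le_trans (trunc_exp'_le_trunc _ _) _; rewrite ler_wpM2l// trunc_exp_le.
have b2 m z : `|trunc_exp m z| <= n * (n * expR (n * z)).
  apply: le_trans (trunc_exp_le _ _) _; rewrite ler_peMl//; last lra.
have b3 m z : `|trunc_exp' m z| <= n * (n * m.+1%:R).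
  by apply: le_trans (trunc_exp'_le_trunc _ _) _; rewrite ler_wpM2l// trunc_exp_bound.
have b4 m z : `|trunc_exp m z| <= n * (n * m.+1%:R).
  apply: le_trans (trunc_exp_bound _ _) _; rewrite ler_peMl//; last lra.
have := @zint_limprim R N hN G_ G K G_cvg G_bound trunc_exp trunc_exp' _ _ _ _ p
  is_derive_trunc_exp continuous_trunc_exp' b4 b3 b2 b1 trunc_exp_cvg trunc_exp'_cvg mG
  (zIZ _ (zIZ _ zE)).
set f := (fun x => _ - _) => h.
have zf : zI f.
  have h1 : zI (fun x => (n%:P * 'X * p - (1 - 'X ^+ 2) * p^`()).[x] * expR (n * U x)) by exact: zI_mulp.
  have Gb x : -1 < x < 1 -> `|G x| <= K.
    move=> hx; have hh : `|(G_ m).[x]| @[m --> \oo] --> `|G x| by apply: cvg_norm; exact: G_cvg.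
    rewrite -(cvg_lim _ hh)//; apply: limr_le; first by apply/cvg_ex; eexists; exact: hh.
    by apply: nearW => m; exact: G_bound.
  have h2 : zI (fun x => G x * ((n *: p).[x] * expR (n * U x))).
    by apply: (zI_mulb _ mG Gb); exact: zI_mulp.
  by apply: zI_ext (zIB h1 h2) => x _; rewrite /f !(hornerD, hornerN, hornerM, hornerC, hornerX, horner_exp, hornerZ); ring.
rewrite -[RHS]oppr0 -h -zintN//; apply: zint_ext => // x _; rewrite /f; ring.
Qed.

End Limit.
End KazdanWarner.

(** * Bounded multipliers of an integrable density *)

Section BoundedMultipliers.
Context {R : realType}.
Variable N : nat.
Hypothesis hN : (3 <= N)%N.
Implicit Types (p q : {poly R}) (x y t a b : R) (f g rho : R -> R).
Local Notation I := (`](-1)%R, 1%R[%classic : set R).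
Local Notation zI := (@zI R N).

Definition bmf f := measurable_fun I f /\ exists M : R, forall x, -1 < x < 1 -> `|f x| <= M.

Lemma bmf_poly p : bmf (horner p).
Proof.
split; first exact: measurable_horner.
by have [M [_ hM]] := horner_bound p; exists M => x /oo_cc; exact: hM.
Qed.

Lemma bmf_ext f g : (forall x, f x = g x) -> bmf f -> bmf g.
Proof. by move=> /funext ->. Qed.

Lemma bmf_cst a : bmf (fun=> a).
Proof. by apply: bmf_ext (bmf_poly a%:P) => x; rewrite hornerC. Qed.

Lemma bmf_id : bmf (fun x => x).
Proof. by apply: bmf_ext (bmf_poly 'X) => x; rewrite hornerX. Qed.

Lemma bmfD f g : bmf f -> bmf g -> bmf (fun x => f x + g x).
Proof.
move=> [mf [M hM]] [mg [M' hM']]; split; first exact: measurable_funD.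
by exists (M + M') => x hx; rewrite (le_trans (ler_normD _ _))// lerD ?hM ?hM'.
Qed.

Lemma bmfM f g : bmf f -> bmf g -> bmf (fun x => f x * g x).
Proof.
move=> [mf [M hM]] [mg [M' hM']]; split; first exact: measurable_funM.
by exists (M * M') => x hx; rewrite normrM ler_pM ?hM ?hM'.
Qed.

Lemma bmfZ a f : bmf f -> bmf (fun x => a * f x).
Proof. by move=> hf; apply: bmfM => //; exact: bmf_cst. Qed.

Lemma bmfN f : bmf f -> bmf (fun x => - f x).
Proof. by move=> hf; apply: bmf_ext (bmfZ (-1) hf) => x; rewrite mulN1r. Qed.

Lemma bmfB f g : bmf f -> bmf g -> bmf (fun x => f x - g x).
Proof. by move=> hf hg; apply: bmfD => //; exact: bmfN. Qed.

Lemma bmf_exp2 f : bmf f -> bmf (fun x => f x ^+ 2).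
Proof. by move=> hf; apply: bmf_ext (bmfM hf hf). Qed.

Lemma zI_bmf rho f : zI rho -> bmf f -> zI (fun x => rho x * f x).
Proof.
move=> hr [mf [M hM]]; apply: zI_ext (zI_mulb hr mf hM) => x _; exact: mulrC.
Qed.

Lemma bmf_zI f : bmf f -> zI f.
Proof. by move=> [mf [M hM]]; exact: zI_bdd mf hM. Qed.

Lemma rintD rho f g : zI rho -> bmf f -> bmf g ->
  zint N (fun x => rho x * (f x + g x)) =
  zint N (fun x => rho x * f x) + zint N (fun x => rho x * g x).
Proof.
move=> hr hf hg; rewrite -zintD; [|exact: zI_bmf..].
by apply: zint_ext => // x _; rewrite mulrDr.
Qed.

Lemma rintZ rho a f : zI rho -> bmf f ->
  zint N (fun x => rho x * (a * f x)) = a * zint N (fun x => rho x * f x).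
Proof.
by move=> hr hf; rewrite -zintZ; [apply: zint_ext => // x _; rewrite mulrCA|exact: zI_bmf].
Qed.

Lemma rintB rho f g : zI rho -> bmf f -> bmf g ->
  zint N (fun x => rho x * (f x - g x)) =
  zint N (fun x => rho x * f x) - zint N (fun x => rho x * g x).
Proof.
move=> hr hf hg; rewrite -zintB//; [|exact: zI_bmf..].
by apply: zint_ext => // x _; rewrite mulrBr.
Qed.

End BoundedMultipliers.

(** * Consequences of the Euler-Lagrange equation: u as a primitive, and lam = 0 *)

Section EulerLagrange.
Context {R : realType}.
Variable N : nat.
Hypothesis hN : (3 <= N)%N.
Implicit Types (p q : {poly R}) (x y t a b : R) (k j m : nat).
Local Notation n := (N%:R : R).
Local Notation mu := (@lebesgue_measure R).
Local Notation I := (`](-1)%R, 1%R[%classic : set R).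
Local Notation c := (@zonal R N).
Local Notation A := (@upc R N).
Local Notation B := (@downc R N).
Local Notation zI := (@zI R N).
Local Notation W := (@zW R N).

(** The adjoint of (1 - x^2) d/dx maps degree j to degrees j + 1 and j - 1. So the zonal
    coefficients of (1 - x^2) u' are combinations of two coefficients of u, and make sense without
    differentiating u. *)
Lemma zonal_divX j : n%:P * 'X * c j - (1 - 'X ^+ 2) * (c j)^`() =
  ((j%:R + n) * A j) *: c j.+1 - ((j%:R - 1) * B j) *: c j.-1.
Proof.
rewrite zonal_deriv// -mulrA zonal_mulX// mul_polyC !scalerDr !scalerN !scalerDr !scalerA.
have hB : j%:R = (2 * j%:R + n - 1) * B j by rewrite downcE.
have -> : ((j%:R + n) * A j) *: c j.+1 = (n * A j) *: c j.+1 + (j%:R * A j) *: c j.+1.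
  by rewrite -scalerDl; congr (_ *: _); ring.
have -> : ((j%:R - 1) * B j) *: c j.-1 = - (n * B j) *: c j.-1 + j%:R *: c j.-1 - (j%:R * B j) *: c j.-1.
  by rewrite -scalerDl -scalerBl; congr (_ *: _); rewrite [X in _ + X - _]hB; ring.
rewrite scaleNr; ring.
Qed.

Lemma zint_divX_zonal (f : R -> R) j : zI f ->
  zint N (fun x => f x * (n * x * (c j).[x] - (1 - x ^+ 2) * ((c j)^`()).[x])) =
  (j%:R + n) * A j * zhat N f j.+1 - (j%:R - 1) * B j * zhat N f j.-1.
Proof.
move=> hf; have h k : zI (fun x => f x * (c k).[x]) by exact: zI_mulpr.
rewrite /zhat -!zintZ// -zintB//; [|exact: zIZ..].
apply: zint_ext => // x _; have := congr1 (horner^~ x) (zonal_divX j).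
rewrite !(hornerD, hornerN, hornerM, hornerC, hornerX, horner_exp, hornerZ) => ->.
by ring.
Qed.

Variables (alpha lam C : R) (u rho : R -> R).
Hypothesis ha : 2^-1 <= alpha <= 1.
Hypothesis C0 : 0 < C.
Hypothesis zu : zI u.
Hypothesis rhoE : forall x, rho x = C * expR (n * u x).
Local Notation r := (fun x => rho x * (1 + lam * x)).
Hypothesis zrho : zI rho.
Hypothesis rho1 : zint N rho = W.
Hypothesis rhox : zint N (fun x => rho x * x) = 0.
Hypothesis EL : forall k, alpha * paneitz_eig N k * zhat N u k =
  (N.-1)`!%:R * (zhat N r k - (k == 0%N)%:R * W).

Let a0 : 0 < alpha. Proof. by case/andP: ha; lra. Qed.

Lemma bmf_lam : bmf (fun x => 1 + lam * x).
Proof. by apply: bmfD; [exact: bmf_cst|apply: bmfZ; exact: bmf_id]. Qed.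

Lemma zI_r : zI r.
Proof. exact: zI_bmf zrho bmf_lam. Qed.

Lemma zint_r : zint N r = W.
Proof.
rewrite rintD//; [|exact: bmf_cst|by apply: bmfZ; exact: bmf_id].
rewrite rintZ//; last exact: bmf_id.
by rewrite rhox mulr0 addr0 -[RHS]rho1; apply: zint_ext => // x _; rewrite mulr1.
Qed.

Definition Gpol m : {poly R} := alpha^-1 *: ('X + kconv N r m).
Definition Gfun x : R := alpha^-1 * (x + kconv_lim N r x).
Definition Gbd : R := alpha^-1 * (1 + kbound N r).

Lemma Gpol_cvg x : -1 < x < 1 -> (Gpol m).[x] @[m --> \oo] --> Gfun x.
Proof.
move=> hx; rewrite (_ : (fun m => (Gpol m).[x]) = fun m => alpha^-1 * (x + (kconv N r m).[x])).
  apply: cvgM; first exact: cvg_cst; apply: cvgD; first exact: cvg_cst.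
  exact (kconv_limP hN zI_r hx).
by apply/funext => m; rewrite !hornerE.
Qed.

Lemma Gpol_bound m x : -1 < x < 1 -> `|(Gpol m).[x]| <= Gbd.
Proof.
move=> hx; rewrite hornerZ normrM gtr0_norm ?invr_gt0// ler_wpM2l ?invr_ge0 ?(ltW a0)//.
rewrite hornerD hornerX (le_trans (ler_normD _ _))// lerD ?kconv_bound//; last exact: zI_r.
by rewrite ler_norml; exact: oo_cc.
Qed.

Lemma bmf_V : bmf (kconv_lim N r).
Proof.
split; first exact (measurable_kconv_lim hN zI_r).
by exists (kbound N r) => x; exact (@kconv_lim_bound R N hN _ zI_r x).
Qed.

Lemma bmf_G : bmf Gfun.
Proof. by apply: bmfZ; apply: bmfD; [exact: bmf_id|exact: bmf_V]. Qed.

Lemma zhat_r0 : zhat N r 0 = W.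
Proof. by rewrite -zint_r; apply: zint_ext => // x _; rewrite zonal0 hornerC mulr1. Qed.

Lemma zhat_rS k : zhat N r k.+1 = alpha * paneitz_eig N k.+1 * zhat N u k.+1 / (N.-1)`!%:R.
Proof. by rewrite EL mul0r subr0 mulrC mulKf// pnatr_eq0 -lt0n fact_gt0. Qed.

(** By [zint_divX_zonal] the right side is the coefficient of (1 - x^2) u' in the weak sense. The
    Euler-Lagrange equation turns the coefficients of [r] into eigenvalues times those of u, and
    [zquotI_pe] cancels the eigenvalues. *)
Lemma zhat_Gfun j : zhat N Gfun j = (j%:R + n) * A j * zhat N u j.+1 - (j%:R - 1) * B j * zhat N u j.-1.
Proof.
have W0 := @zW_gt0 R N hN.
have F0 : (N.-1)`!%:R != 0 :> R by rewrite pnatr_eq0 -lt0n fact_gt0.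
have zV := zI_kconv_lim hN zI_r; have zX : zI (fun x : R => x) by exact (bmf_zI hN bmf_id).
rewrite zhatZ//; last exact: zID.
rewrite zhatD// zhat_kconv_lim//; last exact: zI_r.
have -> : zhat N (fun x : R => x) j = phat N 'X j.
  by rewrite -zhat_horner//; apply: zint_ext => // x _; rewrite hornerX.
have up : A j * zquotI N j * zhat N r j.+1 = alpha * W * ((j%:R + n) * A j * zhat N u j.+1).
  rewrite zhat_rS; apply: (mulIf F0); rewrite mulrA mulfVK//.
  transitivity (A j * alpha * zhat N u j.+1 * (zquotI N j * paneitz_eig N j.+1)); first ring.
  by rewrite zquotI_pe//; ring.
rewrite up -['X]mulr1 -(@zonal0 R N) phatX// !phat_zonal//.
case: j {up} => [|[|j]].
- by rewrite downc_def !mul0r !mulr0 !mul0r add0r !subr0; field; rewrite (gt_eqF a0) gt_eqF.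
(* In degree 1 the mass W of [r], which the Euler-Lagrange equation does not express through u, is
   cancelled by the summand x of G. *)
- rewrite /= !mulr0 add0r zquotI0// zhat_r0 znorm0//.
  by field; rewrite (gt_eqF a0) gt_eqF.
- have -> : B j.+2 * zquotI N j.+1 * zhat N r j.+1 = alpha * W * (j.+1%:R * B j.+2 * zhat N u j.+1).
    rewrite zhat_rS; apply: (mulIf F0); rewrite mulrA mulfVK//.
    transitivity (B j.+2 * alpha * zhat N u j.+1 * (zquotI N j.+1 * paneitz_eig N j.+1)); first ring.
    by rewrite zquotI_pe'//; ring.
  rewrite /= !mulr0 !add0r -[j.+2%:R]natr1 addrK.
  by field; rewrite (gt_eqF a0) gt_eqF.
Qed.

Local Notation U := (limprim Gpol).

Lemma mG : measurable_fun I Gfun.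
Proof. by have [] := bmf_G. Qed.

(** u and U have the same weak derivative, so the coefficients of u - U obey a homogeneous recursion
    of step two. Its lower term vanishes for j = 0 and j = 1, which starts both parities, and only
    the constant mode survives. *)
Lemma u_ae_limprim : exists kap : R, {ae mu, forall x, I x -> u x = U x + kap}.
Proof.
have W0 := @zW_gt0 R N hN; have n3 := @ge3 R N hN.
have zU : zI U by exact (zI_limprim hN Gpol_cvg Gpol_bound).
pose d x := u x - U x.
have zd : zI d by exact: zIB.
have rec j : (j%:R + n) * A j * zhat N d j.+1 = (j%:R - 1) * B j * zhat N d j.-1.
  apply/eqP; rewrite -subr_eq0 -zint_divX_zonal//; apply/eqP.
  have e1 := zint_divX_zonal j zu; rewrite -zhat_Gfun in e1.
  have e2 := zint_limprim_id hN Gpol_cvg Gpol_bound mG (c j).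
  have z1 (f : R -> R) : zI f -> zI (fun x => f x * (n * x * (c j).[x] - (1 - x ^+ 2) * ((c j)^`()).[x])).
    move=> hf; apply: zI_ext (zI_mulpr (n%:P * 'X * c j - (1 - 'X ^+ 2) * (c j)^`()) hf) => x _.
    by rewrite !(hornerD, hornerN, hornerM, hornerC, hornerX, horner_exp).
  have zGc : zI (fun x => Gfun x * (c j).[x]).
    by apply: zI_mulpr; exact (bmf_zI hN bmf_G).
  rewrite zintB// in e2; last exact: z1.
  transitivity (zint N (fun x => u x * (n * x * (c j).[x] - (1 - x ^+ 2) * ((c j)^`()).[x]) -
     U x * (n * x * (c j).[x] - (1 - x ^+ 2) * ((c j)^`()).[x]))).
    by apply: zint_ext => // x _; rewrite /d; ring.
  rewrite zintB//; [|exact: z1..].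
  by rewrite e1; move/eqP: e2; rewrite subr_eq0 => /eqP ->; rewrite subrr.
have d0 k : zhat N d k.+1 = 0.
  elim/ltn_ind: k => k IH.
  have /eqP := rec k; rewrite (_ : _ * zhat N d k.-1 = 0); last first.
    case: k IH => [|[|k]] IH; first by rewrite downc_def !mul0r mulr0 mul0r.
      by rewrite subrr !mul0r.
    by rewrite IH// mulr0.
  rewrite mulf_eq0 gt_eqF ?orFb; first by move/eqP.
  by rewrite mulr_gt0 ?upc_gt0// ltr_wpDl//; lra.
pose kap := zhat N d 0 / W.
have zk : zI (fun=> - kap) by exact: zI_cst.
have := @zhat_eq0_ae R N hN (fun x => d x + - kap) (zID zd zk).
have hk k : zhat N (fun x => d x + - kap) k = 0.
  rewrite zhatD//.
  have -> : zhat N (fun=> - kap) k = - kap * zint N (horner (c k)).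
    by rewrite -zintZ//; exact: zI_poly.
  rewrite zint_zonal//; case: k => [|k]; last by rewrite d0 mulr0 addr0.
  by rewrite /kap/= mulNr mulfVK ?subrr// gt_eqF.
move=> /(_ hk) h; exists kap.
apply: (@filterS _ _ (ae_filter_ringOfSetsType mu) _ _ _ h) => x hx Ix.
by have := hx Ix; rewrite /d => /eqP; rewrite subr_eq0 subr_eq => /eqP ->; rewrite addrC.
Qed.

Lemma kazdan_warner p :
  zint N (fun x => rho x * (n * (Gfun x - x) * p.[x] + (1 - x ^+ 2) * (p^`()).[x])) = 0.
Proof.
have [kap hk] := u_ae_limprim.
have zU : zI U by exact (zI_limprim hN Gpol_cvg Gpol_bound).
have mU := zI_mf zU; have mr := zI_mf zrho.
have mE : measurable_fun I (fun x => expR (n * U x)).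
  by apply: measurableT_comp => //; apply: measurable_funM.
pose C' := C * expR (n * kap).
have C'0 : 0 < C' by rewrite mulr_gt0// expR_gt0.
have ae1 : {ae mu, forall x, I x -> rho x = C' * expR (n * U x)}.
  apply: (@filterS _ _ (ae_filter_ringOfSetsType mu) _ _ _ hk) => x hx Ix.
  by rewrite rhoE hx// mulrDr expRD /C'; ring.
have ae2 : {ae mu, forall x, I x -> C'^-1 * rho x = expR (n * U x)}.
  apply: (@filterS _ _ (ae_filter_ringOfSetsType mu) _ _ _ ae1) => x hx Ix.
  by rewrite hx// mulKf// gt_eqF.
have zE : zI (fun x => expR (n * U x)) by exact: zI_ae_ext mE ae2 (zIZ _ zrho).
have e := zint_limprim_exp hN Gpol_cvg Gpol_bound mG p zE.
have b : bmf (fun x => n * (Gfun x - x) * p.[x] + (1 - x ^+ 2) * (p^`()).[x]).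
  apply: bmfD; apply: bmfM; try exact: bmf_poly.
    by apply: bmfZ; apply: bmfB; [exact: bmf_G|exact: bmf_id].
  by apply: bmfB; [exact: bmf_cst|apply: bmf_exp2; exact: bmf_id].
have zb : zI (fun x => expR (n * U x) * (n * (Gfun x - x) * p.[x] + (1 - x ^+ 2) * (p^`()).[x])).
  exact: zI_bmf zE b.
have [mb _] := b.
transitivity (zint N (fun x => C' * (expR (n * U x) * (n * (Gfun x - x) * p.[x] + (1 - x ^+ 2) * (p^`()).[x])))); last first.
  by rewrite zintZ// e mulr0.
apply: zint_ae_ext.
- exact: measurable_funM.
- by apply: measurable_funM => //; exact: zI_mf zb.
- apply: (@filterS _ _ (ae_filter_ringOfSetsType mu) _ _ _ ae1) => x hx Ix.
  by rewrite hx// mulrA.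
Qed.

Definition rmom2 : R := zint N (fun x => rho x * x ^+ 2).
Local Notation T := rmom2.
Local Notation D := ((W - T) / n).

Lemma rho_gt0 x : 0 < rho x.
Proof. by rewrite rhoE mulr_gt0// expR_gt0. Qed.

Lemma rint_poly_gt0 p : p != 0 -> (forall x, -1 < x < 1 -> 0 <= p.[x]) ->
  0 < zint N (fun x => rho x * p.[x]).
Proof.
move=> p0 hp; apply: zint_gt0 => //; first exact: zI_mulpr.
  by move=> x hx; rewrite mulr_ge0 ?hp// ltW// rho_gt0.
apply: (@filterS _ _ (ae_filter_ringOfSetsType mu) _ _ _ (poly_ae_neq0 p0)) => x hx Ix.
by rewrite mulf_neq0 ?hx// gt_eqF// rho_gt0.
Qed.

Lemma bX2 : bmf (fun x : R => x ^+ 2).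
Proof. by apply: bmf_exp2; exact: bmf_id. Qed.

Lemma rmom2_gt0 : 0 < T.
Proof.
have := @rint_poly_gt0 ('X ^+ 2); rewrite -size_poly_eq0 size_polyXn => /(_ isT).
under eq_fun do rewrite hornerXn.
by move=> h; apply: h => x _; rewrite hornerXn sqr_ge0.
Qed.

Lemma rmom2_ltW : T < W.
Proof.
have := @rint_poly_gt0 (1 - 'X ^+ 2).
have -> : 1 - 'X ^+ 2 != 0 :> {poly R} by exact: one_subX2_neq0.
move=> /(_ isT); under eq_fun do rewrite !(hornerD, hornerN, hornerC, hornerXn).
move=> h; have {h} : 0 < zint N (fun x => rho x * (1 - x ^+ 2)).
  by apply: h => x /onem_sq_gt0; rewrite !(hornerD, hornerN, hornerC, hornerXn); exact: ltW.
rewrite rintB//; [|exact: bmf_cst|exact: bX2].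
rewrite -/T subr_gt0; congr (_ < _); rewrite -rho1.
by apply: zint_ext => // x _; rewrite mulr1.
Qed.

Lemma rint_G : zint N (fun x => rho x * Gfun x) = 0.
Proof.
have n3 := @ge3 R N hN.
have := kazdan_warner 1.
have -> : (fun x => rho x * (n * (Gfun x - x) * (1 : {poly R}).[x] + (1 - x ^+ 2) * (1^`()).[x]))
   = (fun x => rho x * (n * (Gfun x - x))).
  by apply/funext => x; rewrite -polyC1 derivC !hornerC mulr1 mulr0 addr0.
rewrite rintZ//; last by apply: bmfB; [exact: bmf_G|exact: bmf_id].
rewrite rintB//; [|exact: bmf_G|exact: bmf_id].
rewrite rhox subr0 => /eqP; rewrite mulf_eq0 gt_eqF ?orFb; last lra.
by move/eqP.
Qed.

Lemma rint_Gx : zint N (fun x => rho x * (Gfun x * x)) = T - D.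
Proof.
have n3 := @ge3 R N hN.
have := kazdan_warner 'X.
have -> : (fun x => rho x * (n * (Gfun x - x) * 'X.[x] + (1 - x ^+ 2) * (deriv 'X).[x]))
   = (fun x => rho x * (n * (Gfun x * x) + (1 - (n + 1) * x ^+ 2))).
  by apply/funext => x; rewrite derivX hornerX hornerC; ring.
have b1 : bmf (fun x => Gfun x * x) by apply: bmfM; [exact: bmf_G|exact: bmf_id].
have b2 : bmf (fun x : R => 1 - (n + 1) * x ^+ 2).
  by apply: bmfB; [exact: bmf_cst|apply: bmfZ; exact: bX2].
rewrite rintD//; last exact: bmfZ.
rewrite rintZ// rintB//; [|exact: bmf_cst|by apply: bmfZ; exact: bX2].
rewrite rintZ//; last exact: bX2.
have -> : zint N (fun x => rho x * 1) = W.
  by rewrite -rho1; apply: zint_ext => // x _; rewrite mulr1.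
rewrite -/T => h; apply: (@mulfI _ n); first by rewrite gt_eqF//; lra.
have -> : n * (T - (W - T) / n) = n * T - (W - T) by field; rewrite gt_eqF//; lra.
by lra.
Qed.

(** The integral of r G is computed twice. By Kazdan-Warner it is lam (T - D); by G = (x + V) /
    alpha and antisymmetry, alpha times it is lam T. As alpha <= 1 and D > 0, the factor alpha (T -
    D) - T is negative, so lam vanishes. *)
Lemma multiplier_eq0 : lam = 0.
Proof.
have /andP[a1 a2] := ha; have T0 := rmom2_gt0; have TW := rmom2_ltW.
have n3 := @ge3 R N hN; have D0 : 0 < D by rewrite divr_gt0 ?subr_gt0//; lra.
have bG := bmf_G; have bx := @bmf_id R; have bl := bmfZ lam bx.
have e1 : zint N (fun x => r x * Gfun x) = lam * (T - D).
  transitivity (zint N (fun x => rho x * (Gfun x + lam * (Gfun x * x)))).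
    by apply: zint_ext => // x _; ring.
  have b1 : bmf (fun x => Gfun x * x) by exact: bmfM.
  rewrite rintD//; last exact: bmfZ.
  by rewrite rint_G add0r rintZ// rint_Gx.
have e2 : alpha * zint N (fun x => r x * Gfun x) = lam * T.
  rewrite -zintZ; last exact (zI_bmf zI_r bG).
  transitivity (zint N (fun x => rho x * (x + lam * x ^+ 2) + r x * kconv_lim N r x)).
    by apply: zint_ext => // x _; rewrite /Gfun; field; rewrite gt_eqF.
  rewrite zintD; first last.
  - exact (zI_bmf zI_r bmf_V).
  - by apply: zI_bmf => //; apply: bmfD => //; apply: bmfZ; exact: bX2.
  have -> : zint N (fun x => r x * kconv_lim N r x) = 0 by exact (zint_r_kconv_lim hN zI_r).
  rewrite addr0 rintD//; last by apply: bmfZ; exact: bX2.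
  by rewrite rhox add0r rintZ//; exact: bX2.
have /eqP : lam * (alpha * (T - D) - T) = 0 by rewrite mulrBr -e2 e1; ring.
rewrite mulf_eq0 => /orP[/eqP//|/eqP h].
have : alpha * D > 0 by rewrite mulr_gt0.
nra.
Qed.

End EulerLagrange.

(** * Double integrals against rho and an upper bound for the integral of x rho V *)

Section DoubleIntegral.
Context {R : realType}.
Variable N : nat.
Hypothesis hN : (3 <= N)%N.
Implicit Types (p q : {poly R}) (P Q : {poly {poly R}}) (x y t a b : R) (k j m : nat).
Local Notation n := (N%:R : R).
Local Notation mu := (@lebesgue_measure R).
Local Notation I := (`](-1)%R, 1%R[%classic : set R).
Local Notation c := (@zonal R N).
Local Notation zI := (@zI R N).
Local Notation W := (@zW R N).

(** Bivariate polynomials, with y as the outer variable and x as the inner one. Double integrals are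
    taken of these only and as iterated integrals, so that no product measure enters. *)
Definition bival P x y : R := (P.[y%:P]).[x].
Definition tens q p : {poly {poly R}} := locked (q%:P * p^:P).

Lemma tensE q p : tens q p = q%:P * p^:P.
Proof. by rewrite /tens -lock. Qed.

Local Notation X1 := ('X%:P : {poly {poly R}}).
Local Notation X2 := ('X : {poly {poly R}}).

Lemma bivalD P Q x y : bival (P + Q) x y = bival P x y + bival Q x y.
Proof. by rewrite /bival !hornerD. Qed.
Lemma bivalN P x y : bival (- P) x y = - bival P x y.
Proof. by rewrite /bival !hornerN. Qed.
Lemma bivalM P Q x y : bival (P * Q) x y = bival P x y * bival Q x y.
Proof. by rewrite /bival !hornerM. Qed.
Lemma bivalC a x y : bival a%:P%:P x y = a.
Proof. by rewrite /bival !hornerC. Qed.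
Lemma bivalX1 x y : bival X1 x y = x.
Proof. by rewrite /bival hornerC hornerX. Qed.
Lemma bivalX2 x y : bival X2 x y = y.
Proof. by rewrite /bival hornerX hornerC. Qed.
Lemma bival_tens q p x y : bival (tens q p) x y = q.[x] * p.[y].
Proof. by rewrite tensE bivalM /bival hornerC horner_map /= hornerC. Qed.
Lemma bival_exp P x y k : bival (P ^+ k) x y = bival P x y ^+ k.
Proof. by rewrite /bival !horner_exp. Qed.
Definition bivalE := (bivalD, bivalN, bivalM, bivalC, bivalX1, bivalX2, bival_exp).

Lemma bival_sum m (F : nat -> {poly {poly R}}) x y :
  bival (\sum_(i < m) F i) x y = \sum_(i < m) bival (F i) x y.
Proof. by rewrite /bival !horner_sum. Qed.

Lemma bival_poly2 P x : exists p, forall y, bival P x y = p.[y].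
Proof.
exists (map_poly (horner_eval x) P) => y.
have e : y = horner_eval x y%:P by rewrite /horner_eval hornerC.
by rewrite {2}e horner_map.
Qed.

Variable rho : R -> R.
Hypothesis zrho : zI rho.

Definition bint P x : R := zint N (fun y => rho y * bival P x y).
Definition dint P : R := zint N (fun x => rho x * bint P x).

Lemma zI_bival P x : zI (fun y => rho y * bival P x y).
Proof. by have [p hp] := bival_poly2 P x; apply: zI_ext (zI_mulpr p zrho) => y _; rewrite hp. Qed.

Lemma bintD P Q x : bint (P + Q) x = bint P x + bint Q x.
Proof.
rewrite /bint -zintD; [|exact: zI_bival..].
by apply: zint_ext => // y _; rewrite bivalD mulrDr.
Qed.

Lemma bintZ a P x : bint (a%:P%:P * P) x = a * bint P x.
Proof.
rewrite /bint -zintZ; last exact: zI_bival.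
by apply: zint_ext => // y _; rewrite bivalM bivalC mulrCA.
Qed.

Lemma bint_poly P : exists p, forall x, bint P x = p.[x].
Proof.
exists (\sum_(i < size P) zint N (fun y => rho y * y ^+ i) *: P`_i) => x.
have h i : zI (fun y => rho y * y ^+ i).
  by apply: zI_ext (zI_mulpr 'X^i zrho) => y _; rewrite hornerXn.
rewrite horner_sum; under eq_bigr do rewrite hornerZ mulrC -zintZ//.
rewrite -zint_sum//; last by move=> i; exact: zIZ.
rewrite /bint; apply: zint_ext => // y _; rewrite /bival (horner_coef P) horner_sum mulr_sumr.
by apply: eq_bigr => i _; rewrite hornerM -polyC_exp hornerC; ring.
Qed.

Lemma zI_bint P : zI (fun x => rho x * bint P x).
Proof. by have [p hp] := bint_poly P; apply: zI_ext (zI_mulpr p zrho) => y _; rewrite hp. Qed.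

Lemma dintD P Q : dint (P + Q) = dint P + dint Q.
Proof.
rewrite /dint -zintD; [|exact: zI_bint..].
by apply: zint_ext => // x _; rewrite bintD mulrDr.
Qed.

Lemma dintZ a P : dint (a%:P%:P * P) = a * dint P.
Proof.
rewrite /dint -zintZ; last exact: zI_bint.
by apply: zint_ext => // x _; rewrite bintZ mulrCA.
Qed.

Lemma dintN P : dint (- P) = - dint P.
Proof. by rewrite -mulN1r -[in RHS]mulN1r -dintZ !polyCN. Qed.

Lemma dint0 : dint 0 = 0.
Proof. by rewrite -[0 in LHS](mul0r 0) -{1}polyC0 -{1}polyC0 dintZ mul0r. Qed.

Lemma dint_sum m (F : nat -> {poly {poly R}}) :
  dint (\sum_(i < m) F i) = \sum_(i < m) dint (F i).
Proof. by elim: m => [|m IH]; rewrite ?big_ord0 ?dint0// !big_ord_recr /= dintD IH. Qed.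

Lemma dint_tens q p : dint (tens q p) = zint N (fun x => rho x * q.[x]) * zint N (fun x => rho x * p.[x]).
Proof.
have h r : zI (fun x => rho x * r.[x]) by exact: zI_mulpr.
rewrite mulrC -zintZ//; apply: zint_ext => // x _.
rewrite mulrCA; congr (_ * _); rewrite mulrC -zintZ//; apply: zint_ext => // y _.
by rewrite bival_tens mulrCA.
Qed.

Hypothesis rho_ge0 : forall x, 0 < rho x.

Lemma dint_le P Q : (forall x y, -1 < x < 1 -> -1 < y < 1 -> bival P x y <= bival Q x y) ->
  dint P <= dint Q.
Proof.
move=> h; apply: zint_le => //; try exact: zI_bint.
move=> x hx; rewrite ler_wpM2l ?(ltW (rho_ge0 x))//.
apply: zint_le => //; try exact: zI_bival.
by move=> y hy; rewrite ler_wpM2l ?(ltW (rho_ge0 y))// h.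
Qed.

Lemma dint_gt0 P : (forall x, -1 < x < 1 -> 0 < bint P x) -> 0 < dint P.
Proof.
move=> h; apply: zint_gt0 => //; first exact: zI_bint.
  by move=> x hx; rewrite mulr_ge0 ?(ltW (h x hx)) ?(ltW (rho_ge0 x)).
by apply: aeW => x; rewrite mem_I => hx; rewrite gt_eqF// mulr_gt0 ?h.
Qed.

Definition zkernel p : {poly {poly R}} :=
  \sum_(k < size p) (phat N p k / znorm N k)%:P%:P * tens (c k) (c k).

Lemma bival_zkernel p x y : bival (zkernel p) x y = (ztrans N y p).[x].
Proof.
rewrite {2}(zonal_expand hN (leqnn (size p))) ztrans_sum horner_sum.
rewrite (@bival_sum _ (fun k => (phat N p k / znorm N k)%:P%:P * tens (c k) (c k))).
apply: eq_bigr => k _; rewrite bivalM bivalC bival_tens (ztransZ N y) ztrans_zonal// !hornerZ.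
by rewrite [(c k).[x] * _]mulrC.
Qed.

Lemma X1_tens q p : X1 * tens q p = tens ('X * q) p.
Proof. by rewrite !tensE polyCM mulrA. Qed.

Lemma X2_tens q p : X2 * tens q p = tens q ('X * p).
Proof. by rewrite !tensE rmorphM /= map_polyX mulrCA. Qed.

Lemma dint_sq_zkernel p : dint ((X1 - X2) ^+ 2 * zkernel p) =
  2 * \sum_(k < size p) phat N p k / znorm N k *
    (zhat N (fun x => x ^+ 2 * rho x) k * zhat N rho k - zhat N (fun x => x * rho x) k ^+ 2).
Proof.
rewrite mulr_sumr (@dint_sum _ (fun k => (X1 - X2) ^+ 2 * ((phat N p k / znorm N k)%:P%:P * tens (c k) (c k)))).
rewrite mulr_sumr; apply: eq_bigr => k _; rewrite mulrCA dintZ mulrCA; congr (_ * _).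
have -> : (X1 - X2) ^+ 2 * tens (c k) (c k) =
    tens ('X * ('X * c k)) (c k) - 2%:P%:P * tens ('X * c k) ('X * c k) + tens (c k) ('X * ('X * c k)).
  rewrite -!X1_tens -!X2_tens; set t := tens _ _.
  have -> : (2%:P%:P : {poly {poly R}}) = 1 + 1 by rewrite !polyCD !polyC1.
  ring.
rewrite !dintD dintN dintZ !dint_tens.
have -> : zint N (fun x => rho x * ('X * ('X * c k)).[x]) = zhat N (fun x => x ^+ 2 * rho x) k.
  by apply: zint_ext => // x _; rewrite !hornerM !hornerX; ring.
have -> : zint N (fun x => rho x * ('X * c k).[x]) = zhat N (fun x => x * rho x) k.
  by apply: zint_ext => // x _; rewrite !hornerM !hornerX; ring.
by rewrite -/(zhat N rho k); ring.
Qed.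

Lemma size_geom2 m : (size (geom2 m : {poly R}) <= m.*2)%N.
Proof.
by apply: (leq_trans (size_sum _ _ _)); apply/bigmax_leqP => i _; rewrite size_polyXn.
Qed.

(** Symmetrizing x (y - x) in x and y gives - (x - y)^2 / 2. The two sides are matched through their
    expansions in zonal coefficients instead of by exchanging integrals. *)
Lemma zint_x_kconv m : zint N (fun x => x * rho x * (kconv N rho m).[x]) =
  - (2 * W)^-1 * dint ((X1 - X2) ^+ 2 * zkernel (geom2 m)).
Proof.
have W0 := @zW_gt0 R N hN.
rewrite zint_mul_kconv//; last exact: zI_mulx.
rewrite dint_sq_zkernel.
have <- : \sum_(k < m.*2) phat N (geom2 m) k / znorm N k *
    (zhat N (fun x => x ^+ 2 * rho x) k * zhat N rho k - zhat N (fun x => x * rho x) k ^+ 2)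
  = \sum_(k < size (geom2 m : {poly R})) phat N (geom2 m) k / znorm N k *
    (zhat N (fun x => x ^+ 2 * rho x) k * zhat N rho k - zhat N (fun x => x * rho x) k ^+ 2).
  rewrite (big_ord_widen _ (fun k => phat N (geom2 m) k / znorm N k *
    (zhat N (fun x => x ^+ 2 * rho x) k * zhat N rho k - zhat N (fun x => x * rho x) k ^+ 2)) (size_geom2 m)).
  rewrite [RHS]big_mkcond /=; apply: eq_bigr => k _; case: ltnP => // h.
  by rewrite phat_big// !mul0r.
rewrite mulrA (_ : - (2 * W)^-1 * 2 = - W^-1); last by field; rewrite gt_eqF.
rewrite mulNr -mulrN; congr (_ * _); rewrite -sumrN; apply: eq_bigr => k _; rewrite -/(kcoef N m k).
have -> : zhat N (fun x => x * (x * rho x)) k = zhat N (fun x => x ^+ 2 * rho x) k.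
  by apply: zint_ext => // x _; rewrite mulrA.
ring.
Qed.

Lemma indic_neqN x y : \1_(~` [set - x] : set R) y = (y + x != 0)%R%:R :> R.
Proof.
rewrite indicE addr_eq0; have [->|/eqP h] := eqVneq y (- x); last by rewrite mem_set.
by rewrite memNset//= => h; exact: h.
Qed.

(** The error term of [kern_lower]. Even powers of s average to 0 in the limit unless |x| = |y|; the
    factor (x - y)^2 disposes of y = x, and for each x the single point y = - x is discarded by the
    indicator in [f]. *)
Lemma dint_sq_pow_cvg0 : dint ((X1 - X2) ^+ 2 * zkernel 'X^(m.*2)) @[m --> \oo] --> (0 : R).
Proof.
pose P m := (X1 - X2) ^+ 2 * zkernel 'X^(m.*2).
have PE m x y : bival (P m) x y = (x - y) ^+ 2 * (powavg N y m.*2).[x].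
  by rewrite bivalM !bivalE bival_zkernel ztransXn.
have Pb m x y : -1 < x < 1 -> -1 < y < 1 -> `|bival (P m) x y| <= 4.
  move=> hx hy; have hx' := oo_cc hx; have hy' := oo_cc hy.
  have h1 := @powavg_even_ge0 R N hN x y m hx' hy'; have h2 := @powavg_even_le1 R N hN x y m hx' hy'.
  rewrite PE (ger0_norm (mulr_ge0 (sqr_ge0 _) h1)).
  move/andP: hx => [? ?]; move/andP: hy => [? ?].
  by apply: (le_trans (ler_piMr (sqr_ge0 _) h2)); nra.
have inner x : -1 < x < 1 -> bint (P m) x @[m --> \oo] --> (0 : R).
  move=> hx.
  pose f m y := (y + x != 0)%R%:R * (rho y * bival (P m) x y).
  have zf m : bint (P m) x = zint N (f m).
    have zz := zI_mf (zI_bival (P m) x).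
    have hp : 'X + x%:P != 0 :> {poly R} by rewrite -size_poly_eq0 size_XaddC.
    apply: zint_ae_ext => //.
      apply: measurable_funM => //.
      apply: (@eq_measurable_fun _ _ _ _ _ (\1_(~` [set - x] : set R) : R -> R)).
        by move=> y _; exact: indic_neqN.
      by apply: measurable_indic; apply: measurableC; exact: measurable_set1.
    apply: (@filterS _ _ (ae_filter_ringOfSetsType mu) _ _ _ (poly_ae_neq0 hp)) => y hy Iy.
    by have := hy Iy; rewrite hornerD hornerX hornerC /f => ->; rewrite mul1r.
  rewrite (funext zf) -(zint0 hN).
  have f1 m : measurable_fun I (f m).
    apply: measurable_funM; last exact: zI_mf (zI_bival (P m) x).
    apply: (@eq_measurable_fun _ _ _ _ _ (\1_(~` [set - x] : set R) : R -> R)).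
      by move=> y _; exact: indic_neqN.
    by apply: measurable_indic; apply: measurableC; exact: measurable_set1.
  have f2 y : -1 < y < 1 -> f ^~ y @ \oo --> (0 : R).
    move=> hy; have [e|ne] := eqVneq (y + x) 0.
      by rewrite (_ : f^~ y = fun=> 0); [exact: cvg_cst|apply/funext => m; rewrite /f e eqxx mul0r].
    have [e|ne2] := eqVneq x y.
      rewrite (_ : f^~ y = fun=> 0); first exact: cvg_cst.
      by apply/funext => m; rewrite /f PE e subrr expr0n /= !(mul0r, mulr0).
    have hxy : `|x| != `|y|.
      by rewrite eqr_norm2 negb_or ne2 /= -addr_eq0 addrC.
    have h := @powavg_even_cvg0 R N hN x y (oo_cc hx) (oo_cc hy) hxy.
    rewrite (_ : f^~ y = fun m => rho y * (x - y) ^+ 2 * (powavg N y m.*2).[x]).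
      by rewrite -[X in _ --> X](mulr0 (rho y * (x - y) ^+ 2)); apply: cvgM => //; exact: cvg_cst.
    by apply/funext => m; rewrite /f PE ne mul1r mulrA.
  have f3 m y : -1 < y < 1 -> `|f m y| <= 4 * rho y.
    move=> hy; rewrite !normrM (ger0_norm (ltW (rho_ge0 y))).
    have h1 : `|(y + x != 0)%R%:R| <= 1 :> R by case: (y + x != 0); rewrite ?normr1 ?normr0.
    have := Pb m x y hx hy; have := rho_ge0 y.
    move: `|_| h1 (normr_ge0 ((y + x != 0)%R%:R : R)) => s s1 s0.
    move: (normr_ge0 (bival (P m) x y)); move: `|_| (rho y) => b r b0 r0 b4.
    have h3 : s * (r * b) <= r * b by apply: ler_piMl => //; rewrite mulr_ge0// ltW.
    by apply: le_trans h3 _; rewrite mulrC ler_wpM2r// ltW.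
  by have [] := zint_dct f1 f2 (zIZ 4 zrho) f3.
have f1 m : measurable_fun I (fun x => rho x * bint (P m) x) by exact: zI_mf (zI_bint (P m)).
have f2 x : -1 < x < 1 -> rho x * bint (P m) x @[m --> \oo] --> (0 : R).
  by move=> hx; rewrite -[X in _ --> X](mulr0 (rho x)); apply: cvgM; [exact: cvg_cst|exact: inner].
have f3 m x : -1 < x < 1 -> `|rho x * bint (P m) x| <= 4 * zint N rho * rho x.
  move=> hx; rewrite normrM (ger0_norm (ltW (rho_ge0 x))) mulrC ler_wpM2r ?(ltW (rho_ge0 x))//.
  have zb := zI_bival (P m) x.
  apply: (le_trans (zint_norm hN zb)); rewrite -zintZ//; apply: zint_le => //; first exact: zI_norm.
    exact: zIZ.
  move=> y hy; rewrite normrM (ger0_norm (ltW (rho_ge0 y))) mulrC ler_wpM2r ?(ltW (rho_ge0 y))//.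
  exact: Pb.
by have [_] := zint_dct f1 f2 (zIZ _ zrho) f3; rewrite (zint0 hN).
Qed.

Lemma bival1 x y : bival 1 x y = 1.
Proof. by rewrite -!polyC1 bivalC. Qed.

Definition quadQ2 a : {poly {poly R}} := (2 * a)%:P%:P - (a ^+ 2)%:P%:P * (1 - X1 * X2)
  + (2^-1)%:P%:P * (1 - a%:P%:P * (1 - X1 * X2)) ^+ 2.

Lemma bival_quadQ2 a x y : bival (quadQ2 a) x y = (quadQ a).[x * y].
Proof. by rewrite horner_quadQ /quadQ2 !(bivalE, bival1); ring. Qed.

Lemma dint_kernel_lower a m : 0 <= a ->
  dint ((X1 - X2) ^+ 2 * quadQ2 a)
    - (2 * a + (1 + 2 * a) ^+ 2) * dint ((X1 - X2) ^+ 2 * zkernel 'X^(m.*2))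
  <= dint ((X1 - X2) ^+ 2 * zkernel (geom2 m)).
Proof.
move=> a0; rewrite -dintZ -dintN -dintD; apply: dint_le => x y hx hy.
have := kern_lower hN m a0 (oo_cc hx) (oo_cc hy); rewrite /kern => h.
rewrite bivalD bivalN !bivalM bivalC bival_quadQ2 !bival_zkernel ztransXn !(bivalE).
by have := ler_wpM2l (sqr_ge0 (x - y)) h; lra.
Qed.

Variable T : R.
Hypothesis rho1 : zint N rho = W.
Hypothesis rhox : zint N (fun x => rho x * x) = 0.
Hypothesis rhox2 : zint N (fun x => rho x * x ^+ 2) = T.

(** Moments of rho up to order 2 suffice for the explicit part, because each third moment comes
    multiplied by the first one, which is 0. The square is set aside as a positive term. *)
Lemma dint_quadQ2 a : dint ((X1 - X2) ^+ 2 * quadQ2 a) =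
  (2 * a - a ^+ 2) * (2 * T * W) - a ^+ 2 * (2 * T ^+ 2)
  + 2^-1 * dint ((X1 - X2) ^+ 2 * (1 - a%:P%:P * (1 - X1 * X2)) ^+ 2).
Proof.
pose c2 := (2 : R)%:P%:P : {poly {poly R}}.
have c2E : c2 = 1 + 1 by rewrite /c2 !polyCD !polyC1.
have -> : (X1 - X2) ^+ 2 * quadQ2 a =
  (2 * a - a ^+ 2)%:P%:P * (tens ('X * 'X) 1 - c2 * tens 'X 'X + tens 1 ('X * 'X))
  + ((a ^+ 2)%:P%:P * (tens ('X * ('X * 'X)) 'X - c2 * tens ('X * 'X) ('X * 'X) + tens 'X ('X * ('X * 'X)))
  + (2^-1)%:P%:P * ((X1 - X2) ^+ 2 * (1 - a%:P%:P * (1 - X1 * X2)) ^+ 2)).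
  rewrite !tensE !(rmorphM, map_polyX, rmorph1) /= !map_polyX /quadQ2 c2E !(polyCN, polyCD, polyCM) !polyC1.
  move: (a%:P%:P : {poly {poly R}}) X1 X2 ((2^-1)%:P%:P : {poly {poly R}}) => A x1 x2 H.
  ring.
rewrite !(dintD, dintN, dintZ, dint_tens).
have m0 : zint N (fun x => rho x * (1 : {poly R}).[x]) = W.
  by rewrite -rho1; apply: zint_ext => // x _; rewrite -polyC1 hornerC mulr1.
have m1 : zint N (fun x => rho x * 'X.[x]) = 0.
  by rewrite -rhox; apply: zint_ext => // x _; rewrite hornerX.
have m2 : zint N (fun x => rho x * ('X * 'X).[x]) = T.
  by rewrite -rhox2; apply: zint_ext => // x _; rewrite hornerM hornerX.
by rewrite m0 m1 m2; ring.
Qed.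

Lemma dint_square_gt0 a : a < 1 -> 0 < dint ((X1 - X2) ^+ 2 * (1 - a%:P%:P * (1 - X1 * X2)) ^+ 2).
Proof.
move=> a1; apply: dint_gt0 => x hx.
pose p : {poly R} := ((x%:P - 'X) * (1 - a%:P * (1 - x%:P * 'X))) ^+ 2.
rewrite /bint (@zint_ext _ _ hN _ (fun y => rho y * p.[y])); last first.
  move=> y _; congr (_ * _); rewrite !(bivalE, bival1) /p.
  by rewrite !(hornerD, hornerN, hornerM, hornerX, hornerC, horner_exp); ring.
have p0 : p != 0.
  rewrite expf_neq0// mulf_neq0//.
    by rewrite -opprB oppr_eq0 polyXsubC_eq0.
  apply/eqP => /(congr1 (horner^~ 0)).
  rewrite !(hornerD, hornerN, hornerM, hornerX, hornerC) => /eqP.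
  by rewrite mulr0 subr0 mulr1 subr_eq0 eq_sym; apply/negP; rewrite lt_eqF.
apply: zint_gt0 => //; first exact: zI_mulpr.
  by move=> y _; rewrite /p horner_exp mulr_ge0 ?sqr_ge0 ?(ltW (rho_ge0 y)).
apply: (@filterS _ _ (ae_filter_ringOfSetsType mu) _ _ _ (poly_ae_neq0 p0)) => y hy Iy.
by rewrite mulf_neq0 ?hy// gt_eqF// rho_ge0.
Qed.

Lemma zint_x_kconv_lim_lt : 0 < T -> zint N (fun x => x * rho x * kconv_lim N rho x) < - (T * W / (W + T)).
Proof.
move=> T0; have W0 := @zW_gt0 R N hN.
(* This value maximizes 2 a T W - a^2 T (W + T), half of the explicit part of [dint_quadQ2]. Being
   less than 1, it also keeps the remaining square strictly positive. *)
pose a := W / (W + T); have WT : 0 < W + T by rewrite addr_gt0.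
have a0 : 0 <= a by rewrite divr_ge0 ?ltW.
have a1 : a < 1 by rewrite /a ltr_pdivrMr// mul1r ltrDl.
have E0 := dint_square_gt0 a1.
set Q := dint ((X1 - X2) ^+ 2 * quadQ2 a).
have h := zint_kconv_lim hN zrho (zI_mulx zrho).
have h2 : - (2 * W)^-1 * (Q - (2 * a + (1 + 2 * a) ^+ 2) * dint ((X1 - X2) ^+ 2 * zkernel 'X^(m.*2)))
    @[m --> \oo] --> - (2 * W)^-1 * (Q - (2 * a + (1 + 2 * a) ^+ 2) * 0).
  apply: cvgM; first exact: cvg_cst; apply: cvgB; first exact: cvg_cst.
  by apply: cvgM; [exact: cvg_cst|exact: dint_sq_pow_cvg0].
have le : zint N (fun x => x * rho x * kconv_lim N rho x) <= - (2 * W)^-1 * (Q - (2 * a + (1 + 2 * a) ^+ 2) * 0).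
  apply: (ler_cvg_to h h2); apply: nearW => m; rewrite zint_x_kconv.
  rewrite !mulNr lerN2; apply: ler_wpM2l; last exact: dint_kernel_lower.
  by rewrite invr_ge0 mulr_ge0// ltW.
apply: le_lt_trans le _; rewrite mulr0 subr0 /Q dint_quadQ2.
set E := dint _ in E0 *.
have -> : - (2 * W)^-1 * ((2 * a - a ^+ 2) * (2 * T * W) - a ^+ 2 * (2 * T ^+ 2) + 2^-1 * E) =
   - (T * W / (W + T)) - (4 * W)^-1 * E.
  by rewrite /a; field; rewrite (gt_eqF W0) (gt_eqF WT).
by rewrite gtrBl mulr_gt0// invr_gt0 mulr_gt0.
Qed.

End DoubleIntegral.

(** * Cauchy-Schwarz inequalities and zonal partial sums *)

Section SquareIntegrals.
Context {R : realType}.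
Variable N : nat.
Hypothesis hN : (3 <= N)%N.
Implicit Types (p q : {poly R}) (x y t a b : R) (k j m : nat) (f g rho : R -> R).
Local Notation I := (`](-1)%R, 1%R[%classic : set R).
Local Notation c := (@zonal R N).
Local Notation zI := (@zI R N).

Lemma sq_le_of_quad_ge0 (X Y Z : R) : 0 <= X ->
  (forall s, 0 <= X * s ^+ 2 + 2 * Z * s + Y) -> Z ^+ 2 <= X * Y.
Proof.
rewrite le_eqVlt => /predU1P[<-|X0] h.
  have [->|Z0] := eqVneq Z 0; first by rewrite expr0n mul0r.
  have := h (- (Y + 1) / (2 * Z)); rewrite mul0r add0r.
  have -> : 2 * Z * (- (Y + 1) / (2 * Z)) = - (Y + 1) by field.
  lra.
have := h (- Z / X).
have -> : X * (- Z / X) ^+ 2 + 2 * Z * (- Z / X) + Y = Y - Z ^+ 2 / X by field; rewrite gt_eqF.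
by rewrite subr_ge0 ler_pdivrMr// mulrC.
Qed.

Lemma sum_cauchy_schwarz m (w x y : nat -> R) : (forall k, 0 <= w k) ->
  (\sum_(k < m) w k * (x k * y k)) ^+ 2 <=
  (\sum_(k < m) w k * x k ^+ 2) * (\sum_(k < m) w k * y k ^+ 2).
Proof.
move=> w0; apply: sq_le_of_quad_ge0.
  by apply: sumr_ge0 => k _; rewrite mulr_ge0 ?sqr_ge0.
move=> s; suff -> : (\sum_(k < m) w k * x k ^+ 2) * s ^+ 2 + 2 * (\sum_(k < m) w k * (x k * y k)) * s +
    (\sum_(k < m) w k * y k ^+ 2) = \sum_(k < m) w k * (s * x k + y k) ^+ 2.
  by apply: sumr_ge0 => k _; rewrite mulr_ge0 ?sqr_ge0.
rewrite mulr_suml [2 * _]mulrC !mulr_suml -!big_split /=; apply: eq_bigr => k _; ring.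
Qed.

Lemma rint_cauchy_schwarz rho f g : zI rho -> (forall x, 0 <= rho x) -> bmf f -> bmf g ->
  zint N (fun x => rho x * (f x * g x)) ^+ 2 <=
  zint N (fun x => rho x * f x ^+ 2) * zint N (fun x => rho x * g x ^+ 2).
Proof.
move=> hr r0 bf bg; apply: sq_le_of_quad_ge0.
  by apply: zint_ge0 => // x _; rewrite mulr_ge0 ?sqr_ge0.
move=> s; have bfg := bmfM bf bg; have bf2 := bmf_exp2 bf; have bg2 := bmf_exp2 bg.
have -> : zint N (fun x => rho x * f x ^+ 2) * s ^+ 2 + 2 * zint N (fun x => rho x * (f x * g x)) * s
    + zint N (fun x => rho x * g x ^+ 2) = zint N (fun x => rho x * (s * f x + g x) ^+ 2).
  transitivity (zint N (fun x => rho x * ((s ^+ 2 * f x ^+ 2 + (2 * s) * (f x * g x)) + g x ^+ 2))).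
    have b1 := bmfZ (s ^+ 2) bf2; have b2 := bmfZ (2 * s) bfg.
    rewrite !rintD// ?rintZ//; last exact: bmfD.
    by ring.
  by apply: zint_ext => // x _; ring.
by apply: zint_ge0 => // x _; rewrite mulr_ge0 ?sqr_ge0.
Qed.

Definition zpart f m : {poly R} := \sum_(k < m) (zhat N f k / znorm N k) *: c k.

Lemma size_zpart f m : (size (zpart f m) <= m)%N.
Proof.
apply: (leq_trans (size_sum _ _ _)); apply/bigmax_leqP => k _.
by apply: (leq_trans (size_scale_leq _ _)); apply: (leq_trans (size_zonal hN k)).
Qed.

Lemma phat_zpart f m k : phat N (zpart f m) k = if (k < m)%N then zhat N f k else 0.
Proof.
rewrite /zpart (phat_sum hN m (fun k => zhat N f k / znorm N k)); case: ifP => // _.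
by rewrite divfK// gt_eqF// znorm_gt0.
Qed.

Lemma zint_mul_zpart f g m : zI f -> zI g ->
  zint N (fun x => g x * (zpart f m).[x]) = \sum_(k < m) zhat N f k * zhat N g k / znorm N k.
Proof.
move=> hf hg; rewrite (zint_mulp_expand hN hg (size_zpart f m)).
by apply: eq_bigr => k _; rewrite phat_zpart ltn_ord.
Qed.

Lemma zpart_orth f m p : zI f -> (size p <= m)%N ->
  zint N (fun x => (f x - (zpart f m).[x]) * p.[x]) = 0.
Proof.
move=> hf sp; have zp := zI_poly hN (zpart f m).
transitivity (zint N (fun x => f x * p.[x] - (zpart f m).[x] * p.[x])).
  by apply: zint_ext => // x _; rewrite mulrBl.
rewrite zintB//; [|exact: zI_mulpr..].
rewrite !(zint_mulp_expand hN _ sp)//; apply/eqP; rewrite subr_eq0; apply/eqP.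
by apply: eq_bigr => k _; rewrite zhat_horner// phat_zpart ltn_ord.
Qed.

Lemma zpart_best f m p : bmf f -> (size p <= m)%N ->
  zint N (fun x => (f x - (zpart f m).[x]) ^+ 2) <= zint N (fun x => (f x - p.[x]) ^+ 2).
Proof.
move=> bf sp; have zf := bmf_zI hN bf; set v := zpart f m.
have bv : bmf (horner v) by exact: bmf_poly.
have bp : bmf (horner (v - p)) by exact: bmf_poly.
have b1 := bmfB bf bv.
have -> : zint N (fun x => (f x - p.[x]) ^+ 2) = zint N (fun x => (f x - v.[x]) ^+ 2)
   + zint N (fun x => (v - p).[x] ^+ 2).
  have z1 : zI (fun x => (f x - v.[x]) ^+ 2) by exact (bmf_zI hN (bmf_exp2 b1)).
  have z2 : zI (fun x => (v - p).[x] ^+ 2) by exact (bmf_zI hN (bmf_exp2 bp)).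
  have z3 : zI (fun x => (f x - v.[x]) * (v - p).[x]) by exact (bmf_zI hN (bmfM b1 bp)).
  transitivity (zint N (fun x => ((f x - v.[x]) ^+ 2 + (v - p).[x] ^+ 2) + 2 * ((f x - v.[x]) * (v - p).[x]))).
    by apply: zint_ext => // x _; rewrite hornerD hornerN; ring.
  rewrite zintD; [|exact: zID|exact: zIZ].
  rewrite zintD// zintZ// zpart_orth// ?mulr0 ?addr0//.
  by rewrite (leq_trans (size_polyD _ _))// geq_max size_zpart size_polyN.
by rewrite lerDl; apply: zint_ge0 => // x _; exact: sqr_ge0.
Qed.

(** The partial sums are best approximations in mean square, so they do at least as well as the
    polynomials [P m], for which bounded convergence applies. *)
Lemma zpart_cvg f (P : nat -> {poly R}) K : bmf f ->
  (forall x, -1 < x < 1 -> (P m).[x] @[m --> \oo] --> f x) ->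
  (forall m x, -1 < x < 1 -> `|(P m).[x]| <= K) ->
  forall e, 0 < e -> exists m0, forall m, (m0 <= m)%N ->
    zint N (fun x => (f x - (zpart f m).[x]) ^+ 2) < e.
Proof.
move=> bf cP bP e e0; have [mf [M hM]] := bf.
have f1 m : measurable_fun I (fun x => (f x - (P m).[x]) ^+ 2).
  by have [] := bmf_exp2 (bmfB bf (bmf_poly (P m))).
have f2 x : -1 < x < 1 -> (f x - (P m).[x]) ^+ 2 @[m --> \oo] --> (0 : R).
  move=> hx; rewrite -[X in _ --> X](expr0n R 2) -(subrr (f x)).
  by rewrite expr2; apply: cvgM; (apply: cvgB; [exact: cvg_cst|exact: cP]).
have f3 m x : -1 < x < 1 -> `|(f x - (P m).[x]) ^+ 2| <= (M + K) ^+ 2.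
  move=> hx; rewrite normrX; apply: lerXn2r; rewrite ?nnegrE//.
    by apply: addr_ge0; [exact: le_trans (normr_ge0 _) (hM x hx)|exact: le_trans (normr_ge0 _) (bP m x hx)].
  by rewrite (le_trans (ler_normB _ _))// lerD ?hM ?bP.
have [_] := zint_dct f1 f2 (zI_cst hN _) f3; rewrite (zint0 hN) => h.
have [m1 _ hm1] : \forall m \near \oo, zint N (fun x => (f x - (P m).[x]) ^+ 2) < e.
  exact: (cvgr_lt _ h).
exists (size (P m1)) => m hm; apply: le_lt_trans (zpart_best bf hm) _.
by apply: hm1 => /=.
Qed.

End SquareIntegrals.

(** * The second variation tested on G - x *)

Section Stability.
Context {R : realType}.
Variable N : nat.
Hypothesis hN : (3 <= N)%N.
Implicit Types (p q : {poly R}) (x y t a b : R) (k j m : nat) (f g : R -> R).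
Local Notation n := N%:R.
Local Notation I := (`](-1)%R, 1%R[%classic : set R).
Local Notation c := (@zonal R N).
Local Notation A := (@upc R N).
Local Notation B := (@downc R N).
Local Notation zI := (@zI R N).
Local Notation W := (@zW R N).
Local Notation h := (@znorm R N).
Local Notation pe := (@paneitz_eig R N).
Local Notation F := ((N.-1)`!%:R).

Variables (alpha K : R) (u rho G : R -> R) (Gp : nat -> {poly R}).
Hypothesis ha : 2^-1 <= alpha <= 1.
Hypothesis zu : zI u.
Hypothesis zrho : zI rho.
Hypothesis rho_gt0 : forall x, 0 < rho x.
Hypothesis rho1 : zint N rho = W.
Hypothesis rhox : zint N (fun x => rho x * x) = 0.
Hypothesis EL : forall k, alpha * pe k * zhat N u k = F * (zhat N rho k - (k == 0%N)%:R * W).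
Hypothesis bG : bmf G.
Hypothesis Gp_cvg : forall x, -1 < x < 1 -> (Gp m).[x] @[m --> \oo] --> G x.
Hypothesis Gp_bound : forall m x, -1 < x < 1 -> `|(Gp m).[x]| <= K.
Hypothesis zhatG : forall j, zhat N G j =
  (j%:R + n) * A j * zhat N u j.+1 - (j%:R - 1) * B j * zhat N u j.-1.
Hypothesis KW : forall p, zint N (fun x => rho x * (n * (G x - x) * p.[x] + (1 - x ^+ 2) * (p^`()).[x])) = 0.
Local Notation T := (zint N (fun x => rho x * x ^+ 2)).
Local Notation D := ((W - T) / n).
Local Notation S := (W / (n + 1)).
Hypothesis rint_G : zint N (fun x => rho x * G x) = 0.
Hypothesis rint_Gx : zint N (fun x => rho x * (G x * x)) = T - D.

Let a0 : 0 < alpha. Proof. by case/andP: ha; lra. Qed.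
Let F0 : is_true ((0 : R) < (N.-1)`!%:R). Proof. by rewrite ltr0n fact_gt0. Qed.
Let W0 : 0 < W. Proof. exact: zW_gt0. Qed.
Let rho_ge0 x : 0 <= rho x. Proof. exact: ltW. Qed.
Let bx : bmf (fun x : R => x). Proof. exact: bmf_id. Qed.

Let factN : N`!%:R = n * F :> R.
Proof. by rewrite -natrM -[in LHS](prednK (ltn_trans (isT : (0 < 2)%N) hN)) factS prednK ?(ltn_trans _ hN). Qed.

Let h0 k : 0 < h k. Proof. exact: znorm_gt0. Qed.
Let h1E : h 1 = S.
Proof.
have e := @znorm_rec R N hN 0; rewrite !(upc_def, downc_def) znorm0// mulr0 !add0r in e.
have n3 := @ge3 R N hN; rewrite divff ?mul1r in e; last by rewrite gt_eqF//; lra.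
by rewrite e mulrC (_ : 2 * 1 + n - 1 = n + 1)//; ring.
Qed.

Definition vfun x : R := G x - x.
Let bv : bmf vfun. Proof. exact: bmfB. Qed.
Let zv : zI vfun. Proof. exact (bmf_zI hN bv). Qed.

Lemma phat_X j : phat N 'X j = (j == 1%N)%:R * S.
Proof.
rewrite -['X]mulr1 -(@zonal0 R N) phatX// !phat_zonal//.
case: j => [|[|j]]; rewrite /= ?mulr0 ?mul0r ?add0r ?downc_def ?mul0r//.
by rewrite znorm0// mul1r (_ : 2 * 1 + n - 1 = n + 1) ?mul1r 1?mulrC//; ring.
Qed.

Lemma zhat_v j : zhat N vfun j = zhat N G j - (j == 1%N)%:R * S.
Proof.
have zG : zI G by exact (bmf_zI hN bG).
have zx : zI (fun x => -1 * x) by apply: zIZ; exact (bmf_zI hN bx).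
have -> : vfun = (fun x => G x + -1 * x) by apply/funext => x; rewrite /vfun mulN1r.
rewrite zhatD// zhatZ//; last exact (bmf_zI hN bx).
rewrite mulN1r -phat_X -zhat_horner//; congr (_ - _).
by apply: zint_ext => // x _; rewrite hornerX.
Qed.

Lemma rint_v_zonal j : n * zint N (fun x => rho x * (vfun x * (c j).[x])) =
  j%:R * A j * (zhat N rho j.+1 - zhat N rho j.-1).
Proof.
have zc k : zI (fun x => rho x * (c k).[x]) by exact: zI_mulpr.
have b1 : bmf (fun x => vfun x * (c j).[x]) by apply: bmfM => //; exact: bmf_poly.
have b2 : bmf (fun x => (c j.-1).[x] - x * (c j).[x]).
  by apply: bmfB; [exact: bmf_poly|apply: bmfM => //; exact: bmf_poly].
have := KW (c j).
have -> : (fun x => rho x * (n * (G x - x) * (c j).[x] + (1 - x ^+ 2) * ((c j)^`()).[x])) =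
   (fun x => rho x * (n * (vfun x * (c j).[x]) + j%:R * ((c j.-1).[x] - x * (c j).[x]))).
  apply/funext => x; have := congr1 (horner^~ x) (@zonal_deriv R N hN j).
  rewrite !(hornerD, hornerN, hornerM, hornerC, hornerX, horner_exp, hornerZ) => ->.
  by rewrite /vfun; ring.
rewrite rintD//; [|exact: bmfZ..].
rewrite !rintZ// rintB//; [|exact: bmf_poly|by apply: bmfM => //; exact: bmf_poly].
have -> : zint N (fun x => rho x * (x * (c j).[x])) = A j * zhat N rho j.+1 + B j * zhat N rho j.-1.
  by rewrite -zhatX//; apply: zint_ext => // x _; ring.
rewrite -/(zhat N rho j.-1) => e.
have AB := @updownc R N hN j.
have {}AB : B j = 1 - A j by rewrite -AB addrC addKr.
by move/eqP: e; rewrite addr_eq0 => /eqP ->; rewrite AB; ring.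
Qed.

(** The Euler-Lagrange equation differentiated along the conformal field (1 - x^2) d/dx: weakly,
    alpha P G = N! (rho (G - x) + x). The constant S is the squared weighted norm of x. *)
Lemma pe_Gfun j : alpha * pe j * zhat N G j =
  N`!%:R * (zint N (fun x => rho x * (vfun x * (c j).[x])) + (j == 1%N)%:R * S).
Proof.
set Z := zint N _.
have -> : N`!%:R * (Z + (j == 1%N)%:R * S) = F * (n * Z) + (j == 1%N)%:R * S * n * F by rewrite factN; ring.
rewrite rint_v_zonal zhatG {Z}.
case: j => [|j]; first by rewrite pe0// !mul0r !mulr0 mul0r addr0.
have e1 := EL j.+2; have e2 := EL j; rewrite mul0r subr0 in e1.
have r1 := @pe_rec R N hN j.+1; have r2 := @pe_rec R N hN j.
have AB : j.+1%:R * A j.+1 = (j%:R + n) * B j.+1.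
  by rewrite upc_def downc_def -[j.+1%:R]natr1; ring.
rewrite /= -[in X in (X - 1) * _]natr1 addrK.
transitivity (A j.+1 * (alpha * ((j.+1%:R + n) * pe j.+1) * zhat N u j.+2)
   - B j.+1 * (alpha * (j%:R * pe j.+1) * zhat N u j)); first ring.
rewrite -r1 r2.
transitivity (A j.+1 * j.+1%:R * (alpha * pe j.+2 * zhat N u j.+2)
   - B j.+1 * (j%:R + n) * (alpha * pe j * zhat N u j)); first ring.
rewrite e1 e2 [A j.+1 * _]mulrC AB eqSS.
have -> : (j == 0%N)%:R * S * n * F = (j == 0%N)%:R * (B j.+1 * (j%:R + n) * F * W).
  case: j {e1 e2 r1 r2 AB} => [|j]; last by rewrite !mul0r.
  rewrite eqxx !mul1r add0r downc_def (_ : 2 * 1%:R + n - 1 = n + 1); last ring.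
  by ring.
by rewrite /=; ring.
Qed.

(** Since P x = N! x, the function G - x solves the linearized equation up to the term (1 - alpha)
    x; this singles it out as a test direction. *)
Lemma pe_v j : alpha * pe j * zhat N vfun j =
  N`!%:R * (zint N (fun x => rho x * (vfun x * (c j).[x])) + (1 - alpha) * ((j == 1%N)%:R * S)).
Proof.
rewrite zhat_v mulrBr pe_Gfun.
by case: eqP => [->|_]; rewrite ?pe1 ?mul0r; ring.
Qed.

Lemma rint_v : zint N (fun x => rho x * vfun x) = 0.
Proof. by rewrite rintB// rint_G rhox subrr. Qed.

Lemma rint_vx : zint N (fun x => rho x * (vfun x * x)) = - D.
Proof.
transitivity (zint N (fun x => rho x * (G x * x - x ^+ 2))).
  by apply: zint_ext => // x _; rewrite /vfun; ring.
by rewrite rintB//; [rewrite rint_Gx; ring|exact: bmfM|exact: bmf_exp2].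
Qed.

Lemma zonal1 : c 1 = 'X.
Proof.
have e := @zonal_mulX R N hN 0; rewrite zonal0 mulr1 downc_def mul0r scale0r addr0 upc_def mulr0 add0r in e.
by have n3 := @ge3 R N hN; rewrite e divff ?scale1r// gt_eqF//; lra.
Qed.

Lemma alpha_zhat_v1 : alpha * zhat N vfun 1 = (1 - alpha) * S - D.
Proof.
have := pe_v 1; rewrite pe1 mul1r zonal1.
have -> : zint N (fun x => rho x * (vfun x * 'X.[x])) = - D.
  by rewrite -rint_vx; apply: zint_ext => // x _; rewrite hornerX.
move=> e; apply: (@mulfI _ (N`!%:R)); first by rewrite pnatr_eq0 -lt0n fact_gt0.
by rewrite [RHS]mulrC [X in _ = X * _]addrC [RHS]mulrC -e; ring.
Qed.

Lemma alpha_zhat_G1 : alpha * zhat N G 1 = S - D.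
Proof. by have := alpha_zhat_v1; rewrite zhat_v mul1r; lra. Qed.

Lemma rint_sq_eq0 : 0 < T.
Proof.
have zz : zI (fun x => rho x * x ^+ 2) by apply: zI_bmf => //; exact: bmf_exp2.
apply: zint_gt0 => //; first by move=> x _; rewrite mulr_ge0 ?sqr_ge0.
have hp : 'X ^+ 2 != 0 :> {poly R} by rewrite expf_neq0// polyX_eq0.
apply: (@filterS _ _ (ae_filter_ringOfSetsType (@lebesgue_measure R)) _ _ _ (poly_ae_neq0 hp)) => x hx Ix.
by have := hx Ix; rewrite hornerXn => hh; rewrite mulf_neq0// gt_eqF.
Qed.

Lemma rint_sq_ltW : T < W.
Proof.
have b2 : bmf (fun x : R => x ^+ 2) by exact: bmf_exp2.
have b3 := bmfB (bmf_cst 1) b2.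
rewrite -subr_gt0 -rho1 (_ : zint N rho = zint N (fun x => rho x * 1)); last first.
  by apply: zint_ext => // x _; rewrite mulr1.
rewrite -rintB//; last exact: bmf_cst.
apply: zint_gt0 => //; first exact: zI_bmf.
  by move=> x /onem_sq_gt0 hx; rewrite mulr_ge0 ?(ltW hx).
apply: aeW => x; rewrite mem_I => /onem_sq_gt0 hx.
by rewrite mulf_neq0// gt_eqF.
Qed.

Lemma zhat_rhoS k : zhat N rho k.+1 = alpha / F * (pe k.+1 * zhat N u k.+1).
Proof. by have := EL k.+1; rewrite mul0r subr0 => e; rewrite mulrAC mulrA e mulrC mulKf// gt_eqF. Qed.

Definition pform p m : R := \sum_(k < m) pe k / h k * phat N p k ^+ 2.

Let pw_ge0 k : 0 <= pe k / h k.
Proof. by rewrite divr_ge0 ?pe_ge0// ltW. Qed.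

Variable regM : R.
Hypothesis reg : forall m, \sum_(k < m) pe k / h k * zhat N u k ^+ 2 <= regM.

Lemma rint_expand (f : R -> R) p m : zI f -> (size p <= m)%N ->
  zint N (fun x => f x * p.[x]) = \sum_(k < m) phat N p k * zhat N f k / h k.
Proof. by move=> hf sp; exact: zint_mulp_expand. Qed.

Let regM_ge0 : 0 <= regM.
Proof. by have := reg 0; rewrite big_ord0. Qed.

(** Duality: away from degree 0 the coefficients of rho are alpha / (N-1)! times those of P u, so
    integration against rho is bounded in the Paneitz norm even though rho need not be square
    integrable. *)
Lemma rint_sq_le p m : (size p <= m)%N -> phat N p 0 = 0 ->
  zint N (fun x => rho x * p.[x]) ^+ 2 <= (alpha / F) ^+ 2 * regM * pform p m.
Proof.
move=> sp p0; rewrite (rint_expand zrho sp).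
have -> : \sum_(k < m) phat N p k * zhat N rho k / h k =
    alpha / F * \sum_(k < m) pe k / h k * (zhat N u k * phat N p k).
  rewrite mulr_sumr; apply: eq_bigr => -[k hk] _ /=; case: k hk => [|k] hk.
    by rewrite p0 !mul0r !mulr0.
  by rewrite zhat_rhoS; field; rewrite !gt_eqF.
rewrite exprMn -mulrA ler_wpM2l ?sqr_ge0//.
apply: le_trans (sum_cauchy_schwarz _ _ _ pw_ge0) _.
by rewrite ler_wpM2r ?reg// sumr_ge0// => k _; rewrite mulr_ge0 ?sqr_ge0.
Qed.

Let zz k : R := zhat N (fun x => x * rho x) k / pe k.

(** The same duality for x rho: multiplication by x moves the degree by one, and consecutive
    positive eigenvalues have ratio at most N + 1. Degree 0 is left out because its eigenvalue is 0,
    degree 1 because it involves the mass W of rho. *)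
Lemma zz_reg m : \sum_(k < m) (if (k <= 1)%N then 0 else pe k / h k * zz k ^+ 2) <=
  (alpha / F) ^+ 2 * (2 * (n + 1) * regM + 2 * regM).
Proof.
have n3 := @ge3 R N hN; have A1 k : A k <= 1 by have := @updownc R N hN k; have := @downc_ge0 R N hN k; lra.
have B1 k : B k <= 1 by have := @updownc R N hN k; have := @upc_gt0 R N hN k; lra.
have term k : (1 < k)%N -> pe k / h k * zz k ^+ 2 <= (alpha / F) ^+ 2 *
   (2 * (n + 1) * (pe k.+1 / h k.+1 * zhat N u k.+1 ^+ 2) + 2 * (pe k.-1 / h k.-1 * zhat N u k.-1 ^+ 2)).
  case: k => [|[|k]] // _; rewrite /=.
  have r1 := @pe_rec R N hN k.+2; have r2 := @pe_rec R N hN k.+1.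
  have g1 := @znorm_rec R N hN k.+2; have g2 := @znorm_rec R N hN k.+1.
  have p1 : 0 < pe k.+1 by exact: pe_gt0.
  have p2 : 0 < pe k.+2 by exact: pe_gt0.
  have p3 : 0 < pe k.+3 by exact: pe_gt0.
  have k1 : 0 < k.+1%:R :> R by rewrite ltr0n.
  have k2 : 0 < k.+2%:R :> R by rewrite ltr0n.
  have a2 := @upc_gt0 R N hN k.+2; have a1 := @upc_gt0 R N hN k.+1.
  have b2 := @downc_gt0 R N hN k.+1; have b3 := @downc_gt0 R N hN k.+2.
  have hh1 := h0 k.+1; have hh2 := h0 k.+2; have hh3 := h0 k.+3.
  (* [s] and, below, [s'] are the eigenvalues of degrees k + 3 and k + 1 divided by that of degree k
     + 2. *)
  pose s : R := (k.+2%:R + n) / k.+2%:R.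
  have s0 : 0 <= s by rewrite divr_ge0// addr_ge0.
  have s1 : s <= n + 1.
    rewrite ler_pdivrMr//; have : 1 <= (k.+2%:R : R) by rewrite ler1n.
    by move=> ?; nra.
  pose s' : R := k.+1%:R / (k.+1%:R + n).
  have sd : (0 : R) < k.+1%:R + n by rewrite ltr_wpDr// ltr0n.
  have s'0 : 0 <= s' by rewrite divr_ge0// ltW.
  have s'1 : s' <= 1 by rewrite ler_pdivrMr// mul1r lerDl; lra.
  have zE : zz k.+2 = alpha / F * (A k.+2 * s * zhat N u k.+3 + B k.+2 * s' * zhat N u k.+1).
    rewrite /zz zhatX//= !zhat_rhoS.
    have -> : pe k.+3 = s * pe k.+2.
      by apply: (@mulfI _ k.+2%:R); rewrite ?gt_eqF// r1 /s; field; rewrite gt_eqF.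
    have -> : pe k.+1 = s' * pe k.+2.
      by apply: (@mulfI _ (k.+1%:R + n)); rewrite ?gt_eqF// -r2 /s'; field; rewrite gt_eqF.
    by field; rewrite !gt_eqF.
  have q1 : pe k.+2 / h k.+2 * (A k.+2 * s) ^+ 2 <= (n + 1) * (pe k.+3 / h k.+3).
    have -> : pe k.+2 / h k.+2 * (A k.+2 * s) ^+ 2 = s * (A k.+2 * B k.+3) * (pe k.+3 / h k.+3).
      have -> : pe k.+3 = s * pe k.+2.
        by apply: (@mulfI _ k.+2%:R); rewrite ?gt_eqF// r1 /s; field; rewrite gt_eqF.
      have -> : h k.+2 = A k.+2 * h k.+3 / B k.+3 by rewrite g1; field; rewrite gt_eqF.
      by field; rewrite !gt_eqF.
    apply: ler_wpM2r; first by rewrite divr_ge0// ltW.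
    rewrite -[leRHS]mulr1; apply: ler_pM => //; first by rewrite mulr_ge0// ltW.
    by rewrite -[leRHS]mulr1; apply: ler_pM; rewrite // ltW.
  have q2 : pe k.+2 / h k.+2 * (B k.+2 * s') ^+ 2 <= pe k.+1 / h k.+1.
    have -> : pe k.+2 / h k.+2 * (B k.+2 * s') ^+ 2 = s' * (A k.+1 * B k.+2) * (pe k.+1 / h k.+1).
      have -> : pe k.+1 = s' * pe k.+2.
        by apply: (@mulfI _ (k.+1%:R + n)); rewrite ?gt_eqF// -r2 /s'; field; rewrite gt_eqF.
      have -> : h k.+2 = B k.+2 * h k.+1 / A k.+1 by rewrite -g2; field; rewrite gt_eqF.
      by field; rewrite !gt_eqF.
    rewrite -[leRHS]mul1r; apply: ler_wpM2r; first by rewrite divr_ge0// ltW.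
    rewrite -[leRHS]mulr1; apply: ler_pM => //; first by rewrite mulr_ge0// ltW.
    by rewrite -[leRHS]mulr1; apply: ler_pM; rewrite // ltW.
  rewrite zE exprMn mulrCA ler_wpM2l ?sqr_ge0//.
  set X := zhat N u k.+3; set Y := zhat N u k.+1.
  have := ler_wpM2r (sqr_ge0 X) q1; have := ler_wpM2r (sqr_ge0 Y) q2.
  have := pw_ge0 k.+2; set P := pe k.+2 / h k.+2; set x := A k.+2 * s; set y := B k.+2 * s'.
  move=> P0 E2 E1; have : 0 <= P * (x * X - y * Y) ^+ 2 by rewrite mulr_ge0 ?sqr_ge0.
  by nra.
apply: (@le_trans _ _ (\sum_(k < m) (alpha / F) ^+ 2 *
   (2 * (n + 1) * (pe k.+1 / h k.+1 * zhat N u k.+1 ^+ 2) +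
    2 * (if (k == 0%N :> nat) then 0 else pe k.-1 / h k.-1 * zhat N u k.-1 ^+ 2)))).
  apply: ler_sum => -[k hk] _ /=; case: ifP => hk1.
    rewrite mulr_ge0 ?sqr_ge0// addr_ge0// mulr_ge0//.
    - by rewrite mulr_ge0 ?sqr_ge0.
    - by case: ifP => // _; rewrite mulr_ge0 ?sqr_ge0.
  by case: k hk hk1 => // k hk hk1; apply: term; rewrite ltnNge hk1.
rewrite -mulr_sumr ler_wpM2l ?sqr_ge0// big_split /= -!mulr_sumr; apply: lerD.
  rewrite ler_wpM2l//.
  apply: le_trans (reg m.+1); rewrite [leRHS]big_ord_recl /= lerDr.
  by rewrite mulr_ge0 ?sqr_ge0.
rewrite ler_wpM2l//; case: m => [|m]; first by rewrite big_ord0.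
rewrite big_ord_recl /= add0r; apply: le_trans (reg m); rewrite le_eqVlt; apply/orP; left.
by apply/eqP; apply: eq_bigr => k _.
Qed.

Lemma rint_x_sq_le p m : (size p <= m)%N -> phat N p 0 = 0 -> phat N p 1 = 0 ->
  zint N (fun x => rho x * (x * p.[x])) ^+ 2 <=
  (alpha / F) ^+ 2 * (2 * (n + 1) * regM + 2 * regM) * pform p m.
Proof.
move=> sp p0 p1.
have -> : zint N (fun x => rho x * (x * p.[x])) = zint N (fun x => x * rho x * p.[x]).
  by apply: zint_ext => // x _; ring.
rewrite (rint_expand (zI_mulx zrho) sp).
pose w k := if (k <= 1)%N then 0 else pe k / h k.
have w0 k : 0 <= w k by rewrite /w; case: ifP.
have -> : \sum_(k < m) phat N p k * zhat N (fun x => x * rho x) k / h k =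
    \sum_(k < m) w k * (zz k * phat N p k).
  apply: eq_bigr => -[k hk] _ /=; case: k hk => [|[|k]] hk; rewrite ?p0 ?p1 ?mul0r ?mulr0//.
  by rewrite /w /zz /=; field; rewrite !gt_eqF// pe_gt0.
apply: le_trans (sum_cauchy_schwarz _ _ _ w0) _; apply: ler_pM.
- by apply: sumr_ge0 => k _; rewrite mulr_ge0 ?sqr_ge0.
- by apply: sumr_ge0 => k _; rewrite mulr_ge0 ?sqr_ge0.
- apply: le_trans (zz_reg m); apply: ler_sum => k _; rewrite /w; case: ifP => //.
  by rewrite mul0r.
- apply: ler_sum => k _; rewrite /w; case: ifP => // _.
  by rewrite mul0r mulr_ge0 ?sqr_ge0.
Qed.

(** Nonnegativity of the second variation in the polynomial directions tangent to the constraint;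
    the subtracted square comes from the logarithm. *)
Definition pinner_stable := forall p m, (size p <= m)%N ->
  zint N (fun x => rho x * (x * p.[x])) = 0 ->
  N`!%:R * (zint N (fun x => rho x * p.[x] ^+ 2) - zint N (fun x => rho x * p.[x]) ^+ 2 / W)
  <= alpha * pform p m.
Hypothesis stab : pinner_stable.

Lemma phat_addX p b k : phat N (p + b *: 'X) k = phat N p k + (k == 1%N)%:R * (b * S).
Proof. by rewrite phatD// phatZ// phat_X; ring. Qed.

Lemma pform_addX p b m : (1 < m)%N ->
  pform (p + b *: 'X) m = pform p m + N`!%:R * (2 * b * phat N p 1 + b ^+ 2 * S).
Proof.
case: m => [|[|m]] // _; rewrite /pform.
rewrite !(big_ord_recl m.+1) !(big_ord_recl m) /= !phat_addX /= !mul0r !addr0 mul1r.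
have n3 := @ge3 R N hN; have S0 : 0 < S by rewrite divr_gt0//; lra.
have -> : \sum_(i < m) pe (bump 0 (bump 0 i)) / h (bump 0 (bump 0 i)) * phat N (p + b *: 'X) (bump 0 (bump 0 i)) ^+ 2
  = \sum_(i < m) pe (bump 0 (bump 0 i)) / h (bump 0 (bump 0 i)) * phat N p (bump 0 (bump 0 i)) ^+ 2.
  by apply: eq_bigr => i _; rewrite phat_addX /= mul0r addr0.
rewrite (_ : bump 0 0 = 1%N)// pe1 h1E; move: (W / (n + 1)) S0 => s S0.
by field; rewrite !gt_eqF.
Qed.

Lemma rint_addX2 p b : zint N (fun x => rho x * (p + b *: 'X).[x] ^+ 2) =
  zint N (fun x => rho x * p.[x] ^+ 2) + 2 * b * zint N (fun x => rho x * (x * p.[x])) + b ^+ 2 * T.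
Proof.
have b1 : bmf (fun x => p.[x] ^+ 2) by apply: bmf_exp2; exact: bmf_poly.
have b2 : bmf (fun x => x * p.[x]) by apply: bmfM => //; exact: bmf_poly.
have b3 : bmf (fun x : R => x ^+ 2) by exact: bmf_exp2.
have c2 := bmfZ (2 * b) b2; have c3 := bmfZ (b ^+ 2) b3.
transitivity (zint N (fun x => rho x * ((p.[x] ^+ 2 + 2 * b * (x * p.[x])) + b ^+ 2 * x ^+ 2))).
  by apply: zint_ext => // x _; rewrite hornerD hornerZ hornerX; ring.
by rewrite rintD// ?rintD// ?rintZ//; exact: bmfD.
Qed.

Lemma rint_addX p b : zint N (fun x => rho x * (p + b *: 'X).[x]) = zint N (fun x => rho x * p.[x]).
Proof.
transitivity (zint N (fun x => rho x * (p.[x] + b * x))).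
  by apply: zint_ext => // x _; rewrite hornerD hornerZ hornerX.
by rewrite rintD// ?rintZ// ?rhox ?mulr0 ?addr0//; [exact: bmf_poly|exact: bmfZ].
Qed.

Lemma rint_xaddX p b : zint N (fun x => rho x * (x * (p + b *: 'X).[x])) =
  zint N (fun x => rho x * (x * p.[x])) + b * T.
Proof.
have b2 : bmf (fun x => x * p.[x]) by apply: bmfM => //; exact: bmf_poly.
have b3 : bmf (fun x : R => x ^+ 2) by exact: bmf_exp2.
transitivity (zint N (fun x => rho x * (x * p.[x] + b * x ^+ 2))).
  by apply: zint_ext => // x _; rewrite hornerD hornerZ hornerX; ring.
by rewrite rintD// ?rintZ//; exact: bmfZ.
Qed.

(** Lifts the tangency condition: p - (q / T) x is tangent to the constraint, and x meets the
    Paneitz form in degree 1 only. *)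
Lemma stable_addX p m : (size p <= m)%N -> (1 < m)%N ->
  forall q : R, q = zint N (fun x => rho x * (x * p.[x])) ->
  N`!%:R * (zint N (fun x => rho x * p.[x] ^+ 2) - q ^+ 2 / T
     - zint N (fun x => rho x * p.[x]) ^+ 2 / W)
  <= alpha * (pform p m + N`!%:R * (- (2 * (q / T) * phat N p 1) + (q / T) ^+ 2 * S)).
Proof.
move=> sp m1 q qE; have T0 := rint_sq_eq0.
pose b : R := - (q / T).
have sp' : (size (p + b *: 'X)%R <= m)%N.
  rewrite (leq_trans (size_polyD _ _))// geq_max sp (leq_trans (size_scale_leq _ _))//.
  by rewrite size_polyX.
have := stab sp'; rewrite rint_xaddX -qE rint_addX2 rint_addX pform_addX//.
have -> : q + b * T = 0 by rewrite /b; field; rewrite gt_eqF.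
move=> /(_ erefl); congr (_ * _ <= alpha * _).
  by rewrite -qE /b; congr (_ - _); field; rewrite gt_eqF.
by congr (_ + _ * _); rewrite /b sqrrN; ring.
Qed.

(** Stability read backwards: it bounds the L^2(rho) norm by the Paneitz form once the squared
    linear terms are estimated by duality. As rho need not be bounded, no comparison with the weight
    gives this directly. *)
Lemma high_bound : exists C : R, 0 <= C /\ forall p m, (size p <= m)%N ->
  phat N p 0 = 0 -> phat N p 1 = 0 -> zint N (fun x => rho x * p.[x] ^+ 2) <= C * pform p m.
Proof.
have T0 := rint_sq_eq0; have n3 := @ge3 R N hN.
have S0 : 0 < S by rewrite divr_gt0//; lra.
have NF : (0 : R) < N`!%:R by rewrite ltr0n fact_gt0.
pose C1 := (alpha / F) ^+ 2 * regM.
pose C2 := (alpha / F) ^+ 2 * (2 * (n + 1) * regM + 2 * regM).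
have C10 : 0 <= C1 by rewrite mulr_ge0 ?sqr_ge0.
have C20 : 0 <= C2.
  by rewrite mulr_ge0 ?sqr_ge0// addr_ge0// mulr_ge0//; lra.
have aN : 0 <= alpha / N`!%:R by rewrite divr_ge0// ltW.
have CC0 : 0 <= alpha / N`!%:R + alpha * S / T ^+ 2 * C2 + C2 / T + C1 / W.
  rewrite !addr_ge0//; last 2 first.
  - by rewrite divr_ge0// ltW.
  - by rewrite divr_ge0// ltW.
  by rewrite mulr_ge0// divr_ge0 ?sqr_ge0// mulr_ge0// ltW.
exists (alpha / N`!%:R + alpha * S / T ^+ 2 * C2 + C2 / T + C1 / W); split=> //.
move=> p m sp p0 p1.
wlog m1 : m sp / (1 < m)%N.
  move=> H; have [|m1] := ltnP 1 m; first exact: H.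
  have -> : p = 0.
    rewrite (zonal_expand hN sp) big1// => -[k hk] _ /=.
    have := leq_trans hk m1; by case: k hk => [|k] // hk _; rewrite p0 mul0r scale0r.
  rewrite (_ : zint N _ = 0); last first.
    by rewrite -[RHS](zint0 hN); apply: zint_ext => // x _; rewrite horner0 expr0n mulr0.
  by rewrite mulr_ge0//; apply: sumr_ge0 => k _; rewrite mulr_ge0 ?sqr_ge0.
have := stable_addX sp m1 erefl; rewrite p1 mulr0 oppr0 add0r.
have := rint_sq_le sp p0; have := rint_x_sq_le sp p0 p1; rewrite -/C1 -/C2.
set q := zint N (fun x => rho x * (x * p.[x])); set s := zint N (fun x => rho x * p.[x]).
set E := pform p m; set Q := zint N _ => hq hs hst.
have hst' : Q - q ^+ 2 / T - s ^+ 2 / W <= alpha / N`!%:R * E + alpha * (S / T ^+ 2) * q ^+ 2.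
  rewrite -(ler_pM2l NF); apply: le_trans hst _; rewrite le_eqVlt; apply/orP; left; apply/eqP.
  by field; rewrite (gt_eqF T0) (gt_eqF NF) /= gt_eqF//; lra.
have hq1 : q ^+ 2 / T <= C2 * E / T by rewrite ler_wpM2r// invr_ge0 ltW.
have hs1 : s ^+ 2 / W <= C1 * E / W by rewrite ler_wpM2r// invr_ge0 ltW.
have hq2 : alpha * (S / T ^+ 2) * q ^+ 2 <= alpha * (S / T ^+ 2) * (C2 * E).
  by rewrite ler_wpM2l// mulr_ge0 ?(ltW a0)// divr_ge0 ?sqr_ge0// ltW.
have -> : (alpha / N`!%:R + alpha * S / T ^+ 2 * C2 + C2 / T + C1 / W) * E =
  alpha / N`!%:R * E + alpha * (S / T ^+ 2) * (C2 * E) + C2 * E / T + C1 * E / W by ring.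
lra.
Qed.

Local Notation vp m := (zpart N vfun m).

(* The partial sums of the Paneitz form of G - x; that they are bounded is what
   makes G - x an admissible test function in the second variation. *)
Definition vsum m : R := \sum_(k < m) pe k / h k * zhat N vfun k ^+ 2.

Lemma pform_vp m : pform (vp m) m = vsum m.
Proof. by apply: eq_bigr => k _; rewrite phat_zpart// ltn_ord. Qed.

Lemma vsum_nd m m' : (m <= m')%N -> vsum m <= vsum m'.
Proof.
move=> mm; rewrite /vsum (big_ord_widen _ (fun k => pe k / h k * zhat N vfun k ^+ 2) mm).
rewrite big_mkcond /=; apply: ler_sum => k _; case: ifP => // _.
by rewrite mulr_ge0 ?sqr_ge0.
Qed.

Lemma pform_vpB m m' : (m <= m')%N -> pform (vp m' - vp m) m' = vsum m' - vsum m.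
Proof.
move=> mm; rewrite /pform /vsum (big_ord_widen _ (fun k => pe k / h k * zhat N vfun k ^+ 2) mm).
rewrite [X in _ = _ - X]big_mkcond /= -sumrB; apply: eq_bigr => k _.
rewrite -scaleN1r phatD// phatZ// !phat_zpart// ltn_ord.
by case: ifP => _; [ring|rewrite mulr0 addr0 subr0].
Qed.

Lemma size_vpB m m' : (m <= m')%N -> (size (vp m' - vp m)%R <= m')%N.
Proof.
move=> mm; rewrite (leq_trans (size_polyD _ _))// geq_max size_zpart// size_polyN.
by rewrite (leq_trans (size_zpart hN _ _)).
Qed.

Lemma phat_vpB m m' k : (m <= m')%N -> (k < m)%N -> phat N (vp m' - vp m) k = 0.
Proof.
move=> mm km; rewrite -scaleN1r phatD// phatZ// !phat_zpart// km (leq_trans km mm); ring.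
Qed.

(** The linearized equation for G - x, tested on its own partial sum. *)
Lemma vsum_rint m : (1 < m)%N -> alpha * vsum m =
  N`!%:R * (zint N (fun x => rho x * (vfun x * (vp m).[x])) + (1 - alpha) * zhat N vfun 1).
Proof.
move=> m1.
have zc k : zI (fun x => zhat N vfun k / h k * (rho x * (vfun x * (c k).[x]))).
  by apply: zIZ; apply: zI_bmf => //; apply: bmfM => //; exact: bmf_poly.
have -> : zint N (fun x => rho x * (vfun x * (vp m).[x])) =
    \sum_(k < m) zhat N vfun k / h k * zint N (fun x => rho x * (vfun x * (c k).[x])).
  transitivity (zint N (fun x => \sum_(k < m) zhat N vfun k / h k * (rho x * (vfun x * (c k).[x])))).
    apply: zint_ext => // x _; rewrite /zpart horner_sum !mulr_sumr; apply: eq_bigr => k _.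
    by rewrite hornerZ; ring.
  rewrite zint_sum//; apply: eq_bigr => k _; rewrite zintZ//.
  by apply: zI_bmf => //; apply: bmfM => //; exact: bmf_poly.
have -> : (1 - alpha) * zhat N vfun 1 =
    \sum_(k < m) zhat N vfun k / h k * ((1 - alpha) * ((k == 1%N :> nat)%:R * S)).
  rewrite (bigD1 (Ordinal m1))//= big1 ?addr0.
    by rewrite -h1E; field; rewrite gt_eqF.
  move=> k hk; rewrite (_ : (k == 1%N :> nat) = false) ?mul0r ?mulr0//.
  by apply: contraNF hk => /eqP hk; apply/eqP/val_inj.
rewrite -big_split /= /vsum !mulr_sumr; apply: eq_bigr => k _.
transitivity (alpha * pe k * zhat N vfun k * (zhat N vfun k / h k)); first ring.
by rewrite pe_v; ring.
Qed.

Let rp2 (p : {poly R}) : bmf (fun x => p.[x] ^+ 2).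
Proof. by apply: bmf_exp2; exact: bmf_poly. Qed.

(** A bootstrap: [vsum_rint] expresses the form through a pairing of v with its partial sum in
    L^2(rho), and [high_bound] bounds that partial sum by the form again. A weighted Young
    inequality makes the returning term at most half of the left side. *)
Lemma vsum_bounded : exists M, forall m, vsum m <= M.
Proof.
have [C [C0 hC]] := high_bound.
have NF : (0 : R) < N`!%:R by rewrite ltr0n fact_gt0.
(* With this weight the returning term is C / (C + 1) times alpha / 2 times [vsum m]; taking C + 1
   instead of C keeps [th] positive when C = 0. *)
pose th := N`!%:R * (C + 1) / alpha.
have th0 : 0 < th by rewrite divr_gt0// mulr_gt0//; lra.
pose V := zint N (fun x => rho x * vfun x ^+ 2).
pose L := zint N (fun x => rho x * (vp 2).[x] ^+ 2).
pose Q := N`!%:R * (th * V + L / (2 * th) + (1 - alpha) * zhat N vfun 1).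
suff H m : (1 < m)%N -> vsum m <= 2 / alpha * Q.
  by exists (2 / alpha * Q) => m; apply: (le_trans (@vsum_nd m m.+2 _)); [rewrite ltnW|exact: H].
move=> m1; have e := vsum_rint m1.
have rb : zint N (fun x => rho x * (vp m).[x] ^+ 2) <= 2 * L + 2 * (C * vsum m).
  have hq := hC _ _ (size_vpB m1) (phat_vpB m1 (isT : (0 < 2)%N)) (phat_vpB m1 (isT : (1 < 2)%N)).
  rewrite pform_vpB// in hq.
  have b1 := bmfZ 2 (rp2 (vp 2)); have b2 := bmfZ 2 (rp2 (vp m - vp 2)).
  apply: (@le_trans _ _ (zint N (fun x => rho x * (2 * (vp 2).[x] ^+ 2 + 2 * (vp m - vp 2).[x] ^+ 2)))).
    apply: zint_le => //; [exact: zI_bmf|by apply: zI_bmf => //; exact: bmfD|].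
    move=> x _; rewrite ler_wpM2l// hornerD hornerN.
    by have := sqr_ge0 ((vp 2).[x] - ((vp m).[x] - (vp 2).[x])); nra.
  rewrite rintD// !rintZ// lerD// ler_wpM2l//; apply: le_trans hq _.
  rewrite ler_wpM2l// gerBl; apply: sumr_ge0 => k _; by rewrite mulr_ge0 ?sqr_ge0.
have rv : zint N (fun x => rho x * (vfun x * (vp m).[x])) <= th * V + (2 * L + 2 * (C * vsum m)) / (4 * th).
  have b1 := bmfZ th (bmf_exp2 bv); have b2 := bmfZ (4 * th)^-1 (rp2 (vp m)).
  apply: (@le_trans _ _ (zint N (fun x => rho x * (th * vfun x ^+ 2 + (4 * th)^-1 * (vp m).[x] ^+ 2)))).
    apply: zint_le => //.
    - by apply: zI_bmf => //; apply: bmfM => //; exact: bmf_poly.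
    - by apply: zI_bmf => //; exact: bmfD.
    move=> x _; rewrite ler_wpM2l// -subr_ge0.
    have -> : th * vfun x ^+ 2 + (4 * th)^-1 * (vp m).[x] ^+ 2 - vfun x * (vp m).[x] =
      (4 * th)^-1 * (2 * th * vfun x - (vp m).[x]) ^+ 2 by field; rewrite gt_eqF.
    by rewrite mulr_ge0 ?sqr_ge0// invr_ge0 mulr_ge0// ltW.
  rewrite rintD// !rintZ//; last exact: bmf_exp2.
  by rewrite lerD// mulrC ler_wpM2r// invr_ge0 mulr_ge0// ltW.
have E0 : 0 <= vsum m by apply: sumr_ge0 => k _; rewrite mulr_ge0 ?sqr_ge0.
have k1 : alpha * vsum m <= Q + N`!%:R * (C * vsum m / (2 * th)).
  rewrite e /Q -mulrDr ler_wpM2l ?(ltW NF)//.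
  have rvE : (2 * L + 2 * (C * vsum m)) / (4 * th) = L / (2 * th) + C * vsum m / (2 * th).
    by field; rewrite gt_eqF.
  rewrite rvE in rv.
  lra.
have k2 : N`!%:R * (C * vsum m / (2 * th)) <= alpha / 2 * vsum m.
  have -> : N`!%:R * (C * vsum m / (2 * th)) = C / (C + 1) * (alpha / 2 * vsum m).
    by rewrite /th; field; rewrite !gt_eqF//; lra.
  rewrite -[leRHS]mul1r ler_wpM2r//; first by rewrite mulr_ge0// divr_ge0// ltW.
  by rewrite ler_pdivrMr; lra.
have -> : 2 / alpha * Q = Q / (alpha / 2) by field; rewrite gt_eqF.
by rewrite ler_pdivlMr; [lra|rewrite divr_gt0].
Qed.

(** By [high_bound] the differences of partial sums are controlled in L^2(rho) by the tails of the
    bounded monotone sequence [vsum]. The resulting bound 2 C (L - [vsum m]) does not depend on the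
    cutoff of rho, which can then be removed. *)
Lemma rint_vp_cvg0 : zint N (fun x => rho x * (vfun x - (vp m).[x]) ^+ 2) @[m --> \oo] --> (0 : R).
Proof.
have [C [C0 hC]] := high_bound; have [M hM] := vsum_bounded.
have cE : cvgn vsum.
  apply: nondecreasing_is_cvgn; first by move=> m m'; exact: vsum_nd.
  by exists M => _ [m _ <-].
pose L := limn vsum.
have EL' m : vsum m <= L by apply: nondecreasing_cvgn_le => // a b; exact: vsum_nd.
have bvp m : bmf (fun x => (vfun x - (vp m).[x]) ^+ 2).
  by apply: bmf_exp2; apply: bmfB => //; exact: bmf_poly.
(* [rho] is only integrable: cut off at [M0] it is dominated by the weight, for which
   the partial sums converge in mean square. *)
have cut m M0 : (1 < m)%N -> 0 <= M0 ->
    zint N (fun x => Num.min (rho x) M0 * (vfun x - (vp m).[x]) ^+ 2) <= 2 * (C * (L - vsum m)).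
  move=> m1 M00; apply/ler_addgt0Pr => e e0.
  pose e' := e / (2 * M0 + 1); have e'0 : 0 < e' by rewrite divr_gt0//; lra.
  pose P k := Gp k - 'X.
  have cP x : -1 < x < 1 -> (P k).[x] @[k --> \oo] --> vfun x.
    move=> hx; rewrite (_ : (fun k => (P k).[x]) = fun k => (Gp k).[x] - x).
      by apply: cvgB; [exact: Gp_cvg|exact: cvg_cst].
    by apply/funext => k; rewrite hornerD hornerN hornerX.
  have bP k x : -1 < x < 1 -> `|(P k).[x]| <= K + 1.
    move=> hx; rewrite hornerD hornerN hornerX (le_trans (ler_normB _ _))// lerD ?Gp_bound//.
    by rewrite ler_norml; exact: oo_cc.
  have [m0 hm0] := zpart_cvg hN bv cP bP e'0.
  pose m' := maxn m m0.
  have mm : (m <= m')%N by exact: leq_maxl.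
  have := hm0 m' (leq_maxr _ _); set J := zint N _ => hJ.
  have tail : zint N (fun x => rho x * (vp m' - vp m).[x] ^+ 2) <= C * (L - vsum m).
    apply: le_trans (hC _ _ (size_vpB mm) (phat_vpB mm (ltnW m1)) (phat_vpB mm m1)) _.
    by rewrite pform_vpB// ler_wpM2l// lerD2r.
  have zmin : zI (fun x => Num.min (rho x) M0).
    apply: (@zI_le _ _ _ rho) => //.
      by apply: measurable_minr; [exact: zI_mf zrho|exact: measurable_cst].
    by move=> x _; rewrite ger0_norm ?ge_min ?lexx// le_min rho_ge0.
  apply: (@le_trans _ _ (zint N (fun x => 2 * M0 * (vfun x - (vp m').[x]) ^+ 2 + 2 * (rho x * (vp m' - vp m).[x] ^+ 2)))).
    apply: zint_le => //.
    - exact: zI_bmf.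
    - apply: zID; apply: zIZ; first exact (bmf_zI hN (bvp m')).
      exact: zI_bmf.
    move=> x _; rewrite hornerD hornerN.
    set a := vfun x; set b := (vp m').[x]; set d := (vp m).[x].
    have i1 : Num.min (rho x) M0 <= M0 by rewrite ge_min lexx orbT.
    have i2 : Num.min (rho x) M0 <= rho x by rewrite ge_min lexx.
    have i0 : 0 <= Num.min (rho x) M0 by rewrite le_min rho_ge0.
    have j1 := ler_wpM2r (sqr_ge0 (a - b)) i1.
    have j2 := ler_wpM2r (sqr_ge0 (b - d)) i2.
    have j3 := mulr_ge0 i0 (sqr_ge0 (a - b - (b - d))).
    by nra.
  rewrite zintD; [|by apply: zIZ; exact (bmf_zI hN (bvp m'))|by apply: zIZ; exact: zI_bmf].
  rewrite (@zintZ R N (2 * M0) _ (bmf_zI hN (bvp m'))) (@zintZ R N 2); last exact: zI_bmf.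
  rewrite addrC lerD ?ler_wpM2l//.
  have : 2 * M0 * J <= 2 * M0 * e' by apply: ler_wpM2l; [rewrite mulr_ge0|exact: ltW].
  have : (2 * M0 + 1) * e' = e by rewrite /e' mulrC divfK// gt_eqF//; lra.
  by rewrite -/J; lra.
have full m : (1 < m)%N -> zint N (fun x => rho x * (vfun x - (vp m).[x]) ^+ 2) <= 2 * (C * (L - vsum m)).
  move=> m1.
  have f1 k : measurable_fun I (fun x => Num.min (rho x) k%:R * (vfun x - (vp m).[x]) ^+ 2).
    apply: measurable_funM; last by have [] := bvp m.
    by apply: measurable_minr; [exact: zI_mf zrho|exact: measurable_cst].
  have f2 x : -1 < x < 1 -> Num.min (rho x) k%:R * (vfun x - (vp m).[x]) ^+ 2 @[k --> \oo] -->
      rho x * (vfun x - (vp m).[x]) ^+ 2.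
    move=> hx; apply: cvgM; last exact: cvg_cst.
    apply: cvg_near_cst; near=> k; apply/min_idPl; apply: ltW; near: k.
    exact: nbhs_infty_gtr.
  have f3 k x : -1 < x < 1 -> `|Num.min (rho x) k%:R * (vfun x - (vp m).[x]) ^+ 2| <=
      rho x * (vfun x - (vp m).[x]) ^+ 2.
    move=> hx; have i0 : 0 <= Num.min (rho x) k%:R by rewrite le_min rho_ge0/=.
    rewrite (ger0_norm (mulr_ge0 i0 (sqr_ge0 _))).
    by rewrite ler_wpM2r ?sqr_ge0// ge_min lexx.
  have [_ hc] := zint_dct f1 f2 (zI_bmf zrho (bvp m)) f3.
  rewrite -(cvg_lim _ hc)//; apply: limr_le; first by apply/cvg_ex; eexists; exact: hc.
  by apply: nearW => k; exact: cut.
have cc : 2 * (C * (L - vsum m)) @[m --> \oo] --> (0 : R).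
  rewrite -[X in _ --> X](mulr0 2) -(mulr0 C) -(subrr L).
  apply: cvgM; first exact: cvg_cst; apply: cvgM; first exact: cvg_cst.
  by apply: cvgB; [exact: cvg_cst|exact: cE].
apply: (@squeeze_cvgr _ _ _ _ (fun=> 0) (fun m => 2 * (C * (L - vsum m)))) => //; last exact: cvg_cst.
near=> m; apply/andP; split.
  by apply: zint_ge0 => // x _; rewrite mulr_ge0 ?sqr_ge0.
by apply: full; near: m; exact: nbhs_infty_gt.
Unshelve. all: by end_near. Qed.

Lemma sq_cvg0 (d : nat -> R) (a : nat -> R) b : (forall m, d m ^+ 2 <= a m * b) ->
  a m @[m --> \oo] --> (0 : R) -> d m @[m --> \oo] --> (0 : R).
Proof.
move=> hd ha'; apply/norm_cvg0P.
apply: (@squeeze_cvgr _ _ _ _ (fun=> 0) (fun m => Num.sqrt (a m * b))).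
- apply: nearW => m; rewrite normr_ge0/= -sqrtr_sqr; exact: ler_wsqrtr.
- exact: cvg_cst.
- rewrite -[X in _ --> X]sqrtr0 -(mul0r b); apply: (@continuous_cvg _ _ _ _ _ _ Num.sqrt).
    exact: sqrt_continuous.
  by apply: cvgM => //; exact: cvg_cst.
Qed.

Lemma rint_vp_cvg f : bmf f ->
  zint N (fun x => rho x * (f x * (vp m).[x])) @[m --> \oo] --> zint N (fun x => rho x * (f x * vfun x)).
Proof.
move=> bf; have bd m : bmf (fun x => vfun x - (vp m).[x]) by apply: bmfB => //; exact: bmf_poly.
have e m : zint N (fun x => rho x * (f x * (vp m).[x])) =
    zint N (fun x => rho x * (f x * vfun x)) - zint N (fun x => rho x * ((vfun x - (vp m).[x]) * f x)).
  rewrite -rintB//; [|exact: bmfM..].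
  by apply: zint_ext => // x _; ring.
rewrite (funext e) -[X in _ --> X]subr0; apply: cvgB; first exact: cvg_cst.
apply: (@sq_cvg0 _ (fun m => zint N (fun x => rho x * (vfun x - (vp m).[x]) ^+ 2)) (zint N (fun x => rho x * f x ^+ 2))).
  by move=> m; exact: rint_cauchy_schwarz.
exact: rint_vp_cvg0.
Qed.

Lemma rint_vp2_cvg : zint N (fun x => rho x * (vp m).[x] ^+ 2) @[m --> \oo] --> zint N (fun x => rho x * vfun x ^+ 2).
Proof.
have bd m : bmf (fun x => (vfun x - (vp m).[x]) ^+ 2).
  by apply: bmf_exp2; apply: bmfB => //; exact: bmf_poly.
have bvp m : bmf (fun x => 2 * (vfun x * (vp m).[x])).
  by apply: bmfZ; apply: bmfM => //; exact: bmf_poly.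
have bv2 := bmf_exp2 bv.
have e m : zint N (fun x => rho x * (vp m).[x] ^+ 2) = zint N (fun x => rho x * (vfun x - (vp m).[x]) ^+ 2)
   - zint N (fun x => rho x * vfun x ^+ 2) + 2 * zint N (fun x => rho x * (vfun x * (vp m).[x])).
  rewrite -rintZ//; last by apply: bmfM => //; exact: bmf_poly.
  rewrite -rintB// -rintD//; last exact: bmfB.
  by apply: zint_ext => // x _; ring.
rewrite (funext e).
have h1 := rint_vp_cvg0; have h2 := rint_vp_cvg bv.
rewrite [X in _ --> X](_ : _ = 0 - zint N (fun x => rho x * vfun x ^+ 2)
    + 2 * zint N (fun x => rho x * (vfun x * vfun x))); last first.
  have -> : zint N (fun x => rho x * (vfun x * vfun x)) = zint N (fun x => rho x * vfun x ^+ 2).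
    by apply: zint_ext => // x _; rewrite expr2.
  ring.
apply: cvgD; last by apply: cvgM; [exact: cvg_cst|exact: h2].
by apply: cvgB; [exact: h1|exact: cvg_cst].
Qed.

(** In the limit of [stable_addX] along the partial sums, the integral of rho v^2 occurs on both
    sides and cancels. The rest is explicit in T, S, W and alpha, since the pairings of rho v with 1
    and x and the degree 1 coefficient of v are known. *)
Lemma stable_moment : 0 <= (T - S) * (T - alpha * W).
Proof.
have T0 := rint_sq_eq0; have n3 := @ge3 R N hN.
have NF : (0 : R) < N`!%:R by rewrite ltr0n fact_gt0.
pose P m := zint N (fun x => rho x * (vfun x * (vp m).[x])) + (1 - alpha) * zhat N vfun 1.
pose q m := zint N (fun x => rho x * (x * (vp m).[x])).
pose lhs m := zint N (fun x => rho x * (vp m).[x] ^+ 2) - q m ^+ 2 / T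
   - zint N (fun x => rho x * (1 * (vp m).[x])) ^+ 2 / W.
pose rhs m := P m + alpha * (- (2 * (q m / T) * zhat N vfun 1) + (q m / T) ^+ 2 * S).
have le m : (1 < m)%N -> lhs m <= rhs m.
  move=> m1; have := stable_addX (size_zpart hN vfun m) m1 (erefl (q m)).
  rewrite pform_vp phat_zpart// m1; set Y := (- _ + _).
  have -> : alpha * (vsum m + N`!%:R * Y) = N`!%:R * (P m + alpha * Y).
    by rewrite mulrDr vsum_rint// /P; ring.
  rewrite ler_pM2l//; congr (_ - _ ^+ 2 / W <= _).
  by apply: zint_ext => // x _; rewrite mul1r.
pose V := zint N (fun x => rho x * vfun x ^+ 2).
have cq : q m @[m --> \oo] --> - D.
  have := rint_vp_cvg bx; rewrite (_ : zint N _ = - D)//.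
  by rewrite -rint_vx; apply: zint_ext => // x _; rewrite [x * _]mulrC.
have c1 : zint N (fun x => rho x * (1 * (vp m).[x])) @[m --> \oo] --> (0 : R).
  have := rint_vp_cvg (bmf_cst 1); rewrite (_ : zint N _ = 0)//.
  by rewrite -rint_v; apply: zint_ext => // x _; rewrite mul1r.
have cv : zint N (fun x => rho x * (vfun x * (vp m).[x])) @[m --> \oo] --> V.
  have := rint_vp_cvg bv; rewrite (_ : zint N _ = V)//.
have sq (f : nat -> R) (l : R) : f m @[m --> \oo] --> l -> f m ^+ 2 @[m --> \oo] --> l ^+ 2.
  by move=> hf; rewrite expr2; apply: cvgM.
have cl : lhs m @[m --> \oo] --> V - (- D) ^+ 2 / T - 0 ^+ 2 / W.
  apply: cvgB; last by apply: cvgM; [exact: sq|exact: cvg_cst].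
  by apply: cvgB; [exact: rint_vp2_cvg|apply: cvgM; [exact: sq|exact: cvg_cst]].
have cr : rhs m @[m --> \oo] --> V + (1 - alpha) * zhat N vfun 1
    + alpha * (- (2 * (- D / T) * zhat N vfun 1) + (- D / T) ^+ 2 * S).
  apply: cvgD; first by apply: cvgD => //; exact: cvg_cst.
  apply: cvgM; first exact: cvg_cst.
  apply: cvgD; last by apply: cvgM; [apply: sq; apply: cvgM => //; exact: cvg_cst|exact: cvg_cst].
  apply: cvgN; apply: cvgM; last exact: cvg_cst.
  apply: cvgM; first exact: cvg_cst.
  by apply: cvgM => //; exact: cvg_cst.
have key : V - (- D) ^+ 2 / T - 0 ^+ 2 / W <= V + (1 - alpha) * zhat N vfun 1
    + alpha * (- (2 * (- D / T) * zhat N vfun 1) + (- D / T) ^+ 2 * S).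
  apply: (ler_cvg_to cl cr); near=> m; apply: le; near: m; exact: nbhs_infty_gt.
have TW := rint_sq_ltW.
have va := alpha_zhat_v1.
have D0 : 0 < D by rewrite divr_gt0 ?subr_gt0//; lra.
have S0 : 0 < S by rewrite divr_gt0//; lra.
set b := D / T; have b0 : 0 < b by rewrite divr_gt0.
(* Multiplied by alpha, and with alpha [zhat N vfun 1] replaced by (1 - alpha) S - D, the limit
   inequality factorizes. *)
have k1 : 0 <= (1 - alpha + alpha * b) * (S * (1 - alpha + alpha * b) - D).
  have -> : (1 - alpha + alpha * b) * (S * (1 - alpha + alpha * b) - D) =
    (1 - alpha) * ((1 - alpha) * S - D) + 2 * alpha * b * ((1 - alpha) * S - D) + alpha ^+ 2 * b ^+ 2 * S + alpha * b * D by ring.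
  rewrite -va.
  have -> : (1 - alpha) * (alpha * zhat N vfun 1) + 2 * alpha * b * (alpha * zhat N vfun 1) +
    alpha ^+ 2 * b ^+ 2 * S + alpha * b * D = alpha * (((1 - alpha) * zhat N vfun 1) +
      alpha * (2 * b * zhat N vfun 1 + b ^+ 2 * S) + b * D) by ring.
  rewrite mulr_ge0 ?(ltW a0)//.
  have -> : b * D = (- D) ^+ 2 / T by rewrite /b; ring.
  have -> : 2 * b * zhat N vfun 1 + b ^+ 2 * S = - (2 * (- D / T) * zhat N vfun 1) + (- D / T) ^+ 2 * S.
    by rewrite /b; ring.
  by move: key; rewrite expr0n mul0r subr0; lra.
have k2 : 0 < 1 - alpha + alpha * b.
  have /andP[_ a1] := ha; have := mulr_gt0 a0 b0; lra.
have k3 : 0 <= S * (1 - alpha + alpha * b) - D by rewrite pmulr_rge0 in k1.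
have -> : (T - S) * (T - alpha * W) = n * T * (S * (1 - alpha + alpha * b) - D).
  by rewrite /b; field; rewrite (gt_eqF T0) !gt_eqF//; lra.
by rewrite mulr_ge0// mulr_ge0// ltW.
Unshelve. all: by end_near. Qed.

(** Chosen so that the contributions of [pe j.+1] and [pe j.-1] in [moment_term] become [nuw j]
    times j + N - 1 and j times the two parts [ga j] and [gb j] of [zhat N G j]. *)
Definition nuw j : R := pe j.+1 / ((j%:R + n) * (j%:R + n - 1)).

Lemma nuw_gt0 j : 0 < nuw j.
Proof.
have n3 := @ge3 R N hN; have j0 : (0 : R) <= j%:R by [].
by rewrite divr_gt0 ?pe_gt0// mulr_gt0//; lra.
Qed.

Let ga j : R := (j%:R + n) * A j * zhat N u j.+1.
Let gb j : R := (j%:R - 1) * B j * zhat N u j.-1.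
Let gz j : R := nuw j * (j%:R + (n - 1) / 2) * ga j ^+ 2 / h j.
Let gy j : R := nuw j * (j%:R + (n - 1) / 2) * gb j ^+ 2 / h j.

(** The upper part of G in degree j and its lower part in degree j + 2 contain the same coefficient
    of u, and with this weight their squares agree: this is the telescoping. *)
Lemma gy_gz j : gy j.+2 = gz j.
Proof.
have n3 := @ge3 R N hN; have j0 : (0 : R) <= j%:R by [].
have r1 := @pe_rec R N hN j.+2; have r2 := @pe_rec R N hN j.+1.
have g1 := @znorm_rec R N hN j; have g2 := @znorm_rec R N hN j.+1.
have e1 : nuw j.+2 = pe j.+1 / ((j%:R + 2) * (j%:R + 1)).
  have jE1 : j.+1%:R = j%:R + 1 :> R by rewrite -natr1.
  have jE2 : j.+2%:R = j%:R + 2 :> R by rewrite -natr1 jE1; ring.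
  rewrite jE2 in r1; rewrite jE1 in r2; rewrite /nuw jE2.
  have -> : pe j.+3 = (j%:R + 2 + n) * (j%:R + 1 + n) * pe j.+1 / ((j%:R + 2) * (j%:R + 1)).
    apply: (@mulfI _ (j%:R + 2)); first by rewrite gt_eqF//; lra.
    rewrite r1; apply: (@mulfI _ (j%:R + 1)); first by rewrite gt_eqF//; lra.
    by rewrite mulrCA r2; field; rewrite !gt_eqF//; lra.
  by field; rewrite !gt_eqF//; lra.
have e2 : h j.+2 = h j * (B j.+1 * B j.+2) / (A j * A j.+1).
  have a1 := @upc_gt0 R N hN j; have a2 := @upc_gt0 R N hN j.+1.
  have -> : h j.+2 = B j.+2 * h j.+1 / A j.+1 by rewrite -g2; field; rewrite gt_eqF.
  have -> : h j.+1 = B j.+1 * h j / A j by rewrite -g1; field; rewrite gt_eqF.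
  by field; rewrite !gt_eqF.
rewrite /gy /gz e1 e2 /ga /gb /nuw /=.
have hj := h0 j; have pj : 0 < pe j.+1 by exact: pe_gt0.
move: (h j) (pe j.+1) (zhat N u j.+1) hj pj => H P X hj pj.
rewrite !(upc_def, downc_def) -[j.+2%:R]natr1 -[j.+1%:R]natr1.
by field; rewrite !gt_eqF//; lra.
Qed.

Lemma gz_ge0 j : 0 <= gz j.
Proof.
have n3 := @ge3 R N hN; have j0 : (0 : R) <= j%:R by [].
have h1 : 0 <= j%:R + (n - 1) / 2 :> R by lra.
by rewrite /gz divr_ge0 ?(ltW (h0 j))// mulr_ge0 ?sqr_ge0// mulr_ge0// ltW// nuw_gt0.
Qed.

Lemma sum_gz_gy m : 0 <= \sum_(j < m) (gz j - gy j).
Proof.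
have y0 : gy 0 = 0 by rewrite /gy /gb downc_def !mul0r mulr0 mul0r expr0n mulr0 mul0r.
have y1 : gy 1 = 0 by rewrite /gy /gb subrr !mul0r expr0n mulr0 mul0r.
have H k : \sum_(j < k.+2) (gz j - gy j) = gz k + gz k.+1.
  elim: k => [|k IH]; first by rewrite !big_ord_recr big_ord0 /= y0 y1 !subr0 add0r.
  by rewrite big_ord_recr IH /= gy_gz; ring.
case: m => [|[|m]]; first by rewrite big_ord0.
  by rewrite big_ord_recr big_ord0 /= y0 subr0 add0r gz_ge0.
by rewrite H addr_ge0 ?gz_ge0.
Qed.

(** With a = [ga j] and b = [gb j], this rests on ((j + N - 1) a + j b) (a - b) = (N - 1) / 2 (a -
    b)^2 + (j + (N - 1) / 2) (a^2 - b^2): a nonnegative square plus a telescoping difference. *)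
Lemma moment_term j : zhat N G j / h j * (A j * (pe j.+1 * zhat N u j.+1) + B j * (pe j.-1 * zhat N u j.-1))
  = (n - 1) / 2 * nuw j * zhat N G j ^+ 2 / h j + (gz j - gy j).
Proof.
have n3 := @ge3 R N hN; have j0 : (0 : R) <= j%:R by [].
have e1 : A j * (pe j.+1 * zhat N u j.+1) = nuw j * (j%:R + n - 1) * ga j.
  by rewrite /nuw /ga; field; rewrite !gt_eqF//; lra.
have e2 : B j * (pe j.-1 * zhat N u j.-1) = nuw j * j%:R * gb j.
  case: j {j0 e1} => [|j]; first by rewrite downc_def !mul0r mulr0 mul0r.
  rewrite /gb /= /nuw; have j0 : (0 : R) <= j%:R by [].
  have r1 := @pe_rec R N hN j.+1; have r2 := @pe_rec R N hN j.
  have jE1 : j.+1%:R = j%:R + 1 :> R by rewrite -natr1.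
  rewrite jE1 in r1 *.
  have -> : pe j.+2 = (j%:R + 1 + n) * pe j.+1 / (j%:R + 1).
    by rewrite -r1; field; rewrite gt_eqF//; lra.
  transitivity (B j.+1 * zhat N u j * (j%:R * pe j.+1) / (j%:R + n)).
    by rewrite r2; field; rewrite gt_eqF//; lra.
  by field; rewrite !gt_eqF//; lra.
rewrite e1 e2 zhatG -/(ga j) -/(gb j) /gz /gy.
by field; rewrite gt_eqF.
Qed.

Lemma moment_gt j0 : zhat N G j0 != 0 -> S < T.
Proof.
move=> g0; have n3 := @ge3 R N hN; have /andP[al1 al2] := ha.
pose K0 := alpha / F * ((n - 1) / 2 * nuw j0 * zhat N G j0 ^+ 2 / h j0).
have K00 : 0 < K0.
  rewrite mulr_gt0 ?divr_gt0// mulr_gt0 ?exprn_even_gt0//.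
  by rewrite mulr_gt0 ?nuw_gt0//; lra.
(* With the partial sum in place of G - x, the integral of (rho - 1) x G becomes a finite sum of the
   terms of [moment_term]. The square of index [j0] is kept and everything else is nonnegative. *)
have low m : (maxn 2 j0.+1 <= m)%N -> K0 <= zint N (fun x => rho x * (x * (vp m).[x])) + T - zhat N G 1.
  rewrite geq_max => /andP[m2 mj].
  have zxr := zI_mulx zrho.
  have -> : zint N (fun x => rho x * (x * (vp m).[x])) + T - zhat N G 1 =
     \sum_(k < m) zhat N G k / h k * (zhat N (fun x => x * rho x) k - (k == 1%N :> nat)%:R * S).
    have -> : zint N (fun x => rho x * (x * (vp m).[x])) = \sum_(k < m) zhat N vfun k * zhat N (fun x => x * rho x) k / h k.
      by rewrite -zint_mul_zpart//; apply: zint_ext => // x _; ring.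
    have d1 (F1 : nat -> R) : \sum_(k < m) (k == 1%N :> nat)%:R * F1 k = F1 1%N.
      rewrite (bigD1 (Ordinal m2))//= mul1r big1 ?addr0// => k hk.
      rewrite (_ : (k == 1%N :> nat) = false) ?mul0r//.
      by apply: contraNF hk => /eqP hk; apply/eqP/val_inj.
    have Te : T = zhat N (fun x => x * rho x) 1.
      by rewrite /zhat zonal1; apply: zint_ext => // x _; rewrite hornerX; ring.
    have S0 : h 1 != 0 by rewrite gt_eqF.
    have e1 := d1 (fun k => S / h k * zhat N (fun x => x * rho x) k).
    have e2 := d1 (fun k => zhat N G k / h k * S).
    rewrite -h1E !divff// mul1r -Te in e1; rewrite -h1E divfK// in e2.
    rewrite -e1 -e2 -big_split -sumrB /=; apply: eq_bigr => k _.
    by rewrite zhat_v -h1E; ring.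
  have e k : zhat N G k / h k * (zhat N (fun x => x * rho x) k - (k == 1%N :> nat)%:R * S) =
     alpha / F * ((n - 1) / 2 * nuw k * zhat N G k ^+ 2 / h k + (gz k - gy k)).
    rewrite -moment_term [RHS]mulrCA; congr (_ * _); rewrite zhatX// zhat_rhoS.
    case: k => [|[|k]].
    - by rewrite downc_def !mul0r; ring.
    - have := EL 0; rewrite pe0// mulr0 mul0r mul1r /= => /esym/eqP.
      rewrite mulf_eq0 (gt_eqF F0) /= subr_eq0 => /eqP ->.
      have -> : B 1 * W = S.
        by rewrite downc_def mul1r mulrC (_ : 2 * 1 + n - 1 = n + 1)//; ring.
      by rewrite mul1r mulr0; ring.
    - by rewrite /= zhat_rhoS mul0r; ring.
  under eq_bigr do rewrite e.
  rewrite -mulr_sumr big_split /= /K0 ler_wpM2l ?divr_ge0 ?(ltW a0)//.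
  apply: (@le_trans _ _ (\sum_(k < m) (n - 1) / 2 * nuw k * zhat N G k ^+ 2 / h k)); last first.
    by rewrite lerDl sum_gz_gy.
  rewrite (bigD1 (Ordinal mj))//= lerDl; apply: sumr_ge0 => k _.
  rewrite divr_ge0 ?(ltW (h0 k))// mulr_ge0 ?sqr_ge0// mulr_ge0 ?(ltW (nuw_gt0 k))//; lra.
have lim : zint N (fun x => rho x * (x * (vp m).[x])) + T - zhat N G 1 @[m --> \oo] --> - D + T - zhat N G 1.
  apply: cvgB; last exact: cvg_cst; apply: cvgD; last exact: cvg_cst.
  have := rint_vp_cvg bx; rewrite (_ : zint N _ = - D)//.
  by rewrite -rint_vx; apply: zint_ext => // x _; rewrite [x * _]mulrC.
have le : K0 <= - D + T - zhat N G 1.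
  rewrite -(cvg_lim _ lim)//; apply: limr_ge; first by apply/cvg_ex; eexists; exact: lim.
  near=> m; apply: low; near: m; exact: nbhs_infty_ge.
have ag := alpha_zhat_G1.
have p : 0 < alpha * (- D + T - zhat N G 1) by rewrite mulr_gt0// (lt_le_trans K00).
(* By [alpha_zhat_G1] and D = (W - T) / N, the limit is a multiple of T - S whose sign is that of
   alpha (N + 1) - 1. *)
have e : alpha * (- D + T - zhat N G 1) = (T - S) * (alpha * (n + 1) - 1) / n.
  rewrite mulrBr ag; field; rewrite !gt_eqF//; lra.
rewrite e in p; rewrite -subr_gt0.
have q : 0 < alpha * (n + 1) - 1 by nra.
have n0 : (0 : R) < n by lra.
by rewrite pmulr_lgt0 ?invr_gt0// pmulr_lgt0 in p.
Unshelve. all: by end_near. Qed.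

Lemma stable_zhat0 : T < alpha * W -> forall k, zhat N u k.+1 = 0.
Proof.
move=> TW; have n3 := @ge3 R N hN.
have G0 j : zhat N G j = 0.
  apply/eqP; apply: contraPT TW => /moment_gt ST; apply/negP; rewrite -leNgt.
  by have := stable_moment; rewrite pmulr_rge0 ?subr_gt0// subr_ge0.
(* A vanishing coefficient of G in degree k ties u in degree k + 1 to u in degree k - 1; for k = 0
   and k = 1 the lower term has a zero factor. *)
elim/ltn_ind => k IH; have /eqP := zhatG k; rewrite G0 eq_sym subr_eq0.
rewrite [X in _ == X](_ : _ = 0); last first.
  case: k IH => [|[|k]] IH; first by rewrite downc_def !mul0r mulr0 mul0r.
    by rewrite subrr !mul0r.
  by rewrite IH// mulr0.
rewrite mulf_eq0 gt_eqF ?orFb; first by move/eqP.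
by rewrite mulr_gt0 ?upc_gt0// ltr_wpDl//; lra.
Qed.

End Stability.

(** * Sobolev regularity and the Paneitz form under polynomial perturbations *)

Section Sobolev.
Context {R : realType}.
Variable N : nat.
Hypothesis hN : (3 <= N)%N.
Implicit Types (p q : {poly R}) (x y t a b : R) (k j m : nat) (f g u v : R -> R).
Local Notation n := (N%:R : R).
Local Notation mu := (@lebesgue_measure R).
Local Notation I := (`](-1)%R, 1%R[%classic : set R).
Local Notation J := (`[(-1)%R, 1%R]%classic : set R).
Local Notation c := (@zonal R N).
Local Notation w := (@zweight R N).
Local Notation zI := (@zI R N).
Local Notation h := (@znorm R N).
Local Notation pe := (@paneitz_eig R N).

Lemma IsubJ : I `<=` J.
Proof. by move=> x; rewrite /= !in_itv /= => /andP[h1 h2]; rewrite !ltW. Qed.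

(** It serves for e^(N u) before this is known to be integrable. Positive and negative parts are
    scaled separately, and an infinite integral has value 0 under [fine] on both sides. *)
Lemma zint_exprM f b : measurable_fun J f -> zint N (fun x => expR b * f x) = expR b * zint N f.
Proof.
move=> mf; rewrite /zint /Rintegral.
set g := fun x => (w x * f x)%:E.
have mg : measurable_fun J g.
  apply/measurable_EFinP; apply: measurable_funM => //.
  by apply: measurable_funS (@measurable_zweight R N).
have mJ : measurable (J : set (measurableTypeR R)) by exact: measurable_itv.
have e0 : (0 <= expR b)%R by exact: expR_ge0.
have -> : (\int[mu]_(x in J) (w x * (expR b * f x))%:E = \int[mu]_(x in J) ((expR b)%:E * g x))%E.
  by apply: eq_integral => x _; rewrite /g -EFinM mulrCA.
have I1 : (\int[mu]_(x in J) ((expR b)%:E * g x) =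
    \int[mu]_(x in J) ((expR b)%:E * g^\+ x) - \int[mu]_(x in J) ((expR b)%:E * g^\- x))%E.
  rewrite integralE; congr (_ - _)%E; apply: eq_integral => x _.
    by rewrite !funeposE maxe_pMr// mule0.
  by rewrite !funenegE -muleN maxe_pMr// mule0.
have I2 : (\int[mu]_(x in J) g x = \int[mu]_(x in J) g^\+ x - \int[mu]_(x in J) g^\- x)%E.
  by rewrite integralE.
rewrite I1 I2.
rewrite !ge0_integralZl//; first last.
- exact: measurable_funepos.
- exact: measurable_funeneg.
have : (0 <= \int[mu]_(x in J) g^\+ x)%E by apply: integral_ge0 => x _; exact: funepos_ge0.
have : (0 <= \int[mu]_(x in J) g^\- x)%E by apply: integral_ge0 => x _; exact: funeneg_ge0.
have eb : (0 < (expR b)%:E)%E by rewrite lte_fin expR_gt0.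
move: (\int[mu]_(x in J) g^\+ x)%E (\int[mu]_(x in J) g^\- x)%E => [a| |] [d| |] //= _ _;
  rewrite ?(gt0_muley eb)//= ?mulr0//.
by rewrite mulrBr.
Qed.

Lemma zsobolev_zI u : zsobolev N u -> zI u.
Proof.
move=> [mu1 i2 _].
have mI := @mIo R.
have m1 : measurable_fun I u by apply: measurable_funS mu1 => //; exact: IsubJ.
have i1 : zI (fun x => u x ^+ 2) by apply: integrableS i2 => //; exact: IsubJ.
apply: (@zI_le _ _ _ (fun x => 1 + u x ^+ 2)) => //.
  by apply: zID => //; exact: zI_cst.
move=> x _; have := sqr_ge0 (`|u x| - 1).
by rewrite -(@real_normK _ (u x)) ?num_real//; have := normr_ge0 (u x); nra.
Qed.

Lemma zcoefE u k : zI u -> zcoef N u k = zhat N u k / Num.sqrt (h k).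
Proof.
move=> zu; have g0 := @geg1_gt0 R N hN k; rewrite /zcoef.
have -> : zint N (fun x => u x * (gegenbauer N k).[x]) = (gegenbauer N k).[1] * zhat N u k.
  rewrite -zintZ; last exact: zI_mulpr.
  by apply: zint_ext => // x _; rewrite [in LHS](gegenbauerE hN) hornerZ mulrCA.
have -> : zint N (fun x => (gegenbauer N k).[x] ^+ 2) = (gegenbauer N k).[1] ^+ 2 * h k.
  rewrite -zintZ; last exact: zI_poly.
  by apply: zint_ext => // x _; rewrite [in LHS](gegenbauerE hN) hornerZ exprMn hornerM.
rewrite sqrtrM ?sqr_ge0// sqrtr_sqr gtr0_norm// -mulf_div divff ?mul1r// gt_eqF//.
Qed.

Lemma zcoef_sq u k : zI u -> zcoef N u k ^+ 2 = zhat N u k ^+ 2 / h k.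
Proof.
by move=> zu; rewrite zcoefE// exprMn exprVn sqr_sqrtr// ltW// znorm_gt0.
Qed.

Lemma nneseries_ltyP (s : nat -> R) : (forall k, 0 <= s k) ->
  (\sum_(0 <= k <oo) (s k)%:E < +oo)%E <-> exists M, forall m, \sum_(k < m) s k <= M.
Proof.
move=> s0; have s0' k : (0 <= (s k)%:E)%E by rewrite lee_fin.
split.
  move=> hs; exists (fine (\sum_(0 <= k <oo) (s k)%:E)%E) => m.
  rewrite -lee_fin fineK; last by rewrite ge0_fin_numE// nneseries_ge0.
  rewrite -sumEFin -(big_mkord xpredT (fun k => (s k)%:E)).
  exact: nneseries_lim_ge.
move=> [M hM]; apply: le_lt_trans (ltry M); apply: lime_le.
  exact: is_cvg_nneseries.
apply: nearW => m; rewrite big_mkord sumEFin lee_fin; exact: hM.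
Qed.

Lemma fine_nneseries (s : nat -> R) M : (forall k, 0 <= s k) -> (forall m, \sum_(k < m) s k <= M) ->
  \sum_(k < m) s k @[m --> \oo] --> fine (\sum_(0 <= k <oo) (s k)%:E)%E.
Proof.
move=> s0 hM.
have cs : cvgn (fun m => \sum_(k < m) s k).
  apply: nondecreasing_is_cvgn.
    move=> m m' mm; rewrite (big_ord_widen _ s mm) big_mkcond /=.
    by apply: ler_sum => k _; case: ifP.
  by exists M => _ [m _ <-].
rewrite (_ : (\sum_(0 <= k <oo) (s k)%:E)%E = (limn (fun m => \sum_(k < m) s k))%:E)//.
rewrite -EFin_lim//; congr (limn _); apply/funext => m.
by rewrite /= big_mkord sumEFin.
Qed.

Lemma sobolev_pos k : 0 < (1 + lap_eig N k) `^ (n / 2) :> R.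
Proof.
apply: powR_gt0; have n3 := @ge3 R N hN; have k0 : (0 : R) <= k%:R by [].
by rewrite /lap_eig ltr_pwDl// mulr_ge0//; lra.
Qed.

Lemma sobolev_ltyP u : (sobolev_sqnorm N u < +oo)%E <->
  exists M, forall m, \sum_(k < m) (1 + lap_eig N k) `^ (n / 2) * zcoef N u k ^+ 2 <= M.
Proof.
by apply: nneseries_ltyP => k; rewrite mulr_ge0 ?sqr_ge0// ltW// sobolev_pos.
Qed.

Lemma zcoefD u p k : zI u -> zcoef N (fun x => u x + p.[x]) k = zcoef N u k + zcoef N (horner p) k.
Proof.
move=> zu; have zp := zI_poly hN p.
by rewrite !zcoefE//; [rewrite zhatD// mulrDl|exact: zID].
Qed.

Lemma zcoef_big p k : (size p <= k)%N -> zcoef N (horner p) k = 0.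
Proof. by move=> sp; rewrite zcoefE ?zhat_horner// ?phat_big// ?mul0r//; exact: zI_poly. Qed.

Lemma sum_widen_const (s : nat -> R) m m' : (m <= m')%N -> (forall k, (m <= k)%N -> s k = 0) ->
  \sum_(k < m') s k = \sum_(k < m) s k.
Proof.
move=> mm s0; rewrite (big_ord_widen _ s mm) [RHS]big_mkcond /=; apply: eq_bigr => k _.
by case: ltnP => // /s0.
Qed.

Lemma sum_bounded_of_big (s : nat -> R) m : (forall k, 0 <= s k) -> (forall k, (m <= k)%N -> s k = 0) ->
  forall m', \sum_(k < m') s k <= \sum_(k < m) s k.
Proof.
move=> s0 hs m'; have [mm|/ltnW mm] := leqP m m'; first by rewrite (sum_widen_const mm hs).
rewrite (big_ord_widen _ s mm) big_mkcond /=; apply: ler_sum => k _; by case: ifP.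
Qed.

Lemma zsobolevD u p : zsobolev N u -> zsobolev N (fun x => u x + p.[x]).
Proof.
move=> hu; have zu := zsobolev_zI hu; case: hu => [mu1 i2 /sobolev_ltyP[M hM]].
have mp : measurable_fun J (horner p) by exact: measurable_horner.
have mJ : measurable (J : set (measurableTypeR R)) by exact: measurable_itv.
split.
- exact: measurable_funD.
- have [K [K0 hK]] := horner_bound p.
  have ic : mu.-integrable J (fun x => (K ^+ 2)%:E).
    apply/integrableP; split; first exact: measurable_cst.
    rewrite integral_cst//= lebesgue_measure_itv /=; case: ifP => _; last by rewrite mule0 ltry.
    by rewrite -EFinB -EFinM ltry.
  have i3 : mu.-integrable J (fun x => (2%:E * (w x * u x ^+ 2)%:E + 2%:E * (K ^+ 2)%:E)%E).
    by apply: integrableD => //; apply: integrableZl.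
  have w1 x : J x -> w x <= 1.
    rewrite /= in_itv /= => hx; have n3 := @ge3 R N hN; have hx2 := sq_le1 hx.
    have h0 : 0 <= 1 - x ^+ 2 by rewrite subr_ge0.
    rewrite -[leRHS](congr1 (@^~ ((n - 2) / 2)) (powR1 R)) /zweight.
    apply: ge0_ler_powR; rewrite ?nnegrE ?ler01// ?gerBl ?sqr_ge0//.
    by rewrite divr_ge0//; lra.
  apply: (le_integrable mJ _ _ i3).
    apply/measurable_EFinP; apply: measurable_funM.
      by apply: measurable_funS (@measurable_zweight R N).
    by apply: measurable_funX; exact: measurable_funD.
  move=> x Jx; rewrite -!EFinM -EFinD !abse_EFin lee_fin.
  have w0 := @zweight_ge0 R N x; have hp : `|p.[x]| <= K by apply: hK; move: Jx; rewrite /= in_itv.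
  have hp2 : p.[x] ^+ 2 <= K ^+ 2 by rewrite -[p.[x] ^+ 2]real_normK ?num_real// lerXn2r ?nnegrE.
  have ww := w1 x Jx.
  rewrite (ger0_norm (mulr_ge0 w0 (sqr_ge0 _))); apply: le_trans (ler_norm _).
  have h1 : (u x + p.[x]) ^+ 2 <= 2 * u x ^+ 2 + 2 * K ^+ 2.
    by have := sqr_ge0 (u x - p.[x]); nra.
  have := ler_wpM2l w0 h1; have : w x * K ^+ 2 <= K ^+ 2 by rewrite ler_piMl ?sqr_ge0.
  lra.
- apply/sobolev_ltyP.
  pose s k := (1 + lap_eig N k) `^ (n / 2) * zcoef N (horner p) k ^+ 2.
  have s0 k : 0 <= s k by rewrite mulr_ge0 ?sqr_ge0// ltW// sobolev_pos.
  have sb : forall k, (size p <= k)%N -> s k = 0.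
    by move=> k hk; rewrite /s zcoef_big// expr0n mulr0.
  exists (2 * M + 2 * \sum_(k < size p) s k) => m.
  apply: le_trans (_ : 2 * (\sum_(k < m) (1 + lap_eig N k) `^ (n / 2) * zcoef N u k ^+ 2) + 2 * (\sum_(k < m) s k) <= _); last first.
    by rewrite lerD// ler_wpM2l//; exact: sum_bounded_of_big.
  rewrite !mulr_sumr -big_split /=; apply: ler_sum => k _; rewrite zcoefD// /s.
  have := sobolev_pos k; move: (_ `^ _) (zcoef N u k) (zcoef N (horner p) k) => P a b P0.
  by have := mulr_ge0 (ltW P0) (sqr_ge0 (a - b)); nra.
Qed.

Lemma zsobolev_poly p : zsobolev N (horner p).
Proof.
have h0 : zsobolev N (fun=> 0 : R).
  have z0 : zI (fun=> 0 : R) by exact: zI_cst.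
  split; first exact: measurable_cst.
    have -> : (fun x : R => (w x * 0 ^+ 2)%:E) = (fun=> 0%E) by apply/funext => x; rewrite expr2 !mulr0.
    exact: integrable0.
  apply/sobolev_ltyP; exists 0 => m; rewrite big1// => k _.
  by rewrite zcoef_sq// (_ : zhat _ _ _ = 0) ?expr0n ?mul0r ?mulr0// /zhat;
    under eq_fun do rewrite mul0r; exact: zint0.
by have := zsobolevD p h0; rewrite (_ : (fun x => 0 + p.[x]) = horner p)//; apply/funext => x; rewrite add0r.
Qed.

(** The curves of [admissible_line] are nonlinear only in their x component, so every remainder in
    their differentiation is a multiple of x, and this is the only Sobolev norm to compute. *)
Lemma sobolev_norm_scaleX : exists K, forall a, sobolev_norm N (fun x => a * x) = K * `|a|.
Proof.
pose s (a : R) k := (1 + lap_eig N k) `^ (n / 2) * zcoef N (fun x => a * x) k ^+ 2.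
have zx : zI (fun x : R => x) by exact (bmf_zI hN (@bmf_id R)).
have s0 a k : 0 <= s a k by rewrite mulr_ge0 ?sqr_ge0// ltW// sobolev_pos.
have sE a k : s a k = a ^+ 2 * s 1 k.
  rewrite /s !zcoef_sq; [|exact: zIZ..]; rewrite !zhatZ// mul1r exprMn; ring.
have s1 k : (2 <= k)%N -> s 1 k = 0.
  move=> k2; rewrite /s (_ : (fun x => 1 * x) = horner 'X); last by apply/funext => x; rewrite hornerX mul1r.
  by rewrite zcoef_big ?size_polyX// expr0n mulr0.
exists (Num.sqrt (\sum_(k < 2) s 1 k)) => a.
rewrite /sobolev_norm /sobolev_sqnorm -/(s a).
have sa k : (2 <= k)%N -> s a k = 0 by move=> /s1 e; rewrite sE e mulr0.
have c1 := fine_nneseries (s0 a) (sum_bounded_of_big (s0 a) sa).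
have c2 : \sum_(k < m) s a k @[m --> \oo] --> \sum_(k < 2) s a k.
  apply: cvg_near_cst; near=> m; apply: sum_widen_const => //; near: m; exact: nbhs_infty_ge.
rewrite (cvg_unique _ c1 c2)//.
under eq_bigr do rewrite sE.
by rewrite -mulr_sumr sqrtrM ?sqr_ge0// sqrtr_sqr mulrC.
Unshelve. all: by end_near. Qed.

Lemma pe_le_sobolev : exists C, 0 <= C /\ forall k, pe k <= C * (1 + lap_eig N k) `^ (n / 2).
Proof.
have n3 := @ge3 R N hN.
(* With L the Laplace eigenvalue, each factor of the product is at most N^2 (1 + L), and the square
   root present for odd N is at most N times that of 1 + L. *)
exists (n * (n ^+ 2) ^+ N./2); split; first by rewrite mulr_ge0// exprn_ge0// exprn_ge0//; lra.
move=> k; rewrite /paneitz_eig; set L := lap_eig N k.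
have L0 : 0 <= L by rewrite /L /lap_eig mulr_ge0//; have k0 : (0 : R) <= k%:R by []; lra.
have pr : \prod_(i < N./2) (L + i%:R * (n - i%:R - 1)) <= (n ^+ 2) ^+ N./2 * (1 + L) ^+ N./2.
  rewrite -exprMn -[N./2 in leRHS]card_ord -prodr_const; apply: ler_prod => i _.
  have iN : (i%:R : R) <= n - 1.
    have : (i.+1 <= N)%N by rewrite (leq_trans (ltn_ord i))// -divn2 leq_div.
    by rewrite -(ler_nat R) -natr1; lra.
  have i0 : (0 : R) <= i%:R by [].
  move: (i%:R : R) iN i0 => z iN i0; apply/andP; split; first by rewrite addr_ge0// mulr_ge0//; lra.
  have h1 : z * (n - z - 1) <= n * n by apply: ler_pM; lra.
  have h2 : L <= n * n * L by rewrite ler_peMl//; nra.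
  by rewrite expr2; lra.
have -> : (1 + L) `^ (n / 2) = (if odd N then Num.sqrt (1 + L) else 1) * (1 + L) ^+ N./2.
  have NE : n = (odd N)%:R + (N./2)%:R * 2 :> R.
    by rewrite -[in LHS](odd_double_half N) natrD -muln2 natrM.
  have L1 : 0 < 1 + L by lra.
  rewrite {1}NE mulrDl mulfK ?pnatr_eq0// powRD; last by rewrite (gt_eqF L1) implybT.
  rewrite powR_mulrn ?(ltW L1)//; congr (_ * _).
  by case: (odd N); rewrite ?mul0r ?powRr0// div1r powR12_sqrt// ltW.
have p0 : 0 <= (n ^+ 2) ^+ N./2 * (1 + L) ^+ N./2.
  by rewrite mulr_ge0// exprn_ge0// ?sqr_ge0//; lra.
have hs : (if odd N then Num.sqrt (L + ((n - 1) / 2) ^+ 2) else 1) <= n * (if odd N then Num.sqrt (1 + L) else 1).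
  case: ifP => _; last by lra.
  have -> : n = Num.sqrt (n ^+ 2) by rewrite sqrtr_sqr ger0_norm//; lra.
  rewrite -sqrtrM ?sqr_ge0//; apply: ler_wsqrtr.
  rewrite sqrtr_sqr ger0_norm; last lra.
  have h2 : L <= n * n * L by rewrite ler_peMl//; nra.
  have h3 : ((n - 1) / 2) ^+ 2 <= n * n by nra.
  by rewrite [n ^+ 2]expr2; lra.
have -> : n * (n ^+ 2) ^+ N./2 * ((if odd N then Num.sqrt (1 + L) else 1) * (1 + L) ^+ N./2) =
  (n * (if odd N then Num.sqrt (1 + L) else 1)) * ((n ^+ 2) ^+ N./2 * (1 + L) ^+ N./2) by ring.
apply: ler_pM => //.
- by case: ifP => // _; exact: sqrtr_ge0.
- apply: prodr_ge0 => i _; rewrite addr_ge0// mulr_ge0//.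
  have : (i.+1 <= N)%N by rewrite (leq_trans (ltn_ord i))// -divn2 leq_div.
  by rewrite -(ler_nat R) -natr1; lra.
Qed.

Lemma zsobolev_reg u : zsobolev N u -> exists M, forall m, \sum_(k < m) pe k / h k * zhat N u k ^+ 2 <= M.
Proof.
move=> hu; have zu := zsobolev_zI hu; case: hu => [_ _ /sobolev_ltyP[M hM]].
have [C [C0 hC]] := pe_le_sobolev; exists (C * M) => m.
apply: le_trans (_ : C * (\sum_(k < m) (1 + lap_eig N k) `^ (n / 2) * zcoef N u k ^+ 2) <= _); last first.
  by rewrite ler_wpM2l.
rewrite mulr_sumr; apply: ler_sum => k _; rewrite zcoef_sq//.
have X0 : 0 <= zhat N u k ^+ 2 / h k by rewrite divr_ge0 ?sqr_ge0// ltW// znorm_gt0.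
have := ler_wpM2r X0 (hC k); congr (_ <= _); ring.
Qed.

Lemma zhat_addp u p k : zI u -> zhat N (fun x => u x + p.[x]) k = zhat N u k + phat N p k.
Proof. by move=> zu; rewrite zhatD ?zhat_horner//; exact: zI_poly. Qed.

Lemma paneitz_formD u p m : zsobolev N u -> (size p <= m)%N ->
  paneitz_form N (fun x => u x + p.[x]) = paneitz_form N u
    + 2 * (\sum_(k < m) pe k / h k * (zhat N u k * phat N p k))
    + \sum_(k < m) pe k / h k * phat N p k ^+ 2.
Proof.
move=> hu sp; have zu := zsobolev_zI hu; have hup := zsobolevD p hu; have zup := zsobolev_zI hup.
have lim v : zsobolev N v -> \sum_(k < m) pe k / h k * zhat N v k ^+ 2 @[m --> \oo] --> paneitz_form N v.
  move=> hv; have zv := zsobolev_zI hv; have [M hM] := zsobolev_reg hv.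
  have e k : pe k * zcoef N v k ^+ 2 = pe k / h k * zhat N v k ^+ 2.
    by rewrite zcoef_sq//; ring.
  rewrite /paneitz_form; under eq_eseriesr do rewrite e.
  apply: (@fine_nneseries _ M) => // k.
  by rewrite mulr_ge0 ?sqr_ge0// divr_ge0 ?pe_ge0// ltW// znorm_gt0.
apply: (cvg_unique _ (lim _ hup)) => //.
set B := \sum_(k < m) _ * (_ * _); set A := \sum_(k < m) _ * _ ^+ 2.
have e m' : (m <= m')%N -> \sum_(k < m') pe k / h k * zhat N (fun x => u x + p.[x]) k ^+ 2 =
    \sum_(k < m') pe k / h k * zhat N u k ^+ 2 + 2 * B + A.
  move=> mm; have pb k : (m <= k)%N -> phat N p k = 0 by move=> mk; apply: phat_big => //; exact: leq_trans mk.
  rewrite /B -(@sum_widen_const (fun k => pe k / h k * (zhat N u k * phat N p k)) m m')//; last first.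
    by move=> k /pb ->; rewrite !mulr0.
  rewrite /A -(@sum_widen_const (fun k => pe k / h k * phat N p k ^+ 2) m m')//; last first.
    by move=> k /pb ->; rewrite expr0n mulr0.
  rewrite mulr_sumr -!big_split /=; apply: eq_bigr => k _; rewrite zhat_addp//; ring.
apply: cvg_trans (_ : (\sum_(k < m') pe k / h k * zhat N u k ^+ 2 + 2 * B + A @[m' --> \oo]) --> _).
  by apply: near_eq_cvg; near=> m'; rewrite e//; near: m'; exact: nbhs_infty_ge.
apply: cvgD; last exact: cvg_cst; apply: cvgD; last exact: cvg_cst.
exact: lim.
Unshelve. all: by end_near. Qed.

End Sobolev.

(** * Solving the constraint along a polynomial direction *)

Section ConstraintCurve.
Context {R : realType}.
Variable N : nat.
Hypothesis hN : (3 <= N)%N.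
Implicit Types (p q : {poly R}) (x y s t a b d : R) (k j m : nat).
Local Notation n := (N%:R : R).
Local Notation I := (`](-1)%R, 1%R[%classic : set R).
Local Notation zI := (@zI R N).

Lemma expR_taylor1 (z : R) : `|expR z - 1 - z| <= z ^+ 2 * expR `|z|.
Proof.
have h1 := expR_ge1Dx z; rewrite ger0_norm; last lra.
have [z0|z0] := leP 0 z.
  have h2 := expR_ge1Dx (- z); rewrite expRN in h2.
  rewrite ger0_norm//; have e0 := expR_gt0 z; set E := expR z in h1 h2 e0 *.
  have h3 : (1 - z) * E <= 1 by rewrite -ler_pdivlMr// mul1r; lra.
  have h4 : E - 1 <= z * E by lra.
  have := ler_wpM2l z0 h4; nra.
have h2 := expR_ge1Dx (- z); rewrite expRN in h2.
have e0 := expR_gt0 z; rewrite ltr0_norm// expRN; set E := expR z in h1 h2 e0 *.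
have h3 : (1 - z) * E <= 1 by rewrite -ler_pdivlMr// mul1r; lra.
have h4 : 1 <= E^-1 by lra.
have h5 : E - 1 - z <= z ^+ 2 by nra.
by apply: le_trans h5 _; rewrite ler_peMr// sqr_ge0.
Qed.

Lemma norm_le2 (z : R) : `|z| <= 1 -> `|z| <= 2.
Proof. by move=> h; apply: le_trans h _; rewrite ler1n. Qed.

Lemma lip_continuous (f : R -> R) t d C : 0 < d -> 0 <= C ->
  (forall t', `|t' - t| < d -> `|f t' - f t| <= C * `|t' - t|) -> {for t, continuous f}.
Proof.
move=> d0 C0 hf; apply/cvgrPdist_le => eps eps0; near=> t'.
have t1 : `|t - t'| < d by near: t'; apply: cvgr_dist_lt => //.
have t2 : `|t - t'| < eps / (C + 1).
  by near: t'; apply: cvgr_dist_lt => //; rewrite divr_gt0//; lra.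
rewrite distrC in t1; have := hf t' t1; rewrite distrC => hh; apply: le_trans hh _.
move: t2; rewrite ltr_pdivlMr; last by lra.
by rewrite distrC; move: (`|t' - t|) (normr_ge0 (t' - t)) => z z0; nra.
Unshelve. all: by end_near. Qed.

Lemma is_derive_quad (g : R -> R) s l C d : 0 < d ->
  (forall h, `|h| < d -> `|g (s + h) - g s - l * h| <= C * h ^+ 2) -> is_derive s 1 g l.
Proof.
move=> d0 hg.
have C0 : 0 <= C.
  have hd : 0 < d / 2 by rewrite divr_gt0.
  have := hg (d / 2); rewrite ger0_norm ?(ltW hd)// => /(_ _).
  have hd2 : d / 2 < d by lra.
  move=> /(_ hd2) H; have := le_trans (normr_ge0 _) H.
  by rewrite pmulr_lge0// exprn_gt0.
have cv : h^-1 *: ((g \o shift s) (h *: 1) - g s) @[h --> 0^'] --> l.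
  apply/cvgrPdist_le => e e0.
  near=> h.
  have h0 : h != 0 by near: h; exact: nbhs_dnbhs_neq.
  have hd : `|h| < d.
    near: h; apply: dnbhs0_lt; exact: d0.
  have he : `|h| < e / (C + 1).
    near: h; apply: dnbhs0_lt; rewrite divr_gt0//; lra.
  rewrite /= /GRing.scale /= mulr1 [h + s]addrC.
  have hh := hg h hd.
  have -> : l - h^-1 * (g (s + h) - g s) = - (h^-1 * (g (s + h) - g s - l * h)) by field.
  rewrite normrN normrM normfV ler_pdivrMl ?normr_gt0//.
  apply: le_trans hh _; rewrite -[h ^+ 2]real_normK ?num_real//.
  have h1 : `|h| * (C + 1) < e by rewrite -ltr_pdivlMr//; lra.
  have := normr_ge0 h; nra.
apply: DeriveDef; first by apply/cvg_ex; exists l.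
exact: cvg_lim cv.
Unshelve. all: by end_near. Qed.

Variables (rho : R -> R) (eta : {poly R}).
Hypothesis zrho : zI rho.
Hypothesis rho_gt0 : forall x, 0 < rho x.
Hypothesis rhox : zint N (fun x => rho x * x) = 0.

Local Notation tilt s t := (fun x : R => expR (n * (s * eta.[x] + t * x))).

Lemma bmf_tilt s t : bmf (tilt s t).
Proof.
have [mp [M hM]] : bmf (horner (n *: (s *: eta + t *: 'X))) by exact: bmf_poly.
split.
  apply: (@eq_measurable_fun _ _ _ _ _ (expR \o horner (n *: (s *: eta + t *: 'X)))).
    by move=> x _ /=; rewrite !(hornerZ, hornerD, hornerX).
  by apply: measurableT_comp.
exists (expR M) => x hx; rewrite ger0_norm ?expR_ge0// ler_expR.
by apply: le_trans (ler_norm _) _; have := hM x hx; rewrite !(hornerZ, hornerD, hornerX).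
Qed.

(** When rho is proportional to e^(N u), this is, up to a constant, the integral of p against e^(N
    (u + s eta + t x)); the constraint on tau becomes [tilted 'X s (tau s)] = 0. *)
Definition tilted p s t : R := zint N (fun x => rho x * (p.[x] * tilt s t x)).

Let bpt p s t : bmf (fun x => p.[x] * tilt s t x).
Proof. by apply: bmfM; [exact: bmf_poly|exact: bmf_tilt]. Qed.

Lemma tilted00 p : tilted p 0 0 = zint N (fun x => rho x * p.[x]).
Proof. by apply: zint_ext => // x _; rewrite !mul0r addr0 mulr0 expR0 mulr1. Qed.

Let rho1_ge0 : 0 <= zint N rho.
Proof. by apply: zint_ge0 => // x _; rewrite ltW. Qed.

Section Bounds.
Variable M : R.
Hypothesis M0 : 0 <= M.
Hypothesis hM : forall x, -1 <= x <= 1 -> `|eta.[x]| <= M.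

Lemma tilt_arg_le s t x : -1 < x < 1 -> `|s| <= 2 -> `|t| <= 2 ->
  `|n * (s * eta.[x] + t * x)| <= 2 * n * (M + 1).
Proof.
move=> hx hs ht; rewrite normrM (@ger0_norm _ n)// [2 * n]mulrC -mulrA ler_wpM2l//.
apply: le_trans (ler_normD _ _) _; rewrite !normrM mulrDr; apply: lerD.
  by apply: ler_pM => //; rewrite hM// oo_cc.
by apply: ler_pM => //; rewrite ler_norml; exact: oo_cc.
Qed.

Lemma tilt_le s t x : -1 < x < 1 -> `|s| <= 2 -> `|t| <= 2 -> tilt s t x <= expR (2 * n * (M + 1)).
Proof.
by move=> hx hs ht; rewrite ler_expR (le_trans (ler_norm _))// tilt_arg_le.
Qed.

Lemma tilt_ge s t x : -1 < x < 1 -> `|s| <= 2 -> `|t| <= 2 -> expR (- (2 * n * (M + 1))) <= tilt s t x.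
Proof.
move=> hx hs ht; rewrite ler_expR lerNl (le_trans _ (tilt_arg_le hx hs ht))//.
by rewrite -normrN ler_norm.
Qed.

(** A substitute for differentiation under the integral sign: the integrand of the remainder
    contains e^z - 1 - z, with z bounded on the box and linear in the increments, and [expR_taylor1]
    makes it quadratic. *)
Lemma tilted_taylor p : exists C : R, 0 <= C /\ forall s t s' t',
  `|s| <= 2 -> `|t| <= 2 -> `|s'| <= 2 -> `|t'| <= 2 ->
  `|tilted p s' t' - tilted p s t - n * ((s' - s) * tilted (p * eta) s t + (t' - t) * tilted (p * 'X) s t)|
  <= C * ((s' - s) ^+ 2 + (t' - t) ^+ 2).
Proof.
have [Kp [Kp0 hKp]] := horner_bound p.
set L := 2 * n * (M + 1).
pose C0 := Kp * (expR L * (2 * n ^+ 2 * (M ^+ 2 + 1)) * expR (2 * L)).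
have C00 : 0 <= C0.
  rewrite mulr_ge0// mulr_ge0 ?expR_ge0// mulr_ge0 ?expR_ge0// mulr_ge0//.
  by rewrite addr_ge0 ?sqr_ge0.
exists (C0 * zint N rho); split; first exact: mulr_ge0.
move=> s t s' t' hs ht hs' ht'.
pose z x := n * ((s' - s) * eta.[x] + (t' - t) * x).
have be : bmf (horner eta) by exact: bmf_poly.
have bx : bmf (fun x : R => x) by exact: bmf_id.
have -> : tilted p s' t' - tilted p s t - n * ((s' - s) * tilted (p * eta) s t + (t' - t) * tilted (p * 'X) s t)
   = zint N (fun x => rho x * (p.[x] * (tilt s t x * (expR (z x) - 1 - z x)))).
  rewrite /tilted -!rintZ//; [|exact: bpt..].
  rewrite -rintD//; [|by apply: bmfZ; exact: bpt..].
  rewrite -rintZ//; last by apply: bmfD; apply: bmfZ; exact: bpt.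
  rewrite -!rintB//; try by do ?[exact: bpt|apply: bmfB|apply: bmfZ|apply: bmfD].
  apply: zint_ext => // x _; congr (_ * _).
  have -> : tilt s' t' x = tilt s t x * expR (z x).
    by rewrite -expRD /z; congr expR; ring.
  by rewrite !hornerM hornerX /z; ring.
have bz : bmf (fun x => p.[x] * (tilt s t x * (expR (z x) - 1 - z x))).
  apply: bmfM; first exact: bmf_poly; apply: bmfM; first exact: bmf_tilt.
  apply: bmfB; last by apply: bmfZ; apply: bmfD; apply: bmfZ.
  by apply: bmfB; [exact: bmf_tilt|exact: bmf_cst].
have zz := zI_bmf zrho bz.
set Dl := _ + _ ^+ 2.
apply: le_trans (zint_norm hN zz) _.
rewrite mulrAC -zintZ//; apply: zint_le => //; first exact: zI_norm; first exact: zIZ.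
move=> x hx; rewrite normrM (ger0_norm (ltW (rho_gt0 x))) mulrC ler_wpM2r ?(ltW (rho_gt0 x))//.
rewrite /C0 -[leRHS]mulrA normrM; apply: ler_pM => //; first by apply: hKp; exact: oo_cc.
have -> : expR L * (2 * n ^+ 2 * (M ^+ 2 + 1)) * expR (2 * L) * Dl = expR L * (2 * n ^+ 2 * (M ^+ 2 + 1) * Dl * expR (2 * L)) by ring.
rewrite normrM ger0_norm ?expR_ge0//; apply: ler_pM; rewrite ?expR_ge0//; first exact: tilt_le.
apply: le_trans (expR_taylor1 _) _.
have zl : `|z x| <= 2 * L.
  have -> : z x = n * (s' * eta.[x] + t' * x) - n * (s * eta.[x] + t * x) by rewrite /z; ring.
  apply: le_trans (ler_normB _ _) _.
  by have h1 := tilt_arg_le hx hs ht; have h2 := tilt_arg_le hx hs' ht'; rewrite /L; lra.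
have zq : z x ^+ 2 <= 2 * n ^+ 2 * (M ^+ 2 + 1) * Dl.
  rewrite /z exprMn /Dl; set a := s' - s; set b := t' - t.
  have he : eta.[x] ^+ 2 <= M ^+ 2.
    by rewrite -[X in X <= _]real_normK ?num_real// lerXn2r ?nnegrE// hM// oo_cc.
  have hx2 := sq_le1 (oo_cc hx).
  have q1 : (a * eta.[x] + b * x) ^+ 2 <= 2 * (M ^+ 2 + 1) * (a ^+ 2 + b ^+ 2).
    have i1 := ler_wpM2l (sqr_ge0 a) he; have i2 := ler_wpM2l (sqr_ge0 b) hx2.
    have i3 := sqr_ge0 (a * eta.[x] - b * x).
    have i4 := sqr_ge0 a; have i5 := mulr_ge0 (sqr_ge0 M) (sqr_ge0 b).
    nra.
  have -> : 2 * n ^+ 2 * (M ^+ 2 + 1) * (a ^+ 2 + b ^+ 2) = n ^+ 2 * (2 * (M ^+ 2 + 1) * (a ^+ 2 + b ^+ 2)) by ring.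
  by rewrite ler_wpM2l ?sqr_ge0.
by apply: ler_pM; rewrite ?sqr_ge0 ?expR_ge0// ler_expR.
Qed.

Lemma tilted_bound p : exists B : R, 0 <= B /\ forall s t, `|s| <= 2 -> `|t| <= 2 -> `|tilted p s t| <= B.
Proof.
have [Kp [Kp0 hKp]] := horner_bound p; set L := 2 * n * (M + 1).
exists (Kp * expR L * zint N rho); split; first by rewrite !mulr_ge0// expR_ge0.
move=> s t hs ht; have zz := zI_bmf zrho (bpt p s t).
apply: le_trans (zint_norm hN zz) _; rewrite -zintZ//; apply: zint_le => //; first exact: zI_norm; first exact: zIZ.
move=> x hx; rewrite normrM (ger0_norm (ltW (rho_gt0 x))) mulrC ler_wpM2r ?(ltW (rho_gt0 x))//.
rewrite normrM; apply: ler_pM => //; first by apply: hKp; exact: oo_cc.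
by rewrite ger0_norm ?expR_ge0// tilt_le.
Qed.

(** Increasing t raises the tilt where x > 0 and lowers it where x < 0, so x times its increment is
    at least a constant times (t' - t) x^2 pointwise: the slope in t is bounded below uniformly. *)
Lemma tilted_X_mono : exists d : R, 0 < d /\ forall s t t', `|s| <= 2 -> `|t| <= 2 -> `|t'| <= 2 -> t <= t' ->
  d * (t' - t) <= tilted 'X s t' - tilted 'X s t.
Proof.
set L := 2 * n * (M + 1); have n3 := @ge3 R N hN.
have bx2 : bmf (fun x : R => x ^+ 2) by apply: bmf_exp2; exact: bmf_id.
have T0 : 0 < zint N (fun x => rho x * x ^+ 2).
  apply: zint_gt0 => //; first exact: zI_bmf.
    by move=> x _; rewrite mulr_ge0 ?sqr_ge0// ltW.
  have hp : 'X ^+ 2 != 0 :> {poly R} by rewrite expf_neq0// polyX_eq0.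
  apply: (@filterS _ _ (ae_filter_ringOfSetsType (@lebesgue_measure R)) _ _ _ (poly_ae_neq0 hp)) => x hx Ix.
  by have := hx Ix; rewrite hornerXn => hh; rewrite mulf_neq0// gt_eqF.
exists (n * expR (- L) * zint N (fun x => rho x * x ^+ 2)); split.
  by rewrite mulr_gt0// mulr_gt0 ?expR_gt0//; lra.
move=> s t t' hs ht ht' tt.
rewrite /tilted -rintB//; [|exact: bpt..].
rewrite mulrAC -rintZ//; apply: zint_le => //.
- by apply: zI_bmf => //; exact: bmfZ.
- by apply: zI_bmf => //; apply: bmfB; exact: bpt.
move=> x hx; rewrite ler_wpM2l ?(ltW (rho_gt0 x))// hornerX -mulrBr.
have E1 := tilt_ge hx hs ht; have E2 := tilt_ge hx hs ht'.
set z := n * (t' - t) * x.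
have e1 : tilt s t' x = tilt s t x * expR z by rewrite -expRD; congr expR; rewrite /z; ring.
have e2 : tilt s t x = tilt s t' x * expR (- z) by rewrite -expRD; congr expR; rewrite /z; ring.
have dt : 0 <= t' - t by rewrite subr_ge0.
have [x0|x0] := leP 0 x.
  have z0 : 0 <= z by rewrite /z !mulr_ge0.
  have h1 : expR (- L) * z <= tilt s t' x - tilt s t x.
    rewrite e1 -[X in _ - X]mulr1 -mulrBr; apply: ler_pM; rewrite ?expR_ge0//.
    by have := expR_ge1Dx z; lra.
  have -> : n * expR (- L) * (t' - t) * x ^+ 2 = x * (expR (- L) * z) by rewrite /z; ring.
  exact: ler_wpM2l.
have z0 : 0 <= - z by rewrite /z -mulrN mulr_ge0// ?mulr_ge0//; lra.
have h1 : expR (- L) * - z <= tilt s t x - tilt s t' x.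
  rewrite [in leRHS]e2 -[X in _ - X]mulr1 -mulrBr; apply: ler_pM; rewrite ?expR_ge0//.
  by have := expR_ge1Dx (- z); lra.
have -> : n * expR (- L) * (t' - t) * x ^+ 2 = (- x) * (expR (- L) * - z) by rewrite /z; ring.
rewrite -[leRHS]mulrNN opprB; apply: ler_wpM2l => //; lra.
Qed.

End Bounds.

Lemma tilted_sq_gt0 s t : 0 < tilted ('X * 'X) s t.
Proof.
apply: zint_gt0 => //; first by apply: zI_bmf => //; exact: bpt.
  by move=> x _; rewrite hornerM hornerX -expr2 mulr_ge0 ?(ltW (rho_gt0 x))// mulr_ge0 ?sqr_ge0 ?expR_ge0.
have hp : 'X * 'X != 0 :> {poly R} by rewrite mulf_neq0// polyX_eq0.
apply: (@filterS _ _ (ae_filter_ringOfSetsType (@lebesgue_measure R)) _ _ _ (poly_ae_neq0 hp)) => x hx Ix.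
by rewrite mulf_neq0 ?gt_eqF// mulr_gt0 ?expR_gt0// lt_neqAle eq_sym (hx Ix)/= hornerM hornerX -expr2 sqr_ge0.
Qed.

Local Opaque tilted.

Lemma tilted_lip p : exists K : R, 0 <= K /\ forall s t s' t',
  `|s| <= 2 -> `|t| <= 2 -> `|s'| <= 2 -> `|t'| <= 2 ->
  `|tilted p s' t' - tilted p s t| <= K * (`|s' - s| + `|t' - t|).
Proof.
have [M [M0 hM]] := horner_bound eta; have n3 := @ge3 R N hN.
have [C [C0 hC]] := tilted_taylor M0 hM p.
have [B1 [B10 hB1]] := tilted_bound hM (p * eta).
have [B2 [B20 hB2]] := tilted_bound hM (p * 'X).
exists (n * (B1 + B2) + 4 * C); split; first nra.
move=> s t s' t' hs ht hs' ht'.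
have h := hC _ _ _ _ hs ht hs' ht'.
have b1 := hB1 _ _ hs ht; have b2 := hB2 _ _ hs ht.
set A1 := tilted (p * eta) s t in h b1; set A2 := tilted (p * 'X) s t in h b2.
set D := _ - tilted p s t in h *; set a := s' - s in h *; set b := t' - t in h *.
have ha : `|a| <= 4 by apply: le_trans (ler_normB _ _) _; lra.
have hb : `|b| <= 4 by apply: le_trans (ler_normB _ _) _; lra.
have hn : `|n * (a * A1 + b * A2)| <= n * (`|a| * B1 + `|b| * B2).
  rewrite normrM (@ger0_norm _ n)// ler_wpM2l//.
  by apply: le_trans (ler_normD _ _) _; rewrite !normrM; apply: lerD; apply: ler_wpM2l.
have hq : C * (a ^+ 2 + b ^+ 2) <= C * (4 * `|a| + 4 * `|b|).
  apply: ler_wpM2l => //; rewrite -(real_normK (num_real a)) -(real_normK (num_real b)) !expr2.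
  by apply: lerD; apply: ler_wpM2r.
have -> : D = (D - n * (a * A1 + b * A2)) + n * (a * A1 + b * A2) by ring.
apply: le_trans (ler_normD _ _) _; apply: le_trans (lerD h hn) _; apply: le_trans (lerD hq (lexx _)) _.
have q1 : 0 <= n * (`|a| * B2 + `|b| * B1) by rewrite mulr_ge0// addr_ge0// mulr_ge0.
have := q1; lra.
Qed.

(** An implicit function theorem by hand: the intermediate value theorem in t gives existence, and
    the lower bound on the slope in t against the Lipschitz bound in s gives tau(0) = 0 and the
    Lipschitz estimate. *)
Lemma tau_exists : exists (e : R) (tau : R -> R), [/\ 0 < e, e <= 1, tau 0 = 0,
  forall s, `|s| < e -> `|tau s| <= 1 /\ tilted 'X s (tau s) = 0 &
  exists K : R, forall s s', `|s| < e -> `|s'| < e -> `|tau s' - tau s| <= K * `|s' - s| ].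
Proof.
have [M [M0 hM]] := horner_bound eta; have lN10 : -1 <= 0 :> R by lra.
have N11 : -1 <= 1 :> R by lra.
have [d [d0 hd]] := tilted_X_mono hM; have [K [K0 hK]] := tilted_lip 'X.
have lipt s t t' : `|s| <= 2 -> -1 <= t <= 1 -> `|t' - t| < 1 -> `|tilted 'X s t' - tilted 'X s t| <= K * `|t' - t|.
  rewrite -ler_norml => s2 t1 tt; have t2 : `|t| <= 2 by lra.
  have nt' : `|t'| <= 2.
    have -> : t' = t + (t' - t) by ring.
    by apply: le_trans (ler_normD _ _) _; lra.
  by have := hK s t s t' s2 t2 s2 nt'; rewrite subrr normr0 add0r.
have X0 : tilted 'X 0 0 = 0 by rewrite tilted00 -[RHS]rhox; apply: zint_ext => // x _; rewrite hornerX.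
(* For |s| < e the constraint at t = 0 has absolute value at most K e <= d, and the slope d then
   forces a sign change between t = -1 and t = 1. *)
pose e := Num.min 1 (d / (K + 1)).
have e0 : 0 < e by rewrite lt_min ltr01 divr_gt0//; lra.
have e1 : e <= 1 by rewrite ge_min lexx.
have eK : K * e <= d.
  have : e <= d / (K + 1) by rewrite ge_min lexx orbT.
  by rewrite ler_pdivlMr; [have := ltW e0; nra|lra].
clearbody e.
have ex s : `|s| < e -> exists t, `|t| <= 1 /\ tilted 'X s t = 0.
  move=> se; have s2 := norm_le2 (le_trans (ltW se) e1).
  have n0 : `|0 : R| <= 2 by rewrite normr0.
  have n1 : `|1 : R| <= 2 by rewrite normr1; lra.
  have nn1 : `|-1 : R| <= 2 by rewrite normrN normr1; lra.
  have h := hK 0 0 s 0 n0 n0 s2 n0.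
  rewrite X0 !subr0 normr0 addr0 in h.
  have h2 : `|tilted 'X s 0| <= d.
    by apply: le_trans h _; apply: le_trans eK; apply: ler_wpM2l => //; exact: ltW.
  move: h2; rewrite ler_norml => /andP[h3 h4].
  have := hd s 0 1 s2 n0 n1 ler01; rewrite subr0 mulr1 => h5.
  have := hd s (-1) 0 s2 nn1 n0 lN10; rewrite sub0r opprK mulr1 => h6.
  have [||c] := @IVT R (tilted 'X s) (-1) 1 0 N11.
  - apply: continuous_in_subspaceT => t; rewrite inE/= in_itv/= => ht.
    apply: (@lip_continuous _ _ 1 K) => // t'; exact: (lipt s t t').
  - rewrite ge_min le_max; move: h3 h4 h5 h6.
    move: (tilted 'X s (-1)) (tilted 'X s 0) (tilted 'X s 1) => A B C h3 h4 h5 h6.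
     apply/andP; split; apply/orP; [left|right]; lra.
  - by rewrite in_itv/= => hc h0; exists c; rewrite ler_norml.
have [s|tau ht] := @boolp.choice R R (fun s t => `|s| < e -> `|t| <= 1 /\ tilted 'X s t = 0).
  have [/ex[t]|_] := ltP `|s| e; last by exists 0.
  by exists t.
have lip s s' : `|s| < e -> `|s'| < e -> d * `|tau s' - tau s| <= K * `|s' - s|.
  move=> se se'; have [a1 a2] := ht _ se; have [b1 b2] := ht _ se'.
  have t2 := norm_le2 a1; have t2' := norm_le2 b1.
  have s2 := norm_le2 (le_trans (ltW se) e1); have s2' := norm_le2 (le_trans (ltW se') e1).
  have := hK s (tau s) s' (tau s) s2 t2 s2' t2; rewrite subrr normr0 addr0 a2 subr0.
  rewrite ler_norml => /andP[k1 k2].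
  have [le|le] := leP (tau s) (tau s').
    have := hd s' _ _ s2' t2 t2' le; rewrite b2 sub0r ger0_norm ?subr_ge0// => h.
    by apply: le_trans h _; rewrite lerNl.
  have := hd s' _ _ s2' t2' t2 (ltW le); rewrite b2 subr0 ltr0_norm ?subr_lt0// opprB => h.
  exact: le_trans h _.
exists e, tau; split=> //.
  have z0 : `|0 : R| < e by rewrite normr0.
  have [a1 a2] := ht _ z0; have n0 : `|0 : R| <= 2 by rewrite normr0.
  have a3 := norm_le2 a1.
  have [le|le] := leP 0 (tau 0).
    have := hd 0 _ _ n0 n0 a3 le; rewrite a2 X0 !subr0 => h.
    by apply/eqP; rewrite eq_le le andbT; rewrite pmulr_rle0 in h.
  have := hd 0 _ _ n0 a3 n0 (ltW le); rewrite a2 X0 subrr sub0r pmulr_rle0// oppr_le0 => h.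
  by apply/eqP; rewrite eq_le h ltW.
exists (K / d) => s s' se se'.
by rewrite mulrAC ler_pdivlMr// mulrC; exact: lip.
Unshelve. all: by end_near. Qed.

(** Dividing the Taylor estimate of the constraint by its slope in t gives tau up to a quadratic
    error, hence [tau1]. This is a quotient of tilted integrals along the curve, which are now
    differentiable, so tau is of class C^2. *)
Lemma constraint_curve : exists (e : R) (tau tau1 tau2 : R -> R),
  [/\ 0 < e, tau 0 = 0,
    tau1 0 = - (tilted ('X * eta) 0 0 / tilted ('X * 'X) 0 0) &
    forall s, `|s| < e ->
    [/\ tilted 'X s (tau s) = 0,
       is_derive s 1 tau (tau1 s), is_derive s 1 tau1 (tau2 s),
       {for s, continuous tau2} &
       forall p, is_derive s 1 (fun s => tilted p s (tau s))
         (n * (tilted (p * eta) s (tau s) + tau1 s * tilted (p * 'X) s (tau s)))]].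
Proof.
have [M [M0 hM]] := horner_bound eta; have n3 := @ge3 R N hN.
have [e [tau [e0 e1 tau0 htau [K hK]]]] := tau_exists.
pose ph p s := tilted p s (tau s).
pose tau1 s := - (ph ('X * eta) s / ph ('X * 'X) s).
pose ph1 p s := n * (ph (p * eta) s + tau1 s * ph (p * 'X) s).
pose tau2 s := - (ph1 ('X * eta) s / ph ('X * 'X) s - ph ('X * eta) s * ph1 ('X * 'X) s / ph ('X * 'X) s ^+ 2).
have in_e s h : `|h| < e - `|s| -> `|s + h| < e by move=> hh; apply: le_lt_trans (ler_normD _ _) _; lra.
have taylor p : exists C : R, 0 <= C /\ forall s h, `|s| < e -> `|h| < e - `|s| ->
   `|ph p (s + h) - ph p s - n * (h * ph (p * eta) s + (tau (s + h) - tau s) * ph (p * 'X) s)| <= C * h ^+ 2.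
  have [C [C0 hC]] := tilted_taylor M0 hM p.
  exists (C * (1 + K ^+ 2)); split; first by rewrite mulr_ge0// addr_ge0 ?sqr_ge0.
  move=> s h se he; have she := in_e _ _ he.
  have [a1 _] := htau _ se; have [b1 _] := htau _ she.
  have s2 := norm_le2 (le_trans (ltW se) e1); have sh2 := norm_le2 (le_trans (ltW she) e1).
  have t2 := norm_le2 a1; have t2' := norm_le2 b1.
  have := hC _ _ _ _ s2 t2 sh2 t2'; have -> : s + h - s = h by ring.
  move=> H; apply: le_trans H _; rewrite -mulrA ler_wpM2l// mulrDl mul1r lerD2l.
  have := hK _ _ se she; have -> : s + h - s = h by ring.
  move=> H; rewrite -(real_normK (num_real (tau _ - _))) -(real_normK (num_real h)) -exprMn.
  by rewrite lerXn2r// nnegrE// (le_trans _ H).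
have dtau s : `|s| < e -> exists C : R, 0 <= C /\ forall h, `|h| < e - `|s| -> `|tau (s + h) - tau s - tau1 s * h| <= C * h ^+ 2.
  move=> se; have [C [C0 hC]] := taylor 'X.
  have b0 : 0 < ph ('X * 'X) s by exact: tilted_sq_gt0.
  exists (C / (n * ph ('X * 'X) s)); split; first by rewrite divr_ge0// ltW// mulr_gt0//; lra.
  move=> h he; have := hC s h se he.
  have -> : ph 'X (s + h) = 0 by case: (htau _ (in_e _ _ he)).
  have -> : ph 'X s = 0 by case: (htau _ se).
  rewrite subrr sub0r normrN.
  have -> : n * (h * ph ('X * eta) s + (tau (s + h) - tau s) * ph ('X * 'X) s)
     = (n * ph ('X * 'X) s) * (tau (s + h) - tau s - tau1 s * h).
    by rewrite /tau1; field; rewrite gt_eqF.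
  have nb : 0 < n * ph ('X * 'X) s by rewrite mulr_gt0//; lra.
  by rewrite normrM (gtr0_norm nb) mulrC [C / _ * _]mulrAC ler_pdivlMr.
have d1 s : `|s| < e -> is_derive s 1 tau (tau1 s).
  move=> se; have [C [C0 hC]] := dtau s se.
  by apply: (@is_derive_quad _ _ _ C (e - `|s|)) => //; rewrite subr_gt0.
have dp s p : `|s| < e -> is_derive s 1 (ph p) (ph1 p s).
  move=> se; have [C [C0 hC]] := dtau s se; have [C' [C0' hC']] := taylor p.
  apply: (@is_derive_quad _ _ _ (C' + n * (C * `|ph (p * 'X) s|)) (e - `|s|)); first by rewrite subr_gt0.
  move=> h he; have h1 := hC h he; have h2 := hC' s h se he.
  have E (P' P A B dt t1 : R) : P' - P - n * (A + t1 * B) * h =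
    (P' - P - n * (h * A + dt * B)) + n * ((dt - t1 * h) * B) by ring.
  rewrite (E _ _ _ _ (tau (s + h) - tau s)).
  apply: le_trans (ler_normD _ _) _; rewrite [leRHS]mulrDl; apply: lerD => //.
  rewrite normrM (@ger0_norm _ n)// normrM -mulrA ler_wpM2l// mulrAC; exact: ler_wpM2r.
have d2 s : `|s| < e -> is_derive s 1 tau1 (tau2 s).
  move=> se; have b0 : ph ('X * 'X) s != 0 by rewrite gt_eqF// tilted_sq_gt0.
  have da := dp s ('X * eta) se; have db := dp s ('X * 'X) se.
  apply: (is_derive_eq (is_deriveN (is_deriveM da (is_deriveV b0 db)))).
  by rewrite /tau2 /GRing.scale /=; field.
exists e, tau, tau1, tau2; split; [exact: e0|exact: tau0|by rewrite /tau1 /ph tau0|].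
move=> s se; split; [by case: (htau _ se)|exact: d1|exact: d2| |by move=> p; exact: dp].
have b0 : ph ('X * 'X) s != 0 by rewrite gt_eqF// tilted_sq_gt0.
have cp p : {for s, continuous (ph p)} by apply: is_derive_continuous; exact: dp se.
have ct : {for s, continuous tau1} by apply: is_derive_continuous; exact: d2 se.
have c1 p : {for s, continuous (ph1 p)}.
  by apply: cvgM; [exact: cvg_cst|apply: cvgD; [exact: cp|apply: cvgM; [exact: ct|exact: cp]]].
have cV : {for s, continuous (fun s => (ph ('X * 'X) s)^-1)} by apply: cvgV => //; exact: cp.
have cV2 : {for s, continuous (fun s => (ph ('X * 'X) s ^+ 2)^-1)}.
  by apply: cvgV => //; [rewrite expf_neq0|rewrite expr2; apply: cvgM; exact: cp].
apply: cvgN; apply: cvgB; apply: cvgM => //; first exact: c1.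
by apply: cvgM; [exact: cp|exact: c1].
Qed.

End ConstraintCurve.

(** * First and second variation of the functional *)

Section Curves.
Context {R : realType}.
Variable N : nat.
Hypothesis hN : (3 <= N)%N.
Implicit Types (p q eta : {poly R}) (x y s t a b : R) (k j m : nat) (f g u v : R -> R).
Local Notation n := (N%:R : R).
Local Notation mu := (@lebesgue_measure R).
Local Notation I := (`](-1)%R, 1%R[%classic : set R).
Local Notation J := (`[(-1)%R, 1%R]%classic : set R).
Local Notation c := (@zonal R N).
Local Notation zI := (@zI R N).
Local Notation h := (@znorm R N).
Local Notation W := (@zW R N).
Local Notation pe := (@paneitz_eig R N).
Local Notation F := ((N.-1)`!%:R : R).

Lemma is_derive_unique f x a b : is_derive x 1 f a -> is_derive x 1 f b -> a = b.
Proof. by move=> [_ <-] [_ <-]. Qed.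

Lemma is_derive_quot f s a : is_derive s 1 f a ->
  h^-1 * (f (s + h) - f s) - a @[h --> 0^'] --> (0 : R).
Proof.
move=> [df <-].
suff H : h^-1 * (f (s + h) - f s) @[h --> 0^'] --> 'D_1 f s.
  have H2 := cvgB H (cvg_cst ('D_1 f s)); rewrite subrr in H2; exact: H2.
apply: cvg_trans (df : _ @ _ --> 'D_1 f s); apply: near_eq_cvg; near=> h'.
by rewrite /= /GRing.scale /= mulr1 [h' + s]addrC.
Unshelve. all: by end_near. Qed.

Lemma admissible_line u eta (e : R) (tau tau1 tau2 : R -> R) :
  zsobolev N u -> 0 < e -> tau 0 = 0 ->
  (forall s, `|s| < e -> [/\ zint N (fun x => x * expR (n * (u x + (s * eta.[x] + tau s * x)))) = 0,
     is_derive s 1 tau (tau1 s), is_derive s 1 tau1 (tau2 s) & {for s, continuous tau2}]) ->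
  admissible_curve N u (fun s x => u x + (s * eta.[x] + tau s * x)).
Proof.
move=> hu e0 tau0 H; have [K hK] := @sobolev_norm_scaleX R N hN.
split; first by apply/funext => x; rewrite tau0 !mul0r !addr0.
exists e; split=> //.
exists (fun s x => eta.[x] + tau1 s * x), (fun s x => tau2 s * x) => s se.
have [h1 h2 h3 h4] := H s se.
have addp (a b : R) : (fun x => a * eta.[x] + b * x) = horner (a *: eta + b *: 'X).
  by apply/funext => x; rewrite !(hornerD, hornerZ, hornerX).
have K0 (f : R -> R) (G : set_system R) : Filter G -> f y @[y --> G] --> (0 : R) -> K * `|f y| @[y --> G] --> (0 : R).
  move=> FG hf; rewrite -(mulr0 K); apply: cvgM; first exact: cvg_cst.
  by rewrite -(normr0 R); apply: cvg_norm.
split; split.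
- split=> //; have := @zsobolevD R N hN u (s *: eta + tau s *: 'X) hu.
  by congr (zsobolev _ _); apply/funext => x; rewrite !(hornerD, hornerZ, hornerX).
- have := @zsobolev_poly R N hN (1 *: eta + tau1 s *: 'X).
  by rewrite -addp; congr (zsobolev _ _); apply/funext => x; rewrite mul1r.
- have := @zsobolev_poly R N hN (0 *: eta + tau2 s *: 'X).
  by rewrite -addp; congr (zsobolev _ _); apply/funext => x; rewrite mul0r add0r.
- apply: cvg_trans (K0 _ _ _ (is_derive_quot h2)); apply: near_eq_cvg; near=> d.
  have d0 : d != 0 by near: d; exact: nbhs_dnbhs_neq.
  rewrite -hK; congr (sobolev_norm _ _); apply/funext => x; field; exact: d0.
- apply: cvg_trans (K0 _ _ _ (is_derive_quot h3)); apply: near_eq_cvg; near=> d.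
  have d0 : d != 0 by near: d; exact: nbhs_dnbhs_neq.
  rewrite -hK; congr (sobolev_norm _ _); apply/funext => x; field; exact: d0.
- apply: cvg_trans (K0 (fun t => tau2 t - tau2 s) (nbhs s) _ _); last first.
    have H2 := cvgB h4 (cvg_cst (tau2 s)); rewrite subrr in H2; exact: H2.
  apply: near_eq_cvg; near=> t.
  by rewrite -hK; congr (sobolev_norm _ _); apply/funext => x; ring.
Unshelve. all: by end_near. Qed.

Definition log_coef : R := F * Num.sqrt pi * Gamma_fun (n / 2) / (n * Gamma_fun ((n + 1) / 2)).
Definition log_scale : R := Gamma_fun ((n + 1) / 2) / (Num.sqrt pi * Gamma_fun (n / 2)).
Local Notation CC := log_coef.
Local Notation a0 := log_scale.

Lemma functionalE alpha u : functional alpha N u = alpha / 2 * paneitz_form N u + F * zint N u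
  - CC * ln (a0 * zint N (fun x => expR (n * u x))).
Proof. by []. Qed.

Local Opaque log_coef log_scale.

Lemma is_derive_affine (a b s : R) : is_derive s 1 (fun t => a + b * t) b.
Proof.
have h1 := is_deriveD (is_derive_cst a s 1) (is_deriveZ b (@is_derive_id R R s 1)).
by apply: (is_derive_eq h1); rewrite add0r /GRing.scale /= mulr1.
Qed.

(** A divergent integral of a nonnegative function has value 0 under [fine], so a nonzero value
    certifies integrability. *)
Lemma zint_neq0_zI f : measurable_fun I f -> (forall x, 0 <= f x) -> zint N f != 0 -> zI f.
Proof.
move=> mf f0 hf; apply/integrableP; split.
  apply/measurable_EFinP; apply: measurable_funM => //.
  by apply: measurable_funS (@measurable_zweight R N).
under eq_integral => x _ do rewrite /= ger0_norm ?mulr_ge0 ?zweight_ge0//.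
rewrite ltey; apply: contra_neq hf => hi.
by rewrite zintE// /Rintegral hi.
Qed.

Lemma exp_measurable u : zsobolev N u -> measurable_fun J (fun x => expR (n * u x)).
Proof. by move=> [mu1 _ _]; apply: measurableT_comp => //; apply: measurable_funM. Qed.

(* Translating u by constants suffices: if the logarithm were taken at a junk value
   (a nonpositive number, or a nonintegrable exponential) it would be constant, and
   the derivative of the functional would be (N-1)! W <> 0.  This also determines
   the coefficient of the logarithm without evaluating any Gamma function. *)
Lemma critical_exp alpha u : critical_point alpha N u ->
  [/\ zI (fun x => expR (n * u x)), 0 < zint N (fun x => expR (n * u x)), 0 < a0 & CC * n = F * W].
Proof.
move=> [[hu hx] hc]; have zu := zsobolev_zI hN hu; have W0 := @zW_gt0 R N hN.
have mE := exp_measurable hu; set E := zint N (fun x => expR (n * u x)).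
have F0 : 0 < F by rewrite ltr0n fact_gt0.
have E0 : 0 <= E by apply: zint_ge0 => // x _; exact: expR_ge0.
have adm : admissible_curve N u (fun s x => u x + (s * (1 : {poly R}).[x] + 0 * x)).
  apply: (@admissible_line u 1 1 (fun=> 0) (fun=> 0) (fun=> 0)) => // s _; split; try exact: is_derive_cst.
    transitivity (zint N (fun x => expR (n * s) * (x * expR (n * u x)))).
      by apply: zint_ext => // x _; rewrite hornerC mul0r addr0 mulr1 mulrDr expRD; ring.
    rewrite zint_exprM// ?hx ?mulr0//; exact: measurable_funM.
  exact: cst_continuous.
have J1 s : functional alpha N (fun x => u x + (s * (1 : {poly R}).[x] + 0 * x)) =
    alpha / 2 * paneitz_form N u + F * (zint N u + s * W) - CC * ln (a0 * (expR (n * s) * E)).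
  have cE : (fun x => u x + (s * (1 : {poly R}).[x] + 0 * x)) = (fun x => u x + (s%:P).[x]).
    by apply/funext => x; rewrite !hornerC mul0r addr0 mulr1.
  have e1 : paneitz_form N (fun x => u x + (s%:P).[x]) = paneitz_form N u.
    rewrite (@paneitz_formD R N hN u s%:P 1)// ?size_polyC_leq1// !big_ord1 paneitz_eig0 ?(leq_trans _ hN)//.
    by rewrite !mul0r mulr0 !addr0.
  have e2 : zint N (fun x => u x + (s%:P).[x]) = zint N u + s * W.
    rewrite zintD//; last exact: zI_poly.
    by congr (_ + _); rewrite -zintZ; [apply: zint_ext => // x _; rewrite hornerC mulr1|exact: zI_cst].
  have e3 : zint N (fun x => expR (n * (u x + (s%:P).[x]))) = expR (n * s) * E.
    rewrite /E -zint_exprM//; apply: zint_ext => // x _.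
    by rewrite hornerC mulrDr expRD mulrC.
  by rewrite cE functionalE e1 e2 -e3.
have d0 := hc _ adm; rewrite (funext J1) in d0.
have aE : 0 < a0 * E.
  rewrite ltNge; apply/negP => aE.
  have e1 : (fun s => alpha / 2 * paneitz_form N u + F * (zint N u + s * W) - CC * ln (a0 * (expR (n * s) * E)))
    = fun s => (alpha / 2 * paneitz_form N u + F * zint N u) + (F * W) * s.
    apply/funext => s; rewrite ln0; last by rewrite mulrCA mulr_ge0_le0// expR_ge0.
    by rewrite mulr0 subr0; ring.
  rewrite e1 in d0; have := is_derive_unique d0 (is_derive_affine _ _ 0) => /esym/eqP.
  by rewrite mulf_eq0 !gt_eqF.
have En : E != 0 by apply: contraTneq aE => ->; rewrite mulr0 ltxx.
have Ep : 0 < E by rewrite lt_neqAle eq_sym En.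
have ap : 0 < a0 by rewrite -(pmulr_lgt0 _ Ep).
split=> //.
- apply: zint_neq0_zI => //.
  by apply: measurable_funS mE => //; exact: IsubJ.
- have e1 : (fun s => alpha / 2 * paneitz_form N u + F * (zint N u + s * W) - CC * ln (a0 * (expR (n * s) * E)))
    = fun s => (alpha / 2 * paneitz_form N u + F * zint N u - CC * ln (a0 * E)) + (F * W - CC * n) * s.
    apply/funext => s; have -> : a0 * (expR (n * s) * E) = expR (n * s) * (a0 * E) by rewrite mulrCA.
    by rewrite (lnM (_ : expR _ \in Num.pos))// ?posrE ?expR_gt0// expRK; ring.
  rewrite e1 in d0; have := is_derive_unique d0 (is_derive_affine _ _ 0); lra.
Qed.


Lemma is_derive_add f g s a b : is_derive s 1 f a -> is_derive s 1 g b ->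
  is_derive s 1 (fun t => f t + g t) (a + b).
Proof. by move=> h1 h2; exact: (is_deriveD h1 h2). Qed.

Lemma is_derive_scale (k f' s : R) f : is_derive s 1 f f' -> is_derive s 1 (fun t => k * f t) (k * f').
Proof. by move=> h1; exact: (is_deriveZ k h1). Qed.

Lemma is_derive_mul f g s a b : is_derive s 1 f a -> is_derive s 1 g b ->
  is_derive s 1 (fun t => f t * g t) (a * g s + f s * b).
Proof.
move=> h1 h2; apply: (is_derive_eq (is_deriveM h1 h2)).
by rewrite /GRing.scale /= addrC [g s * a]mulrC.
Qed.

Lemma is_derive_div f g s a b : g s != 0 -> is_derive s 1 f a -> is_derive s 1 g b ->
  is_derive s 1 (fun t => f t / g t) (a / g s - f s * b / g s ^+ 2).
Proof.
move=> g0 h1 h2; apply: (is_derive_eq (is_deriveM h1 (is_deriveV g0 h2))).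
by rewrite /GRing.scale /=; field.
Qed.

Lemma is_derive_ln f s a : 0 < f s -> is_derive s 1 f a -> is_derive s 1 (fun t => ln (f t)) (a / f s).
Proof.
move=> f0 h1; have hl := is_derive1_ln f0.
by apply: (is_derive_eq (is_derive1_comp hl h1)); rewrite mulrC.
Qed.

Definition paneitz_pair u m p : R := \sum_(k < m) pe k / h k * (zhat N u k * phat N p k).
Definition paneitz_bil m p q : R := \sum_(k < m) pe k / h k * (phat N p k * phat N q k).

Section Variations.
Variables (alpha : R) (u : R -> R).
Hypothesis ha : 2^-1 <= alpha <= 1.
Hypothesis crit : critical_point alpha N u.

Let E := zint N (fun x => expR (n * u x)).
Definition gibbs x : R := W / E * expR (n * u x).
Local Notation rho := gibbs.

Let hu : zsobolev N u. Proof. by case: crit => [[]]. Qed.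
Let zu : zI u. Proof. exact: zsobolev_zI. Qed.
Let W0 : 0 < W. Proof. exact: zW_gt0. Qed.
Let E0 : 0 < E. Proof. by case: (critical_exp crit). Qed.
Let C0 : 0 < W / E. Proof. exact: divr_gt0. Qed.
Let zE : zI (fun x => expR (n * u x)). Proof. by case: (critical_exp crit). Qed.

Lemma gibbs_gt0 x : 0 < rho x. Proof. by rewrite mulr_gt0// expR_gt0. Qed.
Lemma zI_gibbs : zI rho. Proof. exact: zIZ. Qed.
Lemma zint_gibbs : zint N rho = W.
Proof. by rewrite zintZ// divfK// gt_eqF. Qed.
Lemma zint_gibbs_x : zint N (fun x => rho x * x) = 0.
Proof.
have [[_ hx] _] := crit.
transitivity (zint N (fun x => W / E * (x * expR (n * u x)))).
  by apply: zint_ext => // x _; rewrite /gibbs; ring.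
rewrite zintZ ?hx ?mulr0//.
by apply: zI_ext (zI_bmf zE (@bmf_id R)) => x _ /=; exact: mulrC.
Qed.

Let zr := zI_gibbs.
Local Notation rint p := (zint N (fun x => rho x * p.[x])).
Local Notation T := (rint ('X * 'X)).
Local Notation hatsum := (paneitz_pair u).
Local Notation form := paneitz_bil.

Lemma zI_exp_line eta p s t : zI (fun x => p.[x] * expR (n * (u x + (s * eta.[x] + t * x)))).
Proof.
apply: zI_ext (zI_bmf zE (bmfM (bmf_poly p) (bmf_tilt N eta s t))) => x _.
by rewrite mulrCA -expRD -mulrDr.
Qed.

Lemma zint_exp_tilted eta p s t :
  zint N (fun x => p.[x] * expR (n * (u x + (s * eta.[x] + t * x)))) = (W / E)^-1 * tilted N rho eta p s t.
Proof.
have -> : tilted N rho eta p s t = zint N (fun x => W / E * (p.[x] * expR (n * (u x + (s * eta.[x] + t * x))))).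
  by apply: zint_ext => // x _; rewrite /gibbs -mulrA [expR _ * (_ * _)]mulrCA -expRD -mulrDr.
by rewrite zintZ ?mulKf ?gt_eqF//; exact: zI_exp_line.
Qed.

Lemma functional_line eta m s t : (size eta <= m)%N -> (1 < m)%N ->
  functional alpha N (fun x => u x + (s * eta.[x] + t * x)) =
  alpha / 2 * paneitz_form N u + F * zint N u
  + (alpha * hatsum m eta + F * zint N (horner eta)) * s + alpha * hatsum m 'X * t
  + alpha / 2 * form m eta eta * (s * s) + alpha * form m eta 'X * (s * t) + alpha / 2 * form m 'X 'X * (t * t)
  - CC * ln (a0 / (W / E) * tilted N rho eta 1 s t).
Proof.
move=> me m1; pose p : {poly R} := s *: eta + t *: 'X.
have pE : (fun x => u x + (s * eta.[x] + t * x)) = (fun x => u x + p.[x]).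
  by apply/funext => x; rewrite !(hornerD, hornerZ, hornerX).
have sp : (size p <= m)%N.
  rewrite (leq_trans (size_polyD _ _))// geq_max !(leq_trans (size_scale_leq _ _))//.
  by rewrite size_polyX.
have hp k : phat N p k = s * phat N eta k + t * phat N 'X k by rewrite /p phatD// !phatZ.
have e1 : paneitz_form N (fun x => u x + (s * eta.[x] + t * x)) = paneitz_form N u
   + 2 * (s * hatsum m eta + t * hatsum m 'X)
   + (s * s * form m eta eta + 2 * (s * t) * form m eta 'X + t * t * form m 'X 'X).
  rewrite pE (paneitz_formD hN hu sp) /paneitz_pair /paneitz_bil !mulr_sumr -!big_split !mulr_sumr /=.
  by congr (_ + _ + _); apply: eq_bigr => k _; rewrite hp; ring.
have e2 : zint N (fun x => u x + (s * eta.[x] + t * x)) = zint N u + s * zint N (horner eta).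
  have zx : zI (fun x : R => x) by exact (bmf_zI hN (@bmf_id R)).
  have ze : zI (horner eta) by exact: zI_poly.
  rewrite zintD//; last by apply: zID; exact: zIZ.
  rewrite zintD; [|exact: zIZ..].
  rewrite !zintZ//; have -> : zint N (fun x : R => x) = 0; last by rewrite mulr0 addr0.
  by have := @zint_zonal R N hN 1; rewrite zonal1//= => <-; apply: zint_ext => // x _; rewrite hornerX.
have e3 : zint N (fun x => expR (n * (u x + (s * eta.[x] + t * x)))) = (W / E)^-1 * tilted N rho eta 1 s t.
  by rewrite -zint_exp_tilted; apply: zint_ext => // x _; rewrite -polyC1 hornerC mul1r.
have fE := functionalE alpha (fun x => u x + (s * eta.[x] + t * x)).
rewrite e1 e2 e3 [a0 * _]mulrA in fE; rewrite fE.
move: (CC * ln _) => L; by field.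
Qed.

(** One curve serves both orders. The second derivative is given when the multiplier vanishes and
    eta is tangent to the constraint: then tau has derivative 0 at 0 and its second derivative gets
    the coefficient 0, so the curvature of the constraint does not contribute. *)
Lemma second_variation eta : exists c1 : R -> R -> R,
  [/\ admissible_curve N u c1,
    is_derive (0 : R) 1 (fun s => functional alpha N (c1 s))
       (alpha * hatsum (maxn (size eta) 2) eta + F * zint N (horner eta)
        - F * rint eta - F * (alpha * hatsum 2 'X / (F * T)) * rint ('X * eta))
    & hatsum 2 'X = 0 -> rint ('X * eta) = 0 ->
      second_derive0 (fun s => functional alpha N (c1 s))
      (alpha * form (maxn (size eta) 2) eta eta - N`!%:R * (rint (eta * eta) - rint eta ^+ 2 / W)) ].
Proof.
(* At least 2, so that the truncated forms also contain the degree of x. *)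
set m := maxn _ _.
have me : (size eta <= m)%N by exact: leq_maxl.
have m1 : (1 < m)%N by exact: leq_maxr.
have [_ _ ap CCn] := critical_exp crit; have F0 : 0 < F by rewrite ltr0n fact_gt0.
have n3 := @ge3 R N hN.
have [e [tau [tau1 [tau2 [e0 tau0 t10 H]]]]] := constraint_curve hN eta zr gibbs_gt0 zint_gibbs_x.
pose ph p s := tilted N rho eta p s (tau s).
have ph0 p : ph p 0 = rint p by rewrite /ph tau0 tilted00.
rewrite !tilted00 in t10.
have ph1_gt0 s : 0 < ph 1 s.
  have : 0 < (W / E)^-1 * ph 1 s; last by rewrite pmulr_rgt0// invr_gt0.
  rewrite -zint_exp_tilted; apply: zint_gt0 => //; first exact: zI_exp_line.
    by move=> x _; rewrite -polyC1 hornerC mul1r expR_ge0.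
  by apply: aeW => x _; rewrite -polyC1 hornerC mul1r gt_eqF// expR_gt0.
have ph10 : rint 1 = W by rewrite -zint_gibbs; apply: zint_ext => // x _; rewrite -polyC1 hornerC mulr1.
have T0 : 0 < T.
  by have := tilted_sq_gt0 hN eta zr gibbs_gt0 0 0; rewrite tilted00.
exists (fun s x => u x + (s * eta.[x] + tau s * x)).
have hatX : hatsum m 'X = hatsum 2 'X.
  apply: (@sum_widen_const _ (fun k => pe k / h k * (zhat N u k * phat N 'X k)) 2 m m1) => k k2.
  by rewrite phat_big ?size_polyX// !mulr0.
have e00 : `|0 : R| < e by rewrite normr0.
pose k1 := alpha * hatsum m eta + F * zint N (horner eta).
pose k2 := alpha * hatsum m 'X.
pose A11 := alpha / 2 * form m eta eta; pose A12 := alpha * form m eta 'X; pose A22 := alpha / 2 * form m 'X 'X.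
pose g s := alpha / 2 * paneitz_form N u + F * zint N u + k1 * s + k2 * tau s
  + A11 * (s * s) + A12 * (s * tau s) + A22 * (tau s * tau s) + (- CC) * ln (a0 / (W / E) * ph 1 s).
have gE : (fun s => functional alpha N (fun x => u x + (s * eta.[x] + tau s * x))) = g.
  by apply/funext => s; rewrite (functional_line _ _ me m1) /g mulNr.
pose g1 s := k1 + (2 * A11) * s + k2 * tau1 s + A12 * (tau s + s * tau1 s) + (2 * A22) * (tau s * tau1 s)
  + (- (F * W)) * (ph eta s / ph 1 s).
have dph s p : `|s| < e -> is_derive s 1 (ph p) (n * (ph (p * eta) s + tau1 s * ph (p * 'X) s)).
  by move=> se; have [_ _ _ _] := H s se; exact.
have phX s : `|s| < e -> ph 'X s = 0 by move=> se; have [] := H s se.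
have dtau s : `|s| < e -> is_derive s 1 tau (tau1 s) by move=> se; have [] := H s se.
have dtau1 s : `|s| < e -> is_derive s 1 tau1 (tau2 s) by move=> se; have [] := H s se.
have b0 : 0 < a0 / (W / E) by exact: divr_gt0.
have adm : admissible_curve N u (fun s x => u x + (s * eta.[x] + tau s * x)).
  apply: (@admissible_line u eta e tau tau1 tau2 hu e0 tau0) => s se; have [h1 h2 h3 h4 _] := H s se; split=> //.
  transitivity (zint N (fun x => ('X : {poly R}).[x] * expR (n * (u x + (s * eta.[x] + tau s * x))))).
    by apply: zint_ext => // x _; rewrite hornerX.
  by rewrite zint_exp_tilted h1 mulr0.
clear H; clearbody ph.
have dg s : `|s| < e -> is_derive s 1 g (g1 s).
  move=> se; have h2 := dtau s se; have p0 := ph1_gt0 s.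
  have di := @is_derive_id R R s 1.
  have dl := @is_derive_ln (fun t => a0 / (W / E) * ph 1 t) s _ (mulr_gt0 b0 p0) (is_derive_scale (a0 / (W / E)) (dph s 1 se)).
  have D := is_derive_add (is_derive_add (is_derive_add (is_derive_add (is_derive_add
    (is_derive_affine (alpha / 2 * paneitz_form N u + F * zint N u) k1 s) (is_derive_scale k2 h2))
    (is_derive_scale A11 (is_derive_mul di di))) (is_derive_scale A12 (is_derive_mul di h2)))
    (is_derive_scale A22 (is_derive_mul h2 h2))) (is_derive_scale (- CC) dl).
  apply: (is_derive_eq D); rewrite !mul1r phX// mulr0 addr0 /g1 -CCn !mulr1.
  have p1 : ph 1 s != 0 by rewrite gt_eqF.
  have b1 : a0 / (W / E) != 0 by rewrite gt_eqF.
  move: (a0 / (W / E)) b1 => b b1.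
  by field; rewrite b1 p1.
split; first exact: adm.
  rewrite gE; apply: (is_derive_eq (dg 0 e00)).
  rewrite /g1 t10 tau0 !ph0 ph10 /k1 /k2 hatX.
  have F1 : F != 0 by rewrite gt_eqF.
  have T1 : T != 0 by rewrite gt_eqF.
  have W1 : W != 0 by rewrite gt_eqF.
  move: (rint _) T1 => t T1.
  by field; rewrite F1 T1 W1.
rewrite gE => hX0 rX.
have near_e : \forall s \near (0 : R), `|s| < e.
  near=> s; rewrite -[s]subr0 distrC; near: s; apply: cvgr_dist_lt => //; exact: cvg_id.
split; first by near=> s; apply: (@ex_derive _ _ _ _ _ _ _ (dg s _)); near: s.
apply: (@near_eq_is_derive _ _ _ g1).
  near=> s; rewrite derive1E; have se : `|s| < e by near: s.
  by rewrite (@derive_val _ _ _ _ _ _ _ (dg s se)).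
have d1 := dtau _ e00; have d2 := dtau1 _ e00; have di := @is_derive_id R R 0 1.
have p1 : ph 1 0 != 0 by rewrite gt_eqF.
have D := is_derive_add (is_derive_add (is_derive_add (is_derive_add
   (is_derive_affine k1 (2 * A11) 0) (is_derive_scale k2 d2))
   (is_derive_scale A12 (is_derive_add d1 (is_derive_mul di d2))))
   (is_derive_scale (2 * A22) (is_derive_mul d1 d2)))
   (is_derive_scale (- (F * W)) (is_derive_div p1 (dph _ eta e00) (dph _ 1 e00))).
apply: (is_derive_eq D).
rewrite t10 rX tau0 !ph0 ph10 /k2 hatX hX0 !mul1r !mul0r oppr0.
have -> : N`!%:R = n * F :> R.
  by rewrite -natrM -[in LHS](prednK (ltn_trans (isT : (0 < 2)%N) hN)) factS prednK ?(ltn_trans _ hN).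
have W1 : W != 0 by rewrite gt_eqF.
rewrite /A11; by field.
Unshelve. all: by end_near. Qed.

End Variations.

End Curves.

(** * From stability to constancy *)

Section Assembly.
Context {R : realType}.
Variable N : nat.
Hypothesis hN : (3 <= N)%N.
Implicit Types (p q : {poly R}) (x y s t a b : R) (k j m : nat).
Local Notation n := (N%:R : R).
Local Notation mu := (@lebesgue_measure R).
Local Notation I := (`](-1)%R, 1%R[%classic : set R).
Local Notation c := (@zonal R N).
Local Notation zI := (@zI R N).
Local Notation h := (@znorm R N).
Local Notation W := (@zW R N).
Local Notation pe := (@paneitz_eig R N).
Local Notation F := ((N.-1)`!%:R : R).

Lemma ae_constant_of_zhat (u : R -> R) : zI u -> (forall k, zhat N u k.+1 = 0) -> ae_constant u.
Proof.
move=> zu u0; have W0 := @zW_gt0 R N hN; pose a := zhat N u 0 / W.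
have za : zI (fun=> - a) by exact: zI_cst.
have hk k : zhat N (fun x => u x + - a) k = 0.
  rewrite zhatD//.
  have -> : zhat N (fun=> - a) k = - a * zint N (horner (c k)).
    by rewrite -zintZ//; exact: zI_poly.
  rewrite zint_zonal//; case: k => [|k]; last by rewrite u0 mulr0 addr0.
  by rewrite /a/= mulNr mulfVK ?subrr// gt_eqF.
exists a.
have ane b : {ae mu, forall x, x != b}.
  exists [set b]; split; [exact: measurable_set1|exact: lebesgue_measure_set1|].
  by move=> x /= /negP; rewrite negbK => /eqP.
have FF := ae_filter_ringOfSetsType mu.
have H := @filterI _ _ FF _ _ (@filterI _ _ FF _ _ (ane (-1)) (ane 1)) (zhat_eq0_ae hN (zID zu za) hk).
apply: (@filterS _ _ FF _ _ _ H) => x [[x1 x2] hx].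
rewrite in_itv /= => /andP[a1 a2].
have Ix : I x by rewrite /= in_itv /= !lt_neqAle eq_sym x1 x2 a1 a2.
by have /eqP := hx Ix; rewrite subr_eq0 => /eqP.
Qed.

Variables (alpha : R) (u : R -> R).
Hypothesis ha : 2^-1 <= alpha <= 1.
Hypothesis crit : critical_point alpha N u.
Local Notation rho := (gibbs N u).
Local Notation rint p := (zint N (fun x => rho x * p.[x])).
Local Notation T := (rint ('X * 'X)).
Local Notation lam := (alpha * paneitz_pair N u 2 'X / (F * T)).

Let hu : zsobolev N u. Proof. by case: crit => [[]]. Qed.
Let zu : zI u. Proof. exact: zsobolev_zI. Qed.
Let W0 : 0 < W. Proof. exact: zW_gt0. Qed.
Let zr := zI_gibbs hN crit.
Let r0 := gibbs_gt0 hN crit.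
Let r1 := zint_gibbs hN crit.
Let rx := zint_gibbs_x hN crit.
Let F0 : is_true (0 < F). Proof. by rewrite ltr0n fact_gt0. Qed.
Let a0 : 0 < alpha. Proof. by case/andP: ha; lra. Qed.

Let TE : zint N (fun x => rho x * x ^+ 2) = T.
Proof. by apply: zint_ext => // x _; rewrite hornerM hornerX expr2. Qed.

Lemma euler_lagrange k : alpha * pe k * zhat N u k =
  F * (zhat N (fun x => rho x * (1 + lam * x)) k - (k == 0%N)%:R * W).
Proof.
have [c1 [adm d1 _]] := second_variation hN crit (c k).
have := is_derive_unique (crit.2 _ adm) d1; set m := maxn _ _.
have hE : paneitz_pair N u m (c k) = pe k * zhat N u k.
  have km : (k < m)%N.
    (* Otherwise c_k would have size at most k and be orthogonal to itself. *)
    rewrite ltnNge; apply/negP => mk; have := @phat_zonal R N hN k k.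
    rewrite phat_big// ?(leq_trans (leq_maxl _ _) mk)// eqxx => e.
    by have := @znorm_gt0 R N hN k; rewrite -e ltxx.
  rewrite /paneitz_pair (bigD1 (Ordinal km))//= big1 => [|j jk].
    by rewrite phat_zonal// eqxx addr0; field; rewrite gt_eqF// znorm_gt0.
  by rewrite phat_zonal// ifN ?mulr0//; apply: contraNN jk => /eqP e; apply/eqP/val_inj.
move: lam {d1} => l.
have -> : zhat N (fun x => rho x * (1 + l * x)) k = rint (c k) + l * rint ('X * c k).
  rewrite -rintZ//; last exact: bmf_poly.
  rewrite -rintD//; [|exact: bmf_poly|by apply: bmfZ; exact: bmf_poly].
  apply: zint_ext => // x _; rewrite hornerM hornerX; ring.
have -> : zint N (horner (c k)) = (k == 0%N)%:R * W.
  by rewrite zint_zonal//; case: (k == 0%N); rewrite ?mul1r ?mul0r.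
by rewrite hE; move: (rint _) (rint _) => A B H; lra.
Qed.

Let C0 : 0 < W / zint N (fun x => expR (n * u x)).
Proof. by case: (critical_exp hN crit) => _ E0 _ _; rewrite divr_gt0. Qed.

Let rhoE x : rho x = W / zint N (fun x => expR (n * u x)) * expR (n * u x). Proof. by []. Qed.

Lemma lam0 : lam = 0.
Proof. exact: (multiplier_eq0 hN ha C0 zu rhoE zr r1 rx euler_lagrange). Qed.

Lemma pair_X0 : paneitz_pair N u 2 'X = 0.
Proof.
have T0 : 0 < T by have := tilted_sq_gt0 hN 0 zr r0 0 0; rewrite tilted00.
have /eqP := lam0; rewrite !mulf_eq0 invr_eq0 mulf_eq0 (gt_eqF F0) (gt_eqF T0) (gt_eqF a0) orbF /=.
by rewrite orbF => /eqP.
Qed.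

Let EL k : alpha * pe k * zhat N u k =
  F * (zhat N (fun x => rho x * (1 + 0 * x)) k - (k == 0%N)%:R * W).
Proof. by have := euler_lagrange k; rewrite lam0. Qed.

Let rho0 : (fun x => rho x * (1 + 0 * x)) = rho.
Proof. by apply/funext => x; rewrite mul0r addr0 mulr1. Qed.

(** From G = (x + V) / alpha, the number alpha (T - D) is T plus the integral of x rho V, and the
    bound on that integral leaves alpha (T - D) < T^2 / (W + T). This forces T < W / 2 <= alpha
    W. *)
Lemma tau_bound : zint N (fun x => rho x * x ^+ 2) < alpha * W.
Proof.
have /andP[a1 a2] := ha; have n3 := @ge3 R N hN.
have T0 : 0 < zint N (fun x => rho x * x ^+ 2).
  by rewrite TE; have := tilted_sq_gt0 hN 0 zr r0 0 0; rewrite tilted00.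
have h1 := rint_Gx hN ha C0 zu rhoE zr r1 rx EL.
have h2 := zint_x_kconv_lim_lt hN zr r0 r1 rx erefl T0.
rewrite /rmom2 in h1; set t := zint N (fun x => rho x * x ^+ 2) in T0 h1 h2 *.
have TW : t < W by exact (rmom2_ltW hN C0 rhoE zr r1).
have h3 : alpha * (t - (W - t) / n) = t + zint N (fun x => x * rho x * kconv_lim N rho x).
  rewrite -h1 -zintZ; last first.
    by apply: zI_bmf => //; apply: bmfM; [exact (bmf_G hN alpha 0 zr)|exact: bmf_id].
  have bV := bmf_V hN 0 zr; rewrite rho0 in bV.
  rewrite -zintD.
  - apply: zint_ext => // x _; rewrite /Gfun rho0; field; rewrite gt_eqF//.
  - by apply: zI_bmf => //; apply: bmf_exp2; exact: bmf_id.
  - apply: zI_ext (zI_bmf zr (bmfM (@bmf_id R) bV)) => x _; ring.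
have h4 : alpha * (t - (W - t) / n) < t - t * W / (W + t) by rewrite h3; lra.
have WT : 0 < W + t by rewrite addr_gt0.
have h5 : alpha * (n * t - (W - t)) * (W + t) < n * t ^+ 2.
  have e1 : n * t ^+ 2 = (n * (W + t)) * (t - t * W / (W + t)) by field; rewrite gt_eqF.
  have e2 : alpha * (n * t - (W - t)) * (W + t) = (n * (W + t)) * (alpha * (t - (W - t) / n)).
    by field; rewrite gt_eqF//; lra.
  by rewrite e1 e2 ltr_pM2l// mulr_gt0//; lra.
suff : t < W / 2 by nra.
rewrite ltNge; apply/negP => tW.
have h6 : 0 <= n * t - (W - t) by nra.
have h7 : 2^-1 * ((n * t - (W - t)) * (W + t)) <= alpha * ((n * t - (W - t)) * (W + t)).
  by apply: ler_wpM2r => //; rewrite mulr_ge0// ltW.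
(* If T >= W / 2 then (N - 1) T >= W since N >= 3; but [h5] with alpha lowered to 1/2 says that this
   product is negative. *)
have h8 : 0 <= (W - t) * ((n - 1) * t - W) by rewrite mulr_ge0//; nra.
nra.
Qed.

Lemma constant_of_stable : (forall (c1 : R -> R -> R) d, admissible_curve N u c1 ->
  second_derive0 (fun s => functional alpha N (c1 s)) d -> 0 <= d) -> ae_constant u.
Proof.
move=> st; apply: ae_constant_of_zhat => //.
have [M hM] := zsobolev_reg hN hu.
(* The orthogonality condition says that the direction is tangent, and [pair_X0] that the multiplier
   vanishes, so the second derivative in [second_variation] is available. *)
have stab : pinner_stable N alpha rho.
  move=> p m sp hp; have [c1 [adm _ d2]] := second_variation hN crit p.
  have hX : rint ('X * p) = 0 by rewrite -[RHS]hp; apply: zint_ext => // x _; rewrite hornerM hornerX.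
  have := st _ _ adm (d2 pair_X0 hX); rewrite subr_ge0.
  have -> : rint (p * p) = zint N (fun x => rho x * p.[x] ^+ 2).
    by apply: zint_ext => // x _; rewrite hornerM expr2.
  suff -> : paneitz_bil N (maxn (size p) 2) p p = pform N p m by [].
  rewrite /paneitz_bil /pform; under eq_bigr do rewrite -expr2.
  pose f k := pe k / h k * phat N p k ^+ 2.
  have f0 k : (size p <= k)%N -> f k = 0 by move=> pk; rewrite /f phat_big// expr0n mulr0.
  by rewrite -/f (@sum_widen_const _ f (size p) _ (leq_maxl _ _))// (@sum_widen_const _ f (size p) m).
have bG := bmf_G hN alpha 0 zr.
have G1 := zhat_Gfun hN ha zr r1 rx EL.
have G2 := kazdan_warner hN ha C0 zu rhoE zr r1 rx EL.
have G3 := rint_G hN ha C0 zu rhoE zr r1 rx EL.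
have G4 := rint_Gx hN ha C0 zu rhoE zr r1 rx EL.
have G5 x (hx : -1 < x < 1) := @Gpol_cvg R N hN alpha 0 rho zr x hx.
have G6 m x (hx : -1 < x < 1) := @Gpol_bound R N hN alpha 0 rho ha zr m x hx.
have EL' := EL; rewrite rho0 in EL'.
exact (stable_zhat0 hN ha zr r0 r1 rx EL' bG G5 G6 G1 G2 G3 G4 hM stab tau_bound).
Qed.

End Assembly.

Theorem theorem1p3 (R : realType) (N : nat) (alpha : R)
    (hN : (3 <= N)%N) (halpha : 2^-1 <= alpha <= 1) :
  (forall u : R -> R,
     critical_point alpha N u -> smooth_on_sphere N u -> ~ ae_constant u ->
     unstable_critical_point alpha N u) /\
  (forall u : R -> R, stable_critical_point alpha N u -> ae_constant u).
Proof.
split=> [u cu _ nu|u [cu st]]; last exact: (constant_of_stable hN halpha cu st).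
split=> //; apply: contrapT => H; apply: nu.
apply: (constant_of_stable hN halpha cu) => c1 d adm hd.
by rewrite leNgt; apply/negP => d0; apply: H; exists c1, d.
Qed.
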